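(* Let $\Gamma$ be a finite abelian group and $L=\sum_{\gamma\in\Gamma}L_\gamma$ a $\Gamma$-subgraded Lie algebra of compact operators on a complex Banach space. If every homogeneous commutator $[a,b]$, with $a\in L_\gamma$, $b\in L_\delta$ for some $\gamma,\delta\in\Gamma$, is an Engel element of $L$, then $L$ is $E$-solvable and hence triangularizable.
   Context: An operator Lie algebra is a linear subspace $L\subseteq\mathcal{B}(\mathcal{X})$ closed under $[a,b]=ab-ba$, normed by the operator norm; $\operatorname{ad}a:x\mapsto[a,x]$. An element $a\in L$ is an Engel element of $L$ if $\lim_n\|(\operatorname{ad}a)^n\|^{1/n}=0$. A normed Lie algebra $L$ is $E$-solvable if for every closed ideal $I\neq L$ the quotient $L/I$ contains a nonzero closed ideal all of whose elements are Engel elements of it. A set of operators is triangularizable if there is a maximal chain of closed subspaces each invariant under all its operators. $L$ is $\Gamma$-subgraded if $L=\sum_{\gamma}L_\gamma$ for subspaces (not necessarily direct) with $[L_\gamma,L_\delta]\subseteq L_{\gamma+\delta}$. *)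

(* Defs.v *)
From Stdlib Require Import Reals Classical ClassicalEpsilon List.
From mathcomp Require Import ssreflect ssrfun ssrbool eqtype choice fintype ssralg finalg.

Set Implicit Arguments.
Unset Strict Implicit.

Open Scope R_scope.

Record Cplx := mkC { re : R; im : R }.
Definition C0 : Cplx := mkC 0 0.
Definition C1 : Cplx := mkC 1 0.
Definition Cadd (z w : Cplx) : Cplx := mkC (re z + re w) (im z + im w).
Definition Cmul (z w : Cplx) : Cplx :=
  mkC (re z * re w - im z * im w) (re z * im w + im z * re w).
Definition Cmod (z : Cplx) : R := sqrt (re z * re z + im z * im z).

Record CBanach := {
  bcar :> Type;
  vadd : bcar -> bcar -> bcar;
  vzero : bcar;
  vopp : bcar -> bcar;
  vscal : Cplx -> bcar -> bcar;
  vnorm : bcar -> R;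
  vadd_assoc : forall x y z, vadd x (vadd y z) = vadd (vadd x y) z;
  vadd_comm : forall x y, vadd x y = vadd y x;
  vadd_0 : forall x, vadd x vzero = x;
  vadd_opp : forall x, vadd x (vopp x) = vzero;
  vscal_1 : forall x, vscal C1 x = x;
  vscal_mul : forall a b x, vscal a (vscal b x) = vscal (Cmul a b) x;
  vscal_addv : forall a x y, vscal a (vadd x y) = vadd (vscal a x) (vscal a y);
  vscal_adds : forall a b x, vscal (Cadd a b) x = vadd (vscal a x) (vscal b x);
  vnorm_eq0 : forall x, vnorm x = 0 -> x = vzero;
  vnorm_triangle : forall x y, vnorm (vadd x y) <= vnorm x + vnorm y;
  vnorm_scal : forall a x, vnorm (vscal a x) = Cmod a * vnorm x;
  vcomplete : forall u : nat -> bcar,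
    (forall eps, eps > 0 -> exists N, forall m n, (N <= m)%nat -> (N <= n)%nat ->
        vnorm (vadd (u m) (vopp (u n))) < eps) ->
    exists l, forall eps, eps > 0 -> exists N, forall n, (N <= n)%nat ->
        vnorm (vadd (u n) (vopp l)) < eps
}.

Arguments vadd {c}. Arguments vzero {c}. Arguments vopp {c}.
Arguments vscal {c}. Arguments vnorm {c}.

Definition Rsup (E : R -> Prop) : R :=
  match excluded_middle_informative (exists r, is_lub E r) with
  | left h => proj1_sig (constructive_indefinite_description _ h)
  | right _ => 0
  end.
Definition Rinf (E : R -> Prop) : R := - Rsup (fun r => E (- r)).

Definition nroot (n : nat) (r : R) : R :=
  if Rle_dec r 0 then 0 else Rpower r (/ INR n).

Section Ops.
Variable X : CBanach.

Definition vconv (u : nat -> X) (l : X) : Prop :=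
  forall eps, eps > 0 -> exists N, forall n, (N <= n)%nat ->
    vnorm (vadd (u n) (vopp l)) < eps.

Definition op := X -> X.
Definition opzero : op := fun _ => vzero.
Definition opadd (a b : op) : op := fun v => vadd (a v) (b v).
Definition opsub (a b : op) : op := fun v => vadd (a v) (vopp (b v)).
Definition opscal (c : Cplx) (a : op) : op := fun v => vscal c (a v).
Definition comm (a b : op) : op := fun v => vadd (a (b v)) (vopp (b (a v))).
Definition opsum (l : list op) : op := fold_right opadd opzero l.

Definition linear_op (T : op) : Prop :=
  (forall x y, T (vadd x y) = vadd (T x) (T y)) /\
  (forall c x, T (vscal c x) = vscal c (T x)).
Definition bounded_op (T : op) : Prop :=
  linear_op T /\ exists M, forall x, vnorm (T x) <= M * vnorm x.

Definition opnorm (T : op) : R :=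
  Rsup (fun r => exists x, vnorm x <= 1 /\ r = vnorm (T x)).

Definition compact_op (T : op) : Prop :=
  bounded_op T /\
  forall u : nat -> X, (exists M, forall n, vnorm (u n) <= M) ->
    exists phi : nat -> nat, (forall n, (phi n < phi (S n))%nat) /\
      exists l, vconv (fun n => T (u (phi n))) l.

Definition opset := op -> Prop.

Definition op_subspace (S : opset) : Prop :=
  S opzero /\ (forall a b, S a -> S b -> S (opadd a b)) /\
  (forall c a, S a -> S (opscal c a)).

Definition lie_algebra (L : opset) : Prop :=
  op_subspace L /\ (forall a, L a -> bounded_op a) /\
  (forall a b, L a -> L b -> L (comm a b)).

Definition opconv (T : nat -> op) (A : op) : Prop :=
  Un_cv (fun n => opnorm (opsub (T n) A)) 0.

Definition closed_in (L I : opset) : Prop :=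
  forall (T : nat -> op) A, (forall n, I (T n)) -> L A -> opconv T A -> I A.

Definition ideal (L I : opset) : Prop :=
  op_subspace I /\ (forall a, I a -> L a) /\
  (forall a x, L a -> I x -> I (comm a x)).

Definition closed_ideal (L I : opset) : Prop := ideal L I /\ closed_in L I.

Definition ad (a : op) : op -> op := fun x => comm a x.
Definition adpow (a : op) (n : nat) (x : op) : op := Nat.iter n (ad a) x.

Definition adnorm (L : opset) (a : op) (n : nat) : R :=
  Rsup (fun r => exists x, L x /\ opnorm x <= 1 /\ r = opnorm (adpow a n x)).

Definition engel (L : opset) (a : op) : Prop :=
  L a /\ Un_cv (fun n => nroot n (adnorm L a n)) 0.

Definition qnorm (I : opset) (x : op) : R :=
  Rinf (fun r => exists i, I i /\ r = opnorm (opsub x i)).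

(* norm of (ad (a+I))^n as an operator on the normed quotient L/I *)
Definition adnorm_q (L I : opset) (a : op) (n : nat) : R :=
  Rsup (fun r => exists x, L x /\ qnorm I x <= 1 /\ r = qnorm I (adpow a n x)).

Definition engel_q (L I : opset) (a : op) : Prop :=
  L a /\ Un_cv (fun n => nroot n (adnorm_q L I a n)) 0.

(* E-solvability.  Closed ideals of L/I are identified with closed ideals
   J of L containing I (J/I nonzero iff J contains an element outside I). *)
Definition E_solvable (L : opset) : Prop :=
  forall I, closed_ideal L I -> (exists a, L a /\ ~ I a) ->
    exists J, closed_ideal L J /\ (forall x, I x -> J x) /\
      (exists x, J x /\ ~ I x) /\ (forall a, J a -> engel_q L I a).

Definition vset := X -> Prop.
Definition closed_vsubspace (M : vset) : Prop :=
  M vzero /\ (forall x y, M x -> M y -> M (vadd x y)) /\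
  (forall c x, M x -> M (vscal c x)) /\
  (forall (u : nat -> X) l, (forall n, M (u n)) -> vconv u l -> M l).

Definition vincl (M N : vset) : Prop := forall x, M x -> N x.

Definition chain (C : vset -> Prop) : Prop :=
  (forall M, C M -> closed_vsubspace M) /\
  (forall M N, C M -> C N -> vincl M N \/ vincl N M).

(* maximal among chains of closed subspaces (subspaces up to extensional
   equality) *)
Definition maximal_chain (C : vset -> Prop) : Prop :=
  chain C /\
  forall C', chain C' -> (forall M, C M -> C' M) ->
    forall M, C' M -> exists N, C N /\ forall x, M x <-> N x.

Definition invariant (T : op) (M : vset) : Prop := forall x, M x -> M (T x).

Definition triangularizable (S : opset) : Prop :=
  exists C, maximal_chain C /\ forall M, C M -> forall T, S T -> invariant T M.

End Ops.

(* Gamma-subgrading: L = sum_g L_g (algebraic sum of subspaces of L, not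
   necessarily direct) with [L_g, L_d] contained in L_(g+d). *)
Definition subgraded (G : finZmodType) (X : CBanach) (L : opset X)
    (Lg : G -> opset X) : Prop :=
  (forall g, op_subspace (Lg g)) /\
  (forall g a, Lg g a -> L a) /\
  (forall a, L a -> exists f : G -> op X,
      (forall g, Lg g (f g)) /\ forall v, a v = opsum (map f (enum G)) v) /\
  (forall g d a b, Lg g a -> Lg d b -> Lg (GRing.add g d) (comm a b)).

(* Main.v *)
Require Import Defs.
From Stdlib Require Import Reals Lra Lia List Classical ClassicalEpsilon ProofIrrelevance Arith.
From Stdlib Require Cantor Permutation.
From mathcomp Require Import ssreflect ssrfun ssrbool eqtype choice fintype ssralg finalg.
From mathcomp Require boolp classical_sets seq.
Import Defs.

(* Fix a maximal chain of closed L-invariant subspaces (Zorn). On every gap M/N of it L induces an irreducible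
   graded Lie algebra of compact operators, and the point is that this algebra consists of scalars. Then every closed
   subspace between N and M is invariant, so the chain is maximal among all chains of closed subspaces; and the
   elements of L that vanish on every gap form an ideal Z containing [L, L]. Since the growth of a compact operator
   is governed by its growth on the gaps, the closure of Z + I consists of Engel elements modulo a closed ideal I (if
   Z is contained in I, then L/I is commutative).

   In the irreducible case homogeneous commutators are quasinilpotent: if kap <> 0 is an eigenvalue of [a, b], the
   Engel condition makes its root space invariant, so the space is finite-dimensional, [a, b] - kap is nilpotent and
   taking traces gives kap = 0. If some homogeneous component contains a nonzero finite-rank operator x, Jacobson's
   theorem on weakly closed sets of nilpotents, and the fact that L has no nonzero ideal of operators with vanishing
   joint growth, make x central, hence a nonzero scalar; the space is then finite-dimensional and the same argument
   applies to every homogeneous element. Otherwise let a of degree g act on Y^G as a (x) shift_g. Conjugation by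
   1 + compact minus the identity splits spectrally on spaces of operators, and without finite-rank operators it has
   no large spectral part; therefore products of exponentials of homogeneous elements on Y^G are 1 + compact
   quasinilpotent. A group of operators 1 + (compact quasinilpotent) has joint growth at most 1, because limits of
   normalized words would generate an ideal excluded by Turovskii's theorem and a Hilden-type fixed-ball argument.
   This contradicts the fixed-ball argument applied to a, which is approximated by averages of the exp (z a). *)

Set Implicit Arguments.
Unset Strict Implicit.
Open Scope R_scope.

(** * Complex numbers *)

Declare Scope C_scope.
Delimit Scope C_scope with C.
Bind Scope C_scope with Cplx.

(** Away from finite-rank elements the spectral analysis needs a closed space of operators stable
    under conjugation by products of exponentials. On Y the homogeneous components need not be
    independent, their sum need not be closed, and a sum of homogeneous operators can have finite
    rank although no summand does. On Y^G the components of an operator can be read off one by one: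
    the corresponding space is closed and again free of nonzero finite-rank operators, and summing
    coordinates carries estimates back to Y.

    Conjugation minus the identity, restricted to such a space, need not be compact, and restriction
    can destroy surjectivity of its shifts. Bounds from below survive restriction, and they hold off
    a countable set made of eigenvalues. A ray and a circle avoiding that set carry invertibility
    from large radius, where a Neumann series applies, to arbitrarily small radius. Averages over
    roots of unity of order 2^k replace contour integrals on such circles; they also give the
    spectral radius of a compact operator from its eigenvalues. *)

Definition Copp (z : Cplx) : Cplx := mkC (- re z) (- im z).
Definition Csub (z w : Cplx) : Cplx := Cadd z (Copp w).
Definition Cinv (z : Cplx) : Cplx :=
  mkC (re z / (re z * re z + im z * im z)) (- im z / (re z * re z + im z * im z)).
Definition Cdiv (z w : Cplx) : Cplx := Cmul z (Cinv w).
Definition RtoC (r : R) : Cplx := mkC r 0.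

Notation "z + w" := (Cadd z w) : C_scope.
Notation "z - w" := (Csub z w) : C_scope.
Notation "z * w" := (Cmul z w) : C_scope.
Notation "- z" := (Copp z) : C_scope.
Notation "z / w" := (Cdiv z w) : C_scope.

Lemma C_eq (z w : Cplx) : re z = re w -> im z = im w -> z = w.
Proof. by case: z; case: w => a b c d /= -> ->. Qed.

Lemma C_ring_theory : ring_theory C0 C1 Cadd Cmul Csub Copp (@eq Cplx).
Proof. by split; intros; apply: C_eq => /=; ring. Qed.

Lemma Cnormsq_pos (z : Cplx) : z <> C0 -> 0 < re z * re z + im z * im z.
Proof.
move=> nz; case: (Req_dec (re z) 0) => h1; case: (Req_dec (im z) 0) => h2; try nra.
by case: nz; apply: C_eq.
Qed.

Lemma C1_neq0 : C1 <> C0.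
Proof. by move=> h; have := f_equal re h => /=; lra. Qed.

Lemma C_field_theory : field_theory C0 C1 Cadd Cmul Csub Copp Cdiv Cinv (@eq Cplx).
Proof.
split; [exact: C_ring_theory | exact: C1_neq0 | by [] |].
by move=> z /Cnormsq_pos nz; apply: C_eq => /=; field; lra.
Qed.

Add Field Cfield : C_field_theory.

Lemma Rinv_ge0 (r : R) : 0 < r -> 0 <= / r.
Proof. by move=> h; apply: Rlt_le; exact: Rinv_0_lt_compat. Qed.

Ltac divpos := apply: Rdiv_lt_0_compat; lra.

Lemma Cmod_ge0 (z : Cplx) : 0 <= Cmod z.
Proof. exact: sqrt_pos. Qed.

Lemma Cmod_sq (z : Cplx) : Cmod z * Cmod z = re z * re z + im z * im z.
Proof. by rewrite /Cmod sqrt_sqrt //; nra. Qed.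

Lemma Rsq_eq (a b : R) : 0 <= a -> 0 <= b -> a * a = b * b -> a = b.
Proof. by move=> ha hb h; exact: Rsqr_inj. Qed.

Lemma Rsq_le (a b : R) : 0 <= b -> a * a <= b * b -> a <= b.
Proof. move=> hb h; apply: Rnot_lt_le => hlt; nra. Qed.

Lemma Cmod_mul (z w : Cplx) : Cmod (z * w)%C = Cmod z * Cmod w.
Proof.
apply: Rsq_eq; [exact: Cmod_ge0 | exact: Rmult_le_pos (Cmod_ge0 _) (Cmod_ge0 _) |].
have -> : Cmod z * Cmod w * (Cmod z * Cmod w) = (Cmod z * Cmod z) * (Cmod w * Cmod w) by ring.
by rewrite !Cmod_sq /=; ring.
Qed.

Lemma Cmod_RtoC (r : R) : Cmod (RtoC r) = Rabs r.
Proof.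
apply: Rsq_eq; [exact: Cmod_ge0 | exact: Rabs_pos |].
rewrite Cmod_sq /= -Rabs_mult Rabs_pos_eq; nra.
Qed.

Lemma Cmod_RtoC_pos (r : R) : 0 <= r -> Cmod (RtoC r) = r.
Proof. by move=> h; rewrite Cmod_RtoC Rabs_pos_eq. Qed.

Lemma Cmod_C1 : Cmod C1 = 1.
Proof. by rewrite (_ : C1 = RtoC 1) // Cmod_RtoC_pos //; lra. Qed.

Lemma Cmod_C0 : Cmod C0 = 0.
Proof. by rewrite (_ : C0 = RtoC 0) // Cmod_RtoC_pos //; lra. Qed.

Lemma Cmod_opp (z : Cplx) : Cmod (- z)%C = Cmod z.
Proof. by rewrite /Cmod /=; congr sqrt; ring. Qed.

Lemma Cmod_triangle (z w : Cplx) : Cmod (z + w)%C <= Cmod z + Cmod w.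
Proof.
have hz := Cmod_ge0 z; have hw := Cmod_ge0 w.
have ez := Cmod_sq z; have ew := Cmod_sq w.
apply: Rsq_le; first lra.
rewrite Cmod_sq /=.
have : re z * re w + im z * im w <= Cmod z * Cmod w.
  apply: Rsq_le; first nra.
  have -> : Cmod z * Cmod w * (Cmod z * Cmod w) = (Cmod z * Cmod z) * (Cmod w * Cmod w) by ring.
  rewrite ez ew; have := Rle_0_sqr (re z * im w - im z * re w); rewrite /Rsqr; lra.
nra.
Qed.

Lemma Cmod_sub_sym (z w : Cplx) : Cmod (z - w)%C = Cmod (w - z)%C.
Proof. by rewrite -Cmod_opp; congr Cmod; ring. Qed.

Lemma Cmod_eq0 (z : Cplx) : Cmod z = 0 -> z = C0.
Proof. by move=> h; have := Cmod_sq z; rewrite h => e; apply: C_eq => /=; nra. Qed.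

Lemma Cmod_gt0 (z : Cplx) : z <> C0 -> 0 < Cmod z.
Proof.
move=> nz; have h := Cmod_ge0 z; case: (Req_dec (Cmod z) 0) => [/Cmod_eq0 //|]; lra.
Qed.

Lemma Cmod_inv (z : Cplx) : z <> C0 -> Cmod (Cinv z) = / Cmod z.
Proof.
move=> nz; have p := Cmod_gt0 nz.
apply: (Rmult_eq_reg_l (Cmod z)); last lra.
rewrite -Cmod_mul Rinv_r; last lra.
by rewrite -Cmod_C1; congr Cmod; field.
Qed.

Lemma Csub_eq0 (z w : Cplx) : (z - w)%C = C0 -> z = w.
Proof. by move=> h; have -> : z = (z - w + w)%C by [ring]; rewrite h; ring. Qed.

Lemma Cmul_neq0 (z w : Cplx) : z <> C0 -> w <> C0 -> (z * w)%C <> C0.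
Proof.
move=> hz hw h; have := Cmod_mul z w; rewrite h Cmod_C0.
by have := Cmod_gt0 hz; have := Cmod_gt0 hw; nra.
Qed.

Lemma RtoC_mul (a b : R) : RtoC (a * b) = (RtoC a * RtoC b)%C.
Proof. by apply: C_eq => /=; ring. Qed.

Lemma RtoC_add (a b : R) : RtoC (a + b) = (RtoC a + RtoC b)%C.
Proof. by apply: C_eq => /=; ring. Qed.

Lemma RtoC_neq0 (a : R) : a <> 0 -> RtoC a <> C0.
Proof. by move=> h e; apply: h; have := f_equal re e. Qed.

Lemma RtoC_inv (a : R) : a <> 0 -> RtoC (/ a) = Cinv (RtoC a).
Proof. by move=> h; apply: C_eq => /=; field. Qed.

Definition cis (t : R) : Cplx := mkC (cos t) (sin t).

Lemma cis_add (s t : R) : cis (s + t) = (cis s * cis t)%C.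
Proof. by apply: C_eq => /=; rewrite ?cos_plus ?sin_plus; ring. Qed.

Lemma cis_0 : cis 0 = C1.
Proof. by apply: C_eq => /=; rewrite ?cos_0 ?sin_0. Qed.

Lemma cis_PI : cis PI = (- C1)%C.
Proof. by apply: C_eq => /=; rewrite ?cos_PI ?sin_PI; ring. Qed.

Lemma Cmod_cis (t : R) : Cmod (cis t) = 1.
Proof.
apply: Rsq_eq; [exact: Cmod_ge0 | lra |].
by rewrite Cmod_sq /=; have := sin2_cos2 t; rewrite /Rsqr; lra.
Qed.

Lemma cis_neq0 (t : R) : cis t <> C0.
Proof. by move=> h; have := Cmod_cis t; rewrite h Cmod_C0; lra. Qed.

Lemma sin_abs_le (x : R) : Rabs (sin x) <= Rabs x.
Proof.
have pos : forall y, 0 < y -> Rabs (sin y) <= y.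
  move=> y hy; apply: Rabs_le; split; last by have := sin_lt_x y hy; lra.
  case: (Rle_dec y 1) => h1; last by have := SIN_bound y; lra.
  have : 0 <= sin y by apply: sin_ge_0; have := PI2_1; lra.
  lra.
case: (Rtotal_order x 0) => [h|[->|h]].
- by rewrite -Rabs_Ropp -sin_neg (Rabs_left x) //; apply: pos; lra.
- by rewrite sin_0; lra.
- by rewrite (Rabs_right x); [exact: pos | lra].
Qed.

Lemma cis_lip (s t : R) : Cmod (cis s - cis t)%C <= Rabs (s - t).
Proof.
apply: Rsq_le; first exact: Rabs_pos.
rewrite Cmod_sq /= -Rabs_mult (Rabs_pos_eq ((s-t)*(s-t))); last exact: (Rle_0_sqr (s-t)).
have e : (cos s + - cos t) * (cos s + - cos t) + (sin s + - sin t) * (sin s + - sin t)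
   = 2 - 2 * cos (s - t).
  rewrite cos_minus; have := sin2_cos2 s; have := sin2_cos2 t; rewrite /Rsqr; lra.
rewrite e.
have -> : s - t = 2 * ((s - t) / 2) by field.
rewrite cos_2a_sin.
have h := sin_abs_le ((s - t) / 2).
have : sin ((s-t)/2) * sin ((s-t)/2) <= ((s-t)/2) * ((s-t)/2).
  have := Rsqr_le_abs_1 _ _ h; rewrite /Rsqr //.
lra.
Qed.

Implicit Types X Y Z W : CBanach.

Notation nm := vnorm.
Notation "x [+] y" := (vadd x y) (at level 50, left associativity).
Notation "x [-] y" := (vadd x (vopp y)) (at level 50, left associativity).
Notation "c [*] x" := (vscal c x) (at level 40, left associativity).

(** * Linear identities and norms *)

Section Basics.
Variable X : CBanach.
Implicit Types x y z : X.

Lemma vadd_0l x : vzero [+] x = x.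
Proof. by rewrite vadd_comm vadd_0. Qed.

Lemma vadd_cancel x y z : x [+] z = y [+] z -> x = y.
Proof.
have e : forall t, t = (t [+] z) [-] z by move=> t; rewrite -vadd_assoc vadd_opp vadd_0.
by move=> h; rewrite (e x) h -e.
Qed.

Lemma vscal_0 x : C0 [*] x = vzero.
Proof.
apply: (@vadd_cancel _ _ (C0 [*] x)); rewrite -vscal_adds vadd_0l;
congr vscal; ring.
Qed.

Lemma vscal_0r c : c [*] (vzero : X) = vzero.
Proof.
by apply: (@vadd_cancel _ _ (c [*] vzero)); rewrite -vscal_addv !vadd_0l.
Qed.

Lemma vopp_scal x : vopp x = (- C1)%C [*] x.
Proof.
apply: (@vadd_cancel _ _ x); rewrite vadd_comm vadd_opp -{2}(vscal_1 x) -vscal_adds.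
by rewrite (_ : (- C1 + C1)%C = C0); [rewrite vscal_0 | ring].
Qed.

Lemma vopp_0 : vopp (vzero : X) = vzero.
Proof. by rewrite vopp_scal vscal_0r. Qed.

Lemma vsub_eq0 x y : x [-] y = vzero -> x = y.
Proof. by move=> h; apply: (@vadd_cancel _ _ (vopp y)); rewrite h vadd_opp. Qed.

(** Proof by reflection for linear identities: atoms are positions in a list, and two expressions
    agree as soon as their coefficients at each atom do. [vceq] unfolds to one equation in [Cplx]
    per atom, so [vec] leaves only goals for [ring] or [field]. *)
Inductive vexp := VA (n : nat) | VZ | VP (a b : vexp) | VN (a : vexp) | VS (c : Cplx) (a : vexp).

Fixpoint vden (l : list X) (e : vexp) : X :=
  match e with
  | VA n => nth n l vzero | VZ => vzero
  | VP a b => vden l a [+] vden l b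
  | VN a => vopp (vden l a)
  | VS c a => c [*] vden l a
  end.

Fixpoint vco (e : vexp) (k : nat) : Cplx :=
  match e with
  | VA n => if Nat.eqb n k then C1 else C0
  | VZ => C0
  | VP a b => Cadd (vco a k) (vco b k)
  | VN a => Copp (vco a k)
  | VS c a => Cmul c (vco a k)
  end.

Fixpoint vlc (l : list X) (f : nat -> Cplx) (k : nat) : X :=
  match l with nil => vzero | cons x l' => f k [*] x [+] vlc l' f (S k) end.

Fixpoint vceq (l : list X) (e1 e2 : vexp) (k : nat) : Prop :=
  match l with
  | nil => True
  | cons _ l' => vco e1 k = vco e2 k /\ vceq l' e1 e2 (S k)
  end.

Lemma vlc_ext l f g k : (forall i, f i = g i) -> vlc l f k = vlc l g k.
Proof. by move=> h; elim: l k => //= x l IH k; rewrite h IH. Qed.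

Lemma vlc_add l f g k :
  vlc l f k [+] vlc l g k = vlc l (fun i => Cadd (f i) (g i)) k.
Proof.
elim: l k => /= [|x l IH] k; first by rewrite vadd_0.
rewrite -IH vscal_adds !vadd_assoc; congr vadd.
by rewrite -!vadd_assoc; congr vadd; rewrite vadd_comm.
Qed.

Lemma vlc_scal l f c k : c [*] vlc l f k = vlc l (fun i => Cmul c (f i)) k.
Proof.
elim: l k => /= [|x l IH] k; first by rewrite vscal_0r.
by rewrite -IH vscal_addv vscal_mul.
Qed.

Lemma vlc_0 l f k : (forall i, (k <= i)%nat -> f i = C0) -> vlc l f k = vzero.
Proof.
elim: l k => //= x l IH k h; rewrite h // vscal_0 vadd_0l IH // => i hi; apply: h; lia.
Qed.

Lemma vden_vlc l e : vden l e = vlc l (vco e) 0.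
Proof.
elim: e => [n| |a IHa b IHb|a IHa|c a IHa] /=.
- have gen : forall k, nth n l vzero = vlc l (fun i => if Nat.eqb (k + n) i then C1 else C0) k.
    elim: l n => [|x l IH] [|n] k //=.
    + rewrite Nat.add_0_r Nat.eqb_refl vscal_1 vlc_0 ?vadd_0 // => i hi.
      by have -> : Nat.eqb k i = false by apply/Nat.eqb_neq; lia.
    + have -> : Nat.eqb (k + S n) k = false by apply/Nat.eqb_neq; lia.
      rewrite vscal_0 vadd_0l (IH n (S k)); apply: vlc_ext => i.
      by rewrite (_ : (S k + n = k + S n)%nat) //; lia.
  by rewrite (gen 0%nat).
- by rewrite vlc_0.
- by rewrite IHa IHb vlc_add.
- rewrite IHa vopp_scal vlc_scal; apply: vlc_ext => i; ring.
- by rewrite IHa vlc_scal.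
Qed.

Lemma vceq_sound l e1 e2 : vceq l e1 e2 0 -> vden l e1 = vden l e2.
Proof.
rewrite !vden_vlc; move: 0%nat.
by elim: l => //= x l IH k [-> h]; rewrite (IH _ h).
Qed.

End Basics.

Ltac vmem x l :=
  lazymatch l with
  | nil => constr:(false)
  | cons x _ => constr:(true)
  | cons _ ?l' => vmem x l'
  end.
Ltac vatoms X t l :=
  lazymatch t with
  | vadd ?a ?b => let l1 := vatoms X a l in vatoms X b l1
  | vopp ?a => vatoms X a l
  | vscal _ ?a => vatoms X a l
  | vzero => l
  | ?a => let b := vmem a l in
          lazymatch b with true => l | false => constr:(@cons (bcar X) a l) end
  end.
Ltac vidx x l :=
  lazymatch l with
  | cons x _ => constr:(O)
  | cons _ ?l' => let n := vidx x l' in constr:(S n)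
  end.
Ltac vreify t l :=
  lazymatch t with
  | vadd ?a ?b => let a' := vreify a l in let b' := vreify b l in constr:(VP a' b')
  | vopp ?a => let a' := vreify a l in constr:(VN a')
  | vscal ?c ?a => let a' := vreify a l in constr:(VS c a')
  | vzero => constr:(VZ)
  | ?a => let n := vidx a l in constr:(VA n)
  end.
Ltac vec_pre :=
  lazymatch goal with
  | |- @eq ?T ?a ?b =>
    let e := constr:(vopp a) in
    let X := lazymatch e with @vopp ?X _ => X end in
    let l0 := vatoms X a (@nil (bcar X)) in
    let l := vatoms X b l0 in
    let e1 := vreify a l in
    let e2 := vreify b l in
    change (vden (X:=X) l e1 = vden (X:=X) l e2);
    apply: vceq_sound; cbn [vceq vco Nat.eqb]
  end.
Ltac vec := vec_pre; repeat split; try ring; try (field; repeat split; try assumption).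

Section Basics2.
Variable X : CBanach.
Implicit Types x y z : X.

Lemma nm_0 : nm (vzero : X) = 0.
Proof. by rewrite -(vscal_0 (vzero : X)) vnorm_scal Cmod_C0 Rmult_0_l. Qed.

Lemma nm_opp x : nm (vopp x) = nm x.
Proof. by rewrite vopp_scal vnorm_scal Cmod_opp Cmod_C1 Rmult_1_l. Qed.

Lemma nm_ge0 x : 0 <= nm x.
Proof.
have := vnorm_triangle x (vopp x); rewrite vadd_opp nm_0 nm_opp; lra.
Qed.

Lemma nm_gt0 x : x <> vzero -> 0 < nm x.
Proof.
move=> nz; have := nm_ge0 x; case: (Req_dec (nm x) 0) => [/vnorm_eq0 //|]; lra.
Qed.

Lemma nm_mull x a b : a <= b -> nm x * a <= nm x * b.
Proof. exact: Rmult_le_compat_l (nm_ge0 x). Qed.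

Lemma nm_mulr x a b : a <= b -> a * nm x <= b * nm x.
Proof. exact: Rmult_le_compat_r (nm_ge0 x). Qed.

Lemma nm_sub x y : nm (x [-] y) <= nm x + nm y.
Proof. by have := vnorm_triangle x (vopp y); rewrite nm_opp. Qed.

Lemma nm_sym x y : nm (x [-] y) = nm (y [-] x).
Proof. rewrite -nm_opp; congr nm; vec. Qed.

Lemma nm_tri3 x y z : nm (x [-] z) <= nm (x [-] y) + nm (y [-] z).
Proof.
have -> : x [-] z = (x [-] y) [+] (y [-] z) by vec.
exact: vnorm_triangle.
Qed.

Lemma nm_rev x y : nm x - nm y <= nm (x [-] y).
Proof.
have := vnorm_triangle (x [-] y) y.
have -> : (x [-] y) [+] y = x by vec.
lra.
Qed.

Lemma nm_scalR r x : 0 <= r -> nm (RtoC r [*] x) = r * nm x.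
Proof. by move=> h; rewrite vnorm_scal Cmod_RtoC_pos. Qed.

Lemma nm_small0 x : (forall e, 0 < e -> nm x <= e) -> x = vzero.
Proof.
move=> h; apply: NNPP => /nm_gt0 p; have := h (nm x / 2); lra.
Qed.

Lemma scal_eq0 c x : c [*] x = vzero -> c <> C0 -> x = vzero.
Proof.
move=> h nz; have -> : x = Cinv c [*] (c [*] x) by vec.
by rewrite h vscal_0r.
Qed.

Lemma vconv_unique (u : nat -> X) l l' : vconv u l -> vconv u l' -> l = l'.
Proof.
move=> h h'; apply: vsub_eq0; apply: nm_small0 => e he.
have [N hN] := h (e/2) ltac:(lra); have [N' hN'] := h' (e/2) ltac:(lra).
have := hN (N + N')%nat ltac:(lia); have := hN' (N + N')%nat ltac:(lia).
have := nm_tri3 l (u (N+N')%nat) l'; rewrite (nm_sym l (u _)); lra.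
Qed.

Lemma vconv_add (u v : nat -> X) l m :
  vconv u l -> vconv v m -> vconv (fun n => u n [+] v n) (l [+] m).
Proof.
move=> h h' e he.
have [N hN] := h (e/2) ltac:(lra); have [N' hN'] := h' (e/2) ltac:(lra).
exists (N + N')%nat => n hn; have := hN n ltac:(lia); have := hN' n ltac:(lia).
have -> : (u n [+] v n) [-] (l [+] m) = (u n [-] l) [+] (v n [-] m) by vec.
have := vnorm_triangle (u n [-] l) (v n [-] m); lra.
Qed.

Lemma vconv_const (x : X) : vconv (fun _ => x) x.
Proof. by move=> e he; exists 0%nat => n _; rewrite vadd_opp nm_0. Qed.

Lemma vconv_lip Y (f : X -> Y) C (u : nat -> X) l :
  (forall x y, nm (f x [-] f y) <= C * nm (x [-] y)) ->
  vconv u l -> vconv (fun n => f (u n)) (f l).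
Proof.
move=> hf h e he.
have hC := Rabs_pos C; have hC2 := RRle_abs C.
have pos : 0 < e / (Rabs C + 1) by divpos.
have [N hN] := h _ pos; exists N => n hn.
have := hf (u n) l; have := hN n hn; have := nm_ge0 (u n [-] l) => h0 h1 h2.
have h3 : nm (u n [-] l) * (Rabs C + 1) < e.
  have e1 : e / (Rabs C + 1) * (Rabs C + 1) = e by field; lra.
  have := Rmult_lt_compat_r (Rabs C + 1) _ _ ltac:(lra) h1; lra.
nra.
Qed.

Lemma vconv_scal c (u : nat -> X) l : vconv u l -> vconv (fun n => c [*] u n) (c [*] l).
Proof.
apply: (vconv_lip (C := Cmod c)) => x y.
by rewrite -vnorm_scal; right; congr nm; vec.
Qed.

Lemma vconv_nm_le (u : nat -> X) l C : vconv u l -> (forall n, nm (u n) <= C) -> nm l <= C.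
Proof.
move=> h hu; apply: Rnot_lt_le => hlt.
have [N hN] := h (nm l - C) ltac:(lra); have := hN N (Nat.le_refl _).
rewrite nm_sym; have := nm_rev l (u N); have := hu N; lra.
Qed.

Lemma vconv_sub (u : nat -> X) l (phi : nat -> nat) :
  (forall n, (n <= phi n)%nat) -> vconv u l -> vconv (fun n => u (phi n)) l.
Proof.
by move=> hp h e he; have [N hN] := h e he; exists N => n hn; apply: hN; have := hp n; lia.
Qed.

Lemma vconv_ext (u v : nat -> X) l : (forall n, u n = v n) -> vconv u l -> vconv v l.
Proof. by move=> h hu e he; have [N hN] := hu e he; exists N => n hn; rewrite -h; exact: hN. Qed.

End Basics2.

Local Obligation Tactic := idtac.

(** * Bounded operators *)

Lemma Rsup_lub (E : R -> Prop) b x0 : E x0 -> (forall x, E x -> x <= b) -> is_lub E (Rsup E).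
Proof.
move=> h0 hb.
have ex : exists r, is_lub E r.
  have [r hr] := completeness E (ex_intro _ b hb) (ex_intro _ x0 h0); by exists r.
rewrite /Rsup; case: excluded_middle_informative => // h.
by case: constructive_indefinite_description.
Qed.

Definition lin X Y (f : X -> Y) : Prop :=
  (forall x y, f (x [+] y) = f x [+] f y) /\ (forall c x, f (c [*] x) = c [*] f x).

Record blin X Y := mkB {
  bf :> X -> Y;
  bl_lin : lin bf;
  bl_bd : exists M, forall x, nm (bf x) <= M * nm x }.

Notation bop X := (blin X X).

Section Blin.
Variables X Y : CBanach.
Implicit Types S T : blin X Y.

Lemma blin_ext S T : (forall x, S x = T x) -> S = T.
Proof.
case: S => f hf bf; case: T => g hg bg /= h.
have e : f = g by apply: boolp.funext.
subst g; congr mkB; exact: proof_irrelevance.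
Qed.

Lemma bl_add T x y : T (x [+] y) = T x [+] T y. Proof. by case: (bl_lin T). Qed.
Lemma bl_scal T c x : T (c [*] x) = c [*] T x. Proof. by case: (bl_lin T). Qed.
Lemma bl_opp T x : T (vopp x) = vopp (T x). Proof. by rewrite !vopp_scal bl_scal. Qed.
Lemma bl_0 T : T vzero = vzero.
Proof. by rewrite -(vscal_0 (vzero : X)) bl_scal vscal_0. Qed.

Definition opn T : R := Rsup (fun r => exists x, nm x <= 1 /\ r = nm (T x)).

Lemma opn_lub T : is_lub (fun r => exists x, nm x <= 1 /\ r = nm (T x)) (opn T).
Proof.
have [M hM] := bl_bd T.
apply: (@Rsup_lub _ (Rabs M) 0).
  by exists vzero; rewrite bl_0 !nm_0; split=> //; lra.
move=> r [x [hx ->]]; apply: Rle_trans (hM x) _.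
have := nm_ge0 x; have := RRle_abs M; have := Rabs_pos M; nra.
Qed.

Lemma opn_ge T x : nm (T x) <= opn T * nm x.
Proof.
have [ub _] := opn_lub T.
case: (classic (x = vzero)) => [->|nz]; first by rewrite bl_0 !nm_0; lra.
have p := nm_gt0 nz.
have : nm (T (RtoC (/ nm x) [*] x)) <= opn T.
  apply: ub; eexists; split; last reflexivity.
  rewrite nm_scalR; last by exact: Rinv_ge0.
  by right; field; lra.
rewrite bl_scal nm_scalR; last by exact: Rinv_ge0.
move=> h; have := nm_mulr x h.
by have -> : / nm x * nm (T x) * nm x = nm (T x) by field; lra.
Qed.

Lemma opn_le T c : 0 <= c -> (forall x, nm (T x) <= c * nm x) -> opn T <= c.
Proof.
move=> hc h; have [_ lub] := opn_lub T; apply: lub => r [x [hx ->]].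
apply: Rle_trans (h x) _; have := nm_ge0 x; nra.
Qed.

Lemma opn_ge0 T : 0 <= opn T.
Proof.
have [ub _] := opn_lub T; apply: Rle_trans (ub 0 _); first lra.
by exists vzero; rewrite bl_0 !nm_0; split=> //; lra.
Qed.

Program Definition badd S T : blin X Y := @mkB _ _ (fun x => S x [+] T x) _ _.
Next Obligation.
move=> S T; split=> [x y|c x]; rewrite ?bl_add ?bl_scal; vec.
Qed.
Next Obligation.
move=> S T; exists (opn S + opn T) => x; have := vnorm_triangle (S x) (T x).
have := opn_ge S x; have := opn_ge T x; nra.
Qed.

Program Definition bscal c T : blin X Y := @mkB _ _ (fun x => c [*] T x) _ _.
Next Obligation.
move=> c T; split=> [x y|d x]; rewrite ?bl_add ?bl_scal; vec.
Qed.
Next Obligation.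
move=> c T; exists (Cmod c * opn T) => x; rewrite vnorm_scal.
have := opn_ge T x; have := Cmod_ge0 c; nra.
Qed.

Program Definition bopp T : blin X Y := @mkB _ _ (fun x => vopp (T x)) _ _.
Next Obligation.
move=> T; split=> [x y|d x]; rewrite ?bl_add ?bl_scal; vec.
Qed.
Next Obligation.
by move=> T; exists (opn T) => x; rewrite nm_opp; exact: opn_ge.
Qed.

Program Definition bzero : blin X Y := @mkB _ _ (fun x => vzero) _ _.
Next Obligation. split=> [x y|d x]; vec. Qed.
Next Obligation. exists 0 => x; rewrite nm_0; lra. Qed.

Lemma BB_complete (u : nat -> blin X Y) :
  (forall eps, eps > 0 -> exists N, forall m n, (N <= m)%nat -> (N <= n)%nat ->
        opn (badd (u m) (bopp (u n))) < eps) ->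
  exists l, forall eps, eps > 0 -> exists N, forall n, (N <= n)%nat ->
        opn (badd (u n) (bopp l)) < eps.
Proof.
move=> hc.
have ptc x : exists l : Y, vconv (fun n => u n x) l.
  apply: vcomplete => e he.
  have hx := nm_ge0 x.
  have [N hN] := hc (e / (nm x + 1)) ltac:(divpos).
  exists N => m n hm hn; have h1 := hN m n hm hn.
  have := opn_ge (badd (u m) (bopp (u n))) x; rewrite /= => h2.
  have e1 : e / (nm x + 1) * (nm x + 1) = e by field; lra.
  have := opn_ge0 (badd (u m) (bopp (u n))) => h3.
  apply: Rle_lt_trans h2 _; nra.
pose f x := proj1_sig (constructive_indefinite_description _ (ptc x)).
have hf x : vconv (fun n => u n x) (f x) by rewrite /f; case: constructive_indefinite_description.
have hlin : lin f.
  split=> [x y|c x].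
  - apply: (vconv_unique (hf _)); apply: (vconv_ext _ (vconv_add (hf x) (hf y))) => n.
    by rewrite bl_add.
  - apply: (vconv_unique (hf _)); apply: (vconv_ext _ (vconv_scal c (hf x))) => n.
    by rewrite bl_scal.
have key e : e > 0 -> exists N, forall n, (N <= n)%nat -> forall x, nm (u n x [-] f x) <= e * nm x.
  move=> he; have [N hN] := hc e he; exists N => n hn x.
  apply: (vconv_nm_le (u := fun m => u n x [-] u (N + m)%nat x)).
    apply: vconv_add; first exact: vconv_const.
    apply: (vconv_ext (u := fun m => (- C1)%C [*] u (N + m)%nat x)); first by move=> m; vec.
    rewrite vopp_scal; apply: vconv_scal.
    by apply: (vconv_sub (phi := fun m => (N + m)%nat) _ (hf x)) => m; lia.
  move=> m; have := opn_ge (badd (u n) (bopp (u (N + m)%nat))) x => /= h.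
  apply: Rle_trans h _; apply: nm_mulr.
  by apply: Rlt_le; apply: hN; lia.
have hbd : exists M, forall x, nm (f x) <= M * nm x.
  have [N hN] := key 1 ltac:(lra); exists (1 + opn (u N)) => x.
  have := hN N (Nat.le_refl _) x; rewrite nm_sym => h.
  have := nm_rev (f x) (u N x); have := opn_ge (u N) x; lra.
exists (mkB hlin hbd) => e he; have [N hN] := key (e/2) ltac:(lra).
exists N => n hn; apply: (Rle_lt_trans _ (e/2)); last lra.
by apply: opn_le => [|x /=]; [lra | exact: hN].
Qed.

(** Operators form a [CBanach] themselves, so multiplication maps, commutator maps and conjugations
    are bounded operators on [BB X X] and inherit growth, closure and spectral lemmas without a
    separate theory. *)
Program Definition BB : CBanach := @Build_CBanach (blin X Y) badd bzero bopp bscal opn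
  _ _ _ _ _ _ _ _ _ _ _ BB_complete.
Solve Obligations with (by move=> *; apply: blin_ext => x /=; vec).
Next Obligation.
move=> T h; apply: blin_ext => x /=; apply: vnorm_eq0.
by have := opn_ge T x; have := nm_ge0 (T x); rewrite h; lra.
Qed.
Next Obligation.
move=> S T; apply: opn_le => [|x /=].
  by have := opn_ge0 S; have := opn_ge0 T; lra.
have := vnorm_triangle (S x) (T x); have := opn_ge S x; have := opn_ge T x; nra.
Qed.
Next Obligation.
have le : forall c T, opn (bscal c T) <= Cmod c * opn T.
  move=> c T; apply: opn_le => [|x /=].
    by apply: Rmult_le_pos; [exact: Cmod_ge0 | exact: opn_ge0].
  by rewrite vnorm_scal; have := opn_ge T x; have := Cmod_ge0 c; nra.
move=> c T; apply: Rle_antisym; first exact: le.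
case: (classic (c = C0)) => [->|nz].
  by rewrite Cmod_C0 Rmult_0_l; exact: opn_ge0.
have := le (Cinv c) (bscal c T).
have -> : bscal (Cinv c) (bscal c T) = T by apply: blin_ext => x /=; vec.
rewrite Cmod_inv // => h; have p := Cmod_gt0 nz.
have := Rmult_le_compat_l (Cmod c) _ _ (Rlt_le _ _ p) h.
by have -> : Cmod c * (/ Cmod c * opn (bscal c T)) = opn (bscal c T) by field; lra.
Qed.

End Blin.
Canonical BB.
Arguments vadd : simpl never.
Arguments vscal : simpl never.
Arguments vopp : simpl never.
Arguments vzero : simpl never.
Arguments vnorm : simpl never.

Section BlinOps.
Variables X Y Z : CBanach.

Lemma baddE (S T : blin X Y) x : (S [+] T : blin X Y) x = S x [+] T x. Proof. by []. Qed.
Lemma boppE (T : blin X Y) x : (vopp T : blin X Y) x = vopp (T x). Proof. by []. Qed.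
Lemma bscalE c (T : blin X Y) x : (c [*] T : blin X Y) x = c [*] T x. Proof. by []. Qed.
Lemma bzeroE x : (vzero : blin X Y) x = vzero. Proof. by []. Qed.

Lemma nm_ge (T : blin X Y) x : nm (T x) <= nm T * nm x. Proof. exact: opn_ge. Qed.
Lemma nm_le (T : blin X Y) c : 0 <= c -> (forall x, nm (T x) <= c * nm x) -> nm T <= c.
Proof. exact: opn_le. Qed.

End BlinOps.
Section BlinOps1.
Variables X Y Z : CBanach.
Lemma bcomp_lin (S : blin Y Z) (T : blin X Y) : lin (fun x => S (T x)).
Proof. by split=> [x y|c x]; rewrite ?bl_add ?bl_scal. Qed.
Lemma bcomp_bd (S : blin Y Z) (T : blin X Y) : exists M, forall x, nm (S (T x)) <= M * nm x.
Proof.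
exists (nm S * nm T) => x; have := nm_ge S (T x); have := nm_ge T x; have := nm_ge0 S; nra.
Qed.
Definition bcomp (S : blin Y Z) (T : blin X Y) : blin X Z := mkB (bcomp_lin S T) (bcomp_bd S T).

Lemma bid_bd : exists M, forall x : X, nm x <= M * nm x.
Proof. exists 1 => x; lra. Qed.
Definition bid : bop X := mkB (conj (fun x y => erefl) (fun c x => erefl)) bid_bd.

Lemma bl_lip (T : blin X Y) x y : nm (T x [-] T y) <= nm T * nm (x [-] y).
Proof. by rewrite -bl_opp -bl_add; exact: nm_ge. Qed.

Lemma bl_conv (T : blin X Y) u l : vconv u l -> vconv (fun n => T (u n)) (T l).
Proof. exact: (vconv_lip (bl_lip T)). Qed.

Lemma bconv_app (u : nat -> blin X Y) l x : vconv u l -> vconv (fun n => u n x) (l x).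
Proof.
move=> h; apply: (vconv_lip (C := nm x) (f := fun T : BB X Y => (T : blin X Y) x)) h => S T.
by rewrite -boppE -baddE Rmult_comm; exact: nm_ge.
Qed.

End BlinOps1.

Notation "S [o] T" := (bcomp S T) (at level 39, left associativity).
Arguments bid {X}.

Section BlinOps2.
Variables W X Y Z : CBanach.
Lemma bcompE (S : blin Y Z) (T : blin X Y) x : (S [o] T) x = S (T x). Proof. by []. Qed.
Lemma bidE (x : X) : (bid : bop X) x = x. Proof. by []. Qed.
Lemma bcompA (S : blin Y Z) (T : blin X Y) (U : blin W X) : S [o] (T [o] U) = S [o] T [o] U.
Proof. exact: blin_ext. Qed.
Lemma nm_comp (S : blin Y Z) (T : blin X Y) : nm (S [o] T) <= nm S * nm T.
Proof.
apply: nm_le => [|x]; first by apply: Rmult_le_pos; exact: nm_ge0.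
rewrite bcompE; have := nm_ge S (T x); have := nm_ge T x; have := nm_ge0 S; nra.
Qed.
Lemma comp1b (S : blin X Y) : bid [o] S = S. Proof. exact: blin_ext. Qed.
Lemma compb1 (S : blin X Y) : S [o] bid = S. Proof. exact: blin_ext. Qed.
Lemma compbDl (S T : blin Y Z) (U : blin X Y) : (S [+] T) [o] U = (S [o] U) [+] (T [o] U).
Proof. exact: blin_ext. Qed.
Lemma compbDr (S T : blin X Y) (U : blin Y Z) : U [o] (S [+] T) = (U [o] S) [+] (U [o] T).
Proof. by apply: blin_ext => x; rewrite /= bl_add. Qed.
Lemma compbZl c (S : blin Y Z) (U : blin X Y) : (c [*] S) [o] U = c [*] (S [o] U).
Proof. exact: blin_ext. Qed.
Lemma compbZr c (S : blin X Y) (U : blin Y Z) : U [o] (c [*] S) = c [*] (U [o] S).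
Proof. by apply: blin_ext => x; rewrite /= bl_scal. Qed.
Lemma compbNl (S : blin Y Z) (U : blin X Y) : (vopp S) [o] U = vopp (S [o] U).
Proof. exact: blin_ext. Qed.
Lemma compbNr (S : blin X Y) (U : blin Y Z) : U [o] (vopp S) = vopp (U [o] S).
Proof. by apply: blin_ext => x; rewrite /= bl_opp. Qed.
Lemma comp0b (U : blin X Y) : (vzero : blin Y Z) [o] U = vzero.
Proof. exact: blin_ext. Qed.
Lemma compb0 (U : blin Y Z) : U [o] (vzero : blin X Y) = vzero.
Proof. by apply: blin_ext => x; rewrite /= bl_0. Qed.
Lemma nm_bid : nm (bid : bop X) <= 1.
Proof. by apply: nm_le => [|x]; [lra | rewrite bidE; lra]. Qed.
End BlinOps2.

Ltac bsimp := repeat rewrite ?baddE ?boppE ?bscalE ?bzeroE ?bcompE ?bidE ?bl_add ?bl_scal ?bl_opp ?bl_0.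
Ltac bexp := repeat rewrite ?compbDl ?compbDr ?compbZl ?compbZr ?compbNl ?compbNr
   ?comp0b ?compb0 ?comp1b ?compb1 ?bcompA.
Ltac bvec := bexp; vec.

Fixpoint bpow X (T : bop X) n : bop X :=
  match n with O => bid | S n => T [o] bpow T n end.

Section Pow.
Variable X : CBanach.
Implicit Types S T : bop X.

Lemma bpow_add T m n : bpow T (m + n) = bpow T m [o] bpow T n.
Proof. by elim: m => [|m IH] /=; rewrite ?comp1b // IH bcompA. Qed.

Lemma bpow_S T n : bpow T (S n) = bpow T n [o] T.
Proof. by rewrite -Nat.add_1_r bpow_add /= compb1. Qed.

Lemma bpow_mul T m n : bpow T (m * n) = bpow (bpow T m) n.
Proof. by elim: n => [|n IH]; rewrite ?Nat.mul_0_r // Nat.mul_succ_r Nat.add_comm bpow_add IH. Qed.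

Lemma nm_bpow T n : nm (bpow T n) <= nm T ^ n.
Proof.
elim: n => [|n IH] /=; first exact: nm_bid.
apply: Rle_trans (nm_comp _ _) _; exact: (nm_mull _ IH).
Qed.

Lemma bpow_comm S T n : S [o] T = T [o] S -> S [o] bpow T n = bpow T n [o] S.
Proof.
move=> h; elim: n => [|n IH] /=; first by rewrite comp1b compb1.
by rewrite bcompA h -!bcompA IH.
Qed.

Lemma bpow_scal c T n :
  exists d, bpow (c [*] T) n = d [*] bpow T n /\ Cmod d = Cmod c ^ n.
Proof.
elim: n => [|n [d [IH hd]]] /=; first by exists C1; rewrite Cmod_C1; split=> //; vec.
exists (c * d)%C; rewrite IH Cmod_mul hd; split=> //.
rewrite compbZl compbZr; vec.
Qed.

Lemma bpow_comp S T n : S [o] T = T [o] S -> bpow (S [o] T) n = bpow S n [o] bpow T n.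
Proof.
move=> h; elim: n => [|n IH] /=; first by rewrite comp1b.
rewrite IH !bcompA; congr (_ [o] _); rewrite -!bcompA; congr (_ [o] _).
exact: bpow_comm.
Qed.

Definition bL (a : bop X) : blin (BB X X) (BB X X).
Proof.
refine (@mkB (BB X X) (BB X X) (fun x => a [o] x) _ _).
- by split=> [x y|c x]; [exact: compbDr | exact: compbZr].
- by exists (nm a) => x; exact: nm_comp.
Defined.
Definition bR (a : bop X) : blin (BB X X) (BB X X).
Proof.
refine (@mkB (BB X X) (BB X X) (fun x => x [o] a) _ _).
- by split=> [x y|c x]; [exact: compbDl | exact: compbZl].
- by exists (nm a) => x; rewrite Rmult_comm; exact: nm_comp.
Defined.
End Pow.

Lemma binv X Y (T : blin X Y) c : 0 < c -> (forall x, c * nm x <= nm (T x)) ->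
  (forall y, exists x, T x = y) ->
  exists U : blin Y X, T [o] U = bid /\ U [o] T = bid /\ nm U <= / c.
Proof.
move=> hc lb sur.
pose f y := proj1_sig (constructive_indefinite_description _ (sur y)).
have hf y : T (f y) = y by rewrite /f; case: constructive_indefinite_description.
have inj x y : T x = T y -> x = y.
  move=> h; apply: vsub_eq0; apply: vnorm_eq0.
  have := lb (x [-] y); rewrite bl_add bl_opp h vadd_opp nm_0.
  by have := nm_ge0 (x [-] y); nra.
have hlin : lin f.
  split=> [x y|a x]; apply: inj; rewrite ?bl_add ?bl_scal !hf //.
have bd y : nm (f y) <= / c * nm y.
  have := lb (f y); rewrite hf => h.
  apply: (Rmult_le_reg_l c) => //.
  by have -> : c * (/ c * nm y) = nm y by field; lra.
exists (mkB hlin (ex_intro _ _ bd)); split; last split.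
- by apply: blin_ext => y; exact: hf.
- by apply: blin_ext => x; apply: inj; rewrite /= hf.
- by apply: nm_le => //; exact: Rinv_ge0.
Qed.

Notation cid := constructive_indefinite_description.

Lemma half_pow_small (C e : R) : 0 < e -> exists N, forall n, (N <= n)%nat -> C * (1/2)^n < e.
Proof.
move=> he; have hC := Rabs_pos C.
have [N hN] := pow_lt_1_zero (1/2) ltac:(rewrite Rabs_right; lra) (e / (Rabs C + 1)) ltac:(divpos).
exists N => n hn; have := hN n hn.
have p : 0 < (1/2)^n by apply: pow_lt; lra.
rewrite Rabs_right => [h|]; last lra.
have e1 : e / (Rabs C + 1) * (Rabs C + 1) = e by field; lra.
have := RRle_abs C; nra.
Qed.

Lemma geom_conv X (u : nat -> X) C :
  (forall k, nm (u (S k) [-] u k) <= C * (1/2)^k) ->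
  exists l, vconv u l /\ forall k, nm (u k [-] l) <= 2 * C * (1/2)^k.
Proof.
move=> h.
have hk k j : nm (u (k + j)%nat [-] u k) <= 2 * C * ((1/2)^k - (1/2)^(k+j)).
  elim: j => [|j IH]; first by rewrite Nat.add_0_r vadd_opp nm_0; lra.
  rewrite Nat.add_succ_r; have := nm_tri3 (u (S (k + j))) (u (k + j)%nat) (u k).
  by have := h (k + j)%nat => /=; lra.
have hC : 0 <= C by have := h 0%nat; have := nm_ge0 (u 1%nat [-] u 0%nat) => /=; lra.
have pk k : 0 < (1/2)^k by apply: pow_lt; lra.
have [l hl] : exists l, vconv u l.
  apply: vcomplete => e he; have [N hN] := half_pow_small (4 * C) he.
  exists N => m n hm hn.
  have := hk N (m - N)%nat; have := hk N (n - N)%nat; have := hN N (Nat.le_refl _).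
  have -> : (N + (m - N) = m)%nat by lia.
  have -> : (N + (n - N) = n)%nat by lia.
  have := nm_tri3 (u m) (u N) (u n); rewrite (nm_sym (u N) (u n)).
  have := pk n; have := pk m; nra.
exists l; split=> // k; rewrite nm_sym.
apply: (vconv_nm_le (u := fun j => u (k + j)%nat [-] u k)).
  apply: vconv_add (vconv_const _).
  by apply: (vconv_sub (phi := fun j => (k + j)%nat)) hl => j; lia.
move=> j; have := hk k j; have := pk (k + j)%nat; nra.
Qed.

Lemma fast_idx (d : nat -> nat -> R) :
  (forall e, e > 0 -> exists N, forall m n, (N <= m)%nat -> (N <= n)%nat -> d m n < e) ->
  exists phi : nat -> nat, (forall k, (phi k < phi (S k))%nat) /\
    forall k m n, (phi k <= m)%nat -> (phi k <= n)%nat -> d m n < (1/2)^k.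
Proof.
move=> h.
have h' k : exists N, forall m n, (N <= m)%nat -> (N <= n)%nat -> d m n < (1/2)^k.
  by apply: h; apply: pow_lt; lra.
pose N k := proj1_sig (cid _ (h' k)).
have hN k : forall m n, (N k <= m)%nat -> (N k <= n)%nat -> d m n < (1/2)^k.
  by rewrite /N; case: cid.
pose phi := fix phi k := match k with O => N O | S k' => (S (phi k') + N (S k'))%nat end.
exists phi; split=> [k /=|k m n hm hn]; first lia.
apply: hN; case: k hm hn => /= *; lia.
Qed.

Section Closed.
Variable X : CBanach.
Implicit Types M N : X -> Prop.

Definition vsubspace M := M vzero /\ (forall x y, M x -> M y -> M (x [+] y)) /\
  (forall c x, M x -> M (c [*] x)).

Lemma csub_sub M : closed_vsubspace M -> vsubspace M.
Proof. by case=> h0 [h1 [h2 _]]. Qed.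
Lemma vsub_0 M : vsubspace M -> M vzero. Proof. by case. Qed.
Lemma vsub_add M x y : vsubspace M -> M x -> M y -> M (x [+] y).
Proof. by case=> _ [h _]; exact: h. Qed.
Lemma vsub_scal M c x : vsubspace M -> M x -> M (c [*] x).
Proof. by case=> _ [_ h]; exact: h. Qed.
Lemma vsub_opp M x : vsubspace M -> M x -> M (vopp x).
Proof. by move=> h hx; rewrite vopp_scal; exact: vsub_scal. Qed.
Lemma vsub_sub M x y : vsubspace M -> M x -> M y -> M (x [-] y).
Proof. by move=> h hx hy; apply: vsub_add => //; exact: vsub_opp. Qed.

Definition cl M : X -> Prop := fun x => forall e, 0 < e -> exists y, M y /\ nm (x [-] y) < e.

Lemma cl_incl M x : M x -> cl M x.
Proof. by move=> h e he; exists x; rewrite vadd_opp nm_0. Qed.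

Lemma cl_seq M x : cl M x -> exists u, (forall n, M (u n)) /\ vconv u x.
Proof.
move=> h.
have h' n : exists y, M y /\ nm (x [-] y) < (1/2)^n by apply: h; apply: pow_lt; lra.
exists (fun n => proj1_sig (cid _ (h' n))); split=> [n|e he]; first by case: cid => y [].
have [N hN] := half_pow_small 1 he; exists N => n hn; case: cid => y /= [_ hy].
by rewrite nm_sym; have := hN n hn; lra.
Qed.

Lemma closed_cl M : closed_vsubspace M -> forall x, cl M x -> M x.
Proof. by move=> [_ [_ [_ h]]] x /cl_seq [u [hu hx]]; exact: h hx. Qed.

Lemma cl_closed M : vsubspace M -> closed_vsubspace (cl M).
Proof.
move=> [h0 [h1 h2]]; split; last split; last split.
- exact: cl_incl.
- move=> x y hx hy e he.
  have [a [ha ea]] := hx (e/2) ltac:(lra); have [b [hb eb]] := hy (e/2) ltac:(lra).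
  exists (a [+] b); split; first exact: h1.
  have -> : (x [+] y) [-] (a [+] b) = (x [-] a) [+] (y [-] b) by vec.
  have := vnorm_triangle (x [-] a) (y [-] b); lra.
- move=> c x hx e he; have hc := Cmod_ge0 c.
  have [a [ha ea]] := hx (e / (Cmod c + 1)) ltac:(divpos).
  exists (c [*] a); split; first exact: h2.
  have -> : c [*] x [-] c [*] a = c [*] (x [-] a) by vec.
  rewrite vnorm_scal; have := nm_ge0 (x [-] a) => h.
  have e1 : e / (Cmod c + 1) * (Cmod c + 1) = e by field; lra.
  nra.
- move=> u l hu hl e he; have [N hN] := hl (e/2) ltac:(lra).
  have [y [hy ey]] := hu N (e/2) ltac:(lra); exists y; split=> //.
  have := nm_tri3 l (u N) y; rewrite (nm_sym l (u N)); have := hN N (Nat.le_refl _); lra.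
Qed.

Lemma cl_min M N : closed_vsubspace N -> vincl M N -> vincl (cl M) N.
Proof.
move=> hN h x hx; apply: closed_cl hN _ _ => e he; have [y [hy ey]] := hx e he.
by exists y; split=> //; exact: h.
Qed.

Lemma cl_inv (T : bop X) M : (forall x, M x -> M (T x)) -> forall x, cl M x -> cl M (T x).
Proof.
move=> h x hx e he; have hT := nm_ge0 T.
have [y [hy ey]] := hx (e / (nm T + 1)) ltac:(divpos).
exists (T y); split; first exact: h.
have := bl_lip T x y; have := nm_ge0 (x [-] y).
have e1 : e / (nm T + 1) * (nm T + 1) = e by field; lra.
nra.
Qed.

Inductive span (P : X -> Prop) : X -> Prop :=
| span0 : span P vzero
| span1 x : P x -> span P x
| spanD x y : span P x -> span P y -> span P (x [+] y)
| spanZ c x : span P x -> span P (c [*] x).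

Lemma span_sub P : vsubspace (span P).
Proof. by split; [exact: span0 | split; [exact: spanD | exact: spanZ]]. Qed.

Lemma span_min P M : vsubspace M -> (forall x, P x -> M x) -> forall x, span P x -> M x.
Proof. by move=> [h0 [h1 h2]] h x; elim=> *; auto. Qed.

Lemma csub_zero : closed_vsubspace (fun x : X => x = vzero).
Proof.
split=> //; split; first by move=> x y -> ->; vec.
split; first by move=> c x ->; vec.
move=> u l h hl; apply: (vconv_unique hl).
by apply: vconv_ext (vconv_const _) => n; rewrite h.
Qed.

Lemma csub_ker Y (T : blin X Y) : closed_vsubspace (fun x => T x = vzero).
Proof.
split; first exact: bl_0.
split; first by move=> x y hx hy; rewrite bl_add hx hy; vec.
split; first by move=> c x hx; rewrite bl_scal hx; vec.
move=> u l hu hl; apply: (vconv_unique (bl_conv T hl)).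
by apply: vconv_ext (vconv_const _) => n; rewrite hu.
Qed.

Lemma csub_inter (I : Type) (F : I -> X -> Prop) :
  (forall i, closed_vsubspace (F i)) -> closed_vsubspace (fun x => forall i, F i x).
Proof.
move=> h; split; first by move=> i; case: (h i).
split; first by move=> x y hx hy i; apply: vsub_add; [exact/csub_sub/h | |].
split; first by move=> c x hx i; apply: vsub_scal; [exact/csub_sub/h |].
by move=> u l hu hl i; have [_ [_ [_ hi]]] := h i; apply: (hi u l).
Qed.

End Closed.

Lemma span_map X Y (T : blin X Y) (P : X -> Prop) (Q : Y -> Prop) :
  (forall x, P x -> span Q (T x)) -> forall x, span P x -> span Q (T x).
Proof.
move=> h x; elim=> [|y|y z _ hy _ hz|c y _ hy]; rewrite ?bl_0 ?bl_add ?bl_scal.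
- exact: span0. - exact: h. - exact: spanD. - exact: spanZ.
Qed.

Section Sub.
Variables (X : CBanach) (M : X -> Prop) (HM : closed_vsubspace M).

Definition subcar := {x : X | M x}.
Lemma sub_ext (x y : subcar) : proj1_sig x = proj1_sig y -> x = y.
Proof. by case: x y => [x hx] [y hy] /= e; subst y; congr exist; exact: proof_irrelevance. Qed.

Program Definition Sub : CBanach := @Build_CBanach subcar
  (fun x y => exist _ (proj1_sig x [+] proj1_sig y) (vsub_add (csub_sub HM) (proj2_sig x) (proj2_sig y)))
  (exist _ vzero (vsub_0 (csub_sub HM)))
  (fun x => exist _ (vopp (proj1_sig x)) (vsub_opp (csub_sub HM) (proj2_sig x)))
  (fun c x => exist _ (c [*] proj1_sig x) (vsub_scal c (csub_sub HM) (proj2_sig x)))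
  (fun x => nm (proj1_sig x)) _ _ _ _ _ _ _ _ _ _ _ _.
Solve Obligations with (by move=> *; apply: sub_ext => /=; vec).
Next Obligation. by move=> x h; apply: sub_ext => /=; exact: vnorm_eq0. Qed.
Next Obligation. by move=> x y /=; exact: vnorm_triangle. Qed.
Next Obligation. by move=> c x /=; exact: vnorm_scal. Qed.
Next Obligation.
move=> u hu /=; have [l hl] := @vcomplete X (fun n => proj1_sig (u n)) hu.
have hM : M l by have [_ [_ [_ h]]] := HM; apply: h hl => n; exact: proj2_sig.
by exists (exist _ l hM).
Qed.

Definition incl : blin Sub X.
Proof.
refine (@mkB Sub X (fun x => proj1_sig x) _ _); first by [].
by exists 1 => x; rewrite Rmult_1_l; exact: Rle_refl.
Defined.
Lemma nm_incl x : nm (incl x) = nm x. Proof. by []. Qed.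
Lemma incl_in x : M (incl x). Proof. exact: proj2_sig. Qed.
Lemma incl_inj x y : incl x = incl y -> x = y. Proof. exact: sub_ext. Qed.
Lemma incl_sur x : M x -> exists y, incl y = x. Proof. by move=> h; exists (exist _ x h). Qed.

Lemma cores Z (T : blin Z X) : (forall z, M (T z)) ->
  exists U : blin Z Sub, forall z, incl (U z) = T z.
Proof.
move=> h.
have hl : @lin Z Sub (fun z => exist _ (T z) (h z)).
  by split=> [x y|c x]; apply: sub_ext => /=; rewrite ?bl_add ?bl_scal.
have hb : exists C, forall z : Z, nm (exist _ (T z) (h z) : Sub) <= C * nm z.
  by exists (nm T) => z; exact: nm_ge.
by exists (mkB hl hb).
Qed.

Lemma res (T : bop X) : (forall x, M x -> M (T x)) ->
  exists U : blin Sub Sub, forall z, incl (U z) = T (incl z).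
Proof.
move=> h; have [U hU] := @cores Sub (T [o] incl) (fun z => h _ (incl_in z)).
by exists U.
Qed.
End Sub.

Section Quot.
Variables (X : CBanach) (M : X -> Prop) (HM : closed_vsubspace M).
Let VM := csub_sub HM.

(** Cosets are predicates, so extensionality turns congruence modulo [M] into Leibniz equality, the
    form in which the axioms of [CBanach] are stated. *)
Definition cls (x : X) : X -> Prop := fun y => M (y [-] x).
Definition qcar := {S : X -> Prop | exists x, S = cls x}.
Definition qpr x : qcar := exist _ (cls x) (ex_intro _ x erefl).
Definition qrep (q : qcar) : X := proj1_sig (cid _ (proj2_sig q)).

Lemma qpr_rep q : qpr (qrep q) = q.
Proof.
rewrite /qrep; case: cid => x /=; case: q => S hS /= e; subst S.
by congr exist; exact: proof_irrelevance.
Qed.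

Lemma qpr_eq x y : qpr x = qpr y <-> M (x [-] y).
Proof.
split=> [h|h].
  have e := f_equal (fun q => proj1_sig q x) h; rewrite /= /cls in e.
  by rewrite -e vadd_opp; exact: vsub_0.
have e : cls x = cls y.
  apply/boolp.predeqP => z; rewrite /cls.
  split=> hz.
  - have -> : z [-] y = (z [-] x) [+] (x [-] y) by vec.
    exact: vsub_add.
  - have -> : z [-] x = (z [-] y) [-] (x [-] y) by vec.
    exact: vsub_sub.
rewrite /qpr; move: (ex_intro _ x _) (ex_intro _ y _); rewrite e => p1 p2.
by congr exist; exact: proof_irrelevance.
Qed.

Lemma qrepM x : M (qrep (qpr x) [-] x).
Proof. by apply/qpr_eq; rewrite qpr_rep. Qed.

Definition qadd p q := qpr (qrep p [+] qrep q).
Definition qopp p := qpr (vopp (qrep p)).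
Definition qscal c p := qpr (c [*] qrep p).
Definition qnm (q : qcar) : R := - Rsup (fun r => exists x, qpr x = q /\ r = - nm x).

Lemma qaddE x y : qadd (qpr x) (qpr y) = qpr (x [+] y).
Proof.
apply/qpr_eq.
have -> : (qrep (qpr x) [+] qrep (qpr y)) [-] (x [+] y) = (qrep (qpr x) [-] x) [+] (qrep (qpr y) [-] y) by vec.
by apply: vsub_add => //; exact: qrepM.
Qed.
Lemma qoppE x : qopp (qpr x) = qpr (vopp x).
Proof.
apply/qpr_eq; have -> : vopp (qrep (qpr x)) [-] vopp x = vopp (qrep (qpr x) [-] x) by vec.
by apply: vsub_opp => //; exact: qrepM.
Qed.
Lemma qscalE c x : qscal c (qpr x) = qpr (c [*] x).
Proof.
apply/qpr_eq; have -> : c [*] qrep (qpr x) [-] c [*] x = c [*] (qrep (qpr x) [-] x) by vec.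
by apply: vsub_scal => //; exact: qrepM.
Qed.

Lemma qnm_lub q : is_lub (fun r => exists x, qpr x = q /\ r = - nm x) (- qnm q).
Proof.
rewrite Ropp_involutive; apply: (@Rsup_lub _ 0 (- nm (qrep q))).
  by exists (qrep q); rewrite qpr_rep.
by move=> r [x [_ ->]]; have := nm_ge0 x; lra.
Qed.
Lemma qnm_le x : qnm (qpr x) <= nm x.
Proof.
have [h _] := qnm_lub (qpr x); have := h (- nm x) (ex_intro _ x (conj erefl erefl)); lra.
Qed.
Lemma qnm_lift q e : 0 < e -> exists x, qpr x = q /\ nm x < qnm q + e.
Proof.
move=> he; apply: NNPP => hn; have [_ h] := qnm_lub q.
suff hb : is_upper_bound (fun r => exists x, qpr x = q /\ r = - nm x) (- (qnm q + e)).
  by have := h _ hb; lra.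
move=> r [x [hx ->]]; apply: Rnot_lt_le => hlt; apply: hn; exists x; split=> //; lra.
Qed.
Lemma qnm_ge0 q : 0 <= qnm q.
Proof.
apply: Rnot_lt_le => h; have [x [_ hx]] := @qnm_lift q (- qnm q) ltac:(lra).
by have := nm_ge0 x; lra.
Qed.

Lemma qind (P : qcar -> Prop) : (forall x, P (qpr x)) -> forall q, P q.
Proof. by move=> h q; rewrite -(qpr_rep q). Qed.

Lemma qtri p q : qnm (qadd p q) <= qnm p + qnm q.
Proof.
apply: Rnot_lt_le => hlt; pose e := (qnm (qadd p q) - (qnm p + qnm q)) / 2.
have he : 0 < e by rewrite /e; lra.
have [x [hx hx2]] := @qnm_lift p e he; have [y [hy hy2]] := @qnm_lift q e he.
have := qnm_le (x [+] y); rewrite -qaddE hx hy; have := vnorm_triangle x y.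
by move: hx2 hy2; rewrite /e; lra.
Qed.

(** The increments of a fast subsequence have small coset norm, hence lift to vectors of norm at
    most (1/2)^k. Their partial sums converge in X, and the image of the limit is the limit of the
    whole Cauchy sequence. *)
Lemma qcomplete (u : nat -> qcar) :
  (forall eps, eps > 0 -> exists N, forall m n, (N <= m)%nat -> (N <= n)%nat ->
        qnm (qadd (u m) (qopp (u n))) < eps) ->
  exists l, forall eps, eps > 0 -> exists N, forall n, (N <= n)%nat ->
        qnm (qadd (u n) (qopp l)) < eps.
Proof.
move=> hu; have [phi [hphi hd]] := fast_idx hu.
have hw k : exists w, qpr w = qadd (u (phi (S k))) (qopp (u (phi k))) /\ nm w <= 1 * (1/2)^k.
  have h1 := hd k (phi (S k)) (phi k) ltac:(have := hphi k; lia) (Nat.le_refl _).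
  have [w [e1 e2]] := @qnm_lift (qadd (u (phi (S k))) (qopp (u (phi k))))
     ((1/2)^k - qnm (qadd (u (phi (S k))) (qopp (u (phi k))))) ltac:(lra).
  by exists w; split=> //; lra.
pose w k := proj1_sig (cid _ (hw k)).
have hw1 k : qpr (w k) = qadd (u (phi (S k))) (qopp (u (phi k))) by rewrite /w; case: cid => ? [].
have hw2 k : nm (w k) <= 1 * (1/2)^k by rewrite /w; case: cid => ? [].
pose x := fix x k := match k with O => qrep (u (phi O)) | S k' => x k' [+] w k' end.
have hx k : qpr (x k) = u (phi k).
  elim: k => [|k IH] /=; first exact: qpr_rep.
  rewrite -qaddE IH hw1; rewrite -(qpr_rep (u (phi (S k)))) -(qpr_rep (u (phi k))) !qpr_rep.
  rewrite -{1 2}(qpr_rep (u (phi k))) -{1}(qpr_rep (u (phi (S k)))) qoppE !qaddE.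
  by rewrite -{2}(qpr_rep (u (phi (S k)))); congr qpr; vec.
have [l [hl _]] := geom_conv (u := x) (C := 1) (fun k => ltac:(rewrite /=; have -> : x k [+] w k [-] x k = w k by [vec]; exact: hw2)).
exists (qpr l) => e he.
have [N hN] := hl (e/2) ltac:(lra).
have [N' hN'] := hu (e/2) ltac:(lra).
have phi_ge k : (k <= phi k)%nat by elim: k => [|k IH]; [lia | have := hphi k; lia].
exists N' => n hn.
pose k := (N + N')%nat.
have h1 := hN' n (phi k) hn ltac:(have := phi_ge k; rewrite /k; lia).
have h2 := hN k ltac:(rewrite /k; lia).
have h3 := qnm_le (x k [-] l).
have e3 : qpr (x k [-] l) = qadd (u (phi k)) (qopp (qpr l)) by rewrite -qaddE -qoppE hx.
rewrite e3 in h3.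
have h4 := qtri (qadd (u n) (qopp (u (phi k)))) (qadd (u (phi k)) (qopp (qpr l))).
have e4 : qadd (qadd (u n) (qopp (u (phi k)))) (qadd (u (phi k)) (qopp (qpr l))) = qadd (u n) (qopp (qpr l)).
  elim/qind: (u n) => a; elim/qind: (u (phi k)) => b; rewrite !qoppE !qaddE.
  by congr qpr; vec.
rewrite e4 in h4; lra.
Qed.

Program Definition Quot : CBanach := @Build_CBanach qcar qadd (qpr vzero) qopp qscal qnm
  _ _ _ _ _ _ _ _ _ _ _ qcomplete.
Next Obligation. by elim/qind=> x; elim/qind=> y; elim/qind=> z; rewrite !qaddE; congr qpr; vec. Qed.
Next Obligation. by elim/qind=> x; elim/qind=> y; rewrite !qaddE; congr qpr; vec. Qed.
Next Obligation. by elim/qind=> x; rewrite qaddE; congr qpr; vec. Qed.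
Next Obligation. by elim/qind=> x; rewrite qoppE qaddE; congr qpr; vec. Qed.
Next Obligation. by elim/qind=> x; rewrite qscalE; congr qpr; vec. Qed.
Next Obligation. by move=> a b; elim/qind=> x; rewrite !qscalE; congr qpr; vec. Qed.
Next Obligation. by move=> a; elim/qind=> x; elim/qind=> y; rewrite !(qaddE, qscalE); congr qpr; vec. Qed.
Next Obligation. by move=> a b; elim/qind=> x; rewrite !(qaddE, qscalE); congr qpr; vec. Qed.
Next Obligation.
elim/qind=> x h; apply/qpr_eq; rewrite vopp_0 vadd_0; apply: closed_cl HM _ _ => e he.
have [y [hy1 hy2]] := @qnm_lift (qpr x) e he.
exists (x [-] y); split; last by have -> : x [-] (x [-] y) = y by [vec]; lra.
by apply/qpr_eq.
Qed.
Next Obligation. exact: qtri. Qed.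
Next Obligation.
have le c : forall q, qnm (qscal c q) <= Cmod c * qnm q.
  move=> q; have hc := Cmod_ge0 c; apply: Rnot_lt_le => hlt.
  pose e := (qnm (qscal c q) - Cmod c * qnm q) / (Cmod c + 1).
  have e1 : e * (Cmod c + 1) = qnm (qscal c q) - Cmod c * qnm q by rewrite /e; field; lra.
  have he : 0 < e by rewrite /e; divpos.
  have [x [hx hx2]] := @qnm_lift q e he.
  have := qnm_le (c [*] x); rewrite -qscalE hx vnorm_scal; nra.
move=> c q; apply: Rle_antisym; first exact: le.
case: (classic (c = C0)) => [->|nz]; first by rewrite Cmod_C0 Rmult_0_l; exact: qnm_ge0.
have := le (Cinv c) (qscal c q).
have -> : qscal (Cinv c) (qscal c q) = q by elim/qind: q => x; rewrite !qscalE; congr qpr; vec.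
rewrite Cmod_inv // => h; have p := Cmod_gt0 nz.
have := Rmult_le_compat_l (Cmod c) _ _ (Rlt_le _ _ p) h.
by have -> : Cmod c * (/ Cmod c * qnm (qscal c q)) = qnm (qscal c q) by field; lra.
Qed.

Definition proj : blin X Quot.
Proof.
refine (@mkB X Quot (fun x => qpr x) _ _).
- by split=> [x y|c x]; [exact: (esym (qaddE x y)) | exact: (esym (qscalE c x))].
- by exists 1 => x; rewrite Rmult_1_l; exact: qnm_le.
Defined.

Lemma proj_nm x : nm (proj x) <= nm x. Proof. exact: qnm_le. Qed.
Lemma proj_0 x : proj x = vzero <-> M x.
Proof. have := qpr_eq x vzero; rewrite vopp_0 vadd_0; exact. Qed.
Lemma proj_eq x y : proj x = proj y <-> M (x [-] y). Proof. exact: qpr_eq. Qed.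
Lemma proj_lift (q : Quot) e : 0 < e -> exists x, proj x = q /\ nm x < nm q + e.
Proof. exact: qnm_lift. Qed.
Lemma proj_lift2 (q : Quot) : exists x, proj x = q /\ nm x <= 2 * nm q.
Proof.
case: (classic (q = vzero)) => [->|nz]; first by exists vzero; rewrite bl_0 !nm_0; split=> //; lra.
by have p := nm_gt0 nz; have [x [h1 h2]] := proj_lift q p; exists x; split=> //; lra.
Qed.
Lemma proj_dist x e : nm (proj x) < e -> exists m, M m /\ nm (x [-] m) < e.
Proof.
move=> h; have [y [hy1 hy2]] := @proj_lift (proj x) (e - nm (proj x)) ltac:(lra).
exists (x [-] y); split; first exact/proj_eq.
by have -> : x [-] (x [-] y) = y by [vec]; lra.
Qed.

Lemma qinduced (T : bop X) : (forall x, M x -> M (T x)) ->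
  exists U : blin Quot Quot, (forall x, U (proj x) = proj (T x)) /\ nm U <= nm T.
Proof.
move=> h.
pose f (q : Quot) : Quot := proj (T (qrep q)).
have hf x : f (proj x) = proj (T x).
  by apply/proj_eq; rewrite -bl_opp -bl_add; apply: h; exact: qrepM.
have hl : lin f.
  split=> [p q|c p].
  - by rewrite -(qpr_rep p) -(qpr_rep q); move: (qrep p) (qrep q) => x y;
    rewrite -[qpr x]/(proj x) -[qpr y]/(proj y) -bl_add !hf !bl_add.
  - by rewrite -(qpr_rep p); move: (qrep p) => x; rewrite -[qpr x]/(proj x) -bl_scal !hf !bl_scal.
have hb q : nm (f q) <= nm T * nm q.
  have hT := nm_ge0 T; apply: Rnot_lt_le => hlt.
  pose e := (nm (f q) - nm T * nm q) / (nm T + 1).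
  have e1 : e * (nm T + 1) = nm (f q) - nm T * nm q by rewrite /e; field; lra.
  have he : 0 < e by rewrite /e; divpos.
  have [x [hx hx2]] := @proj_lift q e he.
  have := proj_nm (T x); rewrite -hf hx; have := nm_ge T x; nra.
exists (mkB hl (ex_intro _ _ hb)); split; first exact: hf.
by apply: nm_le; [exact: nm_ge0 |].
Qed.
End Quot.

(** * Compact operators *)

(** Total boundedness of a family, phrased by finite colourings whose classes have small diameter.
    Colourings combine by pairing and need no choice of centres. *)
Definition TB (I : Type) X (P : I -> Prop) (f : I -> X) : Prop :=
  forall e, 0 < e -> exists N (col : I -> nat), (forall i, P i -> (col i < N)%nat) /\
    forall i j, P i -> P j -> col i = col j -> nm (f i [-] f j) <= e.

Lemma choice_fun (A : Type) (B : A -> Type) (Q : forall a, B a -> Prop) :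
  (forall a, exists x, Q a x) -> exists f : forall a, B a, forall a, Q a (f a).
Proof. by move=> h; exists (fun a => proj1_sig (cid _ (h a))) => a; case: cid. Qed.

Lemma dep_choice (A : Type) (Rl : nat -> A -> A -> Prop) (a0 : A) :
  (forall n a, exists b, Rl n a b) -> exists f : nat -> A, f O = a0 /\ forall n, Rl n (f n) (f (S n)).
Proof.
move=> h; have [g hg] := choice_fun (fun p : nat * A => h p.1 p.2).
by exists (fix f n := match n with O => a0 | S n' => g (n', f n') end); split=> // n; exact: (hg (n, _)).
Qed.

Lemma half_pow_gt0 k : 0 < (1/2)^k. Proof. by apply: pow_lt; lra. Qed.

(** Compactness in the form of a bisection argument: badness passes to some class of every finite
    colouring, so bad sets of diameter at most (1/2)^k can be nested, and their images close in on a
    point. Infinite index sets, sets without a finite cover and failures of approximation all serve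
    as [Bad]. *)
Lemma nest (I : Type) X (P : I -> Prop) (f : I -> X) (Bad : (I -> Prop) -> Prop) :
  TB P f -> Bad P -> (forall A, Bad A -> exists i, A i) ->
  (forall A N (col : I -> nat), Bad A -> (forall i, A i -> P i) -> (forall i, A i -> (col i < N)%nat) ->
     exists c, Bad (fun i => A i /\ col i = c)) ->
  exists y, forall e, 0 < e -> exists A, Bad A /\ (forall i, A i -> P i) /\ forall i, A i -> nm (f i [-] y) <= e.
Proof.
move=> htb hP hne hsplit.
pose St := {A : I -> Prop | Bad A /\ forall i, A i -> P i}.
have step (k : nat) (A : St) : exists B : St, (forall i, proj1_sig B i -> proj1_sig A i) /\
    forall i j, proj1_sig B i -> proj1_sig B j -> nm (f i [-] f j) <= (1/2)^k.
  case: A => A [hA hAP] /=.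
  have [N [col [h1 h2]]] := htb _ (half_pow_gt0 k).
  have [c hc] := hsplit A N col hA hAP (fun i hi => h1 i (hAP i hi)).
  have hB : Bad (fun i => A i /\ col i = c) /\ forall i, A i /\ col i = c -> P i by split=> // i [/hAP].
  exists (exist (fun A => Bad A /\ forall i, A i -> P i) _ hB) => /=; split=> [i []//|i j [hi ei] [hj ej]].
  by apply: h2; [exact: hAP | exact: hAP | rewrite ei ej].
have [F [_ hF]] := dep_choice (exist (fun A => Bad A /\ forall i, A i -> P i) P (conj hP (fun i hi => hi)) : St) step.
have [pt hpt] := choice_fun (fun k => hne _ (proj1 (proj2_sig (F (S k))))).
have [y [_ hy]] := geom_conv (u := fun k => f (pt k)) (C := 1) (fun k => ltac:(
  rewrite Rmult_1_l; apply: (proj2 (hF k)); [exact: (proj1 (hF (S k)) _ (hpt (S k))) | exact: hpt])).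
exists y => e he; have [N hN] := half_pow_small 3 he.
exists (proj1_sig (F (S N))); have [h1 h2] := proj2_sig (F (S N)); split=> //; split=> // i hi.
have := nm_tri3 (f i) (f (pt N)) y; have := hy N; have := hN N (Nat.le_refl _).
have := proj2 (hF N) i (pt N) hi (hpt N); lra.
Qed.

Lemma inf_split (A : nat -> Prop) (col : nat -> nat) N :
  (forall n, exists m, (n <= m)%nat /\ A m) -> (forall i, A i -> (col i < N)%nat) ->
  exists c, forall n, exists m, (n <= m)%nat /\ A m /\ col m = c.
Proof.
elim: N A => [|N IH] A hinf hcol.
  by have [m [_ /hcol]] := hinf 0%nat; lia.
case: (classic (forall n, exists m, (n <= m)%nat /\ A m /\ col m = N)) => [h|h]; first by exists N.
have [n0 hn0] := not_all_ex_not _ _ h.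
have [||c hc] := IH (fun m => A m /\ (n0 <= m)%nat).
- move=> n; have [m [h1 h2]] := hinf (n + n0)%nat; exists m; split; [lia | split=> //; lia].
- move=> i [hi hi2]; have := hcol i hi; case: (Nat.eq_dec (col i) N) => [e|]; last lia.
  by case: hn0; exists i.
exists c => n; have [m [h1 [[h2 _] h3]]] := hc n; by exists m.
Qed.

Lemma inc_ge (phi : nat -> nat) : (forall n, (phi n < phi (S n))%nat) -> forall n, (n <= phi n)%nat.
Proof. by move=> h; elim=> [|n IH]; [lia | have := h n; lia]. Qed.

Lemma seq_extract X (u : nat -> X) :
  (forall e, 0 < e -> exists n0 N (col : nat -> nat), (forall n, (n0 <= n)%nat -> (col n < N)%nat) /\
    forall n m, (n0 <= n)%nat -> (n0 <= m)%nat -> col n = col m -> nm (u n [-] u m) <= e) ->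
  exists phi : nat -> nat, (forall n, (phi n < phi (S n))%nat) /\ exists l, vconv (fun n => u (phi n)) l.
Proof.
move=> h.
(* The finitely many indices below [n0] get private colours, the tail colours are shifted by
   [n0]. *)
have htb : TB (fun _ : nat => True) u.
  move=> e he; have [n0 [N [col [h1 h2]]]] := h e he.
  exists (n0 + N)%nat, (fun n => if Nat.ltb n n0 then n else (n0 + col n)%nat); split.
    by move=> i _; case: Nat.ltb_spec => hi; [lia | have := h1 i hi; lia].
  move=> i j _ _; case: Nat.ltb_spec => hi; case: Nat.ltb_spec => hj; try lia.
    by move=> ->; rewrite vadd_opp nm_0; lra.
  by move=> e1; apply: h2 => //; lia.
have [|A|A N col hA _ hcol|y hy] := @nest _ _ _ _ (fun A => forall n, exists m, (n <= m)%nat /\ A m) htb.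
- by move=> n; exists n.
- by move=> /(_ 0%nat) [m [_ hm]]; exists m.
- by have [c hc] := inf_split hA hcol; exists c.
have step (k p : nat) : exists q, (p < q)%nat /\ nm (u q [-] y) <= (1/2)^k.
  have [A [hA [_ hA2]]] := hy _ (half_pow_gt0 k).
  by have [m [h1 h2]] := hA (S p); exists m; split; [lia | exact: hA2].
have [f [_ hf]] := dep_choice 0%nat step.
exists (fun n => f (S n)); split; first by move=> n; case: (hf (S n)).
exists y => e he; have [N hN] := half_pow_small 1 he; exists N => n hn.
by have := hN n hn; have [_] := hf n; lra.
Qed.

Lemma col_pair (a b c d N : nat) : (a < N)%nat -> (c < N)%nat -> (a + N * b = c + N * d)%nat -> a = c /\ b = d.
Proof.
move=> ha hc h; have : b = d by case: (Nat.lt_trichotomy b d) => [?|[//|?]]; nia.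
by move=> e; subst d; split=> //; lia.
Qed.

(** Finitely many colourings are merged into one by writing the colours as digits in mixed radix. *)
Lemma joint_col (I : Type) (P : I -> Prop) (R : nat -> I -> I -> Prop) n :
  (forall k, (k < n)%nat -> exists N (col : I -> nat), (forall i, P i -> (col i < N)%nat) /\
     forall i j, P i -> P j -> col i = col j -> R k i j) ->
  exists N (col : I -> nat), (forall i, P i -> (col i < N)%nat) /\
     forall i j, P i -> P j -> col i = col j -> forall k, (k < n)%nat -> R k i j.
Proof.
elim: n => [|n IH] h.
  by exists 1%nat, (fun _ => 0%nat); split=> [i _|i j _ _ _ k]; lia.
have [|N1 [c1 [h1 h1']]] := IH; first by move=> k hk; apply: h; lia.
have [N2 [c2 [h2 h2']]] := h n ltac:(lia).
exists (N1 * N2)%nat, (fun i => c1 i + N1 * c2 i)%nat; split.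
  by move=> i hi; have := h1 i hi; have := h2 i hi; nia.
move=> i j hi hj e k hk; have [e1 e2] := col_pair (h1 i hi) (h1 j hj) e.
by case: (Nat.eq_dec k n) => [->|ne]; [exact: h2' | apply: h1' => //; lia].
Qed.

Section TBs.
Variables (I : Type) (P : I -> Prop).

Lemma TB_sub X (Q : I -> Prop) (f : I -> X) : (forall i, Q i -> P i) -> TB P f -> TB Q f.
Proof.
move=> h hf e he; have [N [col [h1 h2]]] := hf e he; exists N, col; split; first by move=> i /h /h1.
by move=> i j /h hi /h hj; exact: h2.
Qed.

Lemma TB_map X Y (f : I -> X) (g : I -> Y) C :
  (forall i j, P i -> P j -> nm (g i [-] g j) <= C * nm (f i [-] f j)) -> TB P f -> TB P g.
Proof.
move=> h hf e he; have hC := Rabs_pos C.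
have pe : 0 < e / (Rabs C + 1) by divpos.
have [N [col [h1 h2]]] := hf _ pe; exists N, col; split=> // i j hi hj ec.
have := h i j hi hj; have := h2 i j hi hj ec; have := nm_ge0 (f i [-] f j); have := RRle_abs C.
have e1 : e / (Rabs C + 1) * (Rabs C + 1) = e by field; lra.
nra.
Qed.

Lemma TB_add X (f g : I -> X) : TB P f -> TB P g -> TB P (fun i => f i [+] g i).
Proof.
move=> hf hg e he.
have [|N [col [h1 h2]]] := @joint_col I P (fun k i j => match k with O => nm (f i [-] f j) <= e/2 | _ => nm (g i [-] g j) <= e/2 end) 2.
  by move=> [|[|k]] hk; [apply: hf; lra | apply: hg; lra | lia].
exists N, col; split=> // i j hi hj ec.
have := h2 i j hi hj ec 0%nat ltac:(lia); have := h2 i j hi hj ec 1%nat ltac:(lia).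
have -> : f i [+] g i [-] (f j [+] g j) = (f i [-] f j) [+] (g i [-] g j) by vec.
have := vnorm_triangle (f i [-] f j) (g i [-] g j); lra.
Qed.

Lemma TB_lim X (g : I -> X) :
  (forall e, 0 < e -> exists f : I -> X, TB P f /\ forall i, P i -> nm (g i [-] f i) <= e) -> TB P g.
Proof.
move=> h e he; have [f [hf hfg]] := h (e/3) ltac:(lra).
have [N [col [h1 h2]]] := hf (e/3) ltac:(lra); exists N, col; split=> // i j hi hj ec.
have := hfg i hi; have := hfg j hj; have := h2 i j hi hj ec.
have := nm_tri3 (g i) (f i) (g j); have := nm_tri3 (f i) (f j) (g j); rewrite (nm_sym (f j) (g j)); lra.
Qed.
End TBs.

Definition cpt X Y (T : blin X Y) : Prop := TB (fun x => nm x <= 1) T.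

Section Cpt.
Variables X Y Z : CBanach.

Lemma cpt_ball (T : blin X Y) r : cpt T -> TB (fun x => nm x <= r) T.
Proof.
move=> h; apply: (TB_sub (P := fun x => nm x <= Rabs r + 1)).
  by move=> x hx; have := RRle_abs r; lra.
have pr : 0 < Rabs r + 1 by have := Rabs_pos r; lra.
move: pr; set s := Rabs r + 1 => pr e he.
have [N [col [h1 h2]]] := h (e / s) ltac:(exact: Rdiv_lt_0_compat).
have hs : 0 <= / s by exact: Rinv_ge0.
have sc x : nm x <= s -> nm (RtoC (/ s) [*] x) <= 1.
  move=> hx; rewrite nm_scalR //; apply: (Rmult_le_reg_l s) => //.
  by rewrite -Rmult_assoc Rinv_r; lra.
exists N, (fun x => col (RtoC (/ s) [*] x)); split=> [x /sc /h1 //|x y /sc hx /sc hy ec].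
have := h2 _ _ hx hy ec; rewrite -bl_opp -bl_add.
have -> : RtoC (/ s) [*] x [-] RtoC (/ s) [*] y = RtoC (/ s) [*] (x [-] y) by vec.
rewrite bl_scal nm_scalR // bl_add bl_opp => h3.
have := Rmult_le_compat_l s _ _ (Rlt_le _ _ pr) h3.
have -> : s * (/ s * nm (T x [-] T y)) = nm (T x [-] T y) by field; lra.
by have -> : s * (e / s) = e by field; lra.
Qed.

Lemma cpt_add (S T : blin X Y) : cpt S -> cpt T -> cpt (S [+] T).
Proof. exact: TB_add. Qed.

Lemma cpt_scal c (T : blin X Y) : cpt T -> cpt (c [*] T).
Proof.
apply: (TB_map (C := Cmod c)) => x y _ _; rewrite -vnorm_scal !bscalE; right; congr nm; vec.
Qed.

Lemma cpt_opp (T : blin X Y) : cpt T -> cpt (vopp T).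
Proof. by rewrite vopp_scal; exact: cpt_scal. Qed.

Lemma cpt_compl (S : blin Y Z) (T : blin X Y) : cpt T -> cpt (S [o] T).
Proof. by apply: (TB_map (C := nm S)) => x y _ _; rewrite !bcompE; exact: (bl_lip S). Qed.

Lemma cpt_0 : cpt (vzero : blin X Y).
Proof.
by move=> e he; exists 1%nat, (fun _ => 0%nat); split=> *; [lia | rewrite !bzeroE vadd_opp nm_0; lra].
Qed.

Lemma cpt_lim (T : blin X Y) :
  (forall e, 0 < e -> exists K, cpt K /\ nm (T [-] K) <= e) -> cpt T.
Proof.
move=> h; apply: TB_lim => e he; have [K [hK hd]] := h e he; exists K; split=> // x hx.
have := nm_ge (T [-] K) x; rewrite baddE boppE; have := nm_ge0 (T [-] K); have := nm_ge0 x; nra.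
Qed.

Lemma cpt_conv (u : nat -> blin X Y) T : (forall n, cpt (u n)) -> vconv u T -> cpt T.
Proof.
move=> hu h; apply: cpt_lim => e he; have [N hN] := h e he.
exists (u N); split=> //; rewrite nm_sym; apply: Rlt_le; exact: hN.
Qed.

Lemma cpt_extract (T : blin X Y) (u : nat -> X) C : cpt T -> (forall n, nm (u n) <= C) ->
  exists phi : nat -> nat, (forall n, (phi n < phi (S n))%nat) /\ exists l, vconv (fun n => T (u (phi n))) l.
Proof.
move=> hT hu; apply: (seq_extract (u := fun n => T (u n))) => e he.
have [N [col [h1 h2]]] := cpt_ball C hT he.
exists 0%nat, N, (fun n => col (u n)); split=> [n _|n m _ _]; [exact: h1 | exact: h2].
Qed.
End Cpt.

Lemma cpt_compr X Y Z (S : blin Y Z) (T : blin X Y) : cpt S -> cpt (S [o] T).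
Proof.
move=> h e he; have [N [col [h1 h2]]] := cpt_ball (nm T) h he.
have b x : nm x <= 1 -> nm (T x) <= nm T.
  by move=> hx; have := nm_ge T x; have := nm_ge0 T; nra.
by exists N, (fun x => col (T x)); split=> [x /b /h1 //|x y /b hx /b hy]; exact: h2.
Qed.

Lemma cpt_incl X Y M (HM : closed_vsubspace M) (U : blin Y (Sub HM)) :
  @cpt Y X (incl HM [o] U) -> cpt U.
Proof. by move=> h; exact: h. Qed.

Lemma cpt_res X M (HM : @closed_vsubspace X M) (K : bop X) (U : blin (Sub HM) (Sub HM)) :
  (forall z, incl HM (U z) = K (incl HM z)) -> cpt K -> cpt U.
Proof.
move=> h hK; apply: cpt_incl; rewrite (_ : incl HM [o] U = K [o] incl HM); first exact: cpt_compr.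
exact: blin_ext.
Qed.

Lemma cpt_quot X M (HM : @closed_vsubspace X M) (K : bop X) (U : blin (Quot HM) (Quot HM)) :
  (forall x, U (proj HM x) = proj HM (K x)) -> cpt K -> cpt U.
Proof.
move=> h hK.
have [L hL] := choice_fun (fun q => proj_lift2 (HM := HM) q).
have b q : nm q <= 1 -> nm (L q) <= 2 by move=> hq; case: (hL q) => _; lra.
move=> e he; have [N [col [h1 h2]]] := cpt_ball 2 hK he.
exists N, (fun q => col (L q)); split=> [q /b /h1 //|p q /b hp /b hq ec].
have [ep _] := hL p; have [eq _] := hL q.
rewrite -{1}ep -{1}eq !h -bl_opp -bl_add; apply: Rle_trans (proj_nm _ _) _; exact: h2.
Qed.

(** Vala's theorem. Compactness of b reduces the unit ball to finitely many representatives; for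
    each of them compactness of a colours the points a(R(b r)), and these colours together control a
    R b uniformly. *)
Lemma vala X (a b : bop X) C : cpt a -> cpt b ->
  TB (fun R : bop X => nm R <= C) (fun R : bop X => a [o] R [o] b).
Proof.
move=> ha hb e he.
have hA := nm_ge0 a; have hC := Rabs_pos C; have hC' := RRle_abs C.
(* Replacing x by its representative costs e/4 for R and e/4 for R'; the remaining e/2 is spent on
   the joint colouring. *)
pose d := e / (4 * ((nm a + 1) * (Rabs C + 1))).
have pd : 0 < d by apply: Rdiv_lt_0_compat => //; apply: Rmult_lt_0_compat; [lra | nra].
have ed : d * ((nm a + 1) * (Rabs C + 1)) = e/4 by rewrite /d; field; lra.
have [N [col [h1 h2]]] := hb d pd.
have [r hr] : exists r : nat -> X, forall c, (exists x, nm x <= 1 /\ col x = c) -> nm (r c) <= 1 /\ col (r c) = c.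
  apply: (choice_fun (Q := fun c z => (exists x, nm x <= 1 /\ col x = c) -> nm z <= 1 /\ col z = c)) => c.
  case: (classic (exists x, nm x <= 1 /\ col x = c)) => [[x hx]|h]; first by exists x.
  by exists vzero => /h.
have [|M [cc [g1 g2]]] := @joint_col _ (fun R : bop X => nm R <= C)
   (fun c R R' => nm (a (R (b (r c))) [-] a (R' (b (r c)))) <= e/2) N.
  move=> c _; have [M [cc [g1 g2]]] := cpt_ball (Rabs C * nm (b (r c))) ha (e := e/2) ltac:(lra).
  have bd (R : bop X) : nm R <= C -> nm (R (b (r c))) <= Rabs C * nm (b (r c)).
    by move=> hR; have := nm_ge R (b (r c)); have := nm_ge0 (b (r c)); nra.
  by exists M, (fun R => cc (R (b (r c)))); split=> [R /bd /g1 //|R R' /bd hR /bd hR']; exact: g2.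
exists M, cc; split=> // R R' hR hR' ec.
apply: nm_le => [|x]; first lra.
have key x1 : nm x1 <= 1 -> nm (a (R (b x1)) [-] a (R' (b x1))) <= e.
  move=> hx; have [r1 r2] := hr (col x1) (ex_intro _ x1 (conj hx erefl)).
  have k1 := g2 R R' hR hR' ec (col x1) (h1 _ hx).
  have k2 : nm (b x1 [-] b (r (col x1))) <= d by apply: h2.
  have k3 (Q : bop X) : nm Q <= C -> nm (a (Q (b x1)) [-] a (Q (b (r (col x1))))) <= e/4.
    move=> hQ; rewrite -bl_opp -bl_add -bl_opp -bl_add.
    have := nm_ge a (Q (b x1 [-] b (r (col x1)))); have := nm_ge Q (b x1 [-] b (r (col x1))).
    have := nm_ge0 (Q (b x1 [-] b (r (col x1)))); have := nm_ge0 (b x1 [-] b (r (col x1))) => p1 p2 p3 p4.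
    have q1 : nm (Q (b x1 [-] b (r (col x1)))) <= Rabs C * d by have := nm_ge0 Q; nra.
    have q2 : nm a * nm (Q (b x1 [-] b (r (col x1)))) <= nm a * (Rabs C * d) by apply: Rmult_le_compat_l.
    have q3 : 0 <= d * nm a by nra.
    have q4 : 0 <= d * Rabs C by nra.
    nra.
  have := nm_tri3 (a (R (b x1))) (a (R (b (r (col x1))))) (a (R' (b x1))).
  have := nm_tri3 (a (R (b (r (col x1))))) (a (R' (b (r (col x1))))) (a (R' (b x1))).
  have := k3 R hR; have := k3 R' hR'; rewrite (nm_sym (a (R' (b x1)))); lra.
case: (classic (x = vzero)) => [->|nz]; first by rewrite bl_0 !nm_0; lra.
have px := nm_gt0 nz.
have hs : 0 <= / nm x by exact: Rinv_ge0.
have := key (RtoC (/ nm x) [*] x); rewrite nm_scalR // Rinv_l; last lra.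
move=> /(_ ltac:(lra)).
have -> : a (R (b (RtoC (/ nm x) [*] x))) [-] a (R' (b (RtoC (/ nm x) [*] x))) =
   RtoC (/ nm x) [*] (a (R (b x)) [-] a (R' (b x))) by bsimp; vec.
rewrite nm_scalR // => h3.
have := Rmult_le_compat_l (nm x) _ _ (Rlt_le _ _ px) h3.
have -> : nm x * (/ nm x * nm (a (R (b x)) [-] a (R' (b x)))) = nm (a (R (b x)) [-] a (R' (b x))) by field; lra.
by rewrite Rmult_comm.
Qed.

(** If the image of the ball had no finite cover of the required size, points could be picked
    greedily with images more than e/2 apart, and no subsequence of the images would converge. *)
Lemma compact_op_cpt X (T : bop X) : compact_op (T : op X) -> cpt T.
Proof.
move=> [_ hT] e he; apply: NNPP => hn.
have far (l : list X) : exists x, nm x <= 1 /\ forall y, In y l -> e/2 < nm (T x [-] T y).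
  apply: NNPP => h; apply: hn.
  have hx (x : X) : exists i, nm x <= 1 -> (i < length l)%nat /\ nm (T x [-] T (nth i l vzero)) <= e/2.
    case: (classic (nm x <= 1)) => hx; last by exists 0%nat.
    apply: NNPP => h'; apply: h; exists x; split=> // y /(In_nth _ _ vzero) [i [hi ei]].
    by apply: Rnot_le_lt => hle; apply: h'; exists i => _; rewrite ei.
  have [col hcol] := choice_fun hx.
  exists (length l), col; split=> [x /hcol []//|x y /hcol [_ k1] /hcol [_ k2] ec].
  rewrite ec in k1; have := nm_tri3 (T x) (T (nth (col y) l vzero)) (T y).
  by rewrite (nm_sym (T (nth (col y) l vzero)) (T y)); lra.
have [g hg] := choice_fun far.
pose ls := fix ls n := match n with O => nil | S n' => cons (g (ls n')) (ls n') end.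
have hin m n : (m < n)%nat -> In (g (ls m)) (ls n).
  elim: n => [|n IH] hmn; first lia.
  by case: (Nat.eq_dec m n) => [->|ne] /=; [left | right; apply: IH; lia].
have [phi [hphi [l hl]]] := hT (fun n => g (ls n)) ltac:(exists 1 => n; case: (hg (ls n)) => //).
have [N hN] := hl (e/4) ltac:(lra).
have h1 := hN N (Nat.le_refl _); have h2 := hN (S N) ltac:(lia).
have [_ h3] := hg (ls (phi (S N))); have := h3 _ (hin _ _ (hphi N)).
have := nm_tri3 (T (g (ls (phi (S N))))) l (T (g (ls (phi N)))); rewrite (nm_sym l (T (g (ls (phi N))))); lra.
Qed.

(** The last clause keeps u inside every subspace containing x and [M]; chain arguments need this to
    place u in the next member of the chain. *)
Lemma riesz_lemma X (M : X -> Prop) (x : X) : closed_vsubspace M -> ~ M x ->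
  exists u, nm u = 1 /\ (forall m, M m -> 1/2 <= nm (u [-] m)) /\ exists c m, M m /\ u = c [*] (x [-] m).
Proof.
move=> HM hx.
have nz : proj HM x <> vzero by move=> /proj_0.
have p := nm_gt0 nz.
have [y [hy hy2]] := proj_lift2 (proj HM x).
have py : 0 < nm y by have := proj_nm HM y; rewrite hy; lra.
have hs : 0 <= / nm y by exact: Rinv_ge0.
exists (RtoC (/ nm y) [*] y); split; last split.
- by rewrite nm_scalR //; field; lra.
- move=> m hm.
  have -> : RtoC (/ nm y) [*] y [-] m = RtoC (/ nm y) [*] (y [-] RtoC (nm y) [*] m).
    have nzy : RtoC (nm y) <> C0 by apply: RtoC_neq0; lra.
    rewrite RtoC_inv; last lra.
    vec.
  rewrite nm_scalR //.
  have h : nm (proj HM x) <= nm (y [-] RtoC (nm y) [*] m).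
    have -> : proj HM x = proj HM (y [-] RtoC (nm y) [*] m).
      rewrite -hy; apply/proj_eq.
      have -> : y [-] (y [-] RtoC (nm y) [*] m) = RtoC (nm y) [*] m by vec.
      by apply: vsub_scal => //; exact: csub_sub.
    exact: proj_nm.
  have h2 : / nm y * (nm y / 2) <= / nm y * nm (y [-] RtoC (nm y) [*] m) by apply: Rmult_le_compat_l => //; lra.
  have e : / nm y * (nm y / 2) = 1/2 by field; lra.
  lra.
- exists (RtoC (/ nm y)), (x [-] y); split; first by apply/proj_eq.
  congr vscal; vec.
Qed.

Lemma no_sep X Y (K : blin X Y) (u : nat -> X) C d : cpt K -> 0 < d ->
  (forall n, nm (u n) <= C) -> (forall m n, (m < n)%nat -> d <= nm (K (u n) [-] K (u m))) -> False.
Proof.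
move=> hK hd hu hs; have [phi [hphi [l hl]]] := cpt_extract hK hu.
have [N hN] := hl (d/2) ltac:(lra).
have := hN N (Nat.le_refl _); have := hN (S N) ltac:(lia); have := hs _ _ (hphi N).
have := nm_tri3 (K (u (phi (S N)))) l (K (u (phi N))); rewrite (nm_sym l (K (u (phi N)))); lra.
Qed.

Lemma inc_ker X (F : nat -> X -> Prop) :
  (forall n x, F n x -> F (S n) x) -> forall m n x, (m <= n)%nat -> F m x -> F n x.
Proof. by move=> h m n x; elim: n => [|n IH] hm hx; [have -> : 0%nat = m by lia | case: (Nat.eq_dec m (S n)) => [<-//|ne]; apply: h; apply: IH => //; lia]. Qed.

(** Riesz: unit vectors of F (n+1) at distance 1/2 from F n have images under K at mutual distance
    at least e/2. The scalars vary with n so that the lemma serves both for one eigenvalue (finite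
    ascent) and for infinitely many. *)
Lemma chain_inc X (K : bop X) (F : nat -> X -> Prop) (kap : nat -> Cplx) e :
  cpt K -> 0 < e -> (forall n, closed_vsubspace (F n)) -> (forall n x, F n x -> F (S n) x) ->
  (forall n, exists x, F (S n) x /\ ~ F n x) -> (forall n, e <= Cmod (kap n)) ->
  (forall n x, F n x -> F n (K x)) -> (forall n x, F (S n) x -> F n (K x [-] kap n [*] x)) -> False.
Proof.
move=> hK he hc hi hst hk hinv hd.
have pt n : exists u, nm u = 1 /\ F (S n) u /\ forall m, F n m -> 1/2 <= nm (u [-] m).
  have [x [hx hx2]] := hst n; have [u [h1 [h2 [c [m [h3 h4]]]]]] := riesz_lemma (hc n) hx2.
  exists u; split=> //; split=> //; rewrite h4; apply: vsub_scal; first exact: csub_sub.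
  by apply: vsub_sub => //; [exact: csub_sub | exact: hi].
have [u hu] := choice_fun pt.
apply: (@no_sep _ _ K u 1 (e/2) hK); first lra.
  by move=> n; case: (hu n) => ->; lra.
move=> m n hmn; have [h1 [h2 h3]] := hu n; have [_ [g2 _]] := hu m.
have kz : kap n <> C0 by move=> h; have := hk n; rewrite h Cmod_C0; lra.
pose w := Cinv (kap n) [*] (K (u m) [-] (K (u n) [-] kap n [*] u n)).
have hw : F n w.
  apply: vsub_scal; first exact: csub_sub.
  apply: vsub_sub; [exact: csub_sub | | exact: hd].
  by apply: hinv; apply: (inc_ker hi (m := S m)) => //; lia.
have -> : K (u n) [-] K (u m) = kap n [*] (u n [-] w) by rewrite /w; vec.
rewrite vnorm_scal; have := h3 w hw; have := hk n; nra.
Qed.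

(** The same separation argument run downwards; applied to the ranges of the powers of K - kap it
    yields the Fredholm alternative. *)
Lemma chain_dec X (K : bop X) (F : nat -> X -> Prop) (kap : Cplx) :
  cpt K -> kap <> C0 -> (forall n, closed_vsubspace (F n)) -> (forall n x, F (S n) x -> F n x) ->
  (forall n, exists x, F n x /\ ~ F (S n) x) ->
  (forall n x, F n x -> F n (K x)) -> (forall n x, F n x -> F (S n) (K x [-] kap [*] x)) -> False.
Proof.
move=> hK kz hc hi hst hinv hd; have pk := Cmod_gt0 kz.
have hi' m n x : (m <= n)%nat -> F n x -> F m x.
  elim: n => [|n IH] hmn hx; first by have -> : m = 0%nat by lia.
  case: (Nat.eq_dec m (S n)) => [->//|ne]; apply: IH; [lia | exact: hi].
have pt n : exists u, nm u = 1 /\ F n u /\ forall m, F (S n) m -> 1/2 <= nm (u [-] m).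
  have [x [hx hx2]] := hst n; have [u [h1 [h2 [c [m [h3 h4]]]]]] := riesz_lemma (hc (S n)) hx2.
  exists u; split=> //; split=> //; rewrite h4; apply: vsub_scal; first exact: csub_sub.
  by apply: vsub_sub => //; [exact: csub_sub | exact: hi].
have [u hu] := choice_fun pt.
apply: (@no_sep _ _ K u 1 (Cmod kap/2) hK); first lra.
  by move=> n; case: (hu n) => ->; lra.
move=> m n hmn; have [h1 [h2 h3]] := hu m; have [_ [g2 _]] := hu n.
pose w := Cinv kap [*] (K (u n) [-] (K (u m) [-] kap [*] u m)).
have hw : F (S m) w.
  apply: vsub_scal; first exact: csub_sub.
  apply: vsub_sub; [exact: csub_sub | | exact: hd].
  by apply: hinv; apply: hi' g2; lia.
have -> : K (u n) [-] K (u m) = vopp (kap [*] (u m [-] w)) by rewrite /w; vec.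
rewrite nm_opp vnorm_scal; have := h3 w hw; nra.
Qed.

Section Shift.
Variables (X : CBanach) (K : bop X).
Definition shf (kap : Cplx) : bop X := K [-] kap [*] bid.
Lemma shfE kap x : shf kap x = K x [-] kap [*] x. Proof. by []. Qed.
Lemma shf_comm kap (S : bop X) : S [o] K = K [o] S -> S [o] shf kap = shf kap [o] S.
Proof. by move=> h; rewrite /shf; bexp; rewrite h. Qed.
Lemma shf_pow_comm kap n (S : bop X) : S [o] K = K [o] S -> S [o] bpow (shf kap) n = bpow (shf kap) n [o] S.
Proof. by move=> h; apply: bpow_comm; exact: shf_comm. Qed.

Lemma inj_lb kap : cpt K -> kap <> C0 -> (forall x, K x = kap [*] x -> x = vzero) ->
  exists c, 0 < c /\ forall x, c * nm x <= nm (shf kap x).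
Proof.
move=> hK kz inj; apply: NNPP => hn.
have pt n : exists x, nm x = 1 /\ nm (shf kap x) <= (1/2)^n.
  apply: NNPP => h; apply: hn; exists ((1/2)^n); split; first exact: half_pow_gt0.
  move=> x; case: (classic (x = vzero)) => [->|nz]; first by rewrite bl_0 !nm_0; lra.
  have p := nm_gt0 nz.
  have hs : 0 <= / nm x by exact: Rinv_ge0.
  apply: Rnot_lt_le => hlt; apply: h; exists (RtoC (/ nm x) [*] x); rewrite bl_scal !nm_scalR //.
  split; first by field; lra.
  have := Rmult_le_compat_l (/ nm x) _ _ hs (Rlt_le _ _ hlt).
  by have -> : / nm x * ((1 / 2) ^ n * nm x) = (1/2)^n by field; lra.
have [u hu] := choice_fun pt.
have [phi [hphi [y hy]]] := cpt_extract hK (u := u) (C := 1) (fun n => ltac:(case: (hu n) => ->; lra)).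
have hky : vconv (fun n => kap [*] u (phi n)) y.
  move=> e he; have [N1 h1] := hy (e/2) ltac:(lra); have [N2 h2] := @half_pow_small 1 (e/2) ltac:(lra).
  exists (N1 + N2)%nat => n hnn; have := h1 n ltac:(lia); have := h2 (phi n) ltac:(have := inc_ge hphi n; lia).
  have [_] := hu (phi n); rewrite shfE.
  have := nm_tri3 (kap [*] u (phi n)) (K (u (phi n))) y; rewrite (nm_sym (kap [*] u (phi n)) (K _)); lra.
have e1 : K y = kap [*] y.
  apply: (vconv_unique (bl_conv K hky)).
  by apply: vconv_ext (vconv_scal kap hy) => n; rewrite bl_scal.
have y0 := inj _ e1.
have [N hN] := hky (Cmod kap) (Cmod_gt0 kz); have := hN N (Nat.le_refl _).
by rewrite y0 vopp_0 vadd_0 vnorm_scal; case: (hu (phi N)) => ->; lra.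
Qed.
End Shift.
Arguments shf : simpl never.

Lemma lb_range X Y (T : blin X Y) c : 0 < c -> (forall x, c * nm x <= nm (T x)) ->
  closed_vsubspace (fun y => exists x, y = T x).
Proof.
move=> hc lb; split; first by exists vzero; rewrite bl_0.
split; first by move=> _ _ [x ->] [y ->]; exists (x [+] y); rewrite bl_add.
split; first by move=> a _ [x ->]; exists (a [*] x); rewrite bl_scal.
move=> u l hu hl; have [x hx] := choice_fun hu.
have [z hz] : exists z, vconv x z.
  apply: vcomplete => e he; have [N hN] := hl (c * e / 2) ltac:(nra).
  exists N => m n hm hn; have := lb (x m [-] x n); rewrite bl_add bl_opp -!hx.
  have := hN m hm; have := hN n hn; have := nm_tri3 (u m) l (u n); rewrite (nm_sym l (u n)) => h1 h2 h3 h4.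
  apply: (Rmult_lt_reg_l c) => //; lra.
exists z; apply: (vconv_unique hl); apply: vconv_ext (bl_conv T hz) => n; exact: esym.
Qed.

(** With K - kap bounded below, all ranges of its powers are closed. A vector outside the first
    range would make each inclusion of these ranges strict, contradicting [chain_dec]. *)
Lemma fredholm X (K : bop X) kap : cpt K -> kap <> C0 ->
  (forall x, K x = kap [*] x -> x = vzero) -> forall y, exists x, shf K kap x = y.
Proof.
move=> hK kz inj y0; apply: NNPP => hy0.
have [c [hc lb]] := inj_lb hK kz inj.
set T := shf K kap in lb hy0.
have lbn n : forall x, c^n * nm x <= nm (bpow T n x).
  elim: n => [|n IH] x /=; first lra.
  apply: Rle_trans (lb (bpow T n x)); rewrite Rmult_assoc; apply: Rmult_le_compat_l (IH x); lra.
have inj' x : T x = vzero -> x = vzero.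
  move=> h; apply: inj; apply: vsub_eq0; exact: h.
have injn n x : bpow T n x = vzero -> x = vzero by elim: n => //= n IH /inj'.
apply: (@chain_dec X K (fun n y => exists x, y = bpow T n x) kap hK kz).
- by move=> n; apply: (lb_range (c := c^n)) => //; exact: pow_lt.
- by move=> n _ [x ->]; exists (T x); rewrite bpow_S.
- move=> n; exists (bpow T n y0); split; first by exists y0.
  move=> [x e]; apply: hy0; exists x; rewrite bpow_S bcompE in e.
  apply: vsub_eq0; apply: (injn n); rewrite bl_add bl_opp -e vadd_opp //.
- move=> n _ [x ->]; exists (K x).
  by have /(f_equal (fun S : bop X => S x)) := @shf_pow_comm X K kap n K erefl.
- by move=> n _ [x ->]; exists x.
Qed.

Lemma eig_finite X (K : bop X) e : cpt K -> 0 < e ->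
  exists l : list Cplx, forall kap x, e <= Cmod kap -> x <> vzero -> K x = kap [*] x -> In kap l.
Proof.
move=> hK he; apply: NNPP => hn.
have far (l : list Cplx) : exists p : Cplx * X, e <= Cmod p.1 /\ p.2 <> vzero /\ K p.2 = p.1 [*] p.2 /\ ~ In p.1 l.
  apply: NNPP => h; apply: hn; exists l => kap x h1 h2 h3; apply: NNPP => h4; apply: h; by exists (kap, x).
have [g hg] := choice_fun far.
pose ls := fix ls n := match n with O => nil | S n' => cons (g (ls n')).1 (ls n') end.
pose kap n := (g (ls n)).1; pose v n := (g (ls n)).2.
have hin m n : (m < n)%nat -> In (kap m) (ls n).
  elim: n => [|n IH] hmn; first lia.
  by case: (Nat.eq_dec m n) => [->|ne] /=; [left | right; apply: IH; lia].
have hne m n : (m < n)%nat -> kap n <> kap m.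
  by move=> hmn hk; have [_ [_ [_ h]]] := hg (ls n); apply: h; rewrite -/(kap n) hk; exact: hin.
(* The kernels of the products of K - kap_i strictly increase: the eigenvector v n is killed at
   stage n+1, while at stage n it is only multiplied by nonzero differences of eigenvalues. *)
pose P := fix P n : bop X := match n with O => bid | S n' => shf K (kap n') [o] P n' end.
have PK n : K [o] P n = P n [o] K.
  elim: n => [|n IH] /=; first by rewrite comp1b compb1.
  by rewrite bcompA (@shf_comm _ _ _ K erefl) -!bcompA IH.
have hv n : v n <> vzero /\ K (v n) = kap n [*] v n by have [_ [h1 [h2 _]]] := hg (ls n).
have Pv n m : (n <= m)%nat -> exists a, a <> C0 /\ P n (v m) = a [*] v m.
  elim: n => [|n IH] hnm /=; first by exists C1; split; [exact: C1_neq0 | vec].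
  have [a [ha ea]] := IH ltac:(lia); exists ((kap m - kap n) * a)%C; split.
    by apply: Cmul_neq0 => // h; apply: (hne n m ltac:(lia)); exact: Csub_eq0.
  rewrite ea ?shfE bl_scal (proj2 (hv m)); vec.
apply: (@chain_inc X K (fun n x => P n x = vzero) kap e hK he).
- by move=> n; exact: (csub_ker (P n)).
- by move=> n x /= hx; rewrite hx !bl_0; vec.
- move=> n; exists (v n); have [h1 h2] := hv n; have [a [ha ea]] := Pv n n (Nat.le_refl _); split.
    by rewrite /= ea ?shfE bl_scal h2; vec.
  by rewrite ea => h; apply: h1; exact: scal_eq0 h ha.
- by move=> n; case: (hg (ls n)).
- by move=> n x hx; have /(f_equal (fun S : bop X => S x)) /= <- := PK n; rewrite hx bl_0.
- move=> n x /= hx; rewrite -hx bl_add bl_opp bl_scal ?shfE; congr vadd.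
  by have /(f_equal (fun S : bop X => S x)) /= <- := PK n.
Qed.

Lemma C_complete (u : nat -> Cplx) :
  (forall e, 0 < e -> exists N, forall m n, (N <= m)%nat -> (N <= n)%nat -> Cmod (u m - u n)%C < e) ->
  exists l, forall e, 0 < e -> exists N, forall n, (N <= n)%nat -> Cmod (u n - l)%C < e.
Proof.
move=> h.
have re_le z : Rabs (re z) <= Cmod z.
  by apply: Rsq_le; [exact: Cmod_ge0 | rewrite Cmod_sq -Rabs_mult Rabs_pos_eq; nra].
have im_le z : Rabs (im z) <= Cmod z.
  by apply: Rsq_le; [exact: Cmod_ge0 | rewrite Cmod_sq -Rabs_mult Rabs_pos_eq; nra].
have [a ha] : {l | Un_cv (fun n => re (u n)) l}.
  apply: R_complete => e he; have [N hN] := h e he; exists N => n m hn hm.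
  by apply: Rle_lt_trans (hN n m hn hm); exact: (re_le (u n - u m)%C).
have [b hb] : {l | Un_cv (fun n => im (u n)) l}.
  apply: R_complete => e he; have [N hN] := h e he; exists N => n m hn hm.
  by apply: Rle_lt_trans (hN n m hn hm); exact: (im_le (u n - u m)%C).
exists (mkC a b) => e he.
have [N1 h1] := ha (e/2) ltac:(lra); have [N2 h2] := hb (e/2) ltac:(lra).
exists (N1 + N2)%nat => n hn.
have := h1 n ltac:(lia); have := h2 n ltac:(lia); rewrite /R_dist => k2 k1.
have -> : (u n - mkC a b)%C = (RtoC (re (u n) - a) + mkC 0 1 * RtoC (im (u n) - b))%C by apply: C_eq => /=; ring.
apply: Rle_lt_trans (Cmod_triangle _ _) _; rewrite Cmod_mul !Cmod_RtoC.
have -> : Cmod (mkC 0 1) = 1 by rewrite /Cmod /= (_ : _ + _ = 1) ?sqrt_1 //; ring.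
lra.
Qed.

(** When x lies outside [M], its image in the quotient is nonzero, so coefficients along x are
    controlled by norms and converge with the vectors. Iterated, this closes finite-dimensional
    spans. *)
Lemma csub_line X (M : X -> Prop) x : closed_vsubspace M ->
  closed_vsubspace (fun y => exists c m, M m /\ y = c [*] x [+] m).
Proof.
move=> HM; have VM := csub_sub HM.
case: (classic (M x)) => hx.
  have -> : (fun y => exists c m, M m /\ y = c [*] x [+] m) = M; last by [].
  apply/boolp.predeqP => y; split.
    by move=> [c [m [hm ->]]]; apply: vsub_add => //; exact: vsub_scal.
  by move=> hy; exists C0, y; split=> //; vec.
split; first by exists C0, vzero; split; [exact: vsub_0 | vec].
split.
  move=> _ _ [c [m [hm ->]]] [d [n [hn ->]]]; exists (c + d)%C, (m [+] n); split; [exact: vsub_add | vec].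
split.
  move=> a _ [c [m [hm ->]]]; exists (a * c)%C, (a [*] m); split; [exact: vsub_scal | vec].
move=> u l hu hl.
have [c hc] := choice_fun hu.
have nz : proj HM x <> vzero by move=> /proj_0.
have p := nm_gt0 nz.
have pu n : proj HM (u n) = c n [*] proj HM x.
  have [m [hm ->]] := hc n; rewrite bl_add bl_scal; have /proj_0 -> := hm; vec.
have [k hk] : exists k, forall e, 0 < e -> exists N, forall n, (N <= n)%nat -> Cmod (c n - k)%C < e.
  apply: C_complete => e he; have [N hN] := hl (e * nm (proj HM x) / 2) ltac:(nra).
  exists N => m n hm hn; apply: (Rmult_lt_reg_r (nm (proj HM x))) => //.
  rewrite -vnorm_scal.
  have -> : (c m - c n)%C [*] proj HM x = proj HM (u m [-] u n) by rewrite bl_add bl_opp !pu; vec.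
  apply: Rle_lt_trans (proj_nm _ _) _.
  have := hN m hm; have := hN n hn; have := nm_tri3 (u m) l (u n); rewrite (nm_sym l (u n)); lra.
exists k, (l [-] k [*] x); split; last vec.
have [_ [_ [_ hcl]]] := HM; apply: (hcl (fun n => u n [-] c n [*] x)).
  by move=> n; have [m [hm ->]] := hc n; have -> : c n [*] x [+] m [-] c n [*] x = m by vec.
apply: vconv_add => // e he; have hx0 := nm_ge0 x.
have [N hN] := hk (e / (nm x + 1)) ltac:(divpos); exists N => n hn.
have -> : vopp (c n [*] x) [-] vopp (k [*] x) = vopp ((c n - k)%C [*] x) by vec.
rewrite nm_opp vnorm_scal; have := hN n hn; have := Cmod_ge0 (c n - k)%C.
have e1 : e / (nm x + 1) * (nm x + 1) = e by field; lra.
nra.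
Qed.

Lemma span_cons X (x : X) (l : list X) y :
  span (fun z => In z (x :: l)) y <-> exists c m, span (fun z => In z l) m /\ y = c [*] x [+] m.
Proof.
split.
  elim=> [|z [<-|hz]|_ _ _ [c [m [hm ->]]] _ [d [n [hn ->]]]|a _ _ [c [m [hm ->]]]].
  - by exists C0, vzero; split; [exact: span0 | vec].
  - by exists C1, vzero; split; [exact: span0 | vec].
  - by exists C0, z; split; [exact: span1 | vec].
  - exists (c + d)%C, (m [+] n); split; [exact: spanD | vec].
  - exists (a * c)%C, (a [*] m); split; [exact: spanZ | vec].
move=> [c [m [hm ->]]]; apply: spanD; first by apply: spanZ; apply: span1; left.
apply: span_min hm => [|z hz]; first exact: span_sub.
by apply: span1; right.
Qed.

Lemma span_closed X (l : list X) : closed_vsubspace (span (fun z => In z l)).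
Proof.
elim: l => [|x l IH].
  have -> : span (fun z : X => In z nil) = fun y => y = vzero; last exact: csub_zero.
  apply/boolp.predeqP => y; split.
    by elim=> [//|z []|? ? _ -> _ ->|? ? _ ->]; vec.
  by move=> ->; exact: span0.
have -> : span (fun z => In z (x :: l)) = fun y => exists c m, span (fun z => In z l) m /\ y = c [*] x [+] m.
  by apply/boolp.predeqP => y; exact: span_cons.
exact: csub_line.
Qed.

Definition fd X (M : X -> Prop) : Prop :=
  exists l : list X, forall x, M x -> span (fun z => In z l) x.

Lemma fd_sub X (M N : X -> Prop) : (forall x, M x -> N x) -> fd N -> fd M.
Proof. by move=> h [l hl]; exists l => x /h /hl. Qed.

Lemma fd_map X Y (T : blin X Y) (M : X -> Prop) : fd M -> fd (fun y => exists x, M x /\ y = T x).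
Proof.
move=> [l hl]; exists (map T l) => _ [x [/hl hx ->]].
by apply: span_map hx => y hy; apply: span1; exact: in_map.
Qed.

Lemma fd_add X (M N : X -> Prop) : fd M -> fd N -> fd (fun z => exists x y, M x /\ N y /\ z = x [+] y).
Proof.
move=> [l hl] [k hk]; exists (l ++ k) => _ [x [y [/hl hx [/hk hy ->]]]]; apply: spanD.
  by apply: span_min hx => [|z hz]; [exact: span_sub | apply: span1; apply: in_or_app; left].
by apply: span_min hy => [|z hz]; [exact: span_sub | apply: span1; apply: in_or_app; right].
Qed.

(** Otherwise Riesz's lemma produces an infinite 1/2-separated sequence of unit vectors in [M], all
    fixed by the compact e. *)
Lemma fd_cpt X (e : bop X) (M : X -> Prop) : vsubspace M -> cpt e ->
  (forall x, M x -> e x = x) -> fd M.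
Proof.
move=> VM he hM; apply: NNPP => hn.
have far (l : list {x : X | M x}) : exists u : {x : X | M x}, nm (proj1_sig u) = 1 /\
    forall m, In m l -> 1/2 <= nm (proj1_sig u [-] proj1_sig m).
  apply: NNPP => h; apply: hn; exists (map (@proj1_sig _ _) l) => x hx; apply: NNPP => hx2.
  have [u [h1 [h2 [c [m [h3 h4]]]]]] := riesz_lemma (span_closed _) hx2.
  have hu : M u.
    rewrite h4; apply: vsub_scal => //; apply: vsub_sub => //.
    by apply: span_min h3 => // z /in_map_iff [[w hw] [<- _]].
  apply: h; exists (exist _ u hu); split=> // m' hm; apply: h2; apply: span1; exact: in_map.
have [g hg] := choice_fun far.
pose ls := fix ls n := match n with O => nil | S n' => cons (g (ls n')) (ls n') end.
have hin m n : (m < n)%nat -> In (g (ls m)) (ls n).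
  elim: n => [|n IH] hmn; first lia.
  by case: (Nat.eq_dec m n) => [->|ne] /=; [left | right; apply: IH; lia].
apply: (@no_sep _ _ e (fun n => proj1_sig (g (ls n))) 1 (1/2) he); first lra.
  by move=> n; case: (hg (ls n)) => -> _; lra.
move=> m n hmn; have [_ h] := hg (ls n); rewrite !hM; [exact: (h _ (hin _ _ hmn)) | exact: proj2_sig | exact: proj2_sig].
Qed.

(** * Quasinilpotent operators and spectral splittings *)

(** A bound that survives restriction, induction on quotients and intertwining by bounded maps. It
    lies between spectral radius smaller than s and spectral radius at most s. *)
Definition gr X (T : bop X) (s : R) : Prop := exists C, forall n, nm (bpow T n) <= C * s ^ n.
Definition qn X (T : bop X) : Prop := forall s, 0 < s -> gr T s.

(** The resolvent of A on the unit circle as an arbitrary family of two-sided inverses with a common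
    bound. *)
Definition rfam X (A : bop X) (Rs : R -> bop X) (B : R) : Prop :=
  forall t, (bid [-] cis t [*] A) [o] Rs t = bid /\ Rs t [o] (bid [-] cis t [*] A) = bid /\ nm (Rs t) <= B.

(* Average of the resolvent over the 2^k-th roots of unity: it inverts 1 - (cis t A)^(2^k). *)
Fixpoint gk X (Rs : R -> bop X) (k : nat) (t : R) : bop X :=
  match k with
  | O => Rs t
  | S k => RtoC (1/2) [*] (gk Rs k t [+] gk Rs k (t + PI / 2 ^ k))
  end.

Lemma half2 X (z : X) : RtoC (1/2) [*] (z [+] z) = z.
Proof.
have -> : RtoC (1/2) [*] (z [+] z) = (RtoC (1/2) * (C1 + C1))%C [*] z by vec.
have -> : (RtoC (1/2) * (C1 + C1))%C = C1 by apply: C_eq => /=; field.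
exact: vscal_1.
Qed.

Lemma nm_half X (x y : X) C : nm x <= C -> nm y <= C -> nm (RtoC (1/2) [*] (x [+] y)) <= C.
Proof. by move=> hx hy; rewrite nm_scalR; [have := vnorm_triangle x y; lra | lra]. Qed.

Lemma pow2_split k : Nat.pow 2 (S k) = (Nat.pow 2 k + Nat.pow 2 k)%nat.
Proof. by rewrite /=; lia. Qed.

Lemma pow2_pos k : (1 <= Nat.pow 2 k)%nat.
Proof. by elim: k => [|k IH] /=; lia. Qed.

Lemma pow2_ge k : (k < Nat.pow 2 k)%nat.
Proof. by elim: k => [|k IH] /=; lia. Qed.

Section Dyadic.
Variables (X : CBanach) (A : bop X) (Rs : R -> bop X) (B : R).
Hypothesis HR : rfam A Rs B.

Lemma gk_cis k t : cis (2 ^ k * (t + PI / 2 ^ k)) = (- cis (2 ^ k * t))%C.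
Proof.
have p : 2 ^ k <> 0 by apply: pow_nonzero; lra.
have -> : 2 ^ k * (t + PI / 2 ^ k) = 2 ^ k * t + PI by field.
by rewrite cis_add cis_PI; ring.
Qed.

(** The partial fraction 1/(1-z^2) = (1/(1-z) + 1/(1+z))/2, applied with z equal to (cis t A)^(2^k);
    the half-step in t changes the sign of z. *)
Lemma gk_inv k t : (bid [-] cis (2 ^ k * t) [*] bpow A (Nat.pow 2 k)) [o] gk Rs k t = bid.
Proof.
elim: k t => [|k IH] t.
  by rewrite /= compb1 Rmult_1_l; case: (HR t).
have hP := IH t; have hQ := IH (t + PI / 2 ^ k); rewrite gk_cis in hQ.
rewrite pow2_split bpow_add (_ : 2 ^ S k * t = 2 ^ k * t + 2 ^ k * t); last by rewrite /=; ring.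
rewrite cis_add [gk _ _ _]/=.
move: hP hQ; set P := gk Rs k t; set Q := gk Rs k _; set c := cis _; set n := Nat.pow 2 k => hP hQ.
have e1 : bid [-] (c * c)%C [*] (bpow A n [o] bpow A n) = (bid [+] c [*] bpow A n) [o] (bid [-] c [*] bpow A n) by bvec.
have e2 : bid [-] (c * c)%C [*] (bpow A n [o] bpow A n) = (bid [-] c [*] bpow A n) [o] (bid [-] (- c)%C [*] bpow A n) by bvec.
have e3 : (bid [-] (c * c)%C [*] (bpow A n [o] bpow A n)) [o] P = bid [+] c [*] bpow A n.
  by rewrite e1 -bcompA hP compb1.
have e4 : (bid [-] (c * c)%C [*] (bpow A n [o] bpow A n)) [o] Q = bid [-] c [*] bpow A n.
  by rewrite e2 -bcompA hQ compb1.
rewrite compbZr compbDr e3 e4 -[RHS](half2); congr vscal; vec.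
Qed.

Lemma gk_comm k t : A [o] gk Rs k t = gk Rs k t [o] A.
Proof.
elim: k t => [|k IH] t /=; last by rewrite compbZr compbZl compbDl compbDr !IH.
have [r [l _]] := HR t.
have e : Rs t [o] (bid [-] cis t [*] A) [o] Rs t [o] A = Rs t [o] A by rewrite l comp1b.
have h : cis t [*] (A [o] Rs t) = cis t [*] (Rs t [o] A).
  have e1 : Rs t [-] cis t [*] (A [o] Rs t) = bid by rewrite -r; bvec.
  have e2 : Rs t [-] cis t [*] (Rs t [o] A) = bid by rewrite -l; bvec.
  have -> : cis t [*] (A [o] Rs t) = Rs t [-] (Rs t [-] cis t [*] (A [o] Rs t)) by vec.
  rewrite e1 -e2; vec.
have -> : A [o] Rs t = Cinv (cis t) [*] (cis t [*] (A [o] Rs t)).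
  have := @cis_neq0 t => nz; vec.
have := @cis_neq0 t => nz; rewrite h; vec.
Qed.

(** For exponents of at least 2^k the identity A^n (P + Q) = c^-1 (P - Q), with n = 2^k and a
    unimodular c, lowers the exponent by n. Hence the bound [B] of the resolvent persists for all
    exponents, uniformly in k. *)
Lemma gk_bd k m t : (m < Nat.pow 2 k)%nat -> nm (bpow A m [o] gk Rs k t) <= B.
Proof.
elim: k m t => [|k IH] m t hm.
  have -> : m = 0%nat by move: hm => /=; lia.
  by rewrite /= comp1b; case: (HR t) => _ [].
rewrite pow2_split in hm; rewrite [gk _ _ _]/=.
case: (Nat.lt_ge_cases m (Nat.pow 2 k)) => hk.
  by rewrite compbZr compbDr; apply: nm_half; exact: IH.
have -> : m = (m - Nat.pow 2 k + Nat.pow 2 k)%nat by lia.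
have := IH (m - Nat.pow 2 k)%nat t ltac:(lia); have := IH (m - Nat.pow 2 k)%nat (t + PI / 2 ^ k) ltac:(lia).
move: (m - Nat.pow 2 k)%nat => m0.
have := gk_inv k t; have := gk_inv k (t + PI / 2 ^ k); rewrite gk_cis.
have hc : cis (2 ^ k * t) <> C0 by exact: cis_neq0.
have mc := Cmod_cis (2 ^ k * t).
move: hc mc; set P := gk Rs k t; set Q := gk Rs k _; set c := cis _; set n := Nat.pow 2 k => hc mc hQ hP bQ bP.
have e : bpow A n [o] (P [+] Q) = Cinv c [*] (P [-] Q).
  have e1 : P [-] c [*] (bpow A n [o] P) = bid by rewrite -hP; bvec.
  have e2 : Q [+] c [*] (bpow A n [o] Q) = bid by rewrite -hQ; bvec.
  have -> : P [-] Q = (P [-] c [*] (bpow A n [o] P)) [-] (Q [+] c [*] (bpow A n [o] Q)) [+] c [*] (bpow A n [o] (P [+] Q)).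
    by bvec.
  rewrite e1 e2; vec.
rewrite bpow_add compbZr -bcompA e compbZr compbDr compbNr.
have -> : RtoC (1/2) [*] (Cinv c [*] (bpow A m0 [o] P [-] bpow A m0 [o] Q)) =
   Cinv c [*] (RtoC (1/2) [*] (bpow A m0 [o] P [-] bpow A m0 [o] Q)) by vec.
rewrite vnorm_scal Cmod_inv // mc Rinv_1 Rmult_1_l.
by apply: nm_half => //; rewrite nm_opp.
Qed.

Lemma gk_bd0 k t : nm (gk Rs k t) <= B.
Proof. by have := @gk_bd k 0 t (pow2_pos k); rewrite /= comp1b. Qed.

Lemma rfam_lip s t : nm (Rs s [-] Rs t) <= B * B * nm A * Rabs (s - t).
Proof.
have [_ [l1 b1]] := HR s; have [r2 [_ b2]] := HR t.
have -> : Rs s [-] Rs t = (cis s - cis t)%C [*] (Rs s [o] A [o] Rs t).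
  have -> : Rs s [-] Rs t = Rs s [o] ((bid [-] cis t [*] A) [o] Rs t) [-] (Rs s [o] (bid [-] cis s [*] A)) [o] Rs t.
    by rewrite r2 l1 compb1 comp1b.
  bvec.
rewrite vnorm_scal.
have h1 := cis_lip s t.
have h2 : nm (Rs s [o] A [o] Rs t) <= B * nm A * B.
  apply: Rle_trans (nm_comp _ _) _; apply: Rmult_le_compat => //; try exact: nm_ge0.
  apply: Rle_trans (nm_comp _ _) _; apply: Rmult_le_compat => //; try exact: nm_ge0; lra.
have := Rmult_le_compat _ _ _ _ (Cmod_ge0 _) (nm_ge0 _) h1 h2; lra.
Qed.

Lemma gk_lip k s t : nm (gk Rs k s [-] gk Rs k t) <= B * B * nm A * Rabs (s - t).
Proof.
elim: k s t => [|k IH] s t /=; first exact: rfam_lip.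
have h1 := IH s t; have h2 := IH (s + PI / 2 ^ k) (t + PI / 2 ^ k).
have e : s + PI / 2 ^ k - (t + PI / 2 ^ k) = s - t by ring.
rewrite e in h2; move: h1 h2.
set a := gk Rs k s; set b := gk Rs k t; set c := gk Rs k _; set d := gk Rs k _ => h1 h2.
have -> : RtoC (1/2) [*] (a [+] c) [-] RtoC (1/2) [*] (b [+] d) = RtoC (1/2) [*] ((a [-] b) [+] (c [-] d)) by vec.
exact: nm_half.
Qed.

(** The limit of (1 - A^(2^k))^-1 acts as the Riesz projection for the inside of the circle: it
    exists because consecutive averages differ by a Lipschitz increment over PI/2^k. The part c has
    bounded forward orbit; d is approximated by A^m z with z bounded, since the difference x - (1 -
    A^n)^-1 x equals -A^n (1 - A^n)^-1 x. *)
Lemma split_spectral (x : X) : exists c d, x = c [+] d /\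
  (forall m, nm (bpow A m c) <= B * nm x) /\
  (forall m e, (1 <= m)%nat -> 0 < e -> exists z, nm z <= B * nm x /\ nm (d [-] bpow A m z) <= e).
Proof.
pose L := B * B * nm A * PI.
have [Q [hQ _]] : exists Q, vconv (fun k => gk Rs k 0) Q /\ forall k, nm (gk Rs k 0 [-] Q) <= 2 * L * (1/2)^k.
  apply: geom_conv => k /=.
  have := gk_lip k (0 + PI / 2 ^ k) 0.
  set a := gk Rs k 0; set b := gk Rs k _ => h.
  have -> : RtoC (1/2) [*] (a [+] b) [-] a = RtoC (1/2) [*] (b [-] a) by rewrite -{2}(half2 a); vec.
  rewrite nm_scalR; last lra.
  have p : 0 < PI / 2 ^ k by apply: Rdiv_lt_0_compat; [exact: PI_RGT_0 | apply: pow_lt; lra].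
  rewrite (Rabs_pos_eq (_ - _)) in h; last lra.
  have e : PI / 2 ^ k = PI * (1/2)^k.
    by rewrite /Rdiv Rmult_1_l pow_inv.
  rewrite Rplus_0_l Rminus_0_r e in h.
  have n0 := nm_ge0 (b [-] a); rewrite /L; lra.
have hc := bconv_app x hQ.
exists (Q x), (x [-] Q x); split; first vec.
have bdx k m : (m < Nat.pow 2 k)%nat -> nm (bpow A m (gk Rs k 0 x)) <= B * nm x.
  move=> hm; rewrite -bcompE; apply: Rle_trans (nm_ge _ _) _.
  by apply: nm_mulr; exact: gk_bd.
split.
  move=> m; apply: (vconv_nm_le (u := fun k => bpow A m (gk Rs (m + k) 0 x))).
    apply: bl_conv; apply: (vconv_sub (phi := fun k => (m + k)%nat)) hc => k; lia.
  move=> k; apply: bdx; have := pow2_ge (m + k); lia.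
move=> m e hm he; have [N hN] := hc e he.
pose k := (N + m)%nat; have hk : (m < Nat.pow 2 k)%nat by have := pow2_ge k; rewrite /k; lia.
exists (vopp (bpow A (Nat.pow 2 k - m) (gk Rs k 0 x))); split.
  by rewrite nm_opp; apply: bdx; lia.
have -> : x [-] Q x [-] bpow A m (vopp (bpow A (Nat.pow 2 k - m) (gk Rs k 0 x))) = gk Rs k 0 x [-] Q x.
  rewrite bl_opp -bcompE -bpow_add (_ : (m + (Nat.pow 2 k - m) = Nat.pow 2 k)%nat); last lia.
  have /(f_equal (fun Z : bop X => Z x)) := gk_inv k 0.
  rewrite Rmult_0_r cis_0; bsimp => e1; rewrite -{1}e1; vec.
by apply: Rlt_le; apply: hN; rewrite /k; lia.
Qed.
End Dyadic.

(** One continuation step for the spectral radius. For a suitable n = 2^k the inverse of 1 - A'^n is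
    within 1/4 of 1, so that of 1 - A^n is within 1/2 of 1, which gives |A^n x| <= (|x| + |A^n
    x|)/2. *)
Lemma srstep X (A A' : bop X) Rs Rs' B B' : rfam A Rs B -> rfam A' Rs' B' ->
  (forall t, nm (Rs t [-] Rs' t) <= 1/4) ->
  (forall e, 0 < e -> exists N, forall n, (N <= n)%nat -> nm (bpow A' n) <= e) ->
  exists k, forall x, nm (bpow A (Nat.pow 2 k) x) <= nm x.
Proof.
move=> HR HR' hd h0.
have hk k t : nm (gk Rs k t [-] gk Rs' k t) <= 1/4.
  elim: k t => [|k IH] t /=; first exact: hd.
  have h1 := IH t; have h2 := IH (t + PI / 2 ^ k); move: h1 h2.
  set a := gk Rs k t; set b := gk Rs' k t; set c := gk Rs k _; set d := gk Rs' k _ => h1 h2.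
  have -> : RtoC (1/2) [*] (a [+] c) [-] RtoC (1/2) [*] (b [+] d) = RtoC (1/2) [*] ((a [-] b) [+] (c [-] d)) by vec.
  exact: nm_half.
have hB : 0 <= B' by case: (HR' 0) => _ [_ h]; have := nm_ge0 (Rs' 0); lra.
have [N hN] := h0 (/ (4 * (B' + 1))) ltac:(apply: Rinv_0_lt_compat; lra).
exists N => x; set n := Nat.pow 2 N.
have hn : nm (bpow A' n) <= / (4 * (B' + 1)) by apply: hN; have := pow2_ge N; rewrite /n; lia.
have g' := gk_inv HR' N 0; have g := gk_inv HR N 0; rewrite Rmult_0_r cis_0 in g g'.
have gb := gk_bd0 HR' N 0; have hkN := hk N 0.
move: g g' gb hkN; rewrite -/n; set G := gk Rs N 0; set G' := gk Rs' N 0 => g g' gb hkN.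
have e' : G' [-] bid = bpow A' n [o] G' by rewrite -g'; bvec.
have h1 : nm (G' [-] bid) <= 1/4.
  rewrite e'; apply: Rle_trans (nm_comp _ _) _.
  apply: Rle_trans (Rmult_le_compat _ _ _ _ (nm_ge0 _) (nm_ge0 _) hn gb) _.
  apply: (Rmult_le_reg_l (4 * (B' + 1))); first lra.
  by rewrite -Rmult_assoc Rinv_r; lra.
have h2 : nm (G [-] bid) <= 1/2.
  have -> : G [-] bid = (G [-] G') [+] (G' [-] bid) by vec.
  by have := vnorm_triangle (G [-] G') (G' [-] bid); lra.
have hA : A [o] G = G [o] A by exact: (gk_comm HR).
have com : G [o] bpow A n = bpow A n [o] G by exact: bpow_comm.
have e1 : G (x [-] bpow A n x) = x.
  have e2 : G x [-] C1 [*] bpow A n (G x) = x by rewrite -{3}(bidE x) -g.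
  have e3 : G (bpow A n x) = bpow A n (G x) by rewrite -bcompE com.
  by rewrite bl_add bl_opp e3 -[RHS]e2; vec.
have := nm_ge (G [-] bid) (x [-] bpow A n x).
have -> : (G [-] bid : bop X) (x [-] bpow A n x) = bpow A n x by rewrite baddE boppE bidE e1; vec.
have := nm_sub x (bpow A n x); have := nm_ge0 (x [-] bpow A n x); nra.
Qed.

Lemma gr_pow X (T : bop X) s n0 : 0 < s -> (1 <= n0)%nat -> nm (bpow T n0) <= s ^ n0 -> gr T s.
Proof.
move=> hs hn h.
pose b := 1 + nm T / s.
have hb : 1 <= b.
  have : 0 <= nm T / s by apply: Rmult_le_pos; [exact: nm_ge0 | exact: Rinv_ge0].
  by rewrite /b; lra.
have hTb : nm T <= s * b by have -> : s * b = s + nm T by [rewrite /b; field; lra]; lra.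
exists (b ^ n0) => n.
have small r : (r <= n0)%nat -> nm (bpow T r) <= b ^ n0 * s ^ r.
  move=> hr; apply: Rle_trans (nm_bpow T r) _.
  apply: Rle_trans (pow_incr _ _ r (conj (nm_ge0 _) hTb)) _.
  rewrite Rpow_mult_distr Rmult_comm; apply: Rmult_le_compat_r; first by apply: pow_le; lra.
  exact: Rle_pow.
have := Nat.div_mod n n0 ltac:(lia).
have := Nat.mod_upper_bound n n0 ltac:(lia).
move: (Nat.div n n0) (Nat.modulo n n0) => q r hr ->.
rewrite bpow_add bpow_mul; apply: Rle_trans (nm_comp _ _) _.
have h1 : nm (bpow (bpow T n0) q) <= (s ^ n0) ^ q.
  apply: Rle_trans (nm_bpow _ _) _; apply: pow_incr; split=> //; exact: nm_ge0.
rewrite pow_add pow_mult.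
have := Rmult_le_compat _ _ _ _ (nm_ge0 _) (nm_ge0 _) h1 (small r ltac:(lia)); lra.
Qed.

Lemma gr_mono X (T : bop X) s t : 0 <= s -> s <= t -> gr T s -> gr T t.
Proof.
move=> hs hst [C hC]; exists (Rabs C) => n; apply: Rle_trans (hC n) _.
have := pow_incr s t n (conj hs hst); have := pow_le s n hs; have := RRle_abs C; have := Rabs_pos C; nra.
Qed.

Lemma gr_nm X (T : bop X) : gr T (nm T).
Proof. by exists 1 => n; rewrite Rmult_1_l; exact: nm_bpow. Qed.

Lemma pow_ratio_small C s t e : 0 <= s -> s < t -> 0 < e -> exists N, forall n, (N <= n)%nat -> C * s ^ n <= e * t ^ n.
Proof.
move=> hs hst he.
have hr : Rabs (s / t) < 1.
  rewrite Rabs_pos_eq; last by apply: Rmult_le_pos => //; apply: Rlt_le; apply: Rinv_0_lt_compat; lra.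
  by apply: (Rmult_lt_reg_r t); [lra | rewrite /Rdiv Rmult_assoc Rinv_l; lra].
have hC := Rabs_pos C.
have [N hN] := pow_lt_1_zero _ hr (e / (Rabs C + 1)) ltac:(divpos).
exists N => n hn; have := hN n hn.
have pt : 0 < t ^ n by apply: pow_lt; lra.
rewrite /Rdiv Rpow_mult_distr pow_inv => h.
have ps : 0 <= s ^ n by exact: pow_le.
rewrite Rabs_pos_eq in h; last by apply: Rmult_le_pos => //; exact: Rinv_ge0.
have h2 : s ^ n <= (e * / (Rabs C + 1)) * t ^ n.
  have := Rmult_le_compat_r _ _ _ (Rlt_le _ _ pt) (Rlt_le _ _ h).
  by rewrite Rmult_assoc Rinv_l; lra.
have h3 : C * s ^ n <= (Rabs C + 1) * s ^ n by apply: Rmult_le_compat_r => //; have := RRle_abs C; lra.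
apply: Rle_trans h3 _.
have -> : e * t ^ n = (Rabs C + 1) * (e * / (Rabs C + 1) * t ^ n) by field; lra.
by apply: Rmult_le_compat_l => //; lra.
Qed.

(** Approximate eigenvectors with bounded and bounded-away-from-zero scalars have, along a
    subsequence, a nonzero limit of k u, and this limit is an eigenvector whose eigenvalue lies in
    the annulus. *)
Lemma annulus_lb X (K : bop X) a b : cpt K -> 0 < a ->
  (forall k x, a <= Cmod k -> Cmod k <= b -> K x = k [*] x -> x = vzero) ->
  exists c, 0 < c /\ forall k x, a <= Cmod k -> Cmod k <= b -> c * nm x <= nm (shf K k x).
Proof.
move=> hK ha inj; apply: NNPP => hn.
have pt n : exists p : Cplx * X, nm p.2 = 1 /\ nm (shf K p.1 p.2) <= (1/2)^n /\ a <= Cmod p.1 /\ Cmod p.1 <= b.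
  apply: NNPP => h; apply: hn; exists ((1/2)^n); split; first exact: half_pow_gt0.
  move=> k x k1 k2; case: (classic (x = vzero)) => [->|nz]; first by rewrite bl_0 !nm_0; lra.
  have p := nm_gt0 nz.
  have hs : 0 <= / nm x by exact: Rinv_ge0.
  apply: Rnot_lt_le => hlt; apply: h; exists (k, RtoC (/ nm x) [*] x); rewrite /= bl_scal !nm_scalR //.
  split; first by field; lra.
  have := Rmult_le_compat_l (/ nm x) _ _ hs (Rlt_le _ _ hlt).
  have -> : / nm x * ((1 / 2) ^ n * nm x) = (1/2)^n by field; lra.
  move=> h3; split; last by [].
  have -> : RtoC (/ nm x) [*] K x [-] k [*] (RtoC (/ nm x) [*] x) = RtoC (/ nm x) [*] shf K k x by rewrite shfE; vec.
  by rewrite nm_scalR.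
have [p hp] := choice_fun pt.
pose u n := (p n).2; pose k n := (p n).1.
have [phi [hphi [y hy]]] := cpt_extract hK (u := u) (C := 1) (fun n => ltac:(rewrite /u; case: (hp n) => ->; lra)).
have hky : vconv (fun n => k (phi n) [*] u (phi n)) y.
  move=> e he; have [N1 h1] := hy (e/2) ltac:(lra); have [N2 h2] := @half_pow_small 1 (e/2) ltac:(lra).
  exists (N1 + N2)%nat => n hnn; have := h1 n ltac:(lia); have := h2 (phi n) ltac:(have := inc_ge hphi n; lia).
  have [_ [+ _]] := hp (phi n); rewrite shfE -/(u (phi n)) -/(k (phi n)).
  have := nm_tri3 (k (phi n) [*] u (phi n)) (K (u (phi n))) y; rewrite (nm_sym (k (phi n) [*] u (phi n)) (K _)); lra.
have ny : forall e, 0 < e -> exists n, Rabs (nm y - Cmod (k (phi n))) < e /\ nm (K y [-] k (phi n) [*] y) < e.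
  move=> e he; have hb : 0 < Rabs b + 1 by have := Rabs_pos b; lra.
  have hKy := bl_conv K hky; have [N1 h1] := hky e he; have [N2 h2] := hKy (e/2) ltac:(lra).
  have [N3 h3] := hy (e / (2 * (Rabs b + 1))) ltac:(divpos).
  pose n := (N1 + N2 + N3)%nat; exists n; have := h1 n ltac:(rewrite /n; lia).
  have := h2 n ltac:(rewrite /n; lia); have := h3 n ltac:(rewrite /n; lia).
  have [e1 [_ [a1 a2]]] := hp (phi n); rewrite -/(u (phi n)) -/(k (phi n)) in e1 a1 a2.
  move=> g3 g2 g1; split.
    have n1 : nm (k (phi n) [*] u (phi n)) = Cmod (k (phi n)) by rewrite vnorm_scal e1 Rmult_1_r.
    have := nm_rev y (k (phi n) [*] u (phi n)); have := nm_rev (k (phi n) [*] u (phi n)) y.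
    by rewrite (nm_sym y) n1 => q1 q2; apply: Rabs_def1; lra.
  have := nm_tri3 (K y) (k (phi n) [*] K (u (phi n))) (k (phi n) [*] y).
  rewrite bl_scal in g2; rewrite (nm_sym (K y) (k (phi n) [*] K _)).
  have -> : k (phi n) [*] K (u (phi n)) [-] k (phi n) [*] y = k (phi n) [*] (K (u (phi n)) [-] y) by vec.
  rewrite vnorm_scal => q.
  have q2 : Cmod (k (phi n)) * nm (K (u (phi n)) [-] y) <= (Rabs b + 1) * (e / (2 * (Rabs b + 1))).
    apply: Rmult_le_compat; [exact: Cmod_ge0 | exact: nm_ge0 | have := RRle_abs b; lra | lra].
  have e2 : (Rabs b + 1) * (e / (2 * (Rabs b + 1))) = e/2 by field; lra.
  lra.
have hk n : a <= Cmod (k (phi n)) /\ Cmod (k (phi n)) <= b by have [_ [_]] := hp (phi n).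
have ya : a <= nm y.
  apply: Rnot_lt_le => h; have [n [/Rabs_def2 hn' _]] := ny (a - nm y) ltac:(lra); have := hk n; lra.
have y0 : y <> vzero by move=> h; move: ya; rewrite h nm_0; lra.
have [c [m [hm ec]]] : exists c m, m = vzero /\ K y = c [*] y [+] m.
  apply: (closed_cl (csub_line y (csub_zero X))) => e he.
  have [n [_ h2]] := ny e he; exists (k (phi n) [*] y); split=> //.
  by exists (k (phi n)), vzero; split=> //; vec.
rewrite hm vadd_0 in ec.
have cl_c e : 0 < e -> exists n, Cmod (c - k (phi n))%C < e.
  move=> he; have [n [_ h2]] := ny (e * nm y) ltac:(nra); exists n.
  apply: (Rmult_lt_reg_r (nm y)); first lra.
  by rewrite -vnorm_scal; have -> : (c - k (phi n))%C [*] y = K y [-] k (phi n) [*] y by [rewrite ec; vec].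
have tri (z w : Cplx) : Cmod z <= Cmod w + Cmod (z - w)%C.
  by have := Cmod_triangle w (z - w)%C; have -> : (w + (z - w))%C = z by ring.
apply: y0; apply: (inj c) => //; apply: Rnot_lt_le => h.
  have [n hn'] := cl_c (a - Cmod c) ltac:(lra); have := tri (k (phi n)) c.
  by rewrite Cmod_sub_sym; have := hk n; lra.
have [n hn'] := cl_c (Cmod c - b) ltac:(lra); have := tri c (k (phi n)); have := hk n; lra.
Qed.

Lemma circle_res X (K : bop X) s c : 0 < s -> 0 < c ->
  (forall k, Cmod k = s -> (forall x, c * nm x <= nm (shf K k x)) /\ forall y, exists x, shf K k x = y) ->
  exists Rs, rfam (RtoC (/ s) [*] K) Rs (s / c).
Proof.
move=> hs hc h.
have nz : RtoC s <> C0 by apply: RtoC_neq0; lra.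
have ex t : exists U : bop X, (bid [-] cis t [*] (RtoC (/ s) [*] K)) [o] U = bid /\
    U [o] (bid [-] cis t [*] (RtoC (/ s) [*] K)) = bid /\ nm U <= / (c / s).
  have ct := @cis_neq0 t; have mt := Cmod_cis t.
  pose k := (RtoC s * Cinv (cis t))%C.
  have mk : Cmod k = s by rewrite /k Cmod_mul Cmod_inv // mt Cmod_RtoC_pos; lra.
  have [h1 h2] := h k mk.
  have e : bid [-] cis t [*] (RtoC (/ s) [*] K) = (- (cis t * Cinv (RtoC s)))%C [*] shf K k.
    rewrite /shf /k RtoC_inv; last lra.
    vec.
  have mc : Cmod (- (cis t * Cinv (RtoC s)))%C = / s.
    by rewrite Cmod_opp Cmod_mul mt Cmod_inv // Cmod_RtoC_pos; lra.
  have cs : 0 < c / s by exact: Rdiv_lt_0_compat.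
  apply: (@binv X X (bid [-] cis t [*] (RtoC (/ s) [*] K)) (c / s) cs) => [x|y].
    rewrite e bscalE vnorm_scal mc; have := h1 x => h3.
    have := Rmult_le_compat_l (/ s) _ _ (Rinv_ge0 (hs)) h3.
    by rewrite /Rdiv; lra.
  have [x hx] := h2 (Cinv (- (cis t * Cinv (RtoC s)))%C [*] y); exists x.
  rewrite e bscalE hx.
  have q : (- (cis t * Cinv (RtoC s)))%C <> C0.
    by move=> q; move: mc; rewrite q Cmod_C0; have := Rinv_0_lt_compat _ hs; lra.
  move: (- (cis t * Cinv (RtoC s)))%C q => z q; vec.
have [Rs hR] := choice_fun ex; exists Rs.
have -> : s / c = / (c / s) by field; lra.
exact: hR.
Qed.

Lemma rfam_diff X (A A' : bop X) Rs Rs' B B' : rfam A Rs B -> rfam A' Rs' B' ->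
  forall t, nm (Rs t [-] Rs' t) <= B * B' * nm (A [-] A').
Proof.
move=> HR HR' t; have [_ [l1 b1]] := HR t; have [r2 [_ b2]] := HR' t.
have -> : Rs t [-] Rs' t = cis t [*] (Rs t [o] (A [-] A') [o] Rs' t).
  have -> : Rs t [-] Rs' t = Rs t [o] ((bid [-] cis t [*] A') [o] Rs' t) [-] (Rs t [o] (bid [-] cis t [*] A)) [o] Rs' t.
    by rewrite r2 l1 compb1 comp1b.
  bvec.
rewrite vnorm_scal Cmod_cis Rmult_1_l.
have h2 : nm (Rs t [o] (A [-] A') [o] Rs' t) <= B * nm (A [-] A') * B'.
  apply: Rle_trans (nm_comp _ _) _; apply: Rmult_le_compat => //; try exact: nm_ge0.
  apply: Rle_trans (nm_comp _ _) _; apply: Rmult_le_compat => //; try exact: nm_ge0; lra.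
lra.
Qed.

Lemma Cmod_neq0 z r : Cmod z = r -> 0 < r -> z <> C0.
Proof. by move=> h hr e; move: h; rewrite e Cmod_C0; lra. Qed.

Lemma nm_bpow_scalR X (T : bop X) r n : 0 <= r -> nm (bpow (RtoC r [*] T) n) = r ^ n * nm (bpow T n).
Proof. by move=> hr; have [d [-> hd]] := bpow_scal (RtoC r) T n; rewrite vnorm_scal hd Cmod_RtoC_pos. Qed.

Lemma rfam_mono X (A : bop X) Rs B B' : B <= B' -> rfam A Rs B -> rfam A Rs B'.
Proof. by move=> h HR t; have [h1 [h2 h3]] := HR t; split=> //; split=> //; lra. Qed.

Lemma bounded_pow_gr X (K : bop X) t k : 0 < t ->
  (forall x, nm (bpow (RtoC (/ t) [*] K) (Nat.pow 2 k) x) <= nm x) -> gr K t.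
Proof.
move=> ht h; apply: (gr_pow (n0 := Nat.pow 2 k)) => //; first exact: pow2_pos.
have : nm (bpow (RtoC (/ t) [*] K) (Nat.pow 2 k)) <= 1 by apply: nm_le => [|x]; [lra | rewrite Rmult_1_l].
have it : 0 < / t by exact: Rinv_0_lt_compat.
rewrite nm_bpow_scalR; last lra.
have pt : 0 < t ^ Nat.pow 2 k by exact: pow_lt.
rewrite pow_inv => h2.
have := Rmult_le_compat_l _ _ _ (Rlt_le _ _ pt) h2.
by rewrite -Rmult_assoc Rinv_r; lra.
Qed.

Lemma gr_small X (K : bop X) s t : 0 <= s -> s < t -> gr K s ->
  forall e, 0 < e -> exists N, forall n, (N <= n)%nat -> nm (bpow (RtoC (/ t) [*] K) n) <= e.
Proof.
move=> hs hst [C hC] e he; have [N hN] := pow_ratio_small C hs hst he.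
exists N => n hn.
have it : 0 < / t by apply: Rinv_0_lt_compat; lra.
rewrite nm_bpow_scalR; last lra.
have pt : 0 < t ^ n by apply: pow_lt; lra.
rewrite pow_inv.
apply: (Rmult_le_reg_l (t ^ n)) => //; rewrite -Rmult_assoc Rinv_r; last lra.
by have := hC n; have := hN n hn; lra.
Qed.

(** Starting from the trivial rate nm K + e, the rate is lowered to e in equal steps. Each step
    compares the resolvents on two nearby circles through [srstep]; the lower bound on the whole
    annulus makes the step length uniform. *)
Lemma spec_rad X (K : bop X) e : cpt K -> 0 < e ->
  (forall k x, e <= Cmod k -> K x = k [*] x -> x = vzero) -> gr K e.
Proof.
move=> hK he inj.
have hn := nm_ge0 K.
pose b := nm K + e + 3.
have [c [hc lb]] := @annulus_lb X K e b hK he (fun k x h1 h2 => inj k x h1).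
pose B := b / c.
have hB : 0 < B by apply: Rdiv_lt_0_compat => //; rewrite /b; lra.
have res t : e <= t -> t <= b -> exists Rs, rfam (RtoC (/ t) [*] K) Rs B.
  move=> h1 h2; have [Rs hR] := @circle_res X K t c ltac:(lra) hc (fun k hk => conj (fun x => lb k x ltac:(lra) ltac:(lra))
     (fredholm hK (Cmod_neq0 hk ltac:(lra)) (fun x => inj k x ltac:(lra)))).
  exists Rs; apply: rfam_mono hR; rewrite /B /Rdiv; apply: Rmult_le_compat_r => //.
  by exact: Rinv_ge0.
(* Chosen so that K/t and K/(s + d/2) have resolvents within 1/4. The circle of radius s + d/2 lies
   strictly outside the known rate s, so the powers of K/(s + d/2) tend to zero. *)
pose d0 := e * e / (4 * (B * B * nm K + 1)).
have BB0 : 0 <= B * B * nm K by apply: Rmult_le_pos => //; nra.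
have hd0 : 0 < d0 by apply: Rdiv_lt_0_compat; nra.
have ed0 : d0 * (4 * (B * B * nm K + 1)) = e * e by rewrite /d0; field; lra.
pose d := Rmin d0 1.
have hd : 0 < d by rewrite /d; apply: Rmin_glb_lt; lra.
have hd1 : d <= d0 by exact: Rmin_l.
have hd2 : d <= 1 by exact: Rmin_r.
have step s t : e <= s -> s <= nm K + e -> e <= t -> t <= s -> s - t <= d/2 -> gr K s -> gr K t.
  move=> h1 h2 h3 h4 h5 hg.
  have [Rs HR] := res t h3 ltac:(rewrite /b; lra).
  have [Rs' HR'] := res (s + d/2) ltac:(lra) ltac:(rewrite /b; lra).
  have [k hk] : exists k, forall x, nm (bpow (RtoC (/ t) [*] K) (Nat.pow 2 k) x) <= nm x.
    apply: (srstep HR HR').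
      move=> th; apply: Rle_trans (rfam_diff HR HR' th) _.
      have -> : RtoC (/ t) [*] K [-] RtoC (/ (s + d/2)) [*] K = RtoC (/ t - / (s + d/2)) [*] K.
        rewrite /Rminus RtoC_add (_ : RtoC (- / (s + d / 2)) = (- RtoC (/ (s + d/2)))%C); first vec.
        by apply: C_eq => /=; ring.
      set q := / t - / (s + d/2).
      have qe : q * (t * (s + d/2)) = s + d/2 - t by rewrite /q; field; lra.
      have p1 : e * e <= t * (s + d/2) by nra.
      have q0 : 0 <= q.
        by apply: Rnot_lt_le => hq; have : q * (t * (s + d/2)) < 0; nra.
      rewrite nm_scalR //.
      have q1 : q * (e * e) <= d by nra.
      have q2 : q * (d0 * (4 * (B * B * nm K + 1))) <= d0 by rewrite ed0; lra.
      have q3 : q * (4 * (B * B * nm K + 1)) <= 1.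
        by apply: (Rmult_le_reg_l d0) => //; lra.
      nra.
    by apply: gr_small hg; lra.
  by apply: bounded_pow_gr hk; lra.
have all j : gr K (Rmax e (nm K + e - INR j * (d/2))).
  elim: j => [|j IH].
    apply: (gr_mono (s := nm K)) (gr_nm K); first lra.
    by rewrite Rmax_right /=; lra.
  have l1 := Rmax_l e (nm K + e - INR j * (d/2)); have l2 := Rmax_l e (nm K + e - INR (S j) * (d/2)).
  have pj := pos_INR j; have pj2 : 0 <= INR j * (d/2) by apply: Rmult_le_pos; lra.
  rewrite S_INR in l2 *.
  apply: (step _ _ l1 _ l2 _ _ IH).
  - by apply: Rmax_lub; lra.
  - by apply: Rmax_lub; [exact: l1 | apply: Rle_trans (Rmax_r _ _); lra].
  - suff : Rmax e (nm K + e - INR j * (d / 2)) <= Rmax e (nm K + e - (INR j + 1) * (d / 2)) + d/2 by lra.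
    apply: Rmax_lub; first lra.
    by have := Rmax_r e (nm K + e - (INR j + 1) * (d / 2)); lra.
have [j hj] := INR_unbounded (2 * (nm K) / d).
have := all j; rewrite Rmax_left //.
have := Rmult_lt_compat_r (d/2) _ _ ltac:(lra) hj.
have -> : 2 * nm K / d * (d / 2) = nm K by field; lra.
lra.
Qed.

Lemma spec_qn X (K : bop X) : cpt K ->
  (forall k x, k <> C0 -> K x = k [*] x -> x = vzero) -> qn K.
Proof.
move=> hK inj s hs; apply: spec_rad => // k x hk; apply: inj => h.
by move: hk; rewrite h Cmod_C0; lra.
Qed.

Lemma bpow_eig X (T : bop X) k x n : T x = k [*] x ->
  nm (bpow T n x) = Cmod k ^ n * nm x.
Proof.
move=> h; elim: n => [|n IH] /=; first by rewrite Rmult_1_l.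
have e : bpow T n (T x) = T (bpow T n x) by rewrite -bcompE -bpow_S.
by rewrite -e h bl_scal vnorm_scal IH; ring.
Qed.

Lemma qn_eig X (T : bop X) k x : qn T -> T x = k [*] x -> k <> C0 -> x = vzero.
Proof.
move=> hq hx hk; have pk := Cmod_gt0 hk; apply: NNPP => nz; have px := nm_gt0 nz.
have [C hC] := hq (Cmod k / 2) ltac:(lra).
have [N hN] := @pow_ratio_small C (Cmod k / 2) (Cmod k) (1/2) ltac:(lra) ltac:(lra) ltac:(lra).
have h1 := hN N (Nat.le_refl _); have h2 := hC N; have h3 := nm_ge (bpow T N) x.
rewrite (bpow_eig N hx) in h3.
have pk' : 0 < Cmod k ^ N by exact: pow_lt.
have : Cmod k ^ N <= nm (bpow T N) by exact: (Rmult_le_reg_r _ _ _ px h3).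
lra.
Qed.

Lemma avoid_list (l : list R) a b : a < b -> exists s, a < s /\ s < b /\ ~ In s l.
Proof.
move=> hab.
suff : exists a' b', a <= a' /\ a' < b' /\ b' <= b /\ forall s, a' < s -> s < b' -> ~ In s l.
  by move=> [a' [b' [h1 [h2 [h3 h4]]]]]; exists ((a' + b')/2); split; [lra | split; [lra | apply: h4; lra]].
elim: l => [|r l [a' [b' [h1 [h2 [h3 h4]]]]]]; first by exists a, b; split; [lra | split; [lra | split; [lra | by move=> s _ _ []]]].
case: (Rle_lt_dec r ((a' + b')/2)) => hr.
  exists ((a' + b')/2), b'; split; [lra | split; [lra | split=> // s hs1 hs2 [hs|hs]]]; first lra.
  by apply: (h4 s) => //; lra.
exists a', ((a' + b')/2); split; [lra | split; [lra | split; [lra | move=> s hs1 hs2 [hs|hs]]]]; first lra.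
by apply: (h4 s) => //; lra.
Qed.

(** If T had an eigenvalue lam, some circle of radius s < |lam| would avoid the eigenvalues of T.
    Close approximants have close resolvents there, and their vanishing growth would make a power of
    T/s a contraction, against |lam| > s. *)
Lemma qn_conv X (u : nat -> bop X) T : (forall n, cpt (u n)) -> (forall n, qn (u n)) ->
  vconv u T -> qn T.
Proof.
move=> hu hq hT; have cT := cpt_conv hu hT.
apply: (spec_qn cT) => lam x hl hx; apply: NNPP => nz; have pl := Cmod_gt0 hl.
have [l hll] := @eig_finite X T (Cmod lam / 2) cT ltac:(lra).
have [s [h1 [h2 h3]]] := @avoid_list (map Cmod l) (Cmod lam / 2) (Cmod lam) ltac:(lra).
have inj k y : Cmod k = s -> T y = k [*] y -> y = vzero.
  move=> hk hy; apply: NNPP => ny; apply: h3; rewrite -hk; apply: in_map; apply: (hll k y) => //; lra.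
have [c [hc lb]] := @annulus_lb X T s s cT ltac:(lra) (fun k y a b => inj k y (Rle_antisym _ _ b a)).
have sne k : Cmod k = s -> k <> C0 by move=> hk h; move: hk; rewrite h Cmod_C0; lra.
have [Rs HR] := @circle_res X T s c ltac:(lra) hc (fun k hk => conj (fun x => lb k x ltac:(lra) ltac:(lra))
   (fredholm cT (sne k hk) (fun y => inj k y hk))).
pose d := Rmin (c/2) (c * c / (8 * s)).
have hd : 0 < d.
  rewrite /d; apply: Rmin_glb_lt; first lra.
  by apply: Rdiv_lt_0_compat; nra.
have [n hn] := hT d hd; have {}hn := hn n (Nat.le_refl _).
have d1 : d <= c/2 by exact: Rmin_l.
have d2 : d <= c * c / (8 * s) by exact: Rmin_r.
have lb' k y : Cmod k = s -> c/2 * nm y <= nm (shf (u n) k y).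
  move=> hk; have := lb k y ltac:(lra) ltac:(lra); rewrite !shfE => g1.
  have g2 := nm_ge (u n [-] T) y; rewrite baddE boppE in g2.
  have -> : u n y [-] k [*] y = (T y [-] k [*] y) [+] (u n y [-] T y) by vec.
  have g3 := nm_rev (T y [-] k [*] y) (vopp (u n y [-] T y)).
  have e3 : (T y [-] k [*] y) [-] vopp (u n y [-] T y) = (T y [-] k [*] y) [+] (u n y [-] T y) by vec.
  rewrite e3 nm_opp in g3; have := nm_ge0 y; nra.
have inj' k y : Cmod k = s -> u n y = k [*] y -> y = vzero.
  move=> hk hy; apply: vnorm_eq0; have := lb' k y hk; rewrite shfE hy vadd_opp nm_0; have := nm_ge0 y; nra.
have [Rs' HR'] := @circle_res X (u n) s (c/2) ltac:(lra) ltac:(lra) (fun k hk => conj (fun x => lb' k x hk)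
   (fredholm (hu n) (sne k hk) (fun y => inj' k y hk))).
have s0 : 0 < / s by apply: Rinv_0_lt_compat; lra.
have [k hk] : exists k, forall x, nm (bpow (RtoC (/ s) [*] T) (Nat.pow 2 k) x) <= nm x.
  apply: (srstep HR HR').
    move=> th; apply: Rle_trans (rfam_diff HR HR' th) _.
    have -> : RtoC (/ s) [*] T [-] RtoC (/ s) [*] u n = RtoC (/ s) [*] (T [-] u n) by vec.
    rewrite nm_scalR ?(nm_sym T); last lra.
    have -> : s / c * (s / (c / 2)) * (/ s * nm (u n [-] T)) = (2 * s / (c * c)) * nm (u n [-] T) by field; lra.
    have e1 : (2 * s / (c * c)) * (c * c / (8 * s)) = 1/4 by field; lra.
    have p1 : 0 < 2 * s / (c * c) by apply: Rdiv_lt_0_compat; nra.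
    nra.
  by apply: (gr_small (s := s/2)); [lra | lra | apply: hq; lra].
have := hk x.
have e1 : (RtoC (/ s) [*] T : bop X) x = (RtoC (/ s) * lam)%C [*] x by rewrite bscalE hx; vec.
rewrite (bpow_eig _ e1) Cmod_mul Cmod_RtoC_pos; last lra.
have g1 : 1 < / s * Cmod lam.
  by apply: (Rmult_lt_reg_l s); [lra | rewrite -Rmult_assoc Rinv_r; lra].
have g2 := Rlt_pow_R1 _ (Nat.pow 2 k) g1 ltac:(have := pow2_pos k; lia).
have := nm_gt0 nz; nra.
Qed.

(** Where K - kap is nilpotent, K = kap + nilpotent is invertible by a finite geometric series. S is
    a polynomial in K, so it commutes with whatever commutes with K; e factors through K and
    inherits its compactness. *)
Lemma nil_factor X (K e : bop X) kap k : kap <> C0 -> bpow (shf K kap) k [o] e = vzero ->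
  exists S, (forall Z : bop X, Z [o] K = K [o] Z -> Z [o] S = S [o] Z) /\ e = K [o] S [o] e.
Proof.
move=> nz; elim: k e => [|k IH] e h.
  exists vzero; split; first by move=> Z _; bvec.
  by move: h; rewrite /= comp1b => ->; bvec.
have [|S [hS he]] := IH (shf K kap [o] e); first by rewrite bcompA -bpow_S.
exists (Cinv kap [*] (bid [-] S [o] shf K kap)); split.
  move=> Z hZ; have h1 := hS Z hZ; have h2 := @shf_comm X K kap Z hZ.
  rewrite compbZr compbZl compbDr compbDl compbNl compbNr comp1b compb1.
  by rewrite bcompA h1 -!bcompA h2.
have e1 : e = Cinv kap [*] (K [o] e [-] shf K kap [o] e) by rewrite /shf; bvec.
have -> : K [o] (Cinv kap [*] (bid [-] S [o] shf K kap)) [o] e = Cinv kap [*] (K [o] e [-] K [o] S [o] (shf K kap [o] e)) by bvec.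
by rewrite -he.
Qed.

Lemma nil_cpt X (K e : bop X) kap k : cpt K -> kap <> C0 -> bpow (shf K kap) k [o] e = vzero -> cpt e.
Proof.
move=> hK nz h; have [S [_ ->]] := nil_factor nz h.
by rewrite -bcompA; exact: cpt_compr.
Qed.

Lemma shf_induced X M (HM : @closed_vsubspace X M) (K : bop X) (U : blin (Quot HM) (Quot HM)) kap :
  (forall x, U (proj HM x) = proj HM (K x)) -> forall n x, bpow (shf U kap) n (proj HM x) = proj HM (bpow (shf K kap) n x).
Proof.
by move=> h n x; elim: n => [//|n IH]; rewrite [bpow _ _]/= [bpow (shf K kap) _]/= !bcompE IH !shfE h bl_add bl_opp bl_scal.
Qed.

Lemma lb_pow X (T : bop X) c n : 0 < c -> (forall x, c * nm x <= nm (T x)) ->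
  forall x, c ^ n * nm x <= nm (bpow T n x).
Proof.
move=> hc lb; elim: n => [|n IH] x /=; first lra.
by apply: Rle_trans (lb (bpow T n x)); rewrite Rmult_assoc; apply: Rmult_le_compat_l (IH x); lra.
Qed.

Lemma onto_pow X (T : bop X) n : (forall y, exists x, T x = y) -> forall y, exists x, bpow T n x = y.
Proof.
by move=> h; elim: n => [|n IH] y; [exists y | have [z <-] := h y; have [x <-] := IH z; exists x].
Qed.

(** Finite ascent k comes from [chain_inc]. On the quotient by [M] = ker (K - kap)^k the shift is
    injective, hence onto, so each vector is a sum of an element of [M] and one of the range of (K -
    kap)^k. The projection e is along that range, on which K - kap stays bounded below. *)
Lemma riesz_proj X (K : bop X) kap : cpt K -> kap <> C0 ->
  exists k (e : bop X), e [o] e = e /\ e [o] K = K [o] e /\ bpow (shf K kap) k [o] e = vzero /\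
    (forall j x, bpow (shf K kap) j x = vzero -> e x = x) /\
    (exists c, 0 < c /\ forall x, e x = vzero -> c * nm x <= nm (shf K kap x)).
Proof.
move=> hK nz; set T := shf K kap.
have KT n : K [o] bpow T n = bpow T n [o] K by exact: shf_pow_comm.
have [k hk] : exists k, forall x, bpow T (S k) x = vzero -> bpow T k x = vzero.
  apply: NNPP => hn.
  apply: (@chain_inc X K (fun n x => bpow T n x = vzero) (fun _ => kap) (Cmod kap) hK (Cmod_gt0 nz)).
  - by move=> n; exact: (csub_ker (bpow T n)).
  - by move=> n x hx; rewrite -[bpow T (S n)]/(T [o] bpow T n) bcompE hx bl_0.
  - move=> n; apply: NNPP => h; apply: hn; exists n => x hx; apply: NNPP => hx2; apply: h; by exists x.
  - by move=> _; exact: Rle_refl.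
  - by move=> n x hx; rewrite -bcompE -KT bcompE hx bl_0.
  - by move=> n x; rewrite bpow_S.
pose M := fun x => bpow T k x = vzero.
have HM : closed_vsubspace M by exact: (csub_ker (bpow T k)).
have hker j x : bpow T j x = vzero -> M x.
  elim: j => [|j IH] hx; first by rewrite /M; move: hx => /= ->; rewrite bl_0.
  case: (Nat.le_gt_cases k j) => hkj; last first.
    rewrite /M (_ : k = (k - S j + S j)%nat); last lia.
    by rewrite bpow_add bcompE hx bl_0.
  apply: IH; have e : j = (j - k + k)%nat by lia.
  have : bpow T (S k) (bpow T (j - k) x) = vzero by rewrite -bcompE -bpow_add (_ : (S k + (j - k) = S j)%nat) //; lia.
  by move/hk; rewrite -bcompE -bpow_add (_ : (k + (j - k) = j)%nat) //; lia.
have MK x : M x -> M (K x) by move=> hx; rewrite /M -bcompE -KT bcompE hx bl_0.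
have [Kb [hKb _]] := qinduced HM MK.
have cKb := cpt_quot hKb hK.
have injb q : Kb q = kap [*] q -> q = vzero.
  have [x [<- _]] := proj_lift2 q; rewrite hKb -bl_scal => /proj_eq h.
  by apply/proj_0; apply: (hker (S k)); rewrite bpow_S bcompE.
have [c [hc lb]] := inj_lb cKb nz injb.
have onto := fredholm cKb nz injb.
have ck := pow_lt c k hc.
have dec x : exists r, (exists u, r = bpow T k u) /\ M (x [-] r).
  have [q hq] := onto_pow k onto (proj HM x); have [u [eu _]] := proj_lift2 q.
  exists (bpow T k u); split; first by exists u.
  by apply/proj_eq; rewrite -hq -eu (shf_induced _ hKb).
have uniq r : (exists u, r = bpow T k u) -> M r -> r = vzero.
  move=> [u ->] h; apply: (hker (k + k)%nat); by rewrite bpow_add.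
have [g hg] := choice_fun dec.
have VM := csub_sub HM.
have geq x r : (exists u, r = bpow T k u) -> M (x [-] r) -> g x = r.
  move=> hr hm; have [[u1 e1] h2] := hg x; apply: vsub_eq0; apply: uniq.
    by case: hr => u2 e2; exists (u1 [-] u2); rewrite bl_add bl_opp -e1 -e2.
  have -> : g x [-] r = (x [-] r) [-] (x [-] g x) by vec.
  exact: vsub_sub.
have glin : lin g.
  split=> [x y|a x]; apply: geq.
  - by have [[u1 ->] _] := hg x; have [[u2 ->] _] := hg y; exists (u1 [+] u2); rewrite bl_add.
  - have -> : x [+] y [-] (g x [+] g y) = (x [-] g x) [+] (y [-] g y) by vec.
    by apply: vsub_add => //; [case: (hg x) | case: (hg y)].
  - by have [[u1 ->] _] := hg x; exists (a [*] u1); rewrite bl_scal.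
  - have -> : a [*] x [-] a [*] g x = a [*] (x [-] g x) by vec.
    by apply: vsub_scal => //; case: (hg x).
have gbd : exists C, forall x, nm (g x) <= C * nm x.
  exists (nm (bpow T k) * (2 * / c ^ k)) => x.
  have [q hq] := onto_pow k onto (proj HM x); have [u [eu nu]] := proj_lift2 q.
  have -> : g x = bpow T k u.
    apply: geq; first by exists u.
    by apply/proj_eq; rewrite -hq -eu (shf_induced _ hKb).
  apply: Rle_trans (nm_ge _ _) _; rewrite Rmult_assoc; apply: nm_mull.
  apply: Rle_trans nu _; rewrite Rmult_assoc; apply: Rmult_le_compat_l; first lra.
  have h1 := lb_pow k hc lb q; rewrite hq in h1; have h2 := proj_nm HM x.
  apply: (Rmult_le_reg_l (c ^ k)) => //; rewrite -Rmult_assoc Rinv_r; lra.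
pose G : bop X := mkB glin gbd.
have GE x : G x = g x by [].
have gM x : M x -> g x = vzero.
  move=> hx; apply: geq; first by exists vzero; rewrite bl_0.
  by rewrite vopp_0 vadd_0.
have gR x : (exists u, x = bpow T k u) -> g x = x.
  by move=> hx; apply: geq => //; rewrite vadd_opp; exact: vsub_0.
have gK x : g (K x) = K (g x).
  have [[u hu] hm] := hg x; apply: geq.
    by exists (K u); rewrite hu -bcompE KT.
  by have -> : K x [-] K (g x) = K (x [-] g x) by [rewrite bl_add bl_opp]; exact: MK.
exists k, (bid [-] G); split; last split; last split; last split.
- apply: blin_ext => x; rewrite bcompE !baddE !boppE !bidE !GE.
  have h : M (x [-] g x) by case: (hg x).
  by rewrite (gM _ h); vec.
- by apply: blin_ext => x; rewrite !bcompE !baddE !boppE !bidE !GE gK bl_add bl_opp.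
- by apply: blin_ext => x; rewrite bcompE; case: (hg x).
- move=> j x /hker hx; rewrite baddE boppE bidE GE gM //; vec.
- pose Rg := fun x => (bid [-] G : bop X) x = vzero.
  have HR : closed_vsubspace Rg by exact: (csub_ker (bid [-] G)).
  have RE x : Rg x <-> g x = x.
    by rewrite /Rg baddE boppE bidE GE; split=> [/vsub_eq0|->] //; rewrite vadd_opp.
  have RK x : Rg x -> Rg (K x) by move=> /RE h; apply/RE; rewrite gK h.
  have [Kr hKr] := res HR RK.
  have cKr := cpt_res hKr hK.
  have injr x : Kr x = kap [*] x -> x = vzero.
    move=> h; apply: (@incl_inj _ _ HR); rewrite bl_0.
    have h2 := hKr x; rewrite h bl_scal in h2.
    have /RE <- := incl_in x; apply: gM; apply: (hker 1%nat).
    by rewrite /= -h2 vadd_opp.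
  have [c' [hc' lb']] := inj_lb cKr nz injr; exists c'; split=> // x hx.
  have [z hz] := incl_sur HR hx; have := lb' z; rewrite -[nm z]nm_incl hz.
  have -> : nm (shf Kr kap z) = nm (incl HR (shf Kr kap z)) by [].
  by rewrite shfE bl_add bl_opp bl_scal hKr hz.
Qed.

(** The eigenvalues together with 0, which is included unconditionally: it is the base point of the
    part of K left after peeling. *)
Definition sig0 X (K : bop X) (k : Cplx) : Prop :=
  k = C0 \/ exists v, v <> vzero /\ K v = k [*] v.

Definition peelok X (K : bop X) (p : Cplx * nat * bop X) : Prop :=
  p.1.1 <> C0 /\ p.2 [o] K = K [o] p.2 /\ p.2 [o] p.2 = p.2 /\
  bpow (shf K p.1.1) p.1.2 [o] p.2 = vzero /\ exists v, v <> vzero /\ K v = p.1.1 [*] v.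

Fixpoint sume X (l : list (Cplx * nat * bop X)) : bop X :=
  match l with nil => vzero | cons p l' => p.2 [+] sume l' end.

Lemma sume_comm X (K : bop X) l : (forall p, In p l -> p.2 [o] K = K [o] p.2) -> sume l [o] K = K [o] sume l.
Proof.
elim: l => [|p l IH] h /=; first by bvec.
by rewrite compbDl compbDr IH ?h //; [left | move=> q hq; apply: h; right].
Qed.

(** Induction on the number of large eigenvalues. Passing from K to K (1 - e1) removes one of them
    and creates none, because eigenvectors of the new operator for nonzero values lie in ker e1 and
    are eigenvectors of K. *)
Lemma peel X (K : bop X) e : cpt K -> 0 < e ->
  exists l e0, (forall p, In p l -> peelok K p) /\ bid = e0 [+] sume l /\ e0 [o] K = K [o] e0 /\
    e0 [o] e0 = e0 /\ cpt (sume l) /\ gr (K [o] e0) e.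
Proof.
move=> hK he; have [le hle] := eig_finite hK he.
have [n hn] : exists n, (length le <= n)%nat by exists (length le).
elim: n K le hK hle hn => [|n IH] K le hK hle hn.
  exists nil, bid; split=> //; split; first by rewrite /= vadd_0.
  rewrite comp1b !compb1; do 3! split=> //; first exact: cpt_0.
  apply: spec_rad => // k x h1 h2; apply: NNPP => nz; have := hle k x h1 nz h2.
  by case: le hn {hle} => //= ? ?; lia.
case: (classic (exists k x, e <= Cmod k /\ x <> vzero /\ K x = k [*] x)) => [[k [x [h1 [nx h2]]]]|hno]; last first.
  exists nil, bid; split=> //; split; first by rewrite /= vadd_0.
  rewrite comp1b !compb1; do 3! split=> //; first exact: cpt_0.
  by apply: spec_rad => // k x h1 h2; apply: NNPP => nz; apply: hno; exists k, x.
have kz : k <> C0 by move=> h; move: h1; rewrite h Cmod_C0; lra.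
have [kk [e1 [ee [eK [eN [eker [c [hc lbc]]]]]]]] := riesz_proj hK kz.
pose K' := K [o] (bid [-] e1).
have eK' : e1 [o] K' = vzero by rewrite /K'; bexp; rewrite eK -[K [o] e1 [o] e1]bcompA ee; vec.
have K'e : K' [o] e1 = vzero by rewrite /K'; bexp; rewrite -bcompA ee; vec.
have KK' : K = K' [+] K [o] e1 by rewrite /K'; bvec.
have cK' : cpt K' by exact: cpt_compr.
have K'E : K' = K [-] K [o] e1 by rewrite /K'; bvec.
clearbody K'.
have eigK' k' v : k' <> C0 -> K' v = k' [*] v -> e1 v = vzero /\ K v = k' [*] v.
  move=> nz hv; have h3 : e1 v = vzero.
    apply: (scal_eq0 (c := k')) => //.
    by rewrite -bl_scal -hv -bcompE eK'.
  by split=> //; rewrite {1}KK' baddE bcompE h3 bl_0 vadd_0.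
have [l1 [l2 el]] := in_split _ _ (hle k x h1 nx h2).
have [||l [e0 [hl [hid [e0K [e00 [cl gr0]]]]]]] := IH K' (l1 ++ l2) cK'.
- move=> k' v h3 nv hv.
  have nz : k' <> C0 by move=> h; move: h3; rewrite h Cmod_C0; lra.
  have [ev Kv] := eigK' k' v nz hv.
  have := hle k' v h3 nv Kv; rewrite el => hin; apply: in_or_app; case: (in_app_or _ _ _ hin) => [h|[h|h]]; [by left | | by right].
  exfalso; apply: nv; rewrite -ev; apply: esym; apply: (eker 1%nat).
  by rewrite h -[bpow _ _]/(shf K k' [o] bid) bcompE bidE shfE Kv vadd_opp.
- by move: hn; rewrite el !length_app /=; lia.
have ort p : In p l -> e1 [o] p.2 = vzero /\ p.2 [o] e1 = vzero.
  move=> hp; have [q1 [q2 [q3 [q4 _]]]] := hl p hp.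
  have [S [hS hS2]] := nil_factor q1 q4; split.
    by rewrite hS2 !bcompA eK' !comp0b.
  have h3 := hS _ q2; have h4 := hS K' erefl.
  have -> : p.2 = p.2 [o] S [o] K' by rewrite {1}hS2 -bcompA -h3 bcompA -q2 -bcompA h4 bcompA.
  by rewrite -bcompA K'e compb0.
have okK p : In p l -> peelok K p.
  move=> hp; have [q1 [q2 [q3 [q4 [v [nv hv]]]]]] := hl p hp; have [o1 o2] := ort p hp.
  split=> //; split.
    rewrite KK' compbDl compbDr -bcompA o1 compb0 vadd_0.
    by rewrite -eK bcompA o2 comp0b vadd_0.
  split=> //; split; last by exists v; have [_] := eigK' _ v q1 hv.
  have eqn j : bpow (shf K p.1.1) j [o] p.2 = bpow (shf K' p.1.1) j [o] p.2 /\ e1 [o] (bpow (shf K' p.1.1) j [o] p.2) = vzero.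
    elim: j => [|j [IHj IHj2]] /=; first by rewrite comp1b.
    rewrite -!bcompA IHj; split.
      rewrite {1}/shf {1}KK' !compbDl -bcompA IHj2 compb0 vadd_0 /shf; bvec.
    rewrite /shf compbDl compbDr compbNl compbNr compbZl compbZr comp1b.
    rewrite -/(shf K' p.1.1) IHj2 bcompA eK' comp0b; vec.
  by case: (eqn p.1.2) => -> _.
have e1s : e1 [o] sume l = vzero /\ sume l [o] e1 = vzero.
  elim: l {hl hid cl okK} ort => [|p l IHl] ort /=; first by split; bvec.
  have [o1 o2] := ort p (or_introl erefl).
  have [s1 s2] := IHl (fun q hq => ort q (or_intror hq)).
  by rewrite compbDl compbDr o1 o2 s1 s2; split; vec.
have e0E : e0 = bid [-] sume l by rewrite hid; vec.
have e10 : e1 [o] e0 = e1 by rewrite e0E; bexp; rewrite (proj1 e1s); vec.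
have e01 : e0 [o] e1 = e1 by rewrite e0E; bexp; rewrite (proj2 e1s); vec.
exists ((k, kk, e1) :: l), (e0 [-] e1); split.
  by move=> p [<-|/okK //]; do 4! split=> //; exists x.
split; first by rewrite hid /=; vec.
split.
  rewrite compbDl compbDr compbNl compbNr eK; congr vadd.
  rewrite e0E compbDl compbDr compbNl compbNr comp1b compb1; congr (_ [-] _).
  by apply: sume_comm => p /okK [_ []].
split; first by bexp; rewrite e00 e10 e01 ee; vec.
split; first by apply: cpt_add => //; exact: nil_cpt eN.
have -> : K [o] (e0 [-] e1) = K' [o] e0 by rewrite K'E; bexp; rewrite -[K [o] e1 [o] e0]bcompA e10.
exact: gr0.
Qed.

(** Solves the inequality for a j in terms of a (j+1) and unwinds it m times. The constant depends
    on c, q, p and m only, not on the sequence. *)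
Lemma real_iter c q p m : 0 < c -> 0 <= q -> 0 <= p ->
  exists A, 0 <= A /\ forall (a : nat -> R) f, 0 <= f -> (forall j, c * a j <= f * p ^ j + q * a (S j)) ->
    a O <= A * f + (q / c) ^ m * a m.
Proof.
move=> hc hq hp; elim: m => [|m [A [hA IH]]]; first by exists 0; split=> [|a f *] /=; lra.
have qc : 0 <= q / c by apply: Rmult_le_pos => //; exact: Rinv_ge0.
have pm := pow_le _ m qc.
exists (A + (q / c) ^ m * p ^ m / c); split.
  by apply: Rplus_le_le_0_compat => //; apply: Rmult_le_pos; [apply: Rmult_le_pos; exact: pow_le | exact: Rinv_ge0].
move=> a f hf h; apply: Rle_trans (IH a f hf h) _.
have h1 : a m <= (f * p ^ m + q * a (S m)) / c.
  apply: (Rmult_le_reg_l c) => //; have := h m.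
  by have -> : c * ((f * p ^ m + q * a (S m)) / c) = f * p ^ m + q * a (S m) by field; lra.
have := Rmult_le_compat_l _ _ _ pm h1.
have -> : (q / c) ^ m * ((f * p ^ m + q * a (S m)) / c) = (q / c) ^ m * p ^ m / c * f + (q / c) ^ S m * a (S m).
  by rewrite /=; field; lra.
lra.
Qed.

Lemma lb_op X (T z : bop X) c : 0 < c -> (forall x, c * nm x <= nm (T x)) -> c * nm z <= nm (T [o] z).
Proof.
move=> hc lb.
have : nm z <= / c * nm (T [o] z).
  apply: nm_le => [|x]; first by apply: Rmult_le_pos; [exact: Rinv_ge0 | exact: nm_ge0].
  apply: (Rmult_le_reg_l c) => //; rewrite Rmult_assoc -[c * (/ c * _)]Rmult_assoc Rinv_r; last lra.
  by rewrite Rmult_1_l; apply: Rle_trans (lb (z x)) _; rewrite -bcompE; exact: nm_ge.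
move=> h; have := Rmult_le_compat_l c _ _ (Rlt_le _ _ hc) h.
by rewrite -Rmult_assoc Rinv_r; lra.
Qed.

(** The Rosenblum operator of the pair 1 + K, w (1 + K). *)
Definition ros X (K : bop X) (w : Cplx) (z : bop X) : bop X :=
  (bid [+] K) [o] z [-] w [*] (z [o] (bid [+] K)).

(** The hypothesis says that no point of the spectrum of 1 + K is w times another. The right factor
    is cut by [peel] into pieces on which K is a scalar plus a nilpotent or a small operator; on
    each piece z is recovered from [ros K w z] by iterating a one-sided equation in which only K -
    (w(1+k) - 1) must be bounded below. *)
Lemma ros_lb X (K : bop X) w : cpt K ->
  (forall k, sig0 K k -> ~ sig0 K (w * (C1 + k) - C1)%C) ->
  exists c, 0 < c /\ forall z, c * nm z <= nm (ros K w z).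
Proof.
move=> hK hw.
have lbk k : sig0 K k -> exists c, 0 < c /\ forall x, c * nm x <= nm (shf K (w * (C1 + k) - C1)%C x).
  move=> /hw h; apply: inj_lb => // [e|x hx]; first by apply: h; left.
  by apply: NNPP => nz; apply: h; right; exists x.
(* Write K = k + P to the right of z e. Then [ros] becomes (K - (w(1+k) - 1)) z e - w z e P, an
   inequality linking the norms of z e P^j and z e P^(j+1); m steps suffice once the m-th term is
   absorbed by half of z e. *)
have gen (e P : bop X) k m b : sig0 K k -> e [o] K = K [o] e -> P [o] K = K [o] P ->
   (forall z : bop X, z [o] e [o] K = k [*] (z [o] e) [+] z [o] e [o] P) ->
   (forall c, 0 < c -> (forall x, c * nm x <= nm (shf K (w * (C1 + k) - C1)%C x)) ->
      b <= c -> forall z : bop X, (Cmod w / c) ^ m * nm (z [o] e [o] bpow P m) <= 1/2 * nm (z [o] e)) ->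
   (exists c, 0 < c /\ b <= c /\ forall x, c * nm x <= nm (shf K (w * (C1 + k) - C1)%C x)) ->
   exists A, 0 <= A /\ forall z, nm (z [o] e) <= A * nm (ros K w z).
  move=> hk eK PK heP hm [c [hc [hbc lb]]].
  have [A [hA hit]] := @real_iter c (Cmod w) (nm P) m hc (Cmod_ge0 _) (nm_ge0 _).
  exists (2 * A * nm e); split.
    by apply: Rmult_le_pos; [lra | exact: nm_ge0].
  move=> z.
  have := hit (fun j => nm (z [o] e [o] bpow P j)) (nm (ros K w z) * nm e) (Rmult_le_pos _ _ (nm_ge0 _) (nm_ge0 _)).
  rewrite [bpow P 0]/= compb1 => h.
  have {}h := h _; have hm' := hm c hc lb hbc z; suff : nm (z [o] e) <= A * (nm (ros K w z) * nm e) + (Cmod w / c) ^ m * nm (z [o] e [o] bpow P m) by lra.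
  apply: h => j.
  have PjK : bpow P j [o] K = K [o] bpow P j by rewrite bpow_comm //.
  have idE : ros K w z [o] e [o] bpow P j = shf K (w * (C1 + k) - C1)%C [o] (z [o] e [o] bpow P j) [-] w [*] (z [o] e [o] bpow P (S j)).
    have e1 : z [o] K [o] e [o] bpow P j = k [*] (z [o] e [o] bpow P j) [+] z [o] e [o] bpow P (S j).
      have -> : z [o] K [o] e [o] bpow P j = (z [o] e [o] K) [o] bpow P j by rewrite -[z [o] K [o] e]bcompA -eK bcompA.
      by rewrite heP compbDl compbZl -[bpow P (S j)]/(P [o] bpow P j) !bcompA.
    move: (bpow P (S j)) (bpow P j) e1 {PjK} => u v e1.
    rewrite /ros /shf; bexp; rewrite e1; vec.
  have h1 := lb_op (z [o] e [o] bpow P j) hc lb.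
  have h2 : nm (ros K w z [o] e [o] bpow P j) <= nm (ros K w z) * nm e * nm P ^ j.
    apply: Rle_trans (nm_comp _ _) _; apply: Rmult_le_compat; try exact: nm_ge0; first exact: nm_comp.
    exact: nm_bpow.
  have h3 := vnorm_triangle (ros K w z [o] e [o] bpow P j) (w [*] (z [o] e [o] bpow P (S j))).
  rewrite vnorm_scal in h3.
  have e3 : ros K w z [o] e [o] bpow P j [+] w [*] (z [o] e [o] bpow P (S j)) = shf K (w * (C1 + k) - C1)%C [o] (z [o] e [o] bpow P j).
    rewrite idE; vec.
  rewrite e3 in h3; lra.
have s00 : sig0 K C0 by left.
have [c0 [hc0 lb0]] := lbk C0 s00.
(* Growth ep of K e0 makes (|w|/c0)^N times the N-th power decay like (1/2)^N, so some N gives the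
   factor 1/2 required by [gen]. *)
pose ep := c0 / (2 * (Cmod w + 1)).
have hw0 := Cmod_ge0 w.
have hep : 0 < ep by divpos.
have [l [e0 [hl [hid [e0K [e00 [_ [C hC]]]]]]]] := peel hK hep.
have [A0 [hA0 hb0]] : exists A, 0 <= A /\ forall z, nm (z [o] e0) <= A * nm (ros K w z).
  have [N hN] := @half_pow_small C (1/2) ltac:(lra).
  have PK : K [o] e0 [o] K = K [o] (K [o] e0) by rewrite -bcompA e0K.
  apply: (gen e0 (K [o] e0) C0 N c0 s00 e0K PK); last first.
  - by exists c0; split=> //; split=> //; lra.
  - move=> c hc _ hcc z.
    have h1 : nm (z [o] e0 [o] bpow (K [o] e0) N) <= nm (z [o] e0) * (C * ep ^ N).
      apply: Rle_trans (nm_comp _ _) _; apply: nm_mull; exact: hC.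
    have qc : 0 <= Cmod w / c by apply: Rmult_le_pos => //; exact: Rinv_ge0.
    have h2 : (Cmod w / c) ^ N * (ep ^ N) <= (1/2)^N.
      rewrite -Rpow_mult_distr; apply: pow_incr; split.
        by apply: Rmult_le_pos => //; lra.
      have -> : Cmod w / c * ep = (Cmod w / (Cmod w + 1)) * (c0 / c) / 2 by rewrite /ep; field; lra.
      have i1 : Cmod w / (Cmod w + 1) <= 1 by apply: (Rmult_le_reg_r (Cmod w + 1)); [lra | rewrite /Rdiv Rmult_assoc Rinv_l; lra].
      have i2 : c0 / c <= 1 by apply: (Rmult_le_reg_r c); [lra | rewrite /Rdiv Rmult_assoc Rinv_l; lra].
      have i3 : 0 <= c0 / c by apply: Rmult_le_pos; [lra | exact: Rinv_ge0].
      have i4 : 0 <= Cmod w / (Cmod w + 1) by apply: Rmult_le_pos; [lra | apply: Rlt_le; apply: Rinv_0_lt_compat; lra].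
      nra.
    have h3 := hN N (Nat.le_refl _).
    have p1 := pow_le _ N qc; have p2 := nm_ge0 (z [o] e0).
    have C0' : 0 <= C by have := hC 0%nat; have := nm_ge0 (bpow (K [o] e0) 0) => /=; lra.
    apply: Rle_trans (Rmult_le_compat_l _ _ _ p1 h1) _.
    have -> : (Cmod w / c) ^ N * (nm (z [o] e0) * (C * ep ^ N)) = nm (z [o] e0) * (C * ((Cmod w / c) ^ N * ep ^ N)) by ring.
    have h4 : C * ((Cmod w / c) ^ N * ep ^ N) <= C * (1/2)^N by apply: Rmult_le_compat_l.
    rewrite [1/2 * _]Rmult_comm; apply: Rmult_le_compat_l => //; lra.
  - move=> z; have -> : C0 [*] (z [o] e0) [+] z [o] e0 [o] (K [o] e0) = z [o] (e0 [o] K [o] e0).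
      rewrite !bcompA; vec.
    by rewrite e0K -[K [o] e0 [o] e0]bcompA e00 -bcompA e0K.
have [A1 [hA1 hb1]] : exists A, 0 <= A /\ forall z, nm (z [o] sume l) <= A * nm (ros K w z).
  elim: l hl {hid} => [|p l IH] hl /=.
    by exists 0; split=> [|z]; [lra | rewrite compb0 nm_0; lra].
  have [A1 [hA1 hb1]] := IH (fun q hq => hl q (or_intror hq)).
  have [q1 [q2 [q3 [q4 q5]]]] := hl p (or_introl erefl).
  have sp : sig0 K p.1.1 by right.
  have [c [hc lbc]] := lbk _ sp.
  have [A2 [hA2 hb2]] : exists A, 0 <= A /\ forall z, nm (z [o] p.2) <= A * nm (ros K w z).
    apply: (gen p.2 (shf K p.1.1) p.1.1 p.1.2 c sp q2); last first.
    - by exists c; split=> //; split=> //; lra.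
    - move=> c' _ _ _ z; rewrite -bcompA (@shf_pow_comm X K p.1.1 p.1.2 p.2 q2) q4 compb0 nm_0.
      by have := nm_ge0 (z [o] p.2); lra.
    - by move=> z; rewrite /shf; bvec.
    - by rewrite (@shf_comm X K p.1.1 K erefl).
  exists (A2 + A1); split=> [|z]; first lra.
  rewrite compbDr; have := vnorm_triangle (z [o] p.2) (z [o] sume l).
  by have := hb1 z; have := hb2 z; lra.
exists (/ (A0 + A1 + 1)); split; first by apply: Rinv_0_lt_compat; lra.
move=> z; apply: (Rmult_le_reg_l (A0 + A1 + 1)); first lra.
rewrite -Rmult_assoc Rinv_r; last lra.
have ez : z = z [o] e0 [+] z [o] sume l by rewrite -compbDr -hid compb1.
have := vnorm_triangle (z [o] e0) (z [o] sume l); rewrite -ez; have := hb0 z; have := hb1 z.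
have := nm_ge0 (ros K w z); lra.
Qed.

Lemma uncountable_interval (e : nat -> R) a b : a < b -> exists x, a < x /\ x < b /\ forall n, x <> e n.
Proof.
move=> hab.
pose f := fix f n := match n with
  | O => ((2 * a + b)/3, (a + 2 * b)/3)
  | S n => let p := f n in if Rle_dec (e n) ((p.1 + p.2)/2) then ((p.1 + 2 * p.2)/3, p.2) else (p.1, (2 * p.1 + p.2)/3) end.
have lt n : (f n).1 < (f n).2 by elim: n => [|n IH] /=; [lra | case: Rle_dec => _ /=; lra].
have st n : (f n).1 <= (f (S n)).1 /\ (f (S n)).2 <= (f n).2 /\ ~ ((f (S n)).1 <= e n <= (f (S n)).2).
  by rewrite /=; have := lt n; case: Rle_dec => h /=; lra.
have mono n k : (f n).1 <= (f (n + k)%nat).1 /\ (f (n + k)%nat).2 <= (f n).2.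
  elim: k => [|k IH]; first by rewrite Nat.add_0_r; lra.
  by rewrite Nat.add_succ_r; have := st (n + k)%nat; lra.
have ub m n : (f m).1 <= (f n).2.
  by have := mono m n; have := mono n m; rewrite (Nat.add_comm m n); have := lt (n + m)%nat; lra.
have [||x [hx1 hx2]] := completeness (fun r => exists n, r = (f n).1).
- by exists (f 0%nat).2 => r [n ->].
- by exists (f 0%nat).1, 0%nat.
have inx n : (f n).1 <= x <= (f n).2.
  by split; [apply: hx1; exists n | apply: hx2 => r [m ->]].
exists x; have := inx 0%nat => /= h0; split; [lra | split; [lra | move=> n en]].
by have [_ [_ []]] := st n; rewrite -en.
Qed.

Lemma neumann_onto X (A : bop X) : nm A <= 1/2 -> forall y, exists x, x [+] A x = y.
Proof.
move=> hA y.
pose u := fix u n := match n with O => vzero | S n' => y [-] A (u n') end.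
have [l [hl _]] : exists l, vconv u l /\ forall k, nm (u k [-] l) <= 2 * nm y * (1/2)^k.
  apply: geom_conv; elim=> [|k IH] /=.
    by rewrite bl_0 vopp_0 !vadd_0; lra.
  have -> : y [-] A (y [-] A (u k)) [-] (y [-] A (u k)) = vopp (A ((y [-] A (u k)) [-] u k)) by rewrite !(bl_add, bl_opp); vec.
  rewrite nm_opp; have := nm_ge A ((y [-] A (u k)) [-] u k); rewrite -[y [-] A (u k)]/(u (S k)).
  have := nm_ge0 (u (S k) [-] u k); nra.
exists l.
have h1 : vconv (fun n => u (S n)) l by apply: (vconv_sub (phi := S)) hl => n; lia.
have h2 : vconv (fun n => u (S n)) (y [-] A l).
  apply: vconv_add; first exact: vconv_const.
  rewrite -bl_opp; apply: (vconv_ext (u := fun n => A (vopp (u n)))); first by move=> n; rewrite bl_opp.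
  apply: bl_conv; rewrite vopp_scal; apply: vconv_ext (vconv_scal _ hl) => n; exact/esym/vopp_scal.
by rewrite {1}(vconv_unique h1 h2); vec.
Qed.

Definition lbp X (T : bop X) w c := forall x, c * nm x <= nm (shf T w x).
Definition ontop X (T : bop X) w := forall y, exists x, shf T w x = y.

Lemma lbp_pert X (T : bop X) w w' c : lbp T w c -> lbp T w' (c - Cmod (w - w')%C).
Proof.
move=> h x; have := h x.
have e : shf T w x = shf T w' x [-] (w - w')%C [*] x by rewrite !shfE; vec.
rewrite e; have := nm_sub (shf T w' x) ((w - w')%C [*] x); rewrite vnorm_scal; lra.
Qed.

Lemma onto_pert X (T : bop X) w w' c : 0 < c -> lbp T w c -> Cmod (w - w')%C <= c/2 -> ontop T w -> ontop T w'.
Proof.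
move=> hc lb hd ont y.
have [U [h1 [h2 h3]]] := binv hc lb ont.
have hA : nm ((w - w')%C [*] U) <= 1/2.
  rewrite vnorm_scal; apply: Rle_trans (Rmult_le_compat _ _ _ _ (Cmod_ge0 _) (nm_ge0 _) hd h3) _.
  by right; field; lra.
have [z hz] := neumann_onto hA y; exists (U z).
have -> : shf T w' (U z) = shf T w (U z) [+] (w - w')%C [*] U z by rewrite !shfE; vec.
by rewrite -[shf T w (U z)]bcompE h1.
Qed.

(** A shift that is bounded below and onto stays onto for nearby scalars, by a Neumann series whose
    radius depends on the lower bound at the centre. The supremum of the parameters reached is
    therefore the end of the path. *)
Lemma path_onto X (T : bop X) (g : R -> Cplx) La a b : 0 < La -> a <= b ->
  (forall s t, Cmod (g s - g t)%C <= La * Rabs (s - t)) ->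
  (forall t, a <= t -> t <= b -> exists c, 0 < c /\ lbp T (g t) c) -> ontop T (g a) ->
  exists c, 0 < c /\ forall t, a <= t -> t <= b -> lbp T (g t) c /\ ontop T (g t).
Proof.
move=> hL hab lip hlb ona.
pose P t := exists c, 0 < c /\ forall s, a <= s -> s <= t -> lbp T (g s) c /\ ontop T (g s).
pose E t := a <= t /\ t <= b /\ P t.
have Ea : E a.
  split; [lra | split=> //]; have [c [hc lb]] := hlb a ltac:(lra) hab.
  by exists c; split=> // s h1 h2; have -> : s = a by lra.
have [m [hm1 hm2]] : exists m, is_lub E m.
  have hb : bound E by exists b => t [_ [h _]].
  by have [m hm] := completeness E hb (ex_intro _ a Ea); exists m.
have am : a <= m by exact: hm1.
have mb : m <= b by apply: hm2 => t [_ [h _]].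
have [c [hc lb]] := hlb m am mb.
pose d := c / (8 * La).
have hd : 0 < d by divpos.
have ed : La * d = c/8 by rewrite /d; field; lra.
have [t [[at_ [tb [ct [hct ht]]]] htm]] : exists t, E t /\ m - d < t.
  apply: NNPP => hn; have : m <= m - d; last lra.
  by apply: hm2 => t ht; apply: Rnot_lt_le => hlt; apply: hn; exists t.
have tm : t <= m by apply: hm1; split=> //; split=> //; exists ct.
have lbn s : Rabs (s - m) <= d -> lbp T (g s) (c/2).
  move=> hs x; have := lbp_pert (g s) lb x; have := lip m s; rewrite Rabs_minus_sym.
  have := nm_ge0 x; have : La * Rabs (s - m) <= c/8 by rewrite -ed; apply: Rmult_le_compat_l; lra.
  nra.
have ontn s : Rabs (s - m) <= d -> ontop T (g s).
  move=> hs; have [_ ot] := ht t at_ (Rle_refl _).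
  apply: (onto_pert (c := c/2) _ (lbn t _) _ ot); first lra.
    by rewrite Rabs_left1; lra.
  apply: Rle_trans (lip t s) _.
  have : Rabs (t - s) <= 2 * d.
    have -> : t - s = (t - m) - (s - m) by ring.
    apply: Rle_trans (Rabs_triang _ _) _; rewrite Rabs_Ropp (Rabs_left1 (t - m)); lra.
  nra.
have Pall t' : a <= t' -> t' <= b -> t' <= m + d -> P t'.
  move=> h1 h2 h3; exists (Rmin ct (c/2)); split; first by apply: Rmin_glb_lt; lra.
  move=> s hs1 hs2; case: (Rle_lt_dec s t) => hst.
    have [l1 l2] := ht s hs1 hst; split=> // x; apply: Rle_trans (l1 x).
    by apply: nm_mulr; exact: Rmin_l.
  have hsm : Rabs (s - m) <= d by apply: Rabs_le; lra.
  split; last exact: ontn.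
  move=> x; apply: Rle_trans (lbn s hsm x).
  by apply: nm_mulr; exact: Rmin_r.
case: (Rle_lt_dec b (m + d)) => hbm.
  by have [c' [hc' h]] := Pall b hab (Rle_refl _) hbm; exists c'.
have : m + d <= m; last lra.
by apply: hm1; split; [lra | split; [lra | apply: Pall; lra]].
Qed.

Lemma cis_IZR z : cis (IZR z * (2 * PI)) = C1.
Proof.
have h : sin (IZR z * PI) = 0 by apply: sin_eq_0_1; exists z.
have -> : IZR z * (2 * PI) = 2 * (IZR z * PI) by ring.
by rewrite /cis cos_2a_sin sin_2a h; congr mkC; ring.
Qed.

Lemma cis_red t : exists t', 0 <= t' /\ t' <= 2 * PI /\ cis t = cis t'.
Proof.
have pp : 0 < 2 * PI by have := PI_RGT_0; lra.
pose z := Int_part (t / (2 * PI)); exists (t - IZR z * (2 * PI)).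
have e : t = t / (2 * PI) * (2 * PI) by field; lra.
have [h1 h2] := base_Int_part (t / (2 * PI)); rewrite -/z in h1 h2.
split; [nra | split; first nra].
rewrite -[RHS](_ : cis (t - IZR z * (2 * PI)) * cis (IZR z * (2 * PI)) = _)%C; last by rewrite cis_IZR; ring.
by rewrite -cis_add; congr cis; ring.
Qed.

Lemma cis_neg t : Cinv (cis t) = cis (- t).
Proof.
have h : (cis t * cis (- t))%C = C1 by rewrite -cis_add Rplus_opp_r cis_0.
have nz := @cis_neq0 t.
have -> : cis (- t) = (Cinv (cis t) * (cis t * cis (- t)))%C by field.
rewrite h; ring.
Qed.

Lemma circle_res_gen X (T : bop X) w0 c : w0 <> C0 -> 0 < c ->
  (forall t, lbp T (w0 * cis t)%C c /\ ontop T (w0 * cis t)%C) ->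
  exists Rs, rfam (Cinv w0 [*] T) Rs (Cmod w0 / c).
Proof.
move=> nz hc h; have pw := Cmod_gt0 nz.
have cs : 0 < c / Cmod w0 by exact: Rdiv_lt_0_compat.
have ex t : exists U : bop X, (bid [-] cis t [*] (Cinv w0 [*] T)) [o] U = bid /\
    U [o] (bid [-] cis t [*] (Cinv w0 [*] T)) = bid /\ nm U <= / (c / Cmod w0).
  have ct := @cis_neq0 t; have mt := Cmod_cis t.
  have [h1 h2] := h (- t); rewrite -cis_neg in h1 h2.
  have e : bid [-] cis t [*] (Cinv w0 [*] T) = (- (cis t * Cinv w0))%C [*] shf T (w0 * Cinv (cis t))%C by rewrite /shf; vec.
  have mc : Cmod (- (cis t * Cinv w0))%C = / Cmod w0.
    by rewrite Cmod_opp Cmod_mul mt Cmod_inv //; lra.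
  have q : (- (cis t * Cinv w0))%C <> C0.
    by apply: (Cmod_neq0 mc); exact: Rinv_0_lt_compat.
  move: mc q e; set a := (- _)%C => mc q e.
  apply: (@binv X X (bid [-] cis t [*] (Cinv w0 [*] T)) (c / Cmod w0) cs) => [x|y].
    rewrite e bscalE vnorm_scal mc; have := h1 x => h3.
    have := Rmult_le_compat_l (/ Cmod w0) _ _ (Rinv_ge0 (pw)) h3.
    by rewrite /Rdiv; lra.
  have [x hx] := h2 (Cinv a [*] y); exists x.
  rewrite e bscalE hx; clearbody a; vec.
have [Rs hR] := choice_fun ex; exists Rs.
have -> : Cmod w0 / c = / (c / Cmod w0) by field; lra.
exact: hR.
Qed.

(** T is arbitrary here, so invertibility cannot come from a Fredholm alternative. Only lower bounds
    off a countable set are known; a ray and a circle missing that set transport surjectivity from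
    the region |w| > 2 |T| to a circle of radius below s0. *)
Lemma circle_avoid X (T : bop X) (d : nat -> Cplx) s0 : 0 < s0 ->
  (forall w, w <> C0 -> (forall n, d n <> w) -> exists c, 0 < c /\ lbp T w c) ->
  exists w0 Rs B, w0 <> C0 /\ Cmod w0 < s0 /\ rfam (Cinv w0 [*] T) Rs B.
Proof.
move=> hs0 hlb.
(* Slope of the ray. Its points have positive real part, so a point of the countable set on it would
   have quotient im/re equal to tau; values of the quotient at real part zero do no harm. *)
have [tau [_ [_ htau]]] := @uncountable_interval (fun n => im (d n) / re (d n)) 0 1 ltac:(lra).
have [s [hs1 [hs2 hs3]]] := @uncountable_interval (fun n => Cmod (d n)) 0 s0 ltac:(lra).
pose u := mkC 1 tau.
have uz : u <> C0 by move=> h; have := f_equal re h => /=; lra.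
have pu := Cmod_gt0 uz.
pose v := (RtoC (/ Cmod u) * u)%C.
have mv : Cmod v = 1 by rewrite /v Cmod_mul Cmod_RtoC_pos; [field; lra | exact: Rinv_ge0].
have vz : v <> C0 by apply: (Cmod_neq0 mv); lra.
pose r0 := 2 * nm T + s0 + 1; have hT := nm_ge0 T.
pose g t := (RtoC (r0 + (s - r0) * t) * v)%C.
have gne t : 0 <= t -> t <= 1 -> 0 < r0 + (s - r0) * t by move=> h1 h2; rewrite /r0; nra.
have [c1 [hc1 path1]] : exists c, 0 < c /\ forall t, 0 <= t -> t <= 1 -> lbp T (g t) c /\ ontop T (g t).
  apply: (@path_onto X T g (Rabs (s - r0) + 1) 0 1); first by have := Rabs_pos (s - r0); lra.
  - lra.
  - move=> x y; have -> : (g x - g y)%C = (RtoC ((s - r0) * (x - y)) * v)%C by apply: C_eq => /=; ring.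
    rewrite Cmod_mul mv Cmod_RtoC Rabs_mult; have := Rabs_pos (x - y); have := Rabs_pos (s - r0); nra.
  - move=> t h1 h2; have p := gne t h1 h2; apply: hlb.
      by apply: Cmul_neq0 => //; apply: RtoC_neq0; lra.
    move=> n hn; apply: (htau n).
    have iu : 0 < / Cmod u by exact: Rinv_0_lt_compat.
    have qp : 0 < (r0 + (s - r0) * t) * / Cmod u by exact: Rmult_lt_0_compat.
    have e1 : re (d n) = (r0 + (s - r0) * t) * / Cmod u by rewrite hn /g /v /u /=; ring.
    have e2 : im (d n) = (r0 + (s - r0) * t) * / Cmod u * tau by rewrite hn /g /v /u /=; ring.
    rewrite e1 e2; move: qp; set q := _ * / _ => qp; field; lra.
  - move=> y; have e : g 0 = (RtoC r0 * v)%C by rewrite /g (_ : r0 + (s - r0) * 0 = r0) //; ring.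
    have gz : g 0 <> C0 by rewrite e; apply: Cmul_neq0 => //; apply: RtoC_neq0; rewrite /r0; lra.
    have mg : Cmod (g 0) = r0 by rewrite e Cmod_mul mv Cmod_RtoC_pos /r0; lra.
    have hA : nm ((- Cinv (g 0))%C [*] T) <= 1/2.
      rewrite vnorm_scal Cmod_opp Cmod_inv // mg; apply: (Rmult_le_reg_l r0); first by rewrite /r0; lra.
      by rewrite -Rmult_assoc Rinv_r /r0; lra.
    have [x hx] := neumann_onto hA ((- Cinv (g 0))%C [*] y); exists x.
    have -> : shf T (g 0) x = (- g 0)%C [*] (x [+] ((- Cinv (g 0))%C [*] T : bop X) x) by rewrite shfE bscalE; vec.
    rewrite hx; vec.
pose w0 := g 1.
have e0 : w0 = (RtoC s * v)%C by rewrite /w0 /g (_ : r0 + (s - r0) * 1 = s) //; ring.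
have mw : Cmod w0 = s by rewrite e0 Cmod_mul mv Cmod_RtoC_pos; lra.
have wz : w0 <> C0 by apply: (Cmod_neq0 mw).
have [c2 [hc2 path2]] : exists c, 0 < c /\ forall t, 0 <= t -> t <= 2 * PI -> lbp T (w0 * cis t)%C c /\ ontop T (w0 * cis t)%C.
  apply: (@path_onto X T (fun t => w0 * cis t)%C s 0 (2 * PI)) => //.
  - by have := PI_RGT_0; lra.
  - move=> x y; have -> : (w0 * cis x - w0 * cis y)%C = (w0 * (cis x - cis y))%C by ring.
    rewrite Cmod_mul mw; apply: Rmult_le_compat_l; [lra | exact: cis_lip].
  - move=> t _ _; apply: hlb; first by apply: Cmul_neq0 => //; exact: cis_neq0.
    by move=> n hn; apply: (hs3 n); rewrite hn Cmod_mul Cmod_cis mw Rmult_1_r.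
  - rewrite cis_0 (_ : (w0 * C1)%C = w0); last ring.
    by have [_] := path1 1 ltac:(lra) ltac:(lra).
have [|Rs hR] := circle_res_gen (T := T) wz hc2.
  by move=> t; have [t' [h1 [h2 ->]]] := cis_red t; exact: path2.
by exists w0, Rs, (Cmod w0 / c2); rewrite mw; split=> //; split; [lra | rewrite -{1}mw].
Qed.

Lemma sig0_countable X (K : bop X) : cpt K -> exists q : nat -> Cplx, forall k, sig0 K k -> exists n, q n = k.
Proof.
move=> hK.
have [l hl] := choice_fun (fun j => eig_finite hK (half_pow_gt0 j)).
exists (fun n => let (i, j) := Cantor.of_nat n in nth j (l i) C0) => k.
case: (classic (k = C0)) => [->|nz] hk.
  by exists (Cantor.to_nat (0%nat, length (l 0%nat))); rewrite Cantor.cancel_of_to nth_overflow.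
case: hk => [//|[v [nv hv]]].
have [N hN] := half_pow_small 1 (Cmod_gt0 nz).
have hin := hl N k v ltac:(have := hN N (Nat.le_refl _); lra) nv hv.
have [j [_ hj]] := In_nth _ _ C0 hin.
by exists (Cantor.to_nat (N, j)); rewrite Cantor.cancel_of_to.
Qed.

Definition adm X (h h' : bop X) : blin (BB X X) (BB X X) := bL h [o] bR h' [-] bid.

Lemma admE X (h h' : bop X) z : adm h h' z = h [o] z [o] h' [-] z.
Proof. by rewrite /adm baddE boppE bcompE bidE /= bcompA. Qed.

(** Lower bounds for [adm] minus w on all operators restrict to V, and [circle_avoid] supplies what
    restriction loses. The radius s lies below any prescribed s0 but is chosen before x, as it only
    has to avoid countably many values. *)
Lemma adm_split X (K h' : bop X) (V : bop X -> Prop) s0 : cpt K ->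
  (bid [+] K) [o] h' = bid -> h' [o] (bid [+] K) = bid ->
  @closed_vsubspace (BB X X) V -> (forall z, V z -> V ((bid [+] K) [o] z [o] h')) -> 0 < s0 ->
  exists s, 0 < s /\ s < s0 /\ forall x, V x -> exists B c d, V c /\ V d /\ x = c [+] d /\
    (forall m, nm (bpow (adm (bid [+] K) h') m c) <= B * s ^ m) /\
    (forall m e, (1 <= m)%nat -> 0 < e -> exists z, V z /\ s ^ m * nm z <= B /\ nm (d [-] bpow (adm (bid [+] K) h') m z) <= e).
Proof.
set h := bid [+] K => hK hh1 hh2 HV hinv hs0.
have VV := csub_sub HV.
have admV z : V z -> V (adm h h' z) by move=> hz; rewrite admE; apply: vsub_sub => //; exact: hinv.
have [T hT] := res HV admV.
have [q hq] := sig0_countable hK.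
have hsig k : sig0 K k -> (C1 + k)%C <> C0.
  move=> hk e; case: hk => [hk|[v [nv hv]]]; first by apply: C1_neq0; rewrite -e hk; ring.
  have hv0 : h v = vzero.
    have -> : h v = (C1 + k)%C [*] v by rewrite /h baddE bidE hv; vec.
    by rewrite e vscal_0.
  by apply: nv; rewrite -[v]bidE -hh2 bcompE hv0 bl_0.
(* The excluded values solve (1 + w)(1 + k) - 1 = k' with k, k' in [sig0 K], that is w = (k' - k)/(1
   + k). The lower bound of [ros] is divided by nm h + 1 because [ros] is ([adm] - w) z followed by
   right multiplication with h. *)
have lbT w : w <> C0 -> (forall n, (let (i, j) := Cantor.of_nat n in (q j - q i) / (C1 + q i))%C <> w) -> exists c, 0 < c /\ lbp T w c.
  move=> nz hn.
  have [c [hc lb]] : exists c, 0 < c /\ forall z, c * nm z <= nm (ros K (C1 + w)%C z).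
    apply: ros_lb => // k hk hk'; have hk1 := hsig k hk.
    have [i hi] := hq _ hk; have [j hj] := hq _ hk'.
    by apply: (hn (Cantor.to_nat (i, j))); rewrite Cantor.cancel_of_to hi hj; field.
  have hh := nm_ge0 h.
  exists (c / (nm h + 1)); split; first by divpos.
  move=> x; rewrite -[nm x]nm_incl -[nm (shf T w x)]nm_incl shfE bl_add bl_opp bl_scal hT admE.
  set z : bop X := incl HV x; have := lb z.
  have -> : ros K (C1 + w)%C z = (h [o] z [o] h' [-] z [-] w [*] z) [o] h.
    have e : h [o] z [o] h' [o] h = h [o] z by rewrite -bcompA hh2 compb1.
    rewrite compbDl compbNl compbDl e compbNl compbZl /ros -/h; vec.
  have := nm_comp (h [o] z [o] h' [-] z [-] w [*] z) h; set y := _ [-] w [*] z => h1 h2.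
  have hy := nm_ge0 y.
  apply: (Rmult_le_reg_r (nm h + 1)); first lra.
  have -> : c / (nm h + 1) * nm z * (nm h + 1) = c * nm z by field; lra.
  nra.
have [w0 [Rs [B [wz [ws HR]]]]] := circle_avoid hs0 lbT.
have ps := Cmod_gt0 wz.
have powI m y : incl HV (bpow T m y) = bpow (adm h h') m (incl HV y).
  by elim: m => [//|m IH]; rewrite [bpow T _]/= [bpow (adm h h') _]/= !bcompE hT IH.
have powA m : exists a, Cmod a * Cmod w0 ^ m = 1 /\ bpow (Cinv w0 [*] T) m = a [*] bpow T m.
  have [a [h1 h2]] := bpow_scal (Cinv w0) T m; exists a; split=> //.
  rewrite h2 Cmod_inv // -Rpow_mult_distr Rinv_l ?pow1 //; lra.
exists (Cmod w0); split=> //; split=> // x hx.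
have [y hy] := incl_sur HV hx.
have [c [d [e1 [e2 e3]]]] := split_spectral HR y.
exists (B * nm y), (incl HV c), (incl HV d); split; first exact: incl_in.
split; first exact: incl_in.
split; first by rewrite -hy e1 bl_add.
split.
  move=> m; have [a [ha1 ha2]] := powA m; have := e2 m; rewrite ha2 bscalE vnorm_scal -powI nm_incl => h1.
  have pm : 0 < Cmod w0 ^ m by exact: pow_lt.
  have := Rmult_le_compat_r _ _ _ (Rlt_le _ _ pm) h1; rewrite Rmult_assoc.
  have -> : Cmod a * (nm (bpow T m c) * Cmod w0 ^ m) = Cmod a * Cmod w0 ^ m * nm (bpow T m c) by ring.
  by rewrite ha1 Rmult_1_l.
move=> m e hm he; have [a [ha1 ha2]] := powA m.
have [z [hz1 hz2]] := e3 m e hm he.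
exists (incl HV (a [*] z)); split; first exact: incl_in.
rewrite nm_incl vnorm_scal; split.
  have -> : Cmod w0 ^ m * (Cmod a * nm z) = Cmod a * Cmod w0 ^ m * nm z by ring.
  by rewrite ha1 Rmult_1_l.
rewrite -powI -bl_opp -bl_add nm_incl.
by move: hz2; rewrite ha2 bscalE bl_scal.
Qed.

(** * Joint growth along chains of invariant subspaces *)

Lemma zorn_sets (T : Type) (P : (T -> Prop) -> Prop) :
  (forall F : (T -> Prop) -> Prop, (forall A, F A -> P A) ->
     (forall A B, F A -> F B -> (forall x, A x -> B x) \/ (forall x, B x -> A x)) ->
     P (fun x => exists A, F A /\ A x)) ->
  exists A, P A /\ forall B, (forall x, A x -> B x) -> P B -> forall x, B x -> A x.
Proof.
move=> h; have [F hF htot|A [hA hmax]] := @classical_sets.Zorn_bigcup T P.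
  have -> : classical_sets.bigcup F (fun A => A) = fun x => exists A, F A /\ A x.
    apply/boolp.predeqP => x; split.
      by move=> [A hA hx]; exists A.
    by move=> [A [hA hx]]; exists A.
  by apply: h => // A B hA hB; exact: htot.
exists A; split=> // B hAB hB x hx; apply: NNPP => nx; apply: (hmax B) => //.
split=> //; by move=> hBA; apply: nx; exact: hBA.
Qed.

Section Words.
Variable X : CBanach.
Implicit Types P Q : bop X -> Prop.

Inductive W P : nat -> bop X -> Prop :=
| W0 : W P 0 bid
| WS a n T : P a -> W P n T -> W P (S n) (a [o] T).

(** Joint growth at rate s with one constant for all words: for a single operator it is [gr]. *)
Definition J P (s : R) := exists C, forall n T, W P n T -> nm T <= C * s ^ n.
Definition J0 P := forall s, 0 < s -> J P s.

Lemma W1 P a : P a -> W P 1 a.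
Proof. by move=> h; rewrite -(compb1 a); exact: WS h (W0 _). Qed.

Lemma W_app P m n A B : W P m A -> W P n B -> W P (m + n) (A [o] B).
Proof.
by move=> hA hB; elim: hA => [|a k T ha _ IH] /=; rewrite ?comp1b // -bcompA; exact: WS.
Qed.

Lemma W_split P m n T : W P (m + n) T -> exists A B, W P m A /\ W P n B /\ T = A [o] B.
Proof.
elim: m T => [|m IH] T h.
  by exists bid, T; rewrite comp1b; split=> //; exact: W0.
inversion h as [|a k U ha hU]; subst.
have [A [B [h1 [h2 ->]]]] := IH U hU.
by exists (a [o] A), B; rewrite bcompA; split=> //; exact: WS.
Qed.

Lemma W_mono P Q n T : (forall a, P a -> Q a) -> W P n T -> W Q n T.
Proof. by move=> h; elim=> [|a k U /h ha _ IH]; [exact: W0 | exact: WS]. Qed.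

Lemma W_single K n T : W (fun a => a = K) n T -> T = bpow K n.
Proof. by elim=> [//|a k U -> _ ->]. Qed.

Lemma W_pow K n : W (fun a => a = K) n (bpow K n).
Proof. by elim: n => [|n IH]; [exact: W0 | exact: WS]. Qed.

Lemma W_inv P n T (M : X -> Prop) : (forall a, P a -> forall x, M x -> M (a x)) -> W P n T -> forall x, M x -> M (T x).
Proof. by move=> h; elim=> [//|a k U ha _ IH] x hx; rewrite bcompE; apply: h => //; exact: IH. Qed.

Lemma J_single K s : J (fun a => a = K) s <-> gr K s.
Proof.
split=> [[C h]|[C h]]; exists C => n; first by apply: h; exact: W_pow.
by move=> T /W_single ->.
Qed.

Lemma J_mono P Q s : (forall a, P a -> Q a) -> J Q s -> J P s.
Proof. by move=> h [C hC]; exists C => n T /(W_mono h); exact: hC. Qed.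

Lemma J_le P s t : 0 <= s -> s <= t -> J P s -> J P t.
Proof.
move=> hs hst [C hC]; exists (Rabs C) => n T /hC h; apply: Rle_trans h _.
have := pow_incr s t n (conj hs hst); have := pow_le s n hs; have := RRle_abs C; have := Rabs_pos C; nra.
Qed.

(** Growth of words on M measured modulo N, stated with approximants in N so that successive layers
    can be composed inside X without forming quotients. *)
Definition grow P (N M : X -> Prop) s := exists C, 0 <= C /\ forall n T x, W P n T -> M x ->
  exists y, N y /\ nm (T x [-] y) <= C * s ^ n * nm x.

Lemma grow_le P N M s t : 0 <= s -> s <= t -> grow P N M s -> grow P N M t.
Proof.
move=> hs hst [C [hC h]]; exists C; split=> // n T x hT hx; have [y [h1 h2]] := h n T x hT hx.
exists y; split=> //; apply: Rle_trans h2 _; apply: nm_mulr.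
by apply: Rmult_le_compat_l => //; exact: pow_incr.
Qed.

Lemma grow_J P s : grow P (fun x => x = vzero) (fun _ => True) s -> 0 <= s -> J P s.
Proof.
move=> [C [hC h]] hs; exists C => n T hT; apply: nm_le.
  by apply: Rmult_le_pos => //; exact: pow_le.
by move=> x; have [y [-> h2]] := h n T x hT I; rewrite vopp_0 vadd_0 in h2.
Qed.

Lemma lin_pow_le s t : 0 < s -> s < t -> exists E, 0 <= E /\ forall n, INR (S n) * s ^ n <= E * t ^ n.
Proof.
move=> hs hst; pose d := t / s - 1.
have hd : 0 < d.
  by rewrite /d; apply: (Rmult_lt_reg_r s) => //; have -> : (t / s - 1) * s = t - s by [field; lra]; lra.
have E1 : 0 < 1 + / d by have := Rinv_0_lt_compat _ hd; lra.
exists (1 + / d); split=> [|n]; first lra.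
have h1 : 1 + INR n * d <= (1 + d) ^ n by apply: poly.
have -> : t = s * (1 + d) by rewrite /d; field; lra.
rewrite Rpow_mult_distr (Rmult_comm (s ^ n)) -Rmult_assoc.
apply: Rmult_le_compat_r; first by apply: pow_le; lra.
apply: Rle_trans (Rmult_le_compat_l _ _ _ (Rlt_le _ _ E1) h1).
have -> : (1 + / d) * (1 + INR n * d) = INR n + 1 + / d + INR n * d by field; lra.
rewrite S_INR; have := pos_INR n; have := Rinv_0_lt_compat _ hd; nra.
Qed.

(** As for block triangular operators, a word of length n leaves the upper block at one of n places,
    each contributing order s^n. The linear factor is why the rate rises from s to an arbitrary t >
    s. *)
Lemma grow_trans P (N M Q : X -> Prop) s t p : 0 < s -> s < t -> vsubspace N -> vsubspace M ->
  (forall a, P a -> nm a <= p) -> 0 <= p -> (forall a, P a -> forall x, M x -> M (a x)) ->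
  grow P N M s -> grow P M Q s -> grow P N Q t.
Proof.
move=> hs hst VN VM hp hp0 Minv [C' [hC' g1]] [C [hC g2]].
pose D := C' * C * (1 + p / s) + C' * (1 + C).
have ps0 : 0 <= p / s by apply: Rmult_le_pos => //; exact: Rinv_ge0.
have CC : 0 <= C' * C by exact: Rmult_le_pos.
have CC2 : 0 <= C' * C * (1 + p / s) by apply: Rmult_le_pos; lra.
have CC3 : 0 <= C' * (1 + C) by apply: Rmult_le_pos; lra.
(* The approximant m in M is followed letter by letter: m' - a m again lies in M and is of order
   s^n, so each letter adds one term to the bound modulo N, whence the factor [INR (S n)]. *)
have key n T x : W P n T -> Q x -> exists m, M m /\ nm (T x [-] m) <= C * s ^ n * nm x /\
    forall k U, W P k U -> exists y, N y /\ nm (U m [-] y) <= D * INR (S n) * s ^ (n + k) * nm x.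
  elim=> [|a {}n {}T ha hT IH] hx.
    have [m [h1 h2]] := g2 0%nat bid x (W0 _) hx; rewrite pow_O bidE in h2.
    exists m; split=> //; split=> // k U hU; have [y [h3 h4]] := g1 k U m hU h1.
    exists y; split=> //; apply: Rle_trans h4 _.
    have nmm : nm m <= (1 + C) * nm x.
      by have := nm_rev m x; rewrite (nm_sym m x); move: h2; lra.
    have pk : 0 <= s ^ k by apply: pow_le; lra.
    have := Rmult_le_compat_l _ _ _ (Rmult_le_pos _ _ hC' pk) nmm.
    have nx := nm_ge0 x; rewrite [INR 1]/= Rmult_1_r Nat.add_0_l => h5.
    apply: Rle_trans h5 _; have -> : C' * s ^ k * ((1 + C) * nm x) = C' * (1 + C) * (s ^ k * nm x) by ring.
    have h6 : C' * (1 + C) * (s ^ k * nm x) <= D * (s ^ k * nm x).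
      by apply: Rmult_le_compat_r; [exact: Rmult_le_pos | rewrite /D; lra].
    lra.
  have [m [h1 [h2 h3]]] := IH hx.
  have [m' [h4 h5]] := g2 (S n) (a [o] T) x (WS ha hT) hx.
  exists m'; split=> //; split=> // k U hU.
  have sn : 0 < s ^ n by exact: pow_lt.
  have nx := nm_ge0 x.
  have hd : nm (m' [-] a m) <= C * s ^ n * (s + p) * nm x.
    have -> : m' [-] a m = a (T x [-] m) [-] ((a [o] T) x [-] m') by rewrite bcompE bl_add bl_opp; vec.
    apply: Rle_trans (nm_sub _ _) _.
    have i1 := nm_ge a (T x [-] m).
    have i2 : nm a * nm (T x [-] m) <= p * (C * s ^ n * nm x).
      by apply: Rmult_le_compat; [exact: nm_ge0 | exact: nm_ge0 | exact: hp |].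
    have i3 : C * s ^ S n * nm x = C * s ^ n * s * nm x by rewrite /=; ring.
    rewrite i3 in h5; lra.
  have Md : M (m' [-] a m) by apply: vsub_sub => //; exact: Minv.
  have [y1 [k1 k2]] := g1 k U _ hU Md.
  have [y2 [k3 k4]] := h3 (k + 1)%nat (U [o] a) (W_app hU (W1 ha)).
  exists (y1 [+] y2); split; first exact: vsub_add.
  have -> : U m' [-] (y1 [+] y2) = (U (m' [-] a m) [-] y1) [+] ((U [o] a) m [-] y2) by rewrite bcompE bl_add bl_opp; vec.
  apply: Rle_trans (vnorm_triangle _ _) _.
  have sk : 0 < s ^ k by exact: pow_lt.
  have k5 : C' * s ^ k * nm (m' [-] a m) <= C' * s ^ k * (C * s ^ n * (s + p) * nm x).
    by apply: Rmult_le_compat_l => //; apply: Rmult_le_pos => //; lra.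
  have e1 : C' * s ^ k * (C * s ^ n * (s + p) * nm x) = C' * C * (1 + p / s) * s ^ (S n + k) * nm x.
    by rewrite /= pow_add; field; lra.
  have e2 : (n + (k + 1) = S n + k)%nat by lia.
  rewrite e2 in k4.
  have sN : 0 <= s ^ (S n + k) * nm x by apply: Rmult_le_pos => //; apply: pow_le; lra.
  have k6 : C' * C * (1 + p / s) * (s ^ (S n + k) * nm x) <= D * (s ^ (S n + k) * nm x).
    by apply: Rmult_le_compat_r => //; rewrite /D; lra.
  rewrite (S_INR (S n)). clear -k2 k4 k5 e1 k6. clearbody D. lra.
have [E [hE hE2]] := lin_pow_le hs hst.
have D0 : 0 <= D by rewrite /D; lra.
exists (C + D * E); split; first by have := Rmult_le_pos _ _ D0 hE; lra.
move=> n T x hT hx; have [m [h1 [h2 h3]]] := key n T x hT hx.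
have [y [h4 h5]] := h3 0%nat bid (W0 _); exists y; split=> //.
have -> : T x [-] y = (T x [-] m) [+] (m [-] y) by vec.
apply: Rle_trans (vnorm_triangle _ _) _; rewrite Nat.add_0_r bidE in h5.
have nx := nm_ge0 x.
have i1 : s ^ n <= t ^ n by apply: pow_incr; lra.
have i2 : C * s ^ n * nm x <= C * t ^ n * nm x by apply: Rmult_le_compat_r => //; apply: Rmult_le_compat_l.
have i3 : D * (INR (S n) * s ^ n) * nm x <= D * (E * t ^ n) * nm x.
  by apply: Rmult_le_compat_r => //; apply: Rmult_le_compat_l.
lra.
Qed.

Lemma grow_small P N M s : 0 <= s -> vsubspace N -> vsubspace M -> vincl N M ->
  (forall a, P a -> forall x, N x -> N (a x)) -> (forall a, P a -> forall x, M x -> M (a x)) ->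
  (forall a, P a -> forall x, M x -> exists y, N y /\ nm (a x [-] y) <= s * nm x) -> grow P N M s.
Proof.
move=> hs VN VM hNM Ninv Minv h; exists 1; split; first lra.
move=> n T x; elim=> [|a {}n {}T ha hT IH] hx.
  by exists vzero; split; [exact: vsub_0 | rewrite bidE vopp_0 vadd_0 /=; lra].
have [y [h1 h2]] := IH hx.
have hM : M (T x [-] y) by apply: vsub_sub => //; [exact: (W_inv Minv hT) | exact: hNM].
have [y' [h3 h4]] := h a ha _ hM.
exists (a y [+] y'); split; first by apply: vsub_add => //; exact: Ninv.
have -> : (a [o] T) x [-] (a y [+] y') = a (T x [-] y) [-] y' by rewrite bcompE bl_add bl_opp; vec.
apply: Rle_trans h4 _.
have := Rmult_le_compat_l _ _ _ hs h2; rewrite /=; lra.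
Qed.
End Words.

Section Chains.
Variable X : CBanach.
Implicit Types (P : bop X -> Prop) (N M : X -> Prop) (C E : (X -> Prop) -> Prop).

Definition Inv P M := closed_vsubspace M /\ forall a, P a -> forall x, M x -> M (a x).

(** Closure under suprema and infima is recorded here; the whole space is a member as the infimum of
    the empty family. *)
Definition good_chain P C := (forall M, C M -> Inv P M) /\
  (forall M N, C M -> C N -> vincl M N \/ vincl N M) /\ C (fun x => x = vzero) /\
  (forall E, (exists M, E M) -> (forall M, E M -> C M) -> C (cl (fun x => exists M, E M /\ M x))) /\
  (forall E, (forall M, E M -> C M) -> C (fun x => forall M, E M -> M x)).

(** Closed unions and intersections of members are invariant and comparable with every member, so
    maximality puts them into the chain. *)
Lemma max_chain P : exists C, good_chain P C /\
  forall M, Inv P M -> (forall N, C N -> vincl M N \/ vincl N M) -> C M.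
Proof.
have [|C [[h1 h2] hmax]] := @zorn_sets (X -> Prop) (fun F => (forall M, F M -> Inv P M) /\
   (forall M N, F M -> F N -> vincl M N \/ vincl N M)).
  move=> F hF htot; split; first by move=> M [A [hA hM]]; case: (hF A hA) => h _; exact: h.
  move=> M N [A [hA hM]] [B [hB hN]]; case: (htot A B hA hB) => hAB.
    by case: (hF B hB) => _ h; apply: h => //; exact: hAB.
  by case: (hF A hA) => _ h; apply: h => //; exact: hAB.
have hmx M : Inv P M -> (forall N, C N -> vincl M N \/ vincl N M) -> C M.
  move=> hM hc; apply: (hmax (fun N => C N \/ N = M)); [by left | | by right].
  split; first by move=> N [/h1|->].
  move=> A B [hA|->] [hB|->]; [exact: h2 | | exact: hc | by left].
  by case: (hc A hA); [right | left].
exists C; split=> //; split=> //; split=> //.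
have c0 : C (fun x => x = vzero).
  apply: hmx; first by split; [exact: csub_zero | move=> a _ x ->; rewrite bl_0].
  by move=> N hN; left=> x ->; apply: vsub_0; apply: csub_sub; case: (h1 N hN).
split=> //; split.
  move=> E [M0 hM0] hE; apply: hmx.
    split.
      apply: cl_closed; split; last split.
      - by exists M0; split=> //; apply: vsub_0; apply: csub_sub; case: (h1 _ (hE _ hM0)).
      - move=> x y [A [hA hx]] [B [hB hy]]; case: (h2 A B (hE _ hA) (hE _ hB)) => hAB.
          by exists B; split=> //; apply: vsub_add => //; [apply: csub_sub; case: (h1 _ (hE _ hB)) | exact: hAB].
        by exists A; split=> //; apply: vsub_add => //; [apply: csub_sub; case: (h1 _ (hE _ hA)) | exact: hAB].
      - by move=> c x [A [hA hx]]; exists A; split=> //; apply: vsub_scal => //; apply: csub_sub; case: (h1 _ (hE _ hA)).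
    move=> a ha; apply: cl_inv => x [A [hA hx]]; exists A; split=> //.
    by case: (h1 _ (hE _ hA)) => _ h; exact: h.
  move=> N hN; have hNc : closed_vsubspace N by case: (h1 N hN).
  case: (classic (forall A, E A -> vincl A N)) => h.
    by left; apply: cl_min => // x [A [hA hx]]; exact: (h A hA).
  have [A hA'] := not_all_ex_not _ _ h; have [hA hAN] := imply_to_and _ _ hA'.
  right=> x hx; apply: cl_incl; exists A; split=> //.
  by case: (h2 A N (hE _ hA) hN) => // hNA; exact: hNA.
move=> E hE; apply: hmx.
  split.
    have -> : (fun x => forall M, E M -> M x) = fun x => forall i : {M | E M}, proj1_sig i x.
      apply/boolp.predeqP => x; split.
        by move=> h [M hM]; exact: h.
      by move=> h M hM; exact: (h (exist _ M hM)).
    by apply: csub_inter => -[M hM] /=; case: (h1 _ (hE _ hM)).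
  by move=> a ha x hx M hM; case: (h1 _ (hE _ hM)) => _ h; apply: h => //; exact: hx.
move=> N hN; case: (classic (forall A, E A -> vincl N A)) => h.
  by right=> x hx A hA; exact: (h A hA).
have [A hA'] := not_all_ex_not _ _ h; have [hA hAN] := imply_to_and _ _ hA'.
left=> x hx; case: (h2 A N (hE _ hA) hN) => // hNA.
by apply: hNA; exact: hx.
Qed.

Lemma fin_choose (I : Type) (le : I -> I -> Prop) (E : I -> Prop) (Phi : nat -> I -> Prop) n :
  (exists i, E i) -> (forall i j, E i -> E j -> le i j \/ le j i) ->
  (forall c i j, E i -> E j -> le i j -> Phi c i -> Phi c j) ->
  (forall c, (c < n)%nat -> exists i, E i /\ Phi c i) -> exists i, E i /\ forall c, (c < n)%nat -> Phi c i.
Proof.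
move=> hne htot hmon; elim: n => [|n IH] h.
  by have [i hi] := hne; exists i; split=> // c; lia.
have [|i [hi hi2]] := IH; first by move=> c hc; apply: h; lia.
have [j [hj hj2]] := h n ltac:(lia).
case: (htot i j hi hj) => hij.
  exists j; split=> // c hc; case: (Nat.eq_dec c n) => [->//|ne]; apply: (hmon c i j) => //; apply: hi2; lia.
exists i; split=> // c hc; case: (Nat.eq_dec c n) => [->|ne]; last by apply: hi2; lia.
exact: (hmon n j i).
Qed.

Lemma fin_choose_list (A I : Type) (le : I -> I -> Prop) (E : I -> Prop) (Phi : A -> I -> Prop) (l : list A) :
  (exists i, E i) -> (forall i j, E i -> E j -> le i j \/ le j i) ->
  (forall c i j, E i -> E j -> le i j -> Phi c i -> Phi c j) ->
  (forall c, In c l -> exists i, E i /\ Phi c i) -> exists i, E i /\ forall c, In c l -> Phi c i.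
Proof.
move=> hne htot hmon; elim: l => [|a l IH] h.
  by have [i hi] := hne; exists i.
have [|i [hi hi2]] := IH; first by move=> c hc; apply: h; right.
have [j [hj hj2]] := h a (or_introl erefl).
case: (htot i j hi hj) => hij.
  by exists j; split=> // c [<-//|hc]; apply: (hmon c i j) => //; exact: hi2.
exists i; split=> // c [<-|hc]; [exact: (hmon a j i) | exact: hi2].
Qed.

Lemma unit_scale (K : bop X) M N e : vsubspace M -> vsubspace N -> 0 <= e ->
  (forall x, M x -> nm x <= 1 -> exists y, N y /\ nm (K x [-] y) <= e) ->
  forall x, M x -> exists y, N y /\ nm (K x [-] y) <= e * nm x.
Proof.
move=> VM VN he h x hx; case: (classic (x = vzero)) => [->|nz].
  by exists vzero; split; [exact: vsub_0 | rewrite bl_0 vadd_opp !nm_0; lra].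
have p := nm_gt0 nz; have hs : 0 <= / nm x by exact: Rinv_ge0.
have [||y [h1 h2]] := h (RtoC (/ nm x) [*] x); first exact: vsub_scal.
  by rewrite nm_scalR // Rinv_l; lra.
exists (RtoC (nm x) [*] y); split; first exact: vsub_scal.
have nz' : RtoC (nm x) <> C0 by apply: RtoC_neq0; lra.
have -> : K x [-] RtoC (nm x) [*] y = RtoC (nm x) [*] (K (RtoC (/ nm x) [*] x) [-] y).
  rewrite bl_scal RtoC_inv; last lra.
  vec.
rewrite nm_scalR; last lra.
by rewrite Rmult_comm; apply: Rmult_le_compat_r => //; lra.
Qed.

Variables (l : list (bop X)) (C : (X -> Prop) -> Prop).
Hypothesis hcpt : forall a, In a l -> cpt a.
Hypothesis hC : good_chain (fun a => In a l) C.

Let cinv M : C M -> Inv (fun a => In a l) M. Proof. by case: hC => h _; exact: h. Qed.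
Let csubC M : C M -> vsubspace M. Proof. by move=> /cinv [/csub_sub]. Qed.
Let ctot M N : C M -> C N -> vincl M N \/ vincl N M. Proof. by case: hC => _ [h _]; exact: h. Qed.

(** The images of the ball of M under the letters have finite nets inside M, and finitely many
    points of the closed union are approximated within a single member of the chain. *)
Lemma local_below E e : 0 < e -> (exists M, E M) -> (forall M, E M -> C M) ->
  exists N, E N /\ forall a, In a l -> forall x, cl (fun x => exists M, E M /\ M x) x ->
    exists y, N y /\ nm (a x [-] y) <= e * nm x.
Proof.
move=> he hne hE; set M := cl _.
have cM : C M by case: hC => _ [_ [_ [h _]]]; exact: h.
have [|K N N' hN hN' hinc hK x hx|K hK|N [hN hN2]] := @fin_choose_list _ _ (@vincl X) E
   (fun (a : bop X) N => forall x, M x -> exists y, N y /\ nm (a x [-] y) <= e * nm x) l hne.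
- by move=> A B hA hB; apply: ctot; exact: hE.
- by have [y [h1 h2]] := hK x hx; exists y; split=> //; exact: hinc.
- have [Nc [col [h1 h2]]] := hcpt hK (e := e/2) ltac:(lra).
  have [|c A B hA hB hAB h [r hr]|c hc|N [hN hN2]] := @fin_choose _ (@vincl X) E
     (fun c N => (exists r, M r /\ nm r <= 1 /\ col r = c) ->
        exists r y, M r /\ nm r <= 1 /\ col r = c /\ N y /\ nm (K r [-] y) <= e/2) Nc hne.
  + by move=> A B hA hB; apply: ctot; exact: hE.
  + have [r' [y [k1 [k2 [k3 [k4 k5]]]]]] := h (ex_intro _ r hr).
    by exists r', y; do 4! split=> //; exact: hAB.
  + case: (classic (exists r, M r /\ nm r <= 1 /\ col r = c)) => [[r [k1 [k2 k3]]]|hno]; last first.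
      by have [N hN] := hne; exists N; split.
    have MKr : M (K r) by have [_ h] := cinv cM; exact: h.
    have [y [[N [hN hy]] hy2]] := MKr (e/2) ltac:(lra).
    by exists N; split=> // _; exists r, y; do 4! split=> //; lra.
  exists N; split=> //; apply: unit_scale; [exact: csubC | by apply: csubC; exact: hE | lra | move=> x hx hx1].
  have [r [y [k1 [k2 [k3 [k4 k5]]]]]] := hN2 (col x) (h1 x hx1) (ex_intro _ x (conj hx (conj hx1 erefl))).
  exists y; split=> //; have := nm_tri3 (K x) (K r) y; have := h2 x r hx1 k2 (esym k3); lra.
by exists N.
Qed.

(** If every member contained a unit vector whose image stays e away from the intersection N,
    compactness would give a limit y of such images belonging to every member, hence to N, a
    contradiction. *)
Lemma local_above E e : 0 < e -> (exists M, E M) -> (forall M, E M -> C M) ->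
  exists M, E M /\ forall a, In a l -> forall x, M x ->
    exists y, (forall M, E M -> M y) /\ nm (a x [-] y) <= e * nm x.
Proof.
move=> he hne hE; set N := fun y => forall M, E M -> M y.
have cN : C N by case: hC => _ [_ [_ [_ h]]]; exact: h.
have [|K A B hA hB hinc hK x hx|K hK|M [hM hM2]] := @fin_choose_list _ _ (fun A B => vincl B A) E
   (fun (a : bop X) M => forall x, M x -> exists y, N y /\ nm (a x [-] y) <= e * nm x) l hne.
- by move=> A B hA hB; case: (ctot (hE _ hA) (hE _ hB)); [right | left].
- by apply: hK; exact: hinc.
- apply: NNPP => hno.
  pose Bad (A : X -> Prop) := forall M, E M -> exists x, A x /\ M x /\ nm x <= 1 /\ forall y, N y -> e < nm (K x [-] y).
  have bad0 : Bad (fun x => nm x <= 1).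
    move=> M hM; apply: NNPP => h; apply: hno; exists M; split=> //.
    apply: unit_scale; [by apply: csubC; exact: hE | exact: csubC | lra | move=> x hx hx1].
    apply: NNPP => h'; apply: h; exists x; do 3! split=> //; move=> y hy.
    by apply: Rnot_le_lt => hle; apply: h'; exists y.
  have [A hA|A Nc col hA _ hcol|y hy] := nest (hcpt hK) bad0.
  + by have [M0 hM0] := hne; have [x [hx _]] := hA M0 hM0; exists x.
  + apply: NNPP => hn.
    have [|c M M' hM hM' hinc h x hx|c hc|M [hM hM2]] := @fin_choose _ (fun A B => vincl B A) E
       (fun c M => forall x, A x /\ col x = c -> M x -> nm x <= 1 -> exists y, N y /\ nm (K x [-] y) <= e) Nc hne.
    * by move=> A' B hA' hB; case: (ctot (hE _ hA') (hE _ hB)); [right | left].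
    * by move=> hx1; apply: h => //; exact: hinc.
    * apply: NNPP => h; apply: hn; exists c => M hM; apply: NNPP => h'; apply: h; exists M; split=> // x hx hx1 hx2.
      apply: NNPP => h''; apply: h'; exists x; do 3! split=> //; move=> y hy.
      by apply: Rnot_le_lt => hle; apply: h''; exists y.
    have [x [k1 [k2 [k3 k4]]]] := hA M hM.
    have [y [k5 k6]] := hM2 (col x) (hcol x k1) x (conj k1 erefl) k2 k3.
    by have := k4 y k5; lra.
  have Ny : N y.
    move=> M hM; have [hMc hMi] := cinv (hE _ hM); apply: (closed_cl hMc) => d hd.
    have [A [hA [_ hA2]]] := hy (d/2) ltac:(lra).
    have [x [k1 [k2 _]]] := hA M hM; exists (K x); split; first exact: hMi.
    by rewrite nm_sym; have := hA2 x k1; lra.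
  have [A [hA [_ hA2]]] := hy (e/2) ltac:(lra).
  have [M0 hM0] := hne; have [x [k1 [_ [_ k2]]]] := hA M0 hM0.
  by have := k2 y Ny; have := hA2 x k1; lra.
by exists M.
Qed.

Lemma list_bound : exists p, 0 <= p /\ forall a, In a l -> nm a <= p.
Proof.
clear; elim: l => [|a l' [p [hp h]]]; first by exists 0; split; [lra | ].
exists (p + nm a); split; first by have := nm_ge0 a; lra.
by move=> b [<-|/h hb]; [lra | have := nm_ge0 a; lra].
Qed.

(** Induction along the complete chain: the reachable part passes gaps by hypothesis, suprema by
    [local_below] and infima by [local_above], so it exhausts the space. Compactness supplies the
    control at limit members. *)
Theorem partition s t : 0 < s -> s < t ->
  (forall N M, C N -> C M -> vincl N M -> (exists x, M x /\ ~ N x) ->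
     (forall Q, C Q -> vincl Q N \/ vincl M Q) -> grow (fun a => In a l) N M s) ->
  J (fun a => In a l) t.
Proof.
move=> hs hst hgap; set P := fun a => In a l.
have [p [hp0 hp]] := list_bound.
pose Z := fun x : X => x = vzero.
(* Demanding every rate above s, not one fixed rate, absorbs the loss in [grow_trans] however often
   it is applied. *)
pose G M := C M /\ forall s', s < s' -> grow P Z M s'.
have c0 : C Z by case: hC => _ [_ []].
have Gext N M : G N -> C M -> grow P N M s -> G M.
  move=> [cN hN] cM hg; split=> // s' hs'.
  apply: (@grow_trans _ P Z N M ((s + s')/2) s' p) => //; try lra; try exact: csubC.
  - by case: (cinv cN).
  - by apply: hN; lra.
  - by apply: (grow_le _ _ hg); lra.
have G0 : G Z.
  split=> // s' hs'; exists 0; split; first lra.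
  by move=> n T x _ ->; exists vzero; split=> //; rewrite bl_0 vadd_opp nm_0; lra.
pose Ms := cl (fun x => exists M, G M /\ M x).
have cMs : C Ms by case: hC => _ [_ [_ [h _]]]; apply: h; [exists Z | move=> M []].
have Gle M : G M -> vincl M Ms by move=> hM x hx; apply: cl_incl; exists M.
have GMs : G Ms.
  have [||N [hN hN2]] := @local_below G s hs; first by exists Z.
    by move=> M [].
  apply: (Gext N) => //; have [cN _] := hN.
  apply: grow_small; [lra | exact: csubC | exact: csubC | exact: Gle | by case: (cinv cN) | by case: (cinv cMs) | exact: hN2].
case: (classic (forall x, Ms x)) => hall.
  apply: (J_le (s := (s + t)/2)); [lra | lra | apply: grow_J; last lra].
  have [_ h] := GMs; have [D [hD hD2]] := h ((s + t)/2) ltac:(lra).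
  by exists D; split=> // n T x hT _; exact: hD2.
exfalso.
(* Members strictly above [Ms]. Either their intersection is strictly larger, and the pair is a gap,
   or it equals [Ms], and members slightly above it are reached through [local_above]. *)
pose E M := C M /\ vincl Ms M /\ exists x, M x /\ ~ Ms x.
have [x0 hx0] := not_all_ex_not _ _ hall.
have cT : C (fun x => forall M, False -> M x) by case: hC => _ [_ [_ [_ h]]]; apply: (h (fun _ => False)).
have neE : exists M, E M.
  by exists (fun x => forall M, False -> M x); split=> //; split=> //; exists x0.
have hE M : E M -> C M by case.
pose M1 := fun x => forall M, E M -> M x.
have cM1 : C M1 by case: hC => _ [_ [_ [_ h]]]; exact: h.
have MsM1 : vincl Ms M1 by move=> x hx M [_ [h _]]; exact: h.
case: (classic (exists x, M1 x /\ ~ Ms x)) => [hx|hno].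
  have gm : G M1.
    apply: (Gext Ms) => //; apply: hgap => // Q cQ.
    case: (ctot cQ cMs) => hQ; first by left.
    case: (classic (vincl Q Ms)) => hQ2; [by left | right].
    have [z hz] := not_all_ex_not _ _ hQ2; have [hz1 hz2] := imply_to_and _ _ hz.
    by move=> x hx'; apply: hx'; split=> //; split=> //; exists z.
  by have [x [h1 h2]] := hx; apply: h2; exact: (Gle M1 gm).
have M1Ms : vincl M1 Ms by move=> x hx; apply: NNPP => nx; apply: hno; exists x.
have [M [hM hM2]] := local_above hs neE hE.
have [cM [hMsM [x [h1 h2]]]] := hM.
apply: h2; apply: (Gle M) => //; apply: (Gext Ms) => //.
apply: grow_small; [lra | exact: csubC | exact: csubC | done | by case: (cinv cMs) | by case: (cinv cM) |].
by move=> a ha z hz; have [y [k1 k2]] := hM2 a ha z hz; exists y; split=> //; exact: M1Ms.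
Qed.
End Chains.

(** * Operators induced on the gaps of a chain *)

Section Gap.
Variable X : CBanach.
Implicit Types (N M : X -> Prop) (P : bop X -> Prop).

(* [gp] plays the role of the quotient map from M onto the gap M/N, extended arbitrarily outside M. *)
Record gapspec N M Y (gp : X -> Y) : Prop := {
  g_add : forall x y, M x -> M y -> gp (x [+] y) = gp x [+] gp y;
  g_scal : forall c x, M x -> gp (c [*] x) = c [*] gp x;
  g_0 : forall x, M x -> (gp x = vzero <-> N x);
  g_nm : forall x, M x -> nm (gp x) <= nm x;
  g_lift : forall y, exists x, M x /\ gp x = y /\ nm x <= 2 * nm y;
  g_dist : forall x e, M x -> nm (gp x) < e -> exists n, N n /\ nm (x [-] n) < e;
  g_op : forall T : bop X, (forall x, M x -> M (T x)) -> (forall x, N x -> N (T x)) ->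
    exists U : bop Y, (forall x, M x -> U (gp x) = gp (T x)) /\ nm U <= nm T /\ (cpt T -> cpt U);
  g_pull : forall Q, closed_vsubspace Q -> closed_vsubspace (fun x => M x /\ Q (gp x)) }.

Lemma gap_ex N M : closed_vsubspace N -> closed_vsubspace M -> vincl N M ->
  exists Y gp, @gapspec N M Y gp.
Proof.
move=> HN HM hNM.
have HN' : @closed_vsubspace (Sub HM) (fun z => N (incl HM z)).
  have [n0 [n1 [n2 n3]]] := HN; split; first by rewrite bl_0.
  split; first by move=> x y hx hy; rewrite bl_add; exact: n1.
  split; first by move=> c x hx; rewrite bl_scal; exact: n2.
  by move=> u l hu hl; apply: (n3 (fun n => incl HM (u n))) => //; exact: bl_conv.
pose gp (x : X) : Quot HN' := match boolp.pselect (M x) with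
  | left h => proj HN' (exist _ x h) | right _ => vzero end.
have gpE (z : Sub HM) : gp (incl HM z) = proj HN' z.
  rewrite /gp; case: boolp.pselect => [h|]; last by case; exact: incl_in.
  by congr (proj HN' _); apply: incl_inj.
have sur x : M x -> exists z, incl HM z = x by move=> hx; exists (exist _ x hx).
exists (Quot HN'), gp; split.
- by move=> _ _ /sur [x <-] /sur [y <-]; rewrite -bl_add !gpE bl_add.
- by move=> c _ /sur [x <-]; rewrite -bl_scal !gpE bl_scal.
- by move=> _ /sur [x <-]; rewrite gpE; exact: proj_0.
- by move=> _ /sur [x <-]; rewrite gpE nm_incl; exact: proj_nm.
- move=> y; have [z [<- h2]] := proj_lift2 y; exists (incl HM z); rewrite gpE nm_incl; split; [exact: incl_in | by split].
- move=> _ e /sur [x <-]; rewrite gpE => /proj_dist [m [h1 h2]].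
  by exists (incl HM m); split=> //; rewrite -bl_opp -bl_add nm_incl.
- move=> T hM hN; have [U0 hU0] := res HM hM.
  have [|U [hU hUn]] := @qinduced _ _ HN' U0; first by move=> z hz; rewrite hU0; exact: hN.
  exists U; split; first by move=> _ /sur [x <-]; rewrite gpE hU -gpE hU0.
  split; last by move=> hc; apply: (cpt_quot hU); exact: (cpt_res hU0 hc).
  apply: Rle_trans hUn _; apply: nm_le => [|x]; first exact: nm_ge0.
  by rewrite -(nm_incl (U0 x)) hU0 -(nm_incl x); exact: nm_ge.
- move=> Q [q0 [q1 [q2 q3]]]; have [m0 [m1 [m2 m3]]] := HM; split.
    by split=> //; have := gpE vzero; rewrite !bl_0 => ->.
  split.
    move=> _ _ [/sur [x <-] hx] [/sur [y <-] hy]; split; first by apply: m1; exact: incl_in.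
    by move: hx hy; rewrite -bl_add !gpE bl_add => hx hy; exact: q1.
  split.
    move=> c _ [/sur [x <-] hx]; split; first by apply: m2; exact: incl_in.
    by move: hx; rewrite -bl_scal !gpE bl_scal; exact: q2.
  move=> u l hu hl; have hl' : M l by apply: (m3 u) => // n; case: (hu n).
  split=> //; apply: (q3 (fun n => gp (u n))); first by move=> n; case: (hu n).
  have [z hz] := sur l hl'; move=> e he; have [n0 hn0] := hl e he; exists n0 => n hn.
  have [hun _] := hu n; have [zn hzn] := sur _ hun.
  rewrite -hz -hzn !gpE -bl_opp -bl_add; apply: Rle_lt_trans (proj_nm _ _) _.
  by rewrite -(nm_incl (zn [-] z)) bl_add bl_opp hz hzn; exact: hn0.
Qed.

Variables (N M : X -> Prop) (Y : CBanach) (gp : X -> Y).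
Hypothesis G : gapspec N M gp.

Definition gop (T : bop X) (U : bop Y) := forall x, M x -> U (gp x) = gp (T x).
Definition ind P (U : bop Y) := exists T, P T /\ gop T U.

Lemma gop_uniq (T : bop X) (U U' : bop Y) : gop T U -> gop T U' -> U = U'.
Proof.
move=> h h'; apply: blin_ext => y; have [x [hx [<- _]]] := g_lift G y.
by rewrite h // h'.
Qed.

Lemma gop_id : gop bid bid. Proof. by []. Qed.

Lemma gop_comp (T T' : bop X) (U U' : bop Y) : (forall x, M x -> M (T' x)) -> gop T U -> gop T' U' -> gop (T [o] T') (U [o] U').
Proof. by move=> hM h h' x hx; rewrite !bcompE h' // h //; exact: hM. Qed.

Lemma gop_add (T T' : bop X) (U U' : bop Y) : (forall x, M x -> M (T x)) -> (forall x, M x -> M (T' x)) ->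
  gop T U -> gop T' U' -> gop (T [+] T') (U [+] U').
Proof. by move=> hM hM' h h' x hx; rewrite !baddE h' // h // (g_add G) //; [exact: hM | exact: hM']. Qed.

Lemma gop_scal c (T : bop X) (U : bop Y) : (forall x, M x -> M (T x)) -> gop T U -> gop (c [*] T) (c [*] U).
Proof. by move=> hM h x hx; rewrite !bscalE h // (g_scal G) //; exact: hM. Qed.

Lemma gop_opp (T : bop X) (U : bop Y) : (forall x, M x -> M (T x)) -> gop T U -> gop (vopp T) (vopp U).
Proof. by move=> hM h x hx; rewrite !boppE h // !vopp_scal (g_scal G) //; exact: hM. Qed.

Lemma gop_nm (T : bop X) (U : bop Y) : (forall x, M x -> M (T x)) -> (forall x, N x -> N (T x)) -> gop T U -> nm U <= nm T.
Proof. by move=> hM hN h; have [U' [h1 [h2 _]]] := g_op G hM hN; rewrite (gop_uniq h h1). Qed.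

Lemma gop_cpt (T : bop X) (U : bop Y) : (forall x, M x -> M (T x)) -> (forall x, N x -> N (T x)) -> gop T U -> cpt T -> cpt U.
Proof. by move=> hM hN h; have [U' [h1 [_ h2]]] := g_op G hM hN; rewrite (gop_uniq h h1). Qed.

Lemma ind_W P n (T : bop X) : (forall a, P a -> forall x, M x -> M (a x)) -> (forall a, P a -> forall x, N x -> N (a x)) ->
  W P n T -> exists U, W (ind P) n U /\ gop T U.
Proof.
move=> hM hN; elim=> [|a k T' ha hT [U [h1 h2]]]; first by exists bid; split; [exact: W0 | exact: gop_id].
have [U' [h3 _]] := g_op G (hM a ha) (hN a ha).
by exists (U' [o] U); split; [apply: WS => //; exists a | apply: gop_comp => //; exact: W_inv hT].
Qed.

Lemma ind_W' P n (U : bop Y) : (forall a, P a -> forall x, M x -> M (a x)) ->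
  W (ind P) n U -> exists T, W P n T /\ gop T U.
Proof.
move=> hM; elim=> [|U' k U0 [a [ha ga]] _ [T [h1 h2]]]; first by exists bid; split; [exact: W0 | exact: gop_id].
by exists (a [o] T); split; [exact: WS | apply: gop_comp => //; exact: W_inv h1].
Qed.

Lemma gap_grow P s : 0 < s -> vsubspace N -> (forall a, P a -> forall x, M x -> M (a x)) ->
  (forall a, P a -> forall x, N x -> N (a x)) -> J (ind P) s -> grow P N M s.
Proof.
move=> hs VN hM hN [C hC]; exists (Rabs C + 1); split; first by have := Rabs_pos C; lra.
move=> n T x hT hx; case: (classic (x = vzero)) => [->|nz].
  by exists vzero; split; [exact: vsub_0 | rewrite bl_0 vadd_opp !nm_0; lra].
have [U [h1 h2]] := ind_W hM hN hT; have sn := pow_lt s n hs; have px := nm_gt0 nz.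
have [||y [k1 k2]] := @g_dist _ _ _ _ G (T x) ((Rabs C + 1) * s ^ n * nm x); first exact: W_inv hT _ hx.
  rewrite -h2 //; apply: Rle_lt_trans (nm_ge _ _) _.
  have := hC n U h1; have := RRle_abs C => i1 i2.
  have i3 : nm U < (Rabs C + 1) * s ^ n by apply: Rle_lt_trans i2 _; apply: Rmult_lt_compat_r; lra.
  apply: Rle_lt_trans (nm_mull U (g_nm G hx)) _.
  by apply: Rmult_lt_compat_r.
by exists y; split=> //; lra.
Qed.
End Gap.

Definition irr Y (P : bop Y -> Prop) :=
  forall Q, Inv P Q -> (forall x, Q x -> x = vzero) \/ forall x, Q x.

Lemma gap_irr X (P : bop X -> Prop) C N M Y (gp : X -> Y) :
  good_chain P C -> (forall M, Inv P M -> (forall N, C N -> vincl M N \/ vincl N M) -> C M) ->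
  gapspec N M gp -> C N -> C M -> vincl N M -> (forall Q, C Q -> vincl Q N \/ vincl M Q) ->
  irr (ind M gp P).
Proof.
move=> [hinv [htot _]] hmax G cN cM hNM hgap Q [Qc Qi].
have [HN iN] := hinv _ cN; have [HM iM] := hinv _ cM.
have cR : C (fun x => M x /\ Q (gp x)).
  apply: hmax.
    split; first exact: (g_pull G Qc).
    move=> a ha x [hx hq]; split; first exact: iM.
    have [U [hU _]] := g_op G (iM a ha) (iN a ha).
    by rewrite -hU //; apply: Qi => //; exists a.
  move=> R /hgap [hR|hR]; last by left=> x [hx _]; exact: hR.
  right=> x /hR hx; have hx' := hNM _ hx; split=> //.
  have /(g_0 G) -> := hx; last exact: hNM.
  by case: Qc.
case: (hgap _ cR) => h; [left | right] => y.
  move=> hy; have [x [hx [e _]]] := g_lift G y; rewrite -e; apply/(g_0 G) => //.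
  by apply: h; rewrite e.
by have [x [hx [<- _]]] := g_lift G y; case: (h x hx).
Qed.

(** Two families share the work: the chain is maximal for P, which makes gaps irreducible for P,
    while growth is estimated for the finite list l of compact members of P. *)
Theorem gap_reduction X (P : bop X -> Prop) (l : list (bop X)) s t : 0 < s -> s < t ->
  (forall a, In a l -> cpt a /\ P a) ->
  (forall N M (Y : CBanach) (gp : X -> Y), gapspec N M gp -> Inv P N -> Inv P M -> (exists y : Y, y <> vzero) ->
     irr (ind M gp P) -> J (ind M gp (fun a => In a l)) s) ->
  J (fun a => In a l) t.
Proof.
move=> hs hst hl hY; have [C [hC hmax]] := max_chain P.
have [hinv [htot [h0 [hcl hint]]]] := hC.
have gC : good_chain (fun a => In a l) C.
  split=> // M /hinv [h1 h2]; split=> // a /hl [_ ha]; exact: h2.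
apply: (partition (s := s) _ gC) => //; first by move=> a /hl [].
move=> N M cN cM hNM [x [hx nx]] hgap.
have [HN iN] := hinv _ cN; have [HM iM] := hinv _ cM.
have [Y [gp G]] := gap_ex HN HM hNM.
apply: (gap_grow G) => //; [exact: csub_sub | by move=> a /hl [_ ha]; exact: iM | by move=> a /hl [_ ha]; exact: iN |].
apply: (hY N M) => //; last exact: (gap_irr hC hmax G).
by exists (gp x) => /(g_0 G hx).
Qed.

(** * Hilden's argument and Turovskii's theorem *)

Definition dens Y (S : bop Y -> Prop) :=
  forall y z e, y <> vzero -> 0 < e -> exists t, S t /\ nm (t y [-] z) < e.

Lemma irr_dens Y (P S : bop Y -> Prop) : irr P -> @vsubspace (BB Y Y) S ->
  (forall a t, P a -> S t -> S (a [o] t)) -> (forall y, y <> vzero -> exists t, S t /\ t y <> vzero) -> dens S.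
Proof.
move=> hirr [S0 [S1 S2]] hP hS y z e ny he.
have [t0 [h0 h1]] := hS y ny.
case: (hirr (cl (fun z => exists t, S t /\ z = t y))).
- split; last by move=> a ha; apply: cl_inv => _ [t [ht ->]]; exists (a [o] t); split=> //; exact: hP.
  apply: cl_closed; split; first by exists vzero.
  split; first by move=> _ _ [t [ht ->]] [u [hu ->]]; exists (t [+] u); split=> //; exact: S1.
  by move=> c _ [t [ht ->]]; exists (c [*] t); split=> //; exact: S2.
- by move=> h; case: h1; apply: h; apply: cl_incl; exists t0.
move=> h; have [_ [[t [ht ->]] hd]] := h z e he; exists t; split=> //; by rewrite nm_sym.
Qed.

(** Heine-Borel for K D: a local choice of i near each limit point gives finitely many i in total.
    The list is then filtered to the indices that are really met. *)
Lemma TB_ball_cover X Y (K : blin X Y) (D : X -> Prop) (I : Type) (Good : I -> X -> Prop) r : cpt K ->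
  (forall x, D x -> nm x <= r) ->
  (forall y, (forall e, 0 < e -> exists x, D x /\ nm (K x [-] y) <= e) ->
     exists i e, 0 < e /\ forall x, D x -> nm (K x [-] y) <= e -> Good i x) ->
  exists l : list I, (forall i, In i l -> exists x, D x /\ Good i x) /\ forall x, D x -> exists i, In i l /\ Good i x.
Proof.
move=> hK hD hG.
suff [l hl] : exists l : list I, forall x, D x -> exists i, In i l /\ Good i x.
  pose p i := if boolp.pselect (exists x, D x /\ Good i x) then true else false.
  have hp i : p i = true <-> exists x, D x /\ Good i x by rewrite /p; case: boolp.pselect.
  exists (filter p l); split; first by move=> i /filter_In [_ /hp].
  by move=> x hx; have [i [h1 h2]] := hl x hx; exists i; split=> //; apply/filter_In; split=> //; apply/hp; exists x.
apply: NNPP => hno.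
pose Bad (A : X -> Prop) := (forall x, A x -> D x) /\ ~ exists l : list I, forall x, A x -> exists i, In i l /\ Good i x.
have hT : TB D K by apply: TB_sub (cpt_ball r hK).
have bad0 : Bad D by [].
have [A [hA hA2]|A Nc col [hA hA2] _ hcol|y hy] := nest hT bad0.
- by apply: NNPP => h; apply: hA2; exists nil => x hx; case: h; exists x.
- apply: NNPP => hn.
  have h c : exists l : list I, forall x, A x /\ col x = c -> exists i, In i l /\ Good i x.
    apply: NNPP => h; apply: hn; exists c; split=> // x [hx _]; exact: hA.
  have [f hf] := choice_fun h; apply: hA2.
  exists (flat_map f (seq 0 Nc)) => x hx; have [i [h1 h2]] := hf (col x) x (conj hx erefl).
  exists i; split=> //; apply/in_flat_map; exists (col x); split=> //.
  by apply/in_seq; have := hcol x hx; lia.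
have [|i [e [he h]]] := hG y.
  move=> e he; have [A [[hA hA2] [_ h3]]] := hy e he.
  have [x hx] : exists x, A x by apply: NNPP => h; apply: hA2; exists nil => x hx; case: h; exists x.
  by exists x; split; [exact: hA | exact: h3].
have [A [[hA hA2] [_ h3]]] := hy e he; apply: hA2; exists (i :: nil) => x hx.
by exists i; split; [left | apply: h; [exact: hA | exact: h3]].
Qed.

Lemma list_nm_bound X (l : list X) : exists p, 0 < p /\ forall a, In a l -> nm a <= p.
Proof.
elim: l => [|a l [p [hp h]]]; first by exists 1; split; [lra |].
exists (p + nm a); split; first by have := nm_ge0 a; lra.
by move=> b [<-|/h hb]; [lra | have := nm_ge0 a; lra].
Qed.

(* Hilden-type fixed-ball argument, stable under small perturbations of K. *)
Lemma hilden Y (K : bop Y) (S : bop Y -> Prop) : cpt K -> K <> vzero -> dens S ->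
  exists (l : list (bop Y)) eta r, 0 < eta /\ 0 < r /\ (forall t, In t l -> S t) /\
    forall K', nm (K' [-] K) <= eta ->
      forall n, exists U, W (fun a => exists t, In t l /\ a = t [o] K') n U /\ r <= nm U.
Proof.
move=> hK nz hS.
have [x0 hx0] : exists x0, K x0 <> vzero.
  by apply: NNPP => h; apply: nz; apply: blin_ext => x; apply: NNPP => hx; apply: h; exists x.
have px := nm_gt0 hx0; have pK := nm_ge0 K.
have nx0 : x0 <> vzero by move=> e; apply: hx0; rewrite e bl_0.
have px0 := nm_gt0 nx0.
(* On the ball of radius r0 about x0, K stays at distance at least |K x0|/2 from zero, so density
   yields finitely many t whose products t K send each point of the ball into the ball of half the
   radius. *)
pose r0 := nm (K x0) / (2 * (nm K + 1)).
have hr0 : 0 < r0 by divpos.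
have hr1 : nm K * r0 <= nm (K x0) / 2.
  have e : (nm K + 1) * r0 = nm (K x0) / 2 by rewrite /r0; field; lra.
  by rewrite -e; apply: Rmult_le_compat_r; lra.
have hr2 : r0 <= nm x0 / 2.
  have h := nm_ge K x0; apply: (Rmult_le_reg_l (nm K + 1)); first lra.
  have -> : (nm K + 1) * r0 = nm (K x0) / 2 by rewrite /r0; field; lra.
  by nra.
clearbody r0.
pose D := fun u => nm (u [-] x0) <= r0.
have DK u : D u -> nm (K x0) / 2 <= nm (K u).
  move=> hu; have h1 := bl_lip K u x0; have h2 := nm_rev (K x0) (K u); rewrite (nm_sym (K x0)) in h2.
  have h3 : nm K * nm (u [-] x0) <= nm K * r0 by apply: Rmult_le_compat_l.
  lra.
have Db u : D u -> nm u <= nm x0 + r0 by move=> hu; have := nm_rev u x0; rewrite /D in hu; lra.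
have [y hy|l [hl1 hl2]] := @TB_ball_cover _ _ K D {t | S t} (fun t u => nm (proj1_sig t (K u) [-] x0) <= r0/2) (nm x0 + r0) hK Db.
  have ny : y <> vzero.
    move=> e; have [u [h1 h2]] := hy (nm (K x0) / 4) ltac:(lra).
    by move: h2; rewrite e vopp_0 vadd_0; have := DK u h1; lra.
  have [t [ht1 ht2]] := hS y x0 (r0/4) ny ltac:(lra).
  have pt := nm_ge0 t.
  exists (exist _ t ht1), (r0 / (4 * (nm t + 1))); split; first by divpos.
  move=> u hu hd /=; have h1 := bl_lip t (K u) y.
  have h2 : nm t * nm (K u [-] y) <= r0/4.
    apply: Rle_trans (_ : (nm t + 1) * (r0 / (4 * (nm t + 1))) <= _); last by right; field; lra.
    by apply: Rmult_le_compat; [exact: nm_ge0 | exact: nm_ge0 | lra | ].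
  have := nm_tri3 (t (K u)) (t y) x0; lra.
have [p [hp hp2]] := list_nm_bound (map (fun t => proj1_sig t : BB Y Y) l).
(* Replacing K by K' moves t K u by at most r0/2, exactly the margin left by the half-radius
   ball. *)
pose eta := r0 / (2 * p * (nm x0 + r0)).
have pp : 0 < p * (nm x0 + r0) by apply: Rmult_lt_0_compat; lra.
have heta : 0 < eta by divpos.
exists (map (fun t => proj1_sig t) l), eta, ((nm x0 - r0) / nm x0).
split=> //; split; first by divpos.
split; first by move=> t /in_map_iff [[t' ht'] [<- _]].
move=> K' hK' n.
suff [U [h1 h2]] : exists U, W (fun a => exists t, In t (map (fun t => proj1_sig t) l) /\ a = t [o] K') n U /\ D (U x0).
  exists U; split=> //; apply: (Rmult_le_reg_r (nm x0)) => //.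
  have -> : (nm x0 - r0) / nm x0 * nm x0 = nm x0 - r0 by field; lra.
  have := nm_ge U x0; have := nm_rev x0 (U x0); rewrite nm_sym; move: h2; rewrite /D; lra.
elim: n => [|n [U [h1 h2]]].
  by exists bid; split; [exact: W0 | rewrite /D bidE vadd_opp nm_0; lra].
have [t [ht1 ht2]] := hl2 _ h2.
exists (proj1_sig t [o] K' [o] U); split.
  by apply: WS => //; exists (proj1_sig t); split=> //; apply: in_map.
have pt : nm (proj1_sig t : BB Y Y) <= p by apply: hp2; apply/in_map_iff; exists t.
rewrite /D !bcompE; set u := U x0 in h2 ht2 *.
have -> : (proj1_sig t) (K' u) [-] x0 = (proj1_sig t) ((K' [-] K) u) [+] ((proj1_sig t) (K u) [-] x0).
  by rewrite baddE boppE bl_add bl_opp; vec.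
apply: Rle_trans (vnorm_triangle _ _) _.
have i1 := nm_ge (proj1_sig t) ((K' [-] K) u).
have i2 : nm ((K' [-] K) u) <= eta * (nm x0 + r0).
  apply: Rle_trans (nm_ge _ _) _; apply: Rmult_le_compat => //; [exact: nm_ge0 | exact: nm_ge0 | exact: Db].
have i3 : nm (proj1_sig t : BB Y Y) * nm ((K' [-] K) u) <= p * (eta * (nm x0 + r0)).
  by apply: Rmult_le_compat => //; exact: nm_ge0.
have i4 : p * (eta * (nm x0 + r0)) = r0 / 2 by rewrite /eta; field; lra.
lra.
Qed.

Section Comb.
Variable X : CBanach.
Implicit Types P Q : bop X -> Prop.

(** The real index records the l1-weight of a linear combination, the quantity that multiplies joint
    growth in [cmb_J]. *)
Inductive cmb P : R -> bop X -> Prop :=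
| cmb1 T : P T -> cmb P 1 T
| cmb0 : cmb P 0 vzero
| cmbD c d a b : cmb P c a -> cmb P d b -> cmb P (c + d) (a [+] b)
| cmbZ k c a : cmb P c a -> cmb P (Cmod k * c) (k [*] a).

Definition wrd P T := exists n, W P (S n) T.
Definition alg P b := exists c, cmb (wrd P) c b.

Lemma cmb_ge0 P c b : cmb P c b -> 0 <= c.
Proof. by elim=> *; try lra; apply: Rmult_le_pos => //; exact: Cmod_ge0. Qed.

Lemma cmb_span P b : @span (BB X X) P b -> exists c, cmb P c b.
Proof.
elim=> [|a ha|a a' _ [c hc] _ [d hd]|k a _ [c hc]]; first by exists 0; exact: cmb0.
- by exists 1; exact: cmb1.
- by exists (c + d); exact: cmbD.
by exists (Cmod k * c); exact: cmbZ.
Qed.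

Lemma cmb_map P Q (f : bop X -> bop X) c d b : f vzero = vzero -> (forall a b, f (a [+] b) = f a [+] f b) ->
  (forall k a, f (k [*] a) = k [*] f a) -> (forall a, P a -> cmb Q d (f a)) -> cmb P c b -> cmb Q (c * d) (f b).
Proof.
move=> f0 fD fZ h; elim=> [T hT||c1 c2 a1 a2 _ h1 _ h2|k c1 a1 _ h1].
- by rewrite Rmult_1_l; exact: h.
- by rewrite f0 Rmult_0_l; exact: cmb0.
- by rewrite fD Rmult_plus_distr_r; exact: cmbD.
by rewrite fZ Rmult_assoc; exact: cmbZ.
Qed.

Lemma alg_sub P : @vsubspace (BB X X) (alg P).
Proof.
split; first by exists 0; exact: cmb0.
split; first by move=> a b [c hc] [d hd]; exists (c + d); exact: cmbD.
by move=> k a [c hc]; exists (Cmod k * c); exact: cmbZ.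
Qed.

Lemma alg1 P a : P a -> alg P a. Proof. by move=> h; exists 1; apply: cmb1; exists 0%nat; exact: W1. Qed.

Lemma alg_min P (M : bop X -> Prop) : @vsubspace (BB X X) M -> (forall a, P a -> M a) ->
  (forall a b, P a -> M b -> M (a [o] b)) -> forall b, alg P b -> M b.
Proof.
move=> [M0 [M1 M2]] h1 h2 b [c]; elim=> [T [n hT]|//|{}c d a {}b _ ha _ hb|k {}c a _ ha]; [|exact: M1|exact: M2].
elim: n T hT => [|n IH] T hT; inversion hT as [|a k T' ha hT']; subst.
  by inversion hT'; subst; rewrite compb1; exact: h1.
by apply: h2 => //; exact: IH.
Qed.

Lemma alg_mull P a b : P a -> alg P b -> alg P (a [o] b).
Proof.
move=> ha [c h]; elim: h => [T [n hT]||c1 c2 a1 a2 _ h1 _ h2|k c1 a1 _ h1].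
- by exists 1; apply: cmb1; exists (S n); exact: WS.
- by rewrite compb0; exists 0; exact: cmb0.
- by rewrite compbDr; have [_ [h _]] := alg_sub P; exact: h.
- by rewrite compbZr; have [_ [_ h]] := alg_sub P; exact: h.
Qed.

Lemma alg_comp P a b : alg P a -> alg P b -> alg P (a [o] b).
Proof.
move=> ha hb; move: a ha; apply: (@alg_min P (fun a => alg P (a [o] b))).
- have [h0 [h1 h2]] := alg_sub P; split; first by rewrite comp0b.
  split; first by move=> x y hx hy; rewrite compbDl; exact: h1.
  by move=> c x hx; rewrite compbZl; exact: h2.
- by move=> a ha; exact: alg_mull.
by move=> a c ha hc; rewrite -bcompA; exact: alg_mull.
Qed.

(** Expanding a product of combinations gives words in P whose coefficients have total weight at
    most c^n. Induction on the word of Q keeps an arbitrary prefix V in P, so the expansion is never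
    written out. *)
Lemma cmb_J P Q s c : 0 <= s -> 0 <= c -> J P s -> (forall b, Q b -> exists d, d <= c /\ cmb P d b) -> J Q (c * s).
Proof.
move=> hs hc [C hC] hQ.
have hC0 : 0 <= C by have := hC 0%nat bid (W0 _); rewrite pow_O; have := nm_ge0 (bid : BB X X); lra.
suff key : forall n T, W Q n T -> forall k V, W P k V -> nm (V [o] T) <= C * c ^ n * s ^ (k + n).
  exists C => n T hT; have := key n T hT 0%nat bid (W0 _); rewrite comp1b Rpow_mult_distr /=; lra.
move=> n T; elim=> [|b {}n {}T hb hT IH] k V hV.
  by rewrite compb1 Nat.add_0_r /= Rmult_1_r; exact: hC.
have [d [hd hd2]] := hQ b hb.
have D0 : 0 <= C * c ^ n by apply: Rmult_le_pos => //; exact: pow_le.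
have E0 : 0 <= C * c ^ n * s ^ (k + S n) by apply: Rmult_le_pos => //; exact: pow_le.
suff h : nm (V [o] (b [o] T)) <= d * (C * c ^ n * s ^ (k + S n)).
  have := Rmult_le_compat_r _ _ _ E0 hd; rewrite [c ^ S n]/=; lra.
elim: hd2 => [U hU|| d1 d2 a1 a2 _ h1 _ h2|q d1 a1 _ h1].
- have := IH _ _ (W_app hV (W1 hU)); rewrite bcompA Rmult_1_l.
  by have -> : (k + 1 + n = k + S n)%nat by lia.
- by rewrite comp0b compb0 nm_0; lra.
- rewrite compbDl compbDr; apply: Rle_trans (vnorm_triangle _ _) _; lra.
- rewrite compbZl compbZr vnorm_scal Rmult_assoc; apply: Rmult_le_compat_l => //; exact: Cmod_ge0.
Qed.

Lemma J_wrd P s : 0 <= s -> s <= 1 -> J P s -> J (wrd P) s.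
Proof.
move=> hs hs1 [C hC].
have hC0 : 0 <= C by have := hC 0%nat bid (W0 _); rewrite pow_O; have := nm_ge0 (bid : BB X X); lra.
exists C => n T hT.
have [m hm] : exists m, W P (n + m) T.
  elim: hT => [|a {}n {}T [k hk] _ [m hm]]; first by exists 0%nat; exact: W0.
  by exists (k + m)%nat; have -> : (S n + (k + m) = S k + (n + m))%nat by [lia]; exact: W_app.
apply: Rle_trans (hC _ _ hm) _; apply: Rmult_le_compat_l => //.
rewrite pow_add -{2}(Rmult_1_r (s ^ n)); apply: Rmult_le_compat_l; first exact: pow_le.
by apply: Rle_trans (_ : _ <= 1 ^ m) _; [apply: pow_incr | rewrite pow1; lra].
Qed.

(** Vanishing growth for finite subsets only: compactness arguments along chains handle finitely
    many operators at a time, and no uniformity over P is available. *)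
Definition J0f P := forall l : list (bop X), (forall a, In a l -> P a) -> J0 (fun a => In a l).

Lemma cmb_mono P Q c b : (forall a, P a -> Q a) -> cmb P c b -> cmb Q c b.
Proof.
move=> h; elim=> [T hT||c1 c2 a1 a2 _ h1 _ h2|k c1 a1 _ h1]; [apply: cmb1; exact: h | exact: cmb0 | exact: cmbD | exact: cmbZ].
Qed.

Lemma W_fin P n T : W P n T -> exists l, (forall a, In a l -> P a) /\ W (fun a => In a l) n T.
Proof.
elim=> [|a {}n {}T ha hT [l [h1 h2]]]; first by exists nil; split=> //; exact: W0.
exists (a :: l); split; first by move=> b [<-|/h1].
by apply: WS; [left | apply: W_mono h2 => b; right].
Qed.

Lemma cmb_fin P c b : cmb P c b -> exists l, (forall a, In a l -> P a) /\ cmb (fun a => In a l) c b.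
Proof.
elim=> [T hT||c1 c2 a1 a2 _ [l [h1 h2]] _ [l' [h3 h4]]|k c1 a1 _ [l [h1 h2]]].
- by exists (T :: nil); split; [move=> a [<-|[]] | apply: cmb1; left].
- by exists nil; split=> //; exact: cmb0.
- exists (l ++ l'); split; first by move=> a ha; case: (in_app_or _ _ _ ha); [exact: h1 | exact: h3].
  by apply: cmbD; [apply: cmb_mono h2 | apply: cmb_mono h4] => a ha; apply: in_or_app; [left | right].
by exists l; split=> //; exact: cmbZ.
Qed.

Lemma cmb_fin_list P (l : list (bop X)) c : (forall b, In b l -> exists d, d <= c /\ cmb P d b) ->
  exists k, (forall a, In a k -> P a) /\ forall b, In b l -> exists d, d <= c /\ cmb (fun a => In a k) d b.
Proof.
elim: l => [|b l IH] hl; first by exists nil.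
have [k [h1 h3]] := IH (fun a ha => hl a (or_intror ha)).
have [d [hd hd2]] := hl b (or_introl erefl); have [k' [h4 h5]] := cmb_fin hd2.
exists (k ++ k'); split; first by move=> a ha; case: (in_app_or _ _ _ ha); [exact: h1 | exact: h4].
move=> a [<-|/h3 [e [he1 he2]]].
  by exists d; split; [lra | apply: cmb_mono h5 => x hx; apply: in_or_app; right].
by exists e; split; [lra | apply: cmb_mono he2 => x hx; apply: in_or_app; left].
Qed.

Lemma alg_list P (l : list (bop X)) : (forall b, In b l -> alg P b) ->
  exists c, 0 <= c /\ forall b, In b l -> exists d, d <= c /\ cmb (wrd P) d b.
Proof.
elim: l => [|b l IH] hl; first by exists 0; split=> //; lra.
have [c [h2 h3]] := IH (fun a ha => hl a (or_intror ha)).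
have [d hd] := hl b (or_introl erefl); have d0 := cmb_ge0 hd.
exists (c + d); split; first lra.
move=> a [<-|/h3 [e [he1 he2]]]; first by exists d; split=> //; lra.
by exists e; split=> //; lra.
Qed.

Lemma J0f_cmb P (l : list (bop X)) c : J0f P -> 0 <= c -> (forall b, In b l -> exists d, d <= c /\ cmb P d b) -> J0 (fun a => In a l).
Proof.
move=> hP hc hl s hs; have [k [h1 h2]] := cmb_fin_list hl.
have p : 0 < s / (c + 1) by divpos.
have h3 := cmb_J (Rlt_le _ _ p) hc (hP k h1 _ p) h2.
apply: (J_le _ _ h3); first by apply: Rmult_le_pos; lra.
have -> : c * (s / (c + 1)) = s - s / (c + 1) by field; lra.
lra.
Qed.

Lemma J0f_wrd P : J0f P -> J0f (wrd P).
Proof.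
move=> hP l hl s hs.
have [k [h1 h2]] : exists k, (forall a, In a k -> P a) /\ forall b, In b l -> wrd (fun a => In a k) b.
  elim: l hl => [|b l IH] hl; first by exists nil.
  have [k [h1 h3]] := IH (fun a ha => hl a (or_intror ha)).
  have [n /W_fin [k' [h4 h5]]] := hl b (or_introl erefl).
  exists (k ++ k'); split; first by move=> a ha; case: (in_app_or _ _ _ ha); [exact: h1 | exact: h4].
  move=> a [<-|/h3 [m hm]]; [exists n; apply: W_mono h5 | exists m; apply: W_mono hm] => x hx; apply: in_or_app; [by right | by left].
have p : 0 < Rmin 1 s by apply: Rmin_pos; lra.
apply: (J_le (s := Rmin 1 s)); [lra | exact: Rmin_r |].
by apply: (J_mono h2); apply: J_wrd; [lra | exact: Rmin_l | exact: hP].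
Qed.

Lemma J0f_alg P : J0f P -> J0f (alg P).
Proof. by move=> hP l /alg_list [c [h1 h2]]; apply: (J0f_cmb (J0f_wrd hP) h1 h2). Qed.

Lemma J_pow P s n0 : 0 < s -> (1 <= n0)%nat -> (exists p, forall a, P a -> nm a <= p) ->
  (forall T, W P n0 T -> nm T <= s ^ n0) -> J P s.
Proof.
move=> hs hn [p0 hp0] h; pose p := Rabs p0 + s.
have hp a : P a -> nm a <= p by move=> /hp0; rewrite /p; have := RRle_abs p0; lra.
have ps : s <= p by rewrite /p; have := Rabs_pos p0; lra.
have Wp n T : W P n T -> nm T <= p ^ n.
  elim=> [|a k U ha _ IH]; first by rewrite pow_O; exact: nm_bid.
  apply: Rle_trans (nm_comp _ _) _; apply: Rmult_le_compat => //; try exact: nm_ge0; exact: hp.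
pose b := p / s.
have hb : 1 <= b by rewrite /b; apply: (Rmult_le_reg_r s) => //; rewrite Rmult_1_l; have -> : p / s * s = p by [field; lra].
exists (b ^ n0) => n; elim: (lt_wf n) => {}n _ IH T hT.
case: (Nat.lt_ge_cases n n0) => hlt.
  apply: Rle_trans (Wp _ _ hT) _; have -> : p = b * s by rewrite /b; field; lra.
  rewrite Rpow_mult_distr; apply: Rmult_le_compat_r; first by apply: pow_le; lra.
  by apply: Rle_pow => //; lia.
have e : (n = n0 + (n - n0))%nat by lia.
rewrite e in hT; have [A [B [hA [hB ->]]]] := W_split hT.
apply: Rle_trans (nm_comp _ _) _.
apply: Rle_trans (Rmult_le_compat _ _ _ _ (nm_ge0 _) (nm_ge0 _) (h _ hA) (IH _ _ _ hB)) _; first lia.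
by right; rewrite [in RHS]e pow_add; ring.
Qed.
End Comb.

Lemma TB_or (I : Type) X (P Q : I -> Prop) (f : I -> X) : TB P f -> TB Q f -> TB (fun i => P i \/ Q i) f.
Proof.
move=> hP hQ e he; have [N [c [h1 h2]]] := hP e he; have [N' [c' [h3 h4]]] := hQ e he.
pose pd i := boolp.pselect (P i).
exists (N + N')%nat, (fun i => if pd i then c i else (N + c' i)%nat); split.
  by move=> i [hi|hi]; case: (pd i) => h /=; [have := h1 i h | case: (h hi) | have := h1 i h | have := h3 i hi]; lia.
move=> i j hi hj; case: (pd i) => pi; case: (pd j) => pj /= e1.
- exact: h2.
- by have := h1 i pi; lia.
- by have := h1 j pj; lia.
by apply: h4; [case: hi | case: hj | lia].
Qed.

Lemma TB_list (I A : Type) X (P : A -> I -> Prop) (f : I -> X) (l : list A) :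
  (forall a, In a l -> TB (P a) f) -> TB (fun i => exists a, In a l /\ P a i) f.
Proof.
elim: l => [|a l IH] h.
  by move=> e he; exists 0%nat, (fun _ => 0%nat); split=> [i [a []]|i j [a []]].
apply: (TB_sub (P := fun i => P a i \/ exists b, In b l /\ P b i)).
  by move=> i [b [[<-|hb] hi]]; [left | right; exists b].
by apply: TB_or; [apply: h; left | apply: IH => b hb; apply: h; right].
Qed.

Lemma TB_pre (I I' : Type) X (P : I -> Prop) (P' : I' -> Prop) (f : I -> X) (f' : I' -> X) :
  (forall i', P' i' -> exists i, P i /\ f' i' = f i) -> TB P f -> TB P' f'.
Proof.
move=> h hf e he; have [N [c [h1 h2]]] := hf e he.
have [g hg] : exists g : I' -> option I, forall i', P' i' -> exists i, g i' = Some i /\ P i /\ f' i' = f i.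
  apply: (@choice_fun I' (fun _ => option I) (fun i' o => P' i' -> exists i, o = Some i /\ P i /\ f' i' = f i)) => i'.
  case: (classic (P' i')) => hi; last by exists None.
  by have [i hi'] := h i' hi; exists (Some i) => _; exists i.
exists N, (fun i' => match g i' with Some i => c i | None => 0%nat end); split.
  by move=> i' /hg [i [-> [hi _]]]; exact: h1.
by move=> i' j' /hg [i [-> [hi ->]]] /hg [j [-> [hj ->]]]; exact: h2.
Qed.

Lemma TB_extract (I : Type) X (P : I -> Prop) (f : I -> X) (u : nat -> I) : TB P f -> (forall n, P (u n)) ->
  exists phi : nat -> nat, (forall n, (phi n < phi (S n))%nat) /\ exists l, vconv (fun n => f (u (phi n))) l.
Proof.
move=> hf hu; apply: (@seq_extract X (fun n => f (u n))) => e he.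
have [N [c [h1 h2]]] := hf e he.
by exists 0%nat, N, (fun n => c (u n)); split=> *; [exact: h1 | exact: h2].
Qed.

Lemma pigeon (c : nat -> nat) N : (forall i, (i <= N)%nat -> (c i < N)%nat) -> exists i j, (i < j)%nat /\ (j <= N)%nat /\ c i = c j.
Proof.
move=> h; apply: NNPP => hn.
have inj i j : (i <= N)%nat -> (j <= N)%nat -> c i = c j -> i = j.
  move=> hi hj e; case: (Nat.lt_trichotomy i j) => [hij|[//|hij]]; case: hn; [by exists i, j | by exists j, i].
have nd : NoDup (map c (seq 0 (S N))).
  by apply: NoDup_map_NoDup_ForallPairs; [move=> i j /in_seq hi /in_seq hj; apply: inj; lia | exact: seq_NoDup].
have : List.incl (map c (seq 0 (S N))) (seq 0 N).
  by move=> _ /in_map_iff [i [<- /in_seq hi]]; apply/in_seq; have := h i; lia.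
by move=> /(NoDup_incl_length nd); rewrite length_map !length_seq; lia.
Qed.

Lemma nm_add4 X (a b c d : X) : nm (a [+] b [+] c [+] d) <= nm a + nm b + nm c + nm d.
Proof.
have := vnorm_triangle (a [+] b [+] c) d; have := vnorm_triangle (a [+] b) c; have := vnorm_triangle a b; lra.
Qed.

(** * Turovskii's theorem: finite lists of critical joint growth *)

Section Turovskii.
Variables (Y : CBanach) (l : list (bop Y)).
Let P := fun a => In a l.
Hypothesis lcpt : forall a, P a -> cpt a.

(** A word of length at least two is a R b with letters a, b and a bounded word R, so Vala's theorem
    applies to finitely many pairs. *)
Lemma words_TB C : (forall n T, W P n T -> nm T <= C) -> TB (fun T : BB Y Y => exists n, W P (S (S n)) T) (fun T => T).
Proof.
move=> hC.
pose Pab (ab : bop Y * bop Y) (T : BB Y Y) := exists R : BB Y Y, nm R <= C /\ T = ab.1 [o] R [o] ab.2.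
apply: (TB_sub (P := fun T => exists ab, In ab (list_prod l l) /\ Pab ab T)).
  move=> T [n hT]; inversion hT as [|a k R' ha hR']; subst.
  have e : S n = (n + 1)%nat by lia.
  rewrite e in hR'; have [R [b [hR [hb ->]]]] := W_split hR'.
  inversion hb as [|b' k b0 hb' hb0]; subst; inversion hb0; subst.
  exists (a, b'); split; first exact: in_prod.
  by exists R; split; [exact: hC hR | rewrite compb1 bcompA].
apply: TB_list => -[a b] /in_prod_iff [ha hb].
apply: (TB_pre _ (@vala _ a b C (lcpt ha) (lcpt hb))) => T [R [h1 h2]]; by exists R.
Qed.

Hypothesis lqn : forall n T, W P (S n) T -> qn T.
Hypothesis Hlow : forall t, 0 < t -> t < 1 -> ~ J P t.

Lemma W_cpt n T : W P (S n) T -> cpt T.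
Proof. by move=> h; inversion h as [|a k U ha hU]; subst; apply: cpt_compr; exact: lcpt. Qed.

Lemma bernoulli d m : 0 <= d <= 1 -> 1 - INR m * d <= (1 - d) ^ m.
Proof.
move=> hd; elim: m => [|m IH]; first by rewrite /=; lra.
rewrite S_INR [_ ^ S m]/=; have := Rmult_le_compat_l (1 - d) _ _ ltac:(lra) IH.
have := Rmult_le_pos _ _ (pos_INR m) (Rle_0_sqr d); rewrite /Rsqr; lra.
Qed.

(** If all words of length n had norm below 1/2 <= (1 - 1/(2n))^n, joint growth would be at most 1 -
    1/(2n), below the critical value 1. *)
Lemma long_words n : (1 <= n)%nat -> exists T, W P n T /\ 1/2 <= nm T.
Proof.
move=> hn; apply: NNPP => hno; pose s := 1 - 1 / (2 * INR n).
have hn' : 1 <= INR n by apply: (le_INR 1).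
have i1 : 0 < 1 / (2 * INR n) by divpos.
have i2 : 1 / (2 * INR n) <= 1/2.
  apply: (Rmult_le_reg_r (2 * INR n)); first lra.
  have -> : 1 / (2 * INR n) * (2 * INR n) = 1 by field; lra.
  lra.
apply: (@Hlow s); rewrite /s; try lra.
apply: (J_pow (n0 := n)) => //; first lra.
  by have [p [_ hp]] := list_nm_bound (l : list (BB Y Y)); exists p.
move=> T hT; have h : 1/2 <= s ^ n.
  have := bernoulli (d := 1 / (2 * INR n)) n ltac:(lra); have -> : INR n * (1 / (2 * INR n)) = 1/2 by field; lra.
  rewrite -/s; lra.
apply: Rnot_lt_le => hlt; apply: hno; exists T; split=> //; rewrite -/s in hlt; lra.
Qed.

(** Bounded words have limit points. Two close prefixes of one long word give words u, w with u
    close to u w; in the limit y = y z with z quasinilpotent, hence y = y z^n for all n and y = 0,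
    although |y| >= 1/(2C). *)
Lemma bounded_absurd C : (forall n T, W P n T -> nm T <= C) -> False.
Proof.
move=> hC.
have hC1 : 1/2 <= C by have [T [h1 h2]] := long_words (le_n 1); have := hC _ _ h1; lra.
have key k : exists p : BB Y Y * BB Y Y, (exists n, W P (S (S n)) p.1) /\ (exists n, W P (S (S n)) p.2) /\
    1 / (2 * C) <= nm p.1 /\ nm (p.1 [-] (p.1 : bop Y) [o] p.2) <= (1/2)^k.
  have [N [col [h1 h2]]] := words_TB hC (half_pow_gt0 k).
  (* Prefixes of lengths 2, 4, ..., 2N+2 number N+1, one more than the colours. Steps of two keep
     the prefixes and the connecting words D long enough for [words_TB]. *)
  have [T [hT hT2]] := @long_words (2 * N + 2) ltac:(lia).
  have pre i : (i <= N)%nat -> exists A, W P (2 * i + 2) A /\ exists B, W P (2 * N - 2 * i) B /\ T = A [o] B.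
    move=> hi; have e : (2 * N + 2 = (2 * i + 2) + (2 * N - 2 * i))%nat by lia.
    rewrite e in hT; have [A [B [hA [hB ->]]]] := W_split hT; by exists A; split=> //; exists B.
  have [A [B [hA hB]]] : exists (A B : nat -> bop Y), (forall i, (i <= N)%nat -> W P (2 * i + 2) (A i) /\ W P (2 * N - 2 * i) (B i) /\ T = A i [o] B i) /\
      forall i j, (i < j)%nat -> (j <= N)%nat -> exists n D, W P (S (S n)) D /\ A j = A i [o] D.
    clear pre h1 h2 hT2; elim: N T hT {col} => [|N IH] T hT.
      exists (fun _ => T), (fun _ => bid); split; last by move=> i j; lia.
      move=> i hi. have -> : i = 0%nat by lia.
      rewrite compb1; split=> //; split=> //.
      exact: W0.
    have e : (2 * S N + 2 = (2 * N + 2) + 2)%nat by lia.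
    rewrite e in hT; have [T' [D [hT' [hD ->]]]] := W_split hT.
    have [A [B [hA hB]]] := IH T' hT'.
    exists (fun i => if Nat.eqb i (S N) then T' [o] D else A i), (fun i => if Nat.eqb i (S N) then bid else B i [o] D); split.
      move=> i hi; case: Nat.eqb_spec => hiN.
        subst i; rewrite compb1; split; first by rewrite e; exact: W_app.
        by split=> //; have -> : (2 * S N - 2 * S N = 0)%nat by [lia]; exact: W0.
      have [k1 [k2 k3]] := hA i ltac:(lia); split=> //; split; last by rewrite bcompA -k3.
      by have -> : (2 * S N - 2 * i = (2 * N - 2 * i) + 2)%nat by [lia]; exact: W_app.
    move=> i j hij hj.
    case: (Nat.eqb_spec i (S N)) => hi; first lia.
    case: (Nat.eqb_spec j (S N)) => hjN; last by apply: hB; lia.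
    have [k1 [k2 k3]] := hA i ltac:(lia).
    exists (2 * N - 2 * i)%nat, (B i [o] D); split; last by rewrite bcompA -k3.
    by have -> : (S (S (2 * N - 2 * i)) = (2 * N - 2 * i) + 2)%nat by [lia]; exact: W_app.
  have Atwo i : (i <= N)%nat -> exists n, W P (S (S n)) (A i).
    by move=> hi; exists (2 * i)%nat; have [h _] := hA i hi; have -> : (S (S (2 * i)) = 2 * i + 2)%nat by lia.
  have [i [j [hij [hj hc]]]] := @pigeon (fun i => col (A i)) N (fun i hi => h1 _ (Atwo i hi)).
  have [n [D [hD eD]]] := hB i j hij hj.
  exists (A i, D); split; first by apply: Atwo; lia.
  split; first by exists n.
  split; last by rewrite /= -eD; apply: h2 => //; apply: Atwo; lia.
  have [k1 [k2 k3]] := hA i ltac:(lia); rewrite /=.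
  have := nm_comp (A i) (B i); rewrite -k3 => h3; have h4 := hC _ _ k2; have := nm_ge0 (A i) => h5.
  have h6 := Rmult_le_compat_l _ _ _ h5 h4.
  apply: (Rmult_le_reg_r (2 * C)); first lra.
  have -> : 1 / (2 * C) * (2 * C) = 1 by field; lra.
  by change (nm (T : BB Y Y)) with (vnorm (T : BB Y Y)) in hT2; lra.
have [p hp] := choice_fun key.
have TBw := words_TB hC.
have [phi [hphi [y hy]]] := TB_extract (u := fun n => (p n).1) TBw (fun n => (hp n).1).
have [psi [hpsi [z hz]]] := TB_extract (u := fun n => (p (phi n)).2) TBw (fun n => (hp (phi n)).2.1).
have ge1 := inc_ge hphi; have ge2 := inc_ge hpsi.
have hy' : vconv (fun n => (p (phi (psi n))).1) y := vconv_sub ge2 hy.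
have zq : qn z.
  apply: (@qn_conv _ (fun n => (p (phi (psi n))).2)) => // n.
    by have [_ [[k hk] _]] := hp (phi (psi n)); exact: W_cpt hk.
  by have [_ [[k hk] _]] := hp (phi (psi n)); exact: lqn hk.
have eyz : y = (y : bop Y) [o] z.
  apply: vsub_eq0; apply: nm_small0 => e he.
  have nz0 := nm_ge0 z; have ny0 := nm_ge0 y.
  have e1 : 0 < e / (4 * (1 + nm z)) by divpos.
  have e2 : 0 < e / (4 * (C + 1)) by divpos.
  have [N1 hN1] := hy' _ e1; have [N2 hN2] := hz _ e2; have [N3 hN3] := half_pow_small 1 (e := e/4) ltac:(lra).
  pose n := (N1 + N2 + N3)%nat.
  have i1 := hN1 n ltac:(rewrite /n; lia); have i2 := hN2 n ltac:(rewrite /n; lia).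
  have i3 := hN3 (phi (psi n)) ltac:(have := ge1 (psi n); have := ge2 n; rewrite /n; lia).
  have [[k1 hk1] [_ [_ i4]]] := hp (phi (psi n)); move: i1 i2 i3 i4 (hC _ _ hk1).
  move: (phi (psi n)) ((p (phi (psi n))).2) ((p (phi (psi n))).1) => m w u i1 i2 i3 i4 i5.
  have -> : y [-] (y : bop Y) [o] z = (y [-] u) [+] (u [-] (u : bop Y) [o] w) [+] ((u : bop Y) [o] (w [-] z)) [+] ((u [-] y) : bop Y) [o] z by bvec.
  have j1 := nm_comp (u : bop Y) (w [-] z); have j2 := nm_comp ((u [-] y) : bop Y) z.
  have j3 : nm (u : BB Y Y) * nm (w [-] z) <= C * (e / (4 * (C + 1))).
    by apply: Rmult_le_compat; [exact: nm_ge0 | exact: nm_ge0 | exact: i5 | exact: Rlt_le].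
  have j4 : nm (u [-] y) * nm z <= e / (4 * (1 + nm z)) * nm z by apply: Rmult_le_compat_r => //; exact: Rlt_le.
  have j5 : C * (e / (4 * (C + 1))) <= e/4.
    have -> : e/4 = (C + 1) * (e / (4 * (C + 1))) by field; lra.
    by apply: Rmult_le_compat_r; lra.
  have j6 : e / (4 * (1 + nm z)) * nm z <= e/4.
    have -> : e/4 = e / (4 * (1 + nm z)) * (1 + nm z) by field; lra.
    by apply: Rmult_le_compat_l; lra.
  have j7 : nm (y [-] u) <= e/4.
    rewrite nm_sym; apply: Rle_trans (Rlt_le _ _ i1) _.
    have -> : e/4 = e / (4 * (1 + nm z)) * (1 + nm z) by field; lra.
    by rewrite -{1}(Rmult_1_r (e / (4 * (1 + nm z)))); apply: Rmult_le_compat_l; lra.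
  apply: Rle_trans (nm_add4 _ _ _ _) _; lra.
have ylow : 1 / (2 * C) <= nm y.
  apply: Rnot_lt_le => hlt; have [N hN] := hy' (1/(2*C) - nm y) ltac:(lra).
  have := hN N (le_n _); have [_ [_ [h _]]] := hp (phi (psi N)); have := nm_rev (p (phi (psi N))).1 y; lra.
have ypow n : y = (y : bop Y) [o] bpow z n.
  elim: n => [|n IH]; first by rewrite compb1.
  by rewrite bpow_S bcompA -IH.
have [D hD] := zq (1/2) ltac:(lra).
have c1 : 0 < 1 / (2 * C) by divpos.
have [n hn] := @half_pow_small (nm y * D) (1 / (2 * C)) c1.
have := hn n (le_n _); have := nm_comp (y : bop Y) (bpow z n); rewrite -ypow.
have := nm_mull y (hD n); lra.
Qed.
End Turovskii.

Lemma list_max (A : Type) (l : list A) (Q : A -> R -> Prop) : (forall a C C', Q a C -> C <= C' -> Q a C') ->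
  (forall a, In a l -> exists C, Q a C) -> exists C, forall a, In a l -> Q a C.
Proof.
move=> hm; elim: l => [|a l IH] h; first by exists 0.
have [C hC] := h a (or_introl erefl); have [|C' hC'] := IH; first by move=> b hb; apply: h; right.
exists (Rmax C C') => b [<-|hb]; [apply: hm hC _; exact: Rmax_l | apply: hm (hC' b hb) _; exact: Rmax_r].
Qed.

Lemma halve X Y (T : blin X Y) x : T x = RtoC 2 [*] T (RtoC (1/2) [*] x).
Proof. by rewrite bl_scal vscal_mul -RtoC_mul (_ : 2 * (1/2) = 1) ?vscal_1 //; field. Qed.

Section Unbounded.
Variables (Y : CBanach) (l : list (bop Y)).
Let P := fun a => In a l.
Hypothesis lcpt : forall a, P a -> cpt a.
Hypothesis lirr : irr P.
Hypothesis Hup : forall t, 1 < t -> J P t.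

(** The vectors with bounded orbit have an invariant closure, which is zero or everything. If zero,
    compactness doubles vectors within a fixed number of letters and the growth exceeds 1; if
    everything, images of the ball are uniformly near vectors of bounded orbit, which limits the
    norm of long words. *)
Lemma words_bounded : exists C, forall n T, W P n T -> nm T <= C.
Proof.
apply: NNPP => hunb.
pose Bdd C y := forall n T, W P n T -> nm (T y) <= C.
have BV : vsubspace (fun y => exists C, Bdd C y).
  split; first by exists 0 => n T _; rewrite bl_0 nm_0; lra.
  split.
    move=> x y [C hx] [D hy]; exists (C + D) => n T hT; rewrite bl_add.
    by have := vnorm_triangle (T x) (T y); have := hx n T hT; have := hy n T hT; lra.
  move=> c x [C hx]; exists (Cmod c * C) => n T hT; rewrite bl_scal vnorm_scal.
  by apply: Rmult_le_compat_l (hx n T hT); exact: Cmod_ge0.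
case: (lirr (Q := cl (fun y => exists C, Bdd C y))) => [|h0|hall].
- split; first exact: cl_closed.
  move=> a ha; apply: cl_inv => y [C hy]; exists C => n T hT; rewrite -bcompE.
  by apply: (hy (n + 1)%nat); apply: W_app => //; exact: W1.
(* No nonzero vector has a bounded orbit. By compactness of the letters, a bounded number of further
   letters takes every large enough image to norm at least 2; rescaling at the first such moment
   lets the doubling repeat. *)
- have hy y C : y <> vzero -> exists p : nat * bop Y, W P p.1 p.2 /\ C < nm (p.2 y).
    move=> ny; apply: NNPP => hn; apply: ny; apply: h0; apply: cl_incl; exists C => n T hT.
    by apply: Rnot_lt_le => hlt; apply: hn; exists (n, T).
  pose D a x := nm x <= 1 /\ 1 <= nm ((a : bop Y) x).
  have [L hL] : exists L, forall a, P a -> forall x, D a x -> exists n T, W P n T /\ INR n <= L /\ 2 <= nm (T (a x)).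
    apply: (@list_max _ l (fun a L => forall x, D a x -> exists n T, W P n T /\ INR n <= L /\ 2 <= nm (T (a x)))).
      move=> a C C' h hC x /h [n [T [h1 [h2 h3]]]]; exists n, T; split=> //; split=> //; lra.
    move=> a ha.
    have [||k [_ hk]] := @TB_ball_cover _ _ a (D a) {p : nat * bop Y | W P p.1 p.2}
         (fun p x => 2 <= nm ((proj1_sig p).2 (a x))) 1 (lcpt ha).
    + by move=> x [].
    + move=> y hlim; have ny : y <> vzero.
        move=> e; have [x [[_ h1] h2]] := hlim (1/2) ltac:(lra); rewrite e vopp_0 vadd_0 in h2; lra.
      have [[n T] [h1 h2]] := hy y 3 ny; rewrite /= in h1 h2; have pT := nm_ge0 T.
      exists (exist _ (n, T) h1), (1 / (nm T + 1)); split; first by divpos.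
      move=> x _ hx /=; have h3 := bl_lip T (a x) y.
      have h4 : nm T * nm (a x [-] y) <= 1.
        apply: Rle_trans (_ : (nm T + 1) * (1 / (nm T + 1)) <= _); last by right; field; lra.
        by apply: Rmult_le_compat; [done | exact: nm_ge0 | lra | ].
      have := nm_rev (T y) (T (a x)); rewrite (nm_sym (T y)); lra.
    have [L hL] := @list_max _ k (fun p L => INR (proj1_sig p).1 <= L) (fun p C C' h h' => Rle_trans _ _ _ h h')
       (fun p _ => ex_intro _ _ (Rle_refl _)).
    by exists L => x /hk [[[n T] h1] [h2 h3]]; exists n, T; split=> //; split=> //; exact: (hL _ h2).
  pose l0 := S (Z.to_nat (up L)).
  have hl0 n : INR n <= L -> (n <= l0)%nat.
    move=> h; have [h1 _] := archimed L; have h2 : (Z.of_nat n < up L)%Z.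
      by apply: lt_IZR; rewrite -INR_IZR_INZ; lra.
    rewrite /l0; lia.
  have first n T z : W P n T -> 2 <= nm (T z) -> nm z < 2 ->
      exists V j b x', (j <= n)%nat /\ W P j V /\ P b /\ D b x' /\ V z = RtoC 2 [*] b x'.
    elim=> [|a k U ha hU IH] h1 h2; first by rewrite bidE in h1; lra.
    case: (Rle_lt_dec 2 (nm (U z))) => h3.
      have [V [j [b [x' [k1 k2]]]]] := IH h3 h2; exists V, j, b, x'; split=> //; lia.
    have e := halve a (U z).
    exists (a [o] U), (S k), a, (RtoC (1/2) [*] U z); split; first lia.
    split; first exact: WS.
    split=> //.
    split; last by rewrite bcompE.
    split; first by rewrite nm_scalR; lra.
    by have := h1; rewrite bcompE e nm_scalR; lra.
  have step a x : P a -> D a x -> exists V j b x', (j <= l0)%nat /\ W P j V /\ P b /\ D b x' /\ V (a x) = RtoC 2 [*] b x'.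
    move=> ha hx; case: (Rlt_le_dec (nm (a x)) 2) => h.
      have [n [T [h1 [h2 h3]]]] := hL a ha x hx.
      have [V [j [b [x' [k1 k2]]]]] := first n T (a x) h1 h3 h.
      by exists V, j, b, x'; split=> //; have := hl0 n h2; lia.
    have e := halve a x.
    exists bid, 0%nat, a, (RtoC (1/2) [*] x); split; first lia.
    split; first exact: W0.
    split=> //; split; last by rewrite bidE.
    have [hx1 _] := hx; split; first by rewrite nm_scalR; lra.
    by move: h; rewrite e nm_scalR; lra.
  have grow2 k : forall a x, P a -> D a x -> exists n V, (n <= k * l0)%nat /\ W P n V /\ 2 ^ k <= nm (V (a x)).
    elim: k => [|k IH] a x ha hx.
      exists 0%nat, bid; split; first lia.
      by split; [exact: W0 | rewrite bidE pow_O; case: hx].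
    have [V [j [b [x' [h1 [h2 [h3 [h4 h5]]]]]]]] := step a x ha hx.
    have [n [U [h6 [h7 h8]]]] := IH b x' h3 h4.
    exists (n + j)%nat, (U [o] V); split; first by move: h1 h6; rewrite /=; lia.
    split; first exact: W_app.
    by rewrite bcompE h5 bl_scal nm_scalR /=; lra.
  have [a [x [ha hx]]] : exists a x, P a /\ D a x.
    apply: NNPP => hn; apply: hunb; exists 1 => n T.
    have h1 a : P a -> nm a <= 1.
      move=> ha; apply: Rnot_lt_le => hlt.
      suff : nm a <= 1 by lra.
      have [_ lub] := opn_lub a; apply: lub => r [x [hx ->]].
      by apply: Rnot_lt_le => hl; apply: hn; exists a, x; split=> //; split=> //; lra.
    elim=> [|a k U ha _ IH]; first exact: nm_bid.
    apply: Rle_trans (nm_comp _ _) _; have := h1 a ha; have := nm_ge0 a; have := nm_ge0 U; nra.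
  (* Then t^l0 <= 3/2 < 2, so rate t contradicts doubling within every l0 letters. *)
  pose t := 1 + 1 / (3 * INR l0).
  have hl1 : 1 <= INR l0 by apply: (le_INR 1); rewrite /l0; lia.
  have ht0 : 0 < 1 / (3 * INR l0) by divpos.
  have ht3 : 1 / (3 * INR l0) <= 1/3.
    apply: (Rmult_le_reg_r (3 * INR l0)); first lra.
    have -> : 1 / (3 * INR l0) * (3 * INR l0) = 1 by field; lra.
    lra.
  have htl : t ^ l0 <= 3/2.
    pose d := 1 / (3 * INR l0).
    have h1 := bernoulli (d := d) l0 ltac:(rewrite /d; lra); have e1 : INR l0 * d = 1/3 by rewrite /d; field; lra.
    have h2 : t ^ l0 * (1 - d) ^ l0 <= 1.
      rewrite -Rpow_mult_distr; apply: Rle_trans (_ : _ <= 1 ^ l0) _; last by rewrite pow1; lra.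
    apply: pow_incr.
      have -> : t * (1 - d) = 1 - d * d by rewrite /t -/d; ring.
      rewrite -/d in ht0 ht3; nra.
    have h3 : 0 < t ^ l0 by apply: pow_lt; rewrite /t; lra.
    nra.
  have [C hC] := Hup (t := t) ltac:(rewrite /t; lra).
  have [K hK] := @pow_ratio_small (Rabs C * nm (a x)) (3/2) 2 (1/2) ltac:(lra) ltac:(lra) ltac:(lra).
  have := hK K (le_n _); have [n [V [h1 [h2 h3]]]] := grow2 K a x ha hx.
  have h4 := nm_ge V (a x); have h5 := hC n V h2; have ax := nm_ge0 (a x).
  have h6 : t ^ n <= (3/2) ^ K.
    apply: Rle_trans (Rle_pow t _ _ ltac:(rewrite /t; lra) h1) _.
    rewrite Nat.mul_comm pow_mult; apply: pow_incr; split=> //; apply: pow_le; rewrite /t; lra.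
  have tn : 0 <= t ^ n by apply: pow_le; rewrite /t; lra.
  have h7 : C * t ^ n <= Rabs C * (3/2) ^ K.
    by apply: Rle_trans (Rmult_le_compat_r _ _ _ tn (RRle_abs C)) _; apply: Rmult_le_compat_l => //; exact: Rabs_pos.
  have h8 : nm V * nm (a x) <= Rabs C * (3/2)^K * nm (a x) by apply: Rmult_le_compat_r => //; lra.
  have := pow_lt 2 K ltac:(lra); lra.
(* Record words: unboundedness gives arbitrarily large words U a whose norm is not below that of U.
   Approximating a x within 1/4 by vectors of bounded orbit would give |U a| <= |U|/4 + C. *)
have hmin C : 1 <= C -> exists U a n, W P n U /\ P a /\ C <= nm (U [o] a) /\ nm U <= nm (U [o] a).
  move=> hC; apply: NNPP => hn; apply: hunb; exists C => n; elim: n => [|n IH] T hT.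
    by inversion hT; subst; have := nm_bid Y; lra.
  have e : S n = (n + 1)%nat by lia.
  rewrite e in hT; have [U [a0 [hU [ha ->]]]] := W_split hT.
  inversion ha as [|a k b0 ha' hb0]; subst; inversion hb0; subst; rewrite compb1.
  apply: Rnot_lt_le => hlt; apply: hn; exists U, a, n; split=> //; split=> //; split; first lra.
  by have := IH U hU; lra.
have [C hC] : exists C, forall a, P a -> forall x, nm x <= 1 -> exists b, Bdd C b /\ nm (a x [-] b) <= 1/4.
  apply: (@list_max _ l (fun a C => forall x, nm x <= 1 -> exists b, Bdd C b /\ nm (a x [-] b) <= 1/4)).
    move=> a C C' h hC x /h [b [h1 h2]]; exists b; split=> // n T /h1; lra.
  move=> a ha.
  have [||k [_ hk]] := @TB_ball_cover _ _ a (fun x => nm x <= 1) {b | exists C, Bdd C b}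
         (fun b x => nm (a x [-] proj1_sig b) <= 1/4) 1 (lcpt ha) => //.
    move=> y _; have [b [hb1 hb2]] := hall y (1/8) ltac:(lra).
    exists (exist _ b hb1), (1/8); split; first lra.
    by move=> x _ hx /=; have := nm_tri3 (a x) y b; lra.
  have [C hC] := @list_max _ k (fun b C => Bdd C (proj1_sig b)) (fun b C C' h h' n T hT => Rle_trans _ _ _ (h n T hT) h')
     (fun b _ => proj2_sig b).
  by exists C => x /hk [b [h1 h2]]; exists (proj1_sig b); split=> //; exact: hC.
have [U [a [n [hU [ha [h1 h2]]]]]] := hmin (1 + 2 * Rabs C) ltac:(have := Rabs_pos C; lra).
have pU := nm_ge0 U.
have h3 : nm (U [o] a) <= nm U / 4 + Rabs C.
  have [_ lub] := opn_lub (U [o] a); apply: lub => r [x [hx ->]]; rewrite bcompE.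
  have [b [k1 k2]] := hC a ha x hx.
  have := bl_lip U (a x) b; have := nm_mull U k2; have := nm_rev (U (a x)) (U b).
  by have := k1 n U hU; have := RRle_abs C; lra.
have := Rabs_pos C; lra.
Qed.
End Unbounded.

Section Scale.
Variables (Y : CBanach) (P : bop Y -> Prop) (r : R).
Hypothesis hr : 0 < r.
Let P' b := exists a, P a /\ b = RtoC (/ r) [*] a.

Lemma W_scale n T : W P' n T -> exists U, W P n U /\ T = RtoC ((/ r) ^ n) [*] U.
Proof.
elim=> [|b {}n {}T [a [ha ->]] _ [U [h1 ->]]]; first by exists bid; split; [exact: W0 | rewrite vscal_1].
exists (a [o] U); split; first exact: WS.
by rewrite compbZl compbZr vscal_mul -RtoC_mul.
Qed.

Lemma W_scale' n U : W P n U -> W P' n (RtoC ((/ r) ^ n) [*] U).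
Proof.
elim=> [|a {}n {}U ha _ IH]; first by rewrite /= vscal_1; exact: W0.
have -> : RtoC ((/ r) ^ S n) [*] (a [o] U) = (RtoC (/ r) [*] a) [o] (RtoC ((/ r) ^ n) [*] U).
  by rewrite compbZl compbZr vscal_mul -RtoC_mul.
by apply: WS => //; exists a.
Qed.

Lemma J_scale t : J P' t <-> J P (r * t).
Proof.
have hi n : 0 < (/ r) ^ n by apply: pow_lt; exact: Rinv_0_lt_compat.
have e n C : (/ r) ^ n * (C * (r * t) ^ n) = C * t ^ n.
  have -> : (/ r) ^ n * (C * (r * t) ^ n) = C * ((/ r) ^ n * (r * t) ^ n) by ring.
  by rewrite -Rpow_mult_distr; congr (_ * _ ^ _); field; lra.
split=> -[C hC]; exists C => n T hT.
  apply: (Rmult_le_reg_l _ _ _ (hi n)); rewrite e -nm_scalR; last exact: Rlt_le.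
  by apply: hC; exact: W_scale'.
have [U [h1 ->]] := W_scale hT; rewrite nm_scalR; last exact: Rlt_le.
by rewrite -e; apply: Rmult_le_compat_l (hC n U h1); exact: Rlt_le.
Qed.
End Scale.

Lemma qn_scal Y (T : bop Y) c : qn T -> qn (c [*] T).
Proof.
move=> h s hs; have c0 := Cmod_ge0 c.
have [C hC] := h (s / (Cmod c + 1)) ltac:(divpos).
exists (Rabs C) => n; have [d [-> hd]] := bpow_scal c T n; rewrite vnorm_scal hd.
have p1 : 0 <= s / (Cmod c + 1) by apply: Rlt_le; divpos.
have p2 : Cmod c * (s / (Cmod c + 1)) <= s.
  have -> : s = (Cmod c + 1) * (s / (Cmod c + 1)) by field; lra.
  by rewrite -{1}(_ : s = (Cmod c + 1) * (s / (Cmod c + 1))); [nra | field; lra].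
have h1 : nm (bpow T n) <= Rabs C * (s / (Cmod c + 1)) ^ n.
  apply: Rle_trans (hC n) _; apply: Rmult_le_compat_r; [exact: pow_le | exact: RRle_abs].
apply: Rle_trans (Rmult_le_compat_l _ _ _ (pow_le _ n c0) h1) _.
have -> : Cmod c ^ n * (Rabs C * (s / (Cmod c + 1)) ^ n) = Rabs C * (Cmod c * (s / (Cmod c + 1))) ^ n.
  by rewrite Rpow_mult_distr; ring.
apply: Rmult_le_compat_l; first exact: Rabs_pos.
by apply: pow_incr; split=> //; apply: Rmult_le_pos.
Qed.

Lemma crit_radius Y (P : bop Y -> Prop) s0 : 0 < s0 -> ~ J P s0 -> (exists p, forall a, P a -> nm a <= p) ->
  exists r, 0 < r /\ (forall t, r < t -> J P t) /\ forall t, 0 < t -> t < r -> ~ J P t.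
Proof.
move=> hs0 hn [p hp].
pose E s := 0 < s /\ ~ J P s.
have hb : bound E.
  exists (Rabs p + 1) => s [h1 h2]; apply: Rnot_lt_le => hlt; apply: h2.
  exists 1 => n T; rewrite Rmult_1_l; elim=> [|a k U ha _ IH]; first by rewrite pow_O; exact: nm_bid.
  apply: Rle_trans (nm_comp _ _) _; apply: Rmult_le_compat => //; try exact: nm_ge0.
  by have := hp a ha; have := RRle_abs p; lra.
have [r [hr1 hr2]] := completeness E hb (ex_intro _ s0 (conj hs0 hn)).
have rpos : 0 < r by have := hr1 s0 (conj hs0 hn); lra.
exists r; split=> //; split.
  by move=> t ht; apply: NNPP => h; have := hr1 t (conj (Rlt_trans _ _ _ rpos ht) h); lra.
move=> t ht hlt hJ.
have : r <= t.
  apply: hr2 => s [h1 h2]; apply: Rnot_lt_le => hs; apply: h2; apply: (J_le _ _ hJ); lra.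
lra.
Qed.

(** If growth did not vanish, dividing by the critical radius would make it exactly 1; then
    [words_bounded] and [bounded_absurd] collide. *)
Lemma turovskii_irr Y (l : list (bop Y)) : (forall a, In a l -> cpt a) -> irr (fun a => In a l) ->
  (forall n T, W (fun a => In a l) (S n) T -> qn T) -> J0 (fun a => In a l).
Proof.
move=> hc hi hq s0 hs0; apply: NNPP => hn.
have [|r [hr [h1 h2]]] := crit_radius hs0 hn.
  by have [p [_ hp]] := list_nm_bound (l : list (BB Y Y)); exists p.
pose l' := map (fun a : BB Y Y => RtoC (/ r) [*] a) l.
have el : (fun b => In b l') = fun b => exists a, In a l /\ b = RtoC (/ r) [*] a.
  apply/boolp.predeqP => b; split.
    by move=> /in_map_iff [a [<- ha]]; exists a.
  by move=> [a [ha ->]]; apply: (in_map (fun a : BB Y Y => RtoC (/ r) [*] a)).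
have ir : / r <> 0 by apply: Rinv_neq_0_compat; lra.
have nz : RtoC (/ r) <> C0 by exact: RtoC_neq0.
have hc' a : In a l' -> cpt a by move=> /in_map_iff [b [<- /hc hb]]; exact: cpt_scal.
have hJ t : J (fun a => In a l') t <-> J (fun a => In a l) (r * t) by rewrite el; exact: J_scale.
have [C hC] : exists C, forall n T, W (fun a => In a l') n T -> nm T <= C.
  apply: words_bounded => //; last by move=> t ht; apply/hJ; apply: h1; nra.
  move=> Q [hQ1 hQ2]; apply: hi; split=> // a ha x hx.
  have -> : a x = Cinv (RtoC (/ r)) [*] ((RtoC (/ r) [*] (a : BB Y Y)) : bop Y) x by rewrite bscalE; vec.
  apply: vsub_scal; first exact: csub_sub.
  by apply: hQ2 => //; apply: (in_map (fun a : BB Y Y => RtoC (/ r) [*] a)).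
apply: (bounded_absurd hc' _ _ hC).
  move=> n T; rewrite el => /(W_scale (r := r)) [U [hU ->]]; apply: qn_scal; exact: hq hU.
move=> t ht ht1 /hJ; apply: h2; nra.
Qed.

Lemma qn_le X Y (T : bop X) (U : bop Y) : (forall n, nm (bpow U n) <= nm (bpow T n)) -> qn T -> qn U.
Proof. by move=> h hT s /hT [C hC]; exists C => n; apply: Rle_trans (h n) (hC n). Qed.

Section GapList.
Variables (X : CBanach) (N M : X -> Prop) (Y : CBanach) (gp : X -> Y) (P : bop X -> Prop).
Hypothesis G : gapspec N M gp.
Hypothesis iN : Inv P N.
Hypothesis iM : Inv P M.

Lemma gop_bpow (T : bop X) (U : bop Y) n : (forall x, M x -> M (T x)) -> gop M gp T U -> gop M gp (bpow T n) (bpow U n).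
Proof.
move=> hM h; elim: n => [|n IH]; first exact: gop_id.
apply: (gop_comp _ h IH); clear IH; elim: n => [//|n IH] x hx; exact: (hM _ (IH x hx)).
Qed.

Lemma gop_qn (T : bop X) (U : bop Y) : (forall x, M x -> M (T x)) -> (forall x, N x -> N (T x)) ->
  gop M gp T U -> qn T -> qn U.
Proof.
move=> hM hN h; apply: qn_le => n; apply: (gop_nm G) (gop_bpow n hM h).
  by elim: n => [//|n IH] x hx; exact: (hM _ (IH x hx)).
by elim: n => [//|n IH] x hx; exact: (hN _ (IH x hx)).
Qed.

Lemma ind_list (l : list (bop X)) : (forall a, In a l -> P a) -> exists l' : list (bop Y),
  forall U, In U l' <-> ind M gp (fun a => In a l) U.
Proof.
elim: l => [|a l IH] hl.
  by exists nil => U; split=> // -[a []].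
have [l' hl'] := IH (fun b hb => hl b (or_intror hb)).
have ha := hl a (or_introl erefl).
have [U0 [h0 _]] := g_op G (iM.2 a ha) (iN.2 a ha).
exists (U0 :: l') => U; split.
  move=> [<-|/hl' [b [hb gb]]]; [by exists a; split=> //; left | by exists b; split=> //; right].
move=> [b [[<-|hb] gb]]; [left; exact: (gop_uniq G h0 gb) | by right; apply/hl'; exists b].
Qed.
End GapList.

Theorem turovskii X (l : list (bop X)) : (forall a, In a l -> cpt a) ->
  (forall n T, W (fun a => In a l) (S n) T -> qn T) -> J0 (fun a => In a l).
Proof.
move=> hc hq s hs.
apply: (@gap_reduction X (fun a => In a l) l (s/2) s); [lra | lra | by move=> a ha; split=> //; exact: hc |].
move=> N M Y gp G iN iM _ hirr.
have [l' hl'] := ind_list G iN iM (l := l) (fun a ha => ha).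
have e : (fun U => In U l') = ind M gp (fun a => In a l).
  by apply/boolp.predeqP => U.
rewrite -e in hirr *; apply: turovskii_irr; last lra.
- by move=> U /hl' [a [ha ga]]; apply: (gop_cpt G (iM.2 a ha) (iN.2 a ha) ga); exact: hc.
- exact: hirr.
move=> n U; rewrite e => /(ind_W' (proj2 iM)) [T [hT gT]].
apply: (gop_qn G _ _ gT (hq _ _ hT)); [exact: (W_inv (proj2 iM) hT) | exact: (W_inv (proj2 iN) hT)].
Qed.

(** * Algebras of quasinilpotents and their normalizers *)

Lemma span_mono X (P Q : X -> Prop) x : (forall y, P y -> Q y) -> span P x -> span Q x.
Proof. by move=> h; apply: span_min => [|y hy]; [exact: span_sub | apply: span1; exact: h]. Qed.

(** The first vector with a nonzero coefficient at x eliminates x from the later ones. Order is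
    preserved, so the dependence found concerns earlier vectors only. *)
Lemma steinitz X (l : list X) (v : nat -> X) :
  (forall i, (i <= length l)%nat -> span (fun z => In z l) (v i)) ->
  exists j, (j <= length l)%nat /\ span (fun z => exists i, (i < j)%nat /\ z = v i) (v j).
Proof.
elim: l v => [|x l IH] v hv.
  exists 0%nat; split=> //; have h := hv 0%nat (le_n _).
  have -> : v 0%nat = vzero by elim: h => [|y []|y z _ -> _ ->|c y _ ->] //; vec.
  exact: span0.
rewrite [length _]/= in hv *.
have [c hc] : exists c : nat -> Cplx, forall i, (i <= S (length l))%nat -> span (fun z => In z l) (v i [-] c i [*] x).
  apply: (@choice_fun nat (fun _ => Cplx) (fun i c => (i <= S (length l))%nat -> span (fun z => In z l) (v i [-] c [*] x))) => i.
  case: (classic (i <= S (length l))%nat) => hi; last by exists C0.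
  have [c [m [hm e]]] := proj1 (span_cons x l (v i)) (hv i hi); exists c => _.
  by have -> : v i [-] c [*] x = m by [rewrite e; vec].
case: (classic (exists p, (p <= length l)%nat /\ c p <> C0)) => [hp|hno]; last first.
  have [j [h1 h2]] : exists j, (j <= length l)%nat /\ span (fun z => exists i, (i < j)%nat /\ z = v i) (v j).
    apply: IH => i hi; have := hc i ltac:(lia).
    have -> : c i = C0 by apply: NNPP => n; apply: hno; exists i.
    by have -> : v i [-] C0 [*] x = v i by vec.
  by exists j; split=> //; lia.
have [p [[hp1 hp2] hpm]] := dec_inh_nat_subset_has_unique_least_element _ (fun n => classic _) hp.
have [hpl hpn] := hp1.
have cz i : (i < p)%nat -> c i = C0.
  move=> hi; apply: NNPP => n; have hil : (i <= length l)%nat by lia.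
  by have := hp2 i (conj hil n); lia.
pose u i := if Nat.ltb i p then v i else v (S i) [-] (c (S i) / c p)%C [*] v p.
have [j [hj hs]] : exists j, (j <= length l)%nat /\ span (fun z => exists i, (i < j)%nat /\ z = u i) (u j).
  apply: IH => i hi; rewrite /u; case: Nat.ltb_spec => h.
    by have := hc i ltac:(lia); rewrite cz //; have -> : v i [-] C0 [*] x = v i by vec.
  have h1 := hc (S i) ltac:(lia); have h2 := hc p ltac:(lia).
  have -> : v (S i) [-] (c (S i) / c p)%C [*] v p = (v (S i) [-] c (S i) [*] x) [-] (c (S i) / c p)%C [*] (v p [-] c p [*] x).
    by move: (c (S i)) (c p) hpn => a b nb; vec.
  apply: vsub_sub => //; first exact: span_sub.
  by apply: vsub_scal => //; exact: span_sub.
case: (Nat.lt_ge_cases j p) => hjp.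
  exists j; split; first lia.
  move: hs; have -> : u j = v j by rewrite /u; case: Nat.ltb_spec => //; lia.
  apply: span_mono => z [i [hi ->]]; exists i; split=> //.
  by rewrite /u; case: Nat.ltb_spec => //; lia.
exists (S j); split; first lia.
have vp : span (fun z => exists i, (i < S j)%nat /\ z = v i) (v p) by apply: span1; exists p; split=> //; lia.
have SV := span_sub (fun z => exists i, (i < S j)%nat /\ z = v i).
have -> : v (S j) = u j [+] (c (S j) / c p)%C [*] v p.
  by rewrite /u; case: Nat.ltb_spec => h; [lia | move: (c (S j) / c p)%C => a; vec].
apply: vsub_add => //; last by apply: vsub_scal.
apply: span_min hs => // z [i [hi ->]]; rewrite /u; case: Nat.ltb_spec => h.
  by apply: span1; exists i; split=> //; lia.
apply: vsub_sub => //; last by apply: vsub_scal.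
by apply: span1; exists (S i); split=> //; lia.
Qed.

Lemma J0f_qn X (P : bop X -> Prop) a : J0f P -> P a -> qn a.
Proof.
move=> hP ha s hs; apply/J_single.
by apply: (J_mono _ (hP (a :: nil) _ s hs)) => [b ->|b [<-|[]]]; [left |].
Qed.

(* Consecutive images under a family with vanishing joint growth are independent, hence few in finite dimension. *)
Lemma no_long_chain X (P : bop X -> Prop) (l : list X) (v : nat -> X) : J0f P ->
  (forall i, (i <= length l)%nat -> span (fun z => In z l) (v i) /\ v i <> vzero) ->
  (forall i, (i < length l)%nat -> exists a, P a /\ v (S i) = a (v i)) -> False.
Proof.
move=> hP hv1 hv2.
pose n := length l.
have [j [hj hs]] := @steinitz _ l (fun i => v (n - i)%nat) (fun i hi => (hv1 (n - i)%nat (Nat.le_sub_l _ _)).1).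
have wr k m : (m + k <= n)%nat -> exists T, W P k T /\ v (m + k)%nat = T (v m).
  elim: k => [|k IH] hk; last have [T [h1 h2]] := IH ltac:(lia); first by exists bid; rewrite Nat.add_0_r; split=> //; exact: W0.
  have [a [ha e]] := hv2 (m + k)%nat (ltac:(rewrite -/n; lia)); exists (a [o] T); split; first exact: WS.
  by rewrite Nat.add_succ_r e h2.
have [A [hA e]] : exists A, alg P A /\ v (n - j)%nat = A (v (n - j)%nat).
  move: hs; set y := v (n - j)%nat; move: {1 2}y => z hs.
  have [s0 [s1 s2]] := alg_sub P.
  elim: hs => [|_ [i [hi ->]]|z1 z2 _ [A [h1 ->]] _ [B [h2 ->]]|c z1 _ [A [h1 ->]]].
  - by exists vzero.
  - rewrite -/n in hj; have [T [h1 h2]] := wr (j - i)%nat (n - j)%nat ltac:(lia); exists T; split.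
      by exists 1; apply: cmb1; exists (j - i - 1)%nat; have -> : S (j - i - 1) = (j - i)%nat by lia.
    by rewrite /y -h2; congr v; lia.
  - by exists (A [+] B); split=> //; exact: s1.
  by exists (c [*] A); split=> //; exact: s2.
have [_ nz] := hv1 (n - j)%nat (Nat.le_sub_l _ _); apply: nz.
apply: (qn_eig (k := C1)) (J0f_qn (J0f_alg hP) hA) _ C1_neq0.
by rewrite -e vscal_1.
Qed.

(** Otherwise each nonzero vector of M has a nonzero image under some member of P, and iterating
    yields a chain excluded by [no_long_chain]. *)
Lemma common_kernel X (P : bop X -> Prop) (M : X -> Prop) : J0f P -> fd M ->
  (forall a, P a -> forall x, M x -> M (a x)) -> (exists x, M x /\ x <> vzero) ->
  exists x, M x /\ x <> vzero /\ forall a, P a -> a x = vzero.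
Proof.
move=> hP [l hl] hM [x0 [hx0 nx0]]; apply: NNPP => hno.
have step x : M x -> x <> vzero -> exists a, P a /\ a x <> vzero.
  move=> hx nx; apply: NNPP => h; apply: hno; exists x; split=> //; split=> // a ha; apply: NNPP => h'; apply: h; by exists a.
have [v [hv1 hv2]] : exists v : nat -> X, (forall i, M (v i) /\ v i <> vzero) /\ forall i, exists a, P a /\ v (S i) = a (v i).
  have [f [f0 hf]] := @dep_choice {x | M x /\ x <> vzero} (fun _ x y => exists a, P a /\ proj1_sig y = a (proj1_sig x))
    (exist _ x0 (conj hx0 nx0)) (fun _ x => ltac:(idtac; have [a [h1 h2]] := step _ (proj2_sig x).1 (proj2_sig x).2;
       exists (exist _ (a (proj1_sig x)) (conj (hM a h1 _ (proj2_sig x).1) h2)); exists a; split; [exact: h1 | exact: erefl])).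
  exists (fun i => proj1_sig (f i)); split=> i; [exact: (proj2_sig (f i)) | exact: hf].
by apply: (no_long_chain hP (l := l) (v := v)) => i hi //; have [h1 h2] := hv1 i; split=> //; exact: hl.
Qed.

Definition valg X (A : bop X -> Prop) := @vsubspace (BB X X) A /\ (forall a b, A a -> A b -> A (a [o] b)) /\
  (forall a, A a -> cpt a /\ qn a).

Lemma valg_W X (A P : bop X -> Prop) n T : (forall a b, A a -> A b -> A (a [o] b)) -> (forall a, P a -> A a) ->
  W P (S n) T -> A T.
Proof.
move=> hA hP; elim: n T => [|n IH] T hT; inversion hT as [|a k U ha hU]; subst.
  by inversion hU; subst; rewrite compb1; exact: hP.
by apply: hA; [exact: hP | exact: IH].
Qed.

Lemma semi_J0f X (A : bop X -> Prop) : (forall a b, A a -> A b -> A (a [o] b)) ->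
  (forall a, A a -> cpt a /\ qn a) -> J0f A.
Proof.
move=> hA hq l hl; apply: turovskii; first by move=> a /hl /hq [].
by move=> n T /(valg_W hA hl) /hq [].
Qed.

Lemma valg_cl X (A : bop X -> Prop) : valg A -> valg (@cl (BB X X) A).
Proof.
move=> [h0 [h1 h2]]; split; first by apply: csub_sub; exact: cl_closed.
split; last first.
  move=> a /cl_seq [u [hu hc]]; split; first by apply: (cpt_conv (u := u)) => // n; case: (h2 _ (hu n)).
  by apply: (qn_conv (u := u)) => // n; case: (h2 _ (hu n)).
move=> a b ha hb.
have s1 x : A x -> @cl (BB X X) A (x [o] b).
  by move=> hx; apply: (@cl_inv (BB X X) (bL x) A) hb => y hy; exact: h1.
have [u [hu hc]] := cl_seq ha.
have HC := cl_closed (X := BB X X) h0; have [_ [_ [_ h]]] := HC.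
apply: (h (fun n => (u n : bop X) [o] b)); first by move=> n; exact: s1.
exact: (bl_conv (bR b) hc).
Qed.

(** Turovskii's theorem gives A vanishing growth on finite subsets. But the span of A is dense in
    the sense of [dens], being stable under the irreducible G on both sides, and a nonzero K in A
    would produce through [hilden] words in products t K of norm bounded below. *)
Lemma irr_no_semigroup X (G A : bop X -> Prop) : irr G -> (forall a b, A a -> A b -> A (a [o] b)) ->
  (forall a, A a -> cpt a /\ qn a) -> (forall g a, G g -> A a -> A (g [o] a)) -> (forall g a, G g -> A a -> A (a [o] g)) ->
  forall a, A a -> a = vzero.
Proof.
move=> hG h1 h2 h3 h4 K hK; apply: NNPP => nz.
have hS : dens (@span (BB X X) A).
  apply: (irr_dens hG); first exact: span_sub.
    by move=> g t hg; apply: (span_map (T := bL g)) => x hx; apply: span1; exact: h3.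
  move=> y ny; apply: NNPP => hno.
  have hz t : A t -> t y = vzero.
    by move=> ht; apply: NNPP => h; apply: hno; exists t; split=> //; exact: span1.
  case: (hG (fun y => forall t : {t | A t}, proj1_sig t y = vzero)).
  - split; first by apply: csub_inter => t; exact: csub_ker.
    by move=> g hg x hx [t ht]; exact: (hx (exist _ (t [o] g) (h4 _ _ hg ht))).
  - by move=> h; apply: ny; apply: h => -[t ht]; exact: hz.
  by move=> h; apply: nz; apply: blin_ext => x; exact: (h x (exist _ K hK)).
have [l [eta [r [he [hr [hl hw]]]]]] := hilden (h2 K hK).1 nz hS.
have hw0 := hw K ltac:(rewrite vadd_opp nm_0; lra).
pose l' := map (fun t : BB X X => t [o] K) l.
have [c [hc hc2]] : exists c, 0 <= c /\ forall b, In b l' -> exists d, d <= c /\ cmb A d b.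
  rewrite /l'; elim: l hl {hw hw0 l'} => [|t l IH] hl; first by exists 0; split=> //; lra.
  have [c [k1 k2]] := IH (fun a ha => hl a (or_intror ha)).
  have [d hd] := cmb_span (hl t (or_introl erefl)); have d0 := cmb_ge0 hd.
  exists (c + d); split; first lra.
  move=> b [<-|/k2 [e [he1 he2]]]; last by exists e; split=> //; lra.
  exists (d * 1); split; first lra.
  apply: (cmb_map (f := fun t => t [o] K)) hd => *; rewrite ?comp0b ?compbDl ?compbZl //.
  by apply: cmb1; exact: h1.
have [C hC] := J0f_cmb (semi_J0f h1 h2) hc hc2 (s := 1/2) ltac:(lra).
have [N hN] := half_pow_small C hr.
have [U [hU hU2]] := hw0 N.
have hU' : W (fun a => In a l') N U.
  by apply: W_mono hU => a [t [ht ->]]; apply: (in_map (fun t : BB X X => t [o] K)).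
by have := hC _ _ hU'; have := hN N (le_n _); lra.
Qed.

Definition adk X (K : bop X) : blin (BB X X) (BB X X) := bL K [-] bR K.

Lemma adkE X (K z : bop X) : adk K z = K [o] z [-] z [o] K.
Proof. by []. Qed.

(** Links conjugation to commutators: adm z = [K, z] h', and left and right multiplication commute,
    so the m-th powers differ by the factor h^m. Growth bounds thereby pass from [adm] to ad K at
    the price of |h|^m. *)
Lemma adm_adk X (K h' z : bop X) m : h' [o] (bid [+] K) = bid ->
  bpow (adm (bid [+] K) h') m z [o] bpow (bid [+] K) m = bpow (adk K) m z.
Proof.
move=> e; set h := bid [+] K in e *.
have hK : h [o] K = K [o] h by rewrite /h; bvec.
elim: m => [|m IH]; first by rewrite /= compb1.
rewrite -[bpow (adm h h') (S m)]/(adm h h' [o] bpow (adm h h') m) -[bpow (adk K) (S m)]/(adk K [o] bpow (adk K) m) !bcompE -IH.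
rewrite adkE -[bpow h (S m)]/(h [o] bpow h m) admE.
move: (bpow _ _ z) => w; have ec : K [o] bpow h m = bpow h m [o] K by apply: bpow_comm.
rewrite -(bcompA w) -ec; move: (bpow h m) => q.
have e1 : (h [o] w [o] h' [-] w) [o] h = h [o] w [-] w [o] h.
  by rewrite compbDl compbNl -(bcompA (h [o] w)) e compb1.
rewrite bcompA e1 /h; bvec.
Qed.

Lemma adk_nil X (K R : bop X) kap m a b (z : bop X) : R = shf K kap ->
  bpow R a [o] z = vzero -> z [o] bpow R b = vzero -> (a + b <= S m)%nat -> bpow (adk K) m z = vzero.
Proof.
move=> eR; elim: m a b z => [|m IH] a b z ha hb hab.
  case: a ha hab => [|a] ha hab; first by rewrite comp1b in ha.
  by have e0 : b = 0%nat by [lia]; rewrite e0 compb1 in hb.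
case: a ha hab => [|a] ha hab.
  by rewrite comp1b in ha; rewrite ha bl_0.
case: b hb hab => [|b] hb hab.
  by rewrite compb1 in hb; rewrite hb bl_0.
have -> : bpow (adk K) (S m) z = bpow (adk K) m (R [o] z) [-] bpow (adk K) m (z [o] R).
  rewrite bpow_S bcompE -bl_opp -bl_add; congr (bpow _ m _); rewrite adkE eR /shf; bvec.
rewrite (IH a (S b) (R [o] z)) ?(IH (S a) b (z [o] R)); try lia.
- vec.
- by rewrite bcompA ha comp0b.
- by rewrite -bcompA.
- by rewrite bcompA -bpow_S.
by rewrite -bcompA hb compb0.
Qed.

Lemma adk_pow_comm X (K f z : bop X) m : f [o] K = K [o] f ->
  f [o] bpow (adk K) m z = bpow (adk K) m (f [o] z) /\ bpow (adk K) m z [o] f = bpow (adk K) m (z [o] f).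
Proof.
move=> hf; elim: m => [//|m [IH1 IH2]].
rewrite -[bpow (adk K) (S m)]/(adk K [o] bpow (adk K) m) !bcompE -IH1 -IH2 !adkE.
by split; bexp; rewrite ?hf //; congr (_ [+] vopp _); rewrite -!bcompA ?hf.
Qed.

(* [z] maps the range of a Riesz projection e into ker e; slow growth under ad K is incompatible with the lower bound of
   K - kap on ker e. *)
Lemma offdiag X (K e z : bop X) kap k c0 D t : e [o] K = K [o] e ->
  (forall x, e x = vzero -> c0 * nm x <= nm (shf K kap x)) -> e [o] z = vzero -> z [o] bpow (shf K kap) k = vzero ->
  0 <= t -> t < c0 -> (forall m, nm (bpow (adk K) m z) <= D * t ^ m) -> z = vzero.
Proof.
move=> eK elb ez zk ht htc hD; apply: NNPP => nz; set R0 := shf K kap in elb zk.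
have eR : e [o] R0 = R0 [o] e by apply: shf_comm.
have RK : R0 [o] K = K [o] R0 by rewrite /R0 /shf; bvec.
have [j [hj1 hj2]] : exists j, z [o] bpow R0 j <> vzero /\ z [o] bpow R0 j [o] R0 = vzero.
  apply: NNPP => hno; have all j : z [o] bpow R0 j <> vzero.
    elim: j => [|j IH]; first by rewrite compb1.
    by rewrite bpow_S bcompA => h1; apply: hno; exists j.
  exact: (all k).
have adZ2 m : bpow (adk K) m (z [o] bpow R0 j) = bpow (adk K) m z [o] bpow R0 j.
  by rewrite (adk_pow_comm z m (esym (bpow_comm j (esym RK)))).2.
set Z' := z [o] bpow R0 j in hj1 hj2 adZ2.
have adZ m : bpow (adk K) m Z' = bpow R0 m [o] Z'.
  elim: m => [|m IH]; first by rewrite comp1b.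
  rewrite -[bpow (adk K) (S m)]/(adk K [o] bpow (adk K) m) bcompE IH adkE.
  have -> : K [o] (bpow R0 m [o] Z') [-] bpow R0 m [o] Z' [o] K = R0 [o] (bpow R0 m [o] Z') [-] bpow R0 m [o] (Z' [o] R0).
    by move: (bpow R0 m) => Q; rewrite /R0 /shf; bvec.
  by rewrite hj2 compb0 vopp_0 vadd_0 bcompA.
have [y hy] : exists y, Z' y <> vzero.
  by apply: NNPP => h1; apply: hj1; apply: blin_ext => y; apply: NNPP => h2; apply: h1; exists y.
have eZ : e [o] Z' = vzero by rewrite /Z' bcompA ez comp0b.
have low m : c0 ^ m * nm (Z' y) <= nm (bpow R0 m (Z' y)) /\ e (bpow R0 m (Z' y)) = vzero.
  elim: m => [|m [IH1 IH2]]; first by split; [rewrite pow_O bidE; lra | rewrite bidE -bcompE eZ].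
  rewrite -[bpow R0 (S m)]/(R0 [o] bpow R0 m) bcompE; split; last by rewrite -bcompE eR bcompE IH2 bl_0.
  by apply: Rle_trans (elb _ IH2); rewrite [c0 ^ S m]/= Rmult_assoc; apply: Rmult_le_compat_l; lra.
have py := nm_gt0 hy.
have up m : nm (bpow R0 m (Z' y)) <= D * nm (bpow R0 j) * nm y * t ^ m.
  rewrite -bcompE -adZ adZ2; apply: Rle_trans (nm_ge _ _) _.
  have i1 := nm_comp (bpow (adk K) m z) (bpow R0 j).
  have i2 := nm_mulr (bpow R0 j) (hD m).
  by apply: Rle_trans (nm_mulr y (Rle_trans _ _ _ i1 i2)) _; right; ring.
have [m hm] := @pow_ratio_small (D * nm (bpow R0 j) * nm y) t c0 (nm (Z' y) / 2) ht htc ltac:(lra).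
have := hm m (le_n _); have := up m; have := (low m).1; have := pow_lt c0 m ltac:(lra); nra.
Qed.

Section ConjQn.
Variables (X : CBanach) (K h' : bop X) (A : bop X -> Prop).
Let h := bid [+] K.
Hypothesis hK : cpt K.
Hypothesis hr : h [o] h' = bid.
Hypothesis hl : h' [o] h = bid.
Hypothesis Ac : @closed_vsubspace (BB X X) A.
Hypothesis Av : valg A.
Hypothesis An : forall a, A a -> A (h [o] a [o] h') /\ A (h' [o] a [o] h).
Hypothesis Ai : irr (fun t => A t \/ t = h \/ t = h').

Variables (kap : Cplx) (k : nat) (e : bop X) (c0 : R).
Hypothesis kz : kap <> C0.
Let R0 := shf K kap.
Hypothesis ee : e [o] e = e.
Hypothesis eK : e [o] K = K [o] e.
Hypothesis ek : bpow R0 k [o] e = vzero.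
Hypothesis hc0 : 0 < c0.
Hypothesis elb : forall x, e x = vzero -> c0 * nm x <= nm (R0 x).

Let eR : e [o] R0 = R0 [o] e. Proof. by apply: shf_comm. Qed.
Let eh : e [o] h = h [o] e. Proof. by rewrite /h compbDl compbDr eK; bvec. Qed.
Let eh' : e [o] h' = h' [o] e.
Proof. by rewrite -(comp1b (e [o] h')) -hl -(bcompA h') (bcompA h) -eh -!bcompA hr compb1. Qed.

(** In the splitting b = c + d, slow growth of c prevents it from leaving the range of e, by
    [offdiag]. The block e d e vanishes because d is approximated by high powers of [adm], which
    annihilate e z e by nilpotency. Membership c in A is the gain over e b e itself. *)
Lemma compress (b : bop X) : A b -> exists c, A c /\ c [o] e = e [o] b [o] e.
Proof.
move=> hb; have ph := nm_ge0 h.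
(* The radius is taken so that s |h| < c0: after the transfer to ad K the growth rate of c is still
   below the lower bound c0 of K - kap on ker e. *)
have [|s [s0 [s1 hs]]] := @adm_split X K h' A (c0 / (2 * (nm h + 1))) hK hr hl Ac (fun z hz => (An hz).1).
  by divpos.
have hs2 : s * nm h < c0.
  apply: Rle_lt_trans (_ : c0 / (2 * (nm h + 1)) * (nm h + 1) < _); first by apply: Rmult_le_compat; lra.
  by have -> : c0 / (2 * (nm h + 1)) * (nm h + 1) = c0 / 2 by [field; lra]; lra.
have [B [c [d [hc [hd [ebcd [gc gd]]]]]]] := hs b hb.
exists c; split=> //.
have e2 : e [o] d [o] e = vzero.
  apply: nm_small0 => ep hep; have pe := nm_ge0 e.
  have hep2 : 0 < ep / (nm e * nm e + 1) by apply: Rdiv_lt_0_compat => //; nra.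
  (* Exponent 2k+1 exceeds what ad K can survive on e z e, since (K - kap)^k vanishes on the range
     of e on either side. *)
  have [z [hz [_ hz2]]] := gd (S (k + k)) _ ltac:(lia) hep2; rewrite -/h in hz2.
  have ez : e [o] bpow (adm h h') (S (k + k)) z [o] e = vzero.
    have h1 : bpow (adm h h') (S (k + k)) z = bpow (adk K) (S (k + k)) z [o] bpow h' (S (k + k)).
      rewrite -(adm_adk (h' := h')) // -bcompA -bpow_comp; last by rewrite hr hl.
      rewrite hr; have -> : bpow bid (S (k + k)) = bid :> bop X by elim: (S (k + k)) => [//|n IH]; rewrite -[bpow _ (S n)]/(bid [o] bpow bid n) IH comp1b.
      by rewrite compb1.
    have eq1 := bpow_comm (S (k + k)) eh'.
    rewrite h1; move: (bpow h' _) eq1 => q eq1; rewrite bcompA -(bcompA (e [o] _)) -eq1 (bcompA (e [o] _)).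
    rewrite (adk_pow_comm _ _ eK).1 (adk_pow_comm _ _ eK).2.
    rewrite (adk_nil (K := K) (kap := kap) (R := R0) (a := k) (b := k)) ?comp0b //; last lia.
      by rewrite bcompA bcompA ek !comp0b.
    by rewrite -bcompA (shf_pow_comm kap k eK) ek compb0.
  have -> : e [o] d [o] e = e [o] (d [-] bpow (adm h h') (S (k + k)) z) [o] e.
    by rewrite compbDr compbDl compbNr compbNl ez; vec.
  apply: Rle_trans (nm_comp _ _) _; have h1 := nm_comp e (d [-] bpow (adm h h') (S (k + k)) z).
  have h2 := Rmult_le_compat_r _ _ _ pe h1; have h3 := Rmult_le_compat_l _ _ _ (Rmult_le_pos _ _ pe pe) hz2.
  have h4 : nm e * nm e * (ep / (nm e * nm e + 1)) <= ep.
    have -> : nm e * nm e * (ep / (nm e * nm e + 1)) = ep - ep / (nm e * nm e + 1) by field; nra.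
    lra.
  lra.
have e1 : (bid [-] e) [o] c [o] e = vzero.
  have fK : (bid [-] e) [o] K = K [o] (bid [-] e) by rewrite compbDl compbDr compbNl compbNr eK; bvec.
  apply: (offdiag (k := k) (D := nm (bid [-] e) * Rabs B * nm e) eK elb) hs2 _; last move=> m.
  - by rewrite !bcompA compbDr compbNr ee compb1 vadd_opp !comp0b.
  - by rewrite -bcompA (shf_pow_comm kap k eK) ek compb0.
  - by apply: Rmult_le_pos; lra.
  rewrite -(adk_pow_comm _ m eK).2 -(adk_pow_comm _ m fK).1 -(adm_adk (h' := h')) // -/h.
  have i1 := nm_comp ((bid [-] e) [o] (bpow (adm h h') m c [o] bpow h m)) e.
  have i2 := nm_comp (bid [-] e) (bpow (adm h h') m c [o] bpow h m).
  have i3 := nm_comp (bpow (adm h h') m c) (bpow h m).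
  have i4 := nm_bpow h m; have i5 := gc m; have sm : 0 <= s ^ m by apply: pow_le; lra.
  have i6 : nm (bpow (adm h h') m c) <= Rabs B * s ^ m by apply: Rle_trans i5 _; apply: Rmult_le_compat_r => //; exact: RRle_abs.
  have i7 : nm (bpow (adm h h') m c [o] bpow h m) <= Rabs B * s ^ m * nm h ^ m.
    by apply: Rle_trans i3 _; apply: Rmult_le_compat => //; exact: nm_ge0.
  have i8 := nm_mull (bid [-] e) i7.
  apply: Rle_trans i1 _; apply: Rle_trans (nm_mulr e (Rle_trans _ _ _ i2 i8)) _.
  by rewrite Rpow_mult_distr; right; ring.
have -> : c [o] e = e [o] c [o] e.
  by move: e1; rewrite compbDl comp1b compbNl compbDl compbNl => /vsub_eq0.
by rewrite ebcd compbDr compbDl e2 vadd_0.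
Qed.
End ConjQn.

(** The inverse g' is carried explicitly, and both conjugations must preserve A; this makes the
    relation symmetric and stable under products. *)
Definition nrm X (A : bop X -> Prop) (g g' : bop X) :=
  g [o] g' = bid /\ g' [o] g = bid /\ cpt (g [-] bid) /\ forall a, A a -> A (g [o] a [o] g') /\ A (g' [o] a [o] g).

Lemma nrm_cl X (A : bop X -> Prop) g g' : nrm A g g' -> nrm (@cl (BB X X) A) g g'.
Proof.
move=> [h1 [h2 [h3 h4]]]; do 3! split=> //.
move=> a ha; split.
  by apply: (@cl_inv (BB X X) (bR g' [o] bL g) A) ha => y /h4 [].
by apply: (@cl_inv (BB X X) (bR g [o] bL g') A) ha => y /h4 [].
Qed.

Lemma nrm_inv X (A : bop X -> Prop) g g' : nrm A g g' -> nrm A g' g.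
Proof.
move=> [h1 [h2 [h3 h4]]]; do 2! split=> //; split; last by move=> a /h4 [].
have -> : g' [-] bid = vopp (g' [o] (g [-] bid)) by rewrite compbDr h2; bvec.
by apply: cpt_opp; exact: cpt_compl.
Qed.

Lemma nrm_comp X (A : bop X -> Prop) g g' h h' : nrm A g g' -> nrm A h h' -> nrm A (g [o] h) (h' [o] g').
Proof.
move=> [h1 [h2 [h3 h4]]] [k1 [k2 [k3 k4]]].
split; first by rewrite bcompA -(bcompA g) k1 compb1.
split; first by rewrite bcompA -(bcompA h') h2 compb1.
split.
  have -> : g [o] h [-] bid = g [o] (h [-] bid) [+] (g [-] bid) by bvec.
  by apply: cpt_add => //; exact: cpt_compl.
move=> a ha; split.
  have -> : g [o] h [o] a [o] (h' [o] g') = g [o] (h [o] a [o] h') [o] g' by rewrite !bcompA.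
  by apply: (h4 _ _).1; apply: (k4 _ _).1.
have -> : h' [o] g' [o] a [o] (g [o] h) = h' [o] (g' [o] a [o] g) [o] h by rewrite !bcompA.
by apply: (k4 _ _).2; apply: (h4 _ _).2.
Qed.

(** Suppose g - 1 has a nonzero eigenvalue with Riesz projection e. On the finite-dimensional range
    of e the compressions of A have a common null vector v, by [compress] and [common_kernel]. The
    space spanned by the images of all such vectors is invariant and lies in ker e, hence is zero;
    then the joint kernel of A is invariant and nonzero, and A would vanish. *)
Theorem irr_unipotent X (A : bop X -> Prop) g g' : valg A -> nrm A g g' ->
  irr (fun t => A t \/ t = g \/ t = g') -> (exists a, A a /\ a <> vzero) -> qn (g [-] bid).
Proof.
move=> vA0 nA0 iA0 [a0 [ha0 na0]].
pose B := @cl (BB X X) A.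
have vA : valg B := valg_cl vA0.
have [hr [hl [hK hA]]] : nrm B g g' := nrm_cl nA0.
have AB t : A t -> B t by exact: cl_incl.
have Bc : @closed_vsubspace (BB X X) B by apply: cl_closed; case: vA0.
have iA : irr (fun t => B t \/ t = g \/ t = g').
  move=> Q [Qc Qi]; apply: iA0; split=> // t [ht|ht]; apply: Qi; [by left; exact: AB | by right].
set K := g [-] bid in hK *.
have eg : bid [+] K = g by rewrite /K; vec.
apply: spec_qn => // kap x kz hx; apply: NNPP => nx.
have [k [e [ee [eK [ek [ekx [c0 [hc0 elb]]]]]]]] := riesz_proj hK kz.
have comp b : B b -> exists c, B c /\ c [o] e = e [o] b [o] e.
  by apply: (@compress X K g' B _ _ _ _ _ kap k e c0); rewrite ?eg.
have eg1 : e [o] g = g [o] e by rewrite -eg compbDl compbDr eK; bvec.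
have eg2 : e [o] g' = g' [o] e.
  by rewrite -(comp1b (e [o] g')) -hl -(bcompA g') (bcompA g) -eg1 -!bcompA hr compb1.
have [BV [Bm Bq]] := vA.
(* Only elements c with c e = e c e are used. They satisfy (c e)^(n+1) = c^(n+1) e, so the products
   c e are quasinilpotent and form a semigroup to which Turovskii's theorem applies. *)
have [v [hv [nv kv]]] : exists v, e v = v /\ v <> vzero /\ forall t, (exists c, B c /\ c [o] e = e [o] c [o] e /\ t = c [o] e) -> t v = vzero.
  apply: common_kernel.
  - apply: semi_J0f.
      move=> _ _ [c [hc [ec ->]]] [d [hd [ed ->]]]; exists (c [o] d); split; first exact: Bm.
      have e1 : c [o] e [o] (d [o] e) = c [o] d [o] e by rewrite -bcompA (bcompA e) -ed bcompA.
      split; last exact: e1.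
      have e3 : e [o] (c [o] d [o] e) = c [o] d [o] e by rewrite -e1 bcompA (bcompA e c e) -ec.
      by rewrite -[RHS]bcompA e3.
    move=> _ [c [hc [ec ->]]]; split; first by apply: cpt_compr; case: (Bq c hc).
    have pw n : bpow (c [o] e) (S n) = bpow c (S n) [o] e.
      elim: n => [|n IH]; first by rewrite /= !compb1.
      rewrite -[bpow (c [o] e) (S (S n))]/(c [o] e [o] bpow (c [o] e) (S n)) IH -[bpow c (S (S n))]/(c [o] bpow c (S n)).
      have e2 : e [o] (bpow c (S n) [o] e) = bpow c (S n) [o] e.
        by rewrite -IH -[bpow _ (S n)]/(c [o] e [o] bpow (c [o] e) n) {1}ec -!bcompA (bcompA e e) ee !bcompA -ec.
      by rewrite -(bcompA c e) e2 bcompA.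
    move=> s hs; have [C hC] := (Bq c hc).2 s hs; exists (Rabs C * nm e + 1) => n.
    have sn : 0 < s ^ n by exact: pow_lt.
    case: n sn => [|n] sn.
      by rewrite pow_O; have := nm_bid X; have := Rmult_le_pos _ _ (Rabs_pos C) (nm_ge0 e); rewrite -[bpow _ 0]/bid; lra.
    rewrite pw; apply: Rle_trans (nm_comp _ _) _.
    have := nm_mulr e (hC (S n)).
    have := Rmult_le_compat_r _ _ _ (Rlt_le _ _ sn) (RRle_abs C) => i1 i2.
    have := nm_mulr e i1; lra.
  - apply: (@fd_cpt X e (fun x => e x = x)) => //; last exact: (nil_cpt hK kz ek).
    split; first exact: bl_0.
    by split; [move=> y z hy hz; rewrite bl_add hy hz | move=> c y hy; rewrite bl_scal hy].
  - by move=> _ [c [hc [ec ->]]] y hy; rewrite -bcompE bcompA -ec.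
  exists x; split=> //; apply: (ekx 1%nat); rewrite -[bpow _ _]/(shf K kap [o] bid) compb1 shfE hx; exact: vadd_opp.
have kb b : B b -> e (b v) = vzero.
  move=> hb; have [c [hc ec]] := comp b hb.
  have h1 : c [o] e = e [o] c [o] e by rewrite -bcompA ec !bcompA ee.
  have := kv (c [o] e) (ex_intro _ c (conj hc (conj h1 erefl))).
  by rewrite ec !bcompE hv.
(* Condition N is preserved by g and g', which commute with e and normalize [B]; this gives
   invariance of the span of [S0] under g as well as under A. *)
pose N v := e v = v /\ forall b, B b -> e (b v) = vzero.
have gN : forall w, N w -> N (g w) /\ N (g' w).
  move=> w [h1 h2]; split; split.
  - by rewrite -bcompE eg1 bcompE h1.
  - move=> b /hA [_ hb]; have h3 := h2 _ hb.
    have E : e [o] b [o] g = g [o] e [o] (g' [o] b [o] g) by rewrite -eg1 !bcompA -(bcompA e g) hr compb1.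
    by have := f_equal (fun t : bop X => t w) E; rewrite !bcompE => ->; rewrite !bcompE in h3; rewrite h3 bl_0.
  - by rewrite -bcompE eg2 bcompE h1.
  - move=> b /hA [hb _]; have h3 := h2 _ hb.
    have E : e [o] b [o] g' = g' [o] e [o] (g [o] b [o] g') by rewrite -eg2 !bcompA -(bcompA e g') hl compb1.
    by have := f_equal (fun t : bop X => t w) E; rewrite !bcompE => ->; rewrite !bcompE in h3; rewrite h3 bl_0.
pose S0 z := exists b w, B b /\ N w /\ z = b w.
have AN b : B b -> b v = vzero.
  case: (iA (cl (span S0))) => [|h|h hb].
  - split; first by apply: cl_closed; exact: span_sub.
    move=> t ht; apply: cl_inv; apply: span_map => _ [d [w [hd [hw ->]]]]; apply: span1.
    case: ht => [ht|[->|->]]; first by exists (t [o] d), w; split=> //; exact: Bm.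
      exists (g [o] d [o] g'), (g w); split; first by case: (hA d hd).
      by split; [case: (gN w hw) | rewrite -!bcompE -(bcompA (g [o] d)) hl compb1].
    exists (g' [o] d [o] g), (g' w); split; first by case: (hA d hd).
    by split; [case: (gN w hw) | rewrite -!bcompE -(bcompA (g' [o] d)) hr compb1].
  - by move=> hb; apply: h; apply: cl_incl; apply: span1; exists b, v; split=> //; split.
  case: nv; rewrite -hv; have := h v; apply: (cl_min (csub_ker e)).
  apply: span_min; first by apply: csub_sub; exact: csub_ker.
  by move=> _ [c [w [hc [[_ hw] ->]]]]; exact: hw.
case: (iA (fun y => forall b : {b | B b}, proj1_sig b y = vzero)).
- split; first by apply: csub_inter => b; exact: csub_ker.
  move=> t ht y hy [b hb] /=.
  have hy' c : B c -> c y = vzero by move=> hc; exact: (hy (exist _ c hc)).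
  case: ht => [ht|[->|->]]; first by rewrite -bcompE; apply: hy'; exact: Bm.
    have h1 := hy' _ (hA b hb).2; rewrite !bcompE in h1.
    by have := f_equal g h1; rewrite bl_0 -!bcompE hr comp1b.
  have h1 := hy' _ (hA b hb).1; rewrite !bcompE in h1.
  by have := f_equal g' h1; rewrite bl_0 -!bcompE hl comp1b.
- by move=> h; apply: nv; apply: h => -[b hb]; exact: AN.
by move=> h; apply: na0; apply: blin_ext => y; exact: (h y (exist _ a0 (AB _ ha0))).
Qed.

Lemma qn_comm X (S T : bop X) : S [o] T = T [o] S -> qn T -> qn (S [o] T).
Proof.
move=> hc hT s hs; have pS := nm_ge0 S; have ps : 0 < s / (nm S + 1) by divpos.
have [C hC] := hT _ ps; exists (Rabs C) => n; rewrite bpow_comp //.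
apply: Rle_trans (nm_comp _ _) _.
have h1 : nm (bpow S n) <= (nm S + 1) ^ n by apply: Rle_trans (nm_bpow _ _) _; apply: pow_incr; lra.
have h2 : nm (bpow T n) <= Rabs C * (s / (nm S + 1)) ^ n.
  by apply: Rle_trans (hC n) _; apply: Rmult_le_compat_r; [apply: pow_le; lra | exact: RRle_abs].
apply: Rle_trans (Rmult_le_compat _ _ _ _ (nm_ge0 _) (nm_ge0 _) h1 h2) _; right.
have -> : (nm S + 1) ^ n * (Rabs C * (s / (nm S + 1)) ^ n) = Rabs C * ((nm S + 1) ^ n * (s / (nm S + 1)) ^ n) by ring.
by rewrite -Rpow_mult_distr; congr (_ * _ ^ _); field; lra.
Qed.

Lemma qn_0 X : qn (vzero : bop X).
Proof.
move=> s hs; exists 1 => n; case: n => [|n]; first by rewrite pow_O Rmult_1_l; exact: nm_bid.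
rewrite -[bpow _ (S n)]/((vzero : bop X) [o] bpow vzero n) comp0b nm_0.
by have := pow_lt s (S n) hs; lra.
Qed.

Lemma gap_qn X (P : bop X -> Prop) (T : bop X) : cpt T -> P T ->
  (forall N M (Y : CBanach) (gp : X -> Y), gapspec N M gp -> Inv P N -> Inv P M -> (exists y : Y, y <> vzero) ->
     irr (ind M gp P) -> forall U, gop M gp T U -> qn U) -> qn T.
Proof.
move=> hT PT h s hs; apply/J_single.
have e : (fun a => a = T) = fun a => In a (T :: nil).
  by apply/boolp.predeqP => a; split=> [->|[->|[]]]; first by left.
rewrite e; apply: (@gap_reduction X P (T :: nil) (s/2) s); [lra | lra | by move=> a [<-|[]] |].
move=> N M Y gp G iN iM hne hi.
have [U [gU _]] := g_op G (iM.2 T PT) (iN.2 T PT).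
apply: (J_mono (Q := fun a => a = U)); last by apply/J_single; apply: (h N M Y gp G) => //; lra.
by move=> V [a [[<-|[]] ga]]; exact: (gop_uniq G ga gU).
Qed.

Section IndAlg.
Variables (X : CBanach) (N M : X -> Prop) (Y : CBanach) (gp : X -> Y) (P A : bop X -> Prop).
Hypothesis G : gapspec N M gp.
Hypothesis iN : Inv P N.
Hypothesis iM : Inv P M.
Hypothesis AP : forall a, A a -> P a.

Lemma ind_valg : valg A -> valg (ind M gp A).
Proof.
move=> [[A0 [A1 A2]] [Am Aq]].
have im a : A a -> forall x, M x -> M (a x) by move=> /AP; exact: (proj2 iM).
have jn a : A a -> forall x, N x -> N (a x) by move=> /AP; exact: (proj2 iN).
split; first split.
- exists vzero; split=> // x hx; rewrite !bzeroE; apply: esym; apply/(g_0 G); first by apply: vsub_0; exact: csub_sub iM.1.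
  by apply: vsub_0; exact: csub_sub iN.1.
- split.
    move=> U V [a [ha ga]] [b [hb gb]]; exists (a [+] b); split; first exact: A1.
    by apply: (gop_add G) => //; exact: im.
  by move=> c U [a [ha ga]]; exists (c [*] a); split; [exact: A2 | apply: (gop_scal G) => //; exact: im].
split.
  by move=> U V [a [ha ga]] [b [hb gb]]; exists (a [o] b); split; [exact: Am | apply: gop_comp => //; exact: im].
move=> U [a [ha ga]]; have [c q] := Aq a ha; split.
  exact: (gop_cpt G (im a ha) (jn a ha) ga c).
exact: (gop_qn G (im a ha) (jn a ha) ga q).
Qed.

Lemma ind_nrm g g' U U' : P g -> P g' -> gop M gp g U -> gop M gp g' U' -> nrm A g g' -> nrm (ind M gp A) U U'.
Proof.
move=> hg hg' gU gU' [h1 [h2 [h3 h4]]].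
have im a : P a -> forall x, M x -> M (a x) by exact: (proj2 iM).
have c1 := gop_comp (im _ hg') gU gU'; have c2 := gop_comp (im _ hg) gU' gU.
split; first by apply: (gop_uniq G c1); rewrite h1; exact: gop_id.
split; first by apply: (gop_uniq G c2); rewrite h2; exact: gop_id.
have VM := csub_sub iM.1; have VN := csub_sub iN.1.
split.
  have gd : gop M gp (g [-] bid) (U [-] bid).
    apply: (gop_add G) => //; [exact: im | by move=> x hx; rewrite boppE bidE; exact: vsub_opp |].
    by apply: (gop_opp G) => //; exact: gop_id.
  apply: (gop_cpt G _ _ gd h3) => x hx; rewrite baddE boppE bidE; apply: vsub_sub => //; [exact: im | exact: (iN.2 _ hg)].
move=> V [a [ha ga]]; have [k1 k2] := h4 a ha; split.
  exists (g [o] a [o] g'); split=> //; apply: gop_comp => //; first exact: im.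
  by apply: gop_comp => //; apply: im; exact: AP.
exists (g' [o] a [o] g); split=> //; apply: gop_comp => //; first exact: im.
by apply: gop_comp => //; apply: im; exact: AP.
Qed.
End IndAlg.

(** The alternating Neumann series converges since a is quasinilpotent, and its partial sums stay in
    A. Closedness puts the limit there too. *)
Lemma valg_inv X (A : bop X -> Prop) a : @closed_vsubspace (BB X X) A -> valg A -> A a ->
  exists b, A b /\ (bid [+] a) [o] (bid [+] b) = bid /\ (bid [+] b) [o] (bid [+] a) = bid.
Proof.
move=> Ac [[A0 [A1 A2]] [Am Aq]] ha.
pose u := fix u n : BB X X := match n with O => vzero | S n => vopp (a [o] (bid [+] u n)) end.
have uA n : A (u n).
  elim: n => [//|n IH]; rewrite -[u (S n)]/(vopp (a [o] (bid [+] u n))) vopp_scal; apply: A2.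
  by rewrite compbDr compb1; apply: A1 => //; exact: Am.
have [C hC] := (Aq a ha).2 (1/2) ltac:(lra).
have du n : nm (u (S n) [-] u n) = nm (bpow a (S n)).
  have -> : u (S n) [-] u n = ((- C1)%C [*] bid) [o] bpow (vopp a) n [o] a.
    elim: n => [|n IH].
      by rewrite -[u 1%nat]/(vopp (a [o] (bid [+] vzero))) -[u 0%nat]/(vzero : BB X X) /= vadd_0 compb1; bvec.
    have -> : u (S (S n)) [-] u (S n) = vopp (a [o] (u (S n) [-] u n)).
      by rewrite -[u (S (S n))]/(vopp (a [o] (bid [+] u (S n)))) -[u (S n) in X in _ [-] X]/(vopp (a [o] (bid [+] u n))); move: (u (S n)) (u n) => p q; bvec.
    rewrite IH -[bpow (vopp a) (S n)]/(vopp a [o] bpow (vopp a) n); move: (bpow _ n) => q; bvec.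
  have [d [e1 e2]] := bpow_scal (- C1)%C a n; rewrite vopp_scal e1.
  rewrite bpow_S; move: (bpow a n) => q.
  have -> : ((- C1)%C [*] bid) [o] (d [*] q) [o] a = ((- C1) * d)%C [*] (q [o] a) by bvec.
  by rewrite vnorm_scal Cmod_mul e2 !Cmod_opp Cmod_C1 pow1 !Rmult_1_l.
have [b [hb _]] := @geom_conv (BB X X) u (Rabs C) (fun n => ltac:(rewrite du; apply: Rle_trans (hC (S n)) _;
   have := pow_lt (1/2) n ltac:(lra); have := RRle_abs C; have := Rabs_pos C; rewrite /=; nra)).
have Ab : A b by have [_ [_ [_ h]]] := Ac; exact: (h u).
have e : b = vopp (a [o] (bid [+] b)).
  apply: (vconv_unique (u := fun n => u (n + 1)%nat)); first by apply: (vconv_sub (phi := fun n => (n + 1)%nat)) => // n; lia.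
  apply: (vconv_ext (u := fun n => vopp (a [o] (bid [+] u n)))); first by move=> n; rewrite Nat.add_1_r.
  apply: (vconv_lip (f := fun z : BB X X => vopp (a [o] (bid [+] z)) : BB X X) (C := nm a)) hb => x y.
  have -> : vopp (a [o] (bid [+] x)) [-] vopp (a [o] (bid [+] y)) = vopp (a [o] (x [-] y)) by bvec.
  by rewrite nm_opp; exact: nm_comp.
have r : (bid [+] a) [o] (bid [+] b) = bid.
  rewrite compbDl comp1b; have e' : b [+] a [o] (bid [+] b) = vzero.
    by move: (a [o] _) e => w ->; vec.
  by rewrite -vadd_assoc e' vadd_0.
exists b; split; first exact: Ab.
split; first exact: r.
have cu n : a [o] u n = u n [o] a.
  elim: n => [|n IH]; first by rewrite comp0b compb0.
  rewrite -[u (S n)]/(vopp (a [o] (bid [+] u n))) compbNr compbNl; congr vopp.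
  by rewrite -(bcompA a) compbDr compbDl -IH; bvec.
have cb : a [o] b = b [o] a.
  apply: (vconv_unique (u := fun n => a [o] u n)); first exact: (bl_conv (bL a) hb).
  by apply: (vconv_ext (u := fun n => u n [o] a)) => //; exact: (bl_conv (bR a) hb).
by apply: eq_trans _ r; bexp; rewrite cb; vec.
Qed.

Section Unip.
Variable X : CBanach.
Implicit Types (A : bop X -> Prop).

Lemma nrm_one_plus A a b : @closed_vsubspace (BB X X) A -> valg A -> A a -> A b ->
  (bid [+] a) [o] (bid [+] b) = bid -> (bid [+] b) [o] (bid [+] a) = bid -> nrm A (bid [+] a) (bid [+] b).
Proof.
move=> Ac [[A0 [A1 A2]] [Am Aq]] ha hb h1 h2; split=> //; split=> //; split.
  by have -> : bid [+] a [-] bid = a by [vec]; case: (Aq a ha).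
have cj p q c : A p -> A q -> A c -> A ((bid [+] p) [o] c [o] (bid [+] q)).
  move=> hp hq hc; have -> : (bid [+] p) [o] c [o] (bid [+] q) = c [+] p [o] c [+] (c [o] q [+] p [o] c [o] q) by bvec.
  have i1 := Am p c hp hc; have i2 := Am c q hc hq; have i3 := Am _ _ i1 hq.
  by apply: (A1); exact: A1.
by move=> c hc; split; exact: cj.
Qed.

End Unip.

(** Checked on irreducible gaps. Where A acts as zero only g remains; elsewhere g (1 + a) normalizes
    the induced algebra and [irr_unipotent] applies to it directly. *)
Theorem unipotent_mul X (A : bop X -> Prop) g g' a : valg A -> nrm A g g' -> qn (g [-] bid) -> A a -> qn (g [o] (bid [+] a) [-] bid).
Proof.
move=> vA nA gq ha; set T := _ [-] bid.
have [_ [_ [gc _]]] := nA; have [_ [Am Aq]] := vA.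
have Tc : cpt T.
  have -> : T = (g [-] bid) [+] g [o] a by rewrite /T; bvec.
  by apply: cpt_add => //; apply: cpt_compl; case: (Aq a ha).
apply: (@gap_qn X (fun t => A t \/ t = g \/ t = g' \/ t = T)) => //; first by right; right; right.
move=> N M Y gp G iN iM hne hi UT gT.
set P := fun t => _ in iN iM hi.
have AP t : A t -> P t by left.
have Pg : P g by right; left.
have Pg' : P g' by right; right; left.
have [U [gU _]] := g_op G (iM.2 g Pg) (iN.2 g Pg).
have [U' [gU' _]] := g_op G (iM.2 g' Pg') (iN.2 g' Pg').
have [Ua [ga _]] := g_op G (iM.2 a (AP a ha)) (iN.2 a (AP a ha)).
have VM := csub_sub iM.1; have VN := csub_sub iN.1.
have eT : UT = U [o] (bid [+] Ua) [-] bid.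
  apply: (gop_uniq G gT).
  have m1 x : M x -> M ((bid [+] a) x) by move=> hx; rewrite baddE bidE; apply: vsub_add => //; apply: iM.2 => //; exact: AP.
  have g1 : gop M gp (bid [+] a) (bid [+] Ua) by apply: (gop_add G) => //; apply: iM.2; exact: AP.
  apply: (gop_add G).
  - by move=> x hx; rewrite bcompE; apply: iM.2 => //; exact: m1.
  - by move=> x hx; rewrite boppE bidE; exact: vsub_opp.
  - exact: gop_comp.
  by apply: (gop_opp G) => //; exact: gop_id.
have vI := ind_valg G iN iM AP vA; have nI := ind_nrm G iN iM AP Pg Pg' gU gU' nA.
have IUa : ind M gp A Ua by exists a.
(* In the nonzero case, the irreducible system generated by A, g and g' is also irreducible for A
   and g (1 + a), since 1 + a is invertible within the closure of the induced algebra. *)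
case: (classic (exists c, ind M gp A c /\ c <> vzero)) => [[c [hc nc]]|hno]; last first.
  have e0 : Ua = vzero by apply: NNPP => h; apply: hno; exists Ua.
  rewrite eT e0 vadd_0 compb1.
  have gd : gop M gp (g [-] bid) (U [-] bid).
    apply: (gop_add G) => //; [exact: iM.2 | by move=> x hx; rewrite boppE bidE; exact: vsub_opp |].
    by apply: (gop_opp G) => //; exact: gop_id.
  by apply: (gop_qn G _ _ gd gq) => x hx; rewrite baddE boppE bidE; apply: vsub_sub => //; [exact: iM.2 | exact: iN.2].
pose B := @cl (BB Y Y) (ind M gp A).
have vB : valg B := valg_cl vI.
have Bc : @closed_vsubspace (BB Y Y) B by apply: cl_closed; case: vI.
have nB : nrm B U U' := nrm_cl nI.
have IB t : ind M gp A t -> B t by exact: cl_incl.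
have [b [hb [r1 r2]]] := valg_inv Bc vB (IB _ IUa).
have nh := nrm_comp nB (nrm_one_plus Bc vB (IB _ IUa) hb r1 r2).
rewrite eT; apply: (irr_unipotent vB nh); last by exists c; split=> //; exact: IB.
move=> Q [Qc Qi]; apply: hi; split=> //; have VQ := csub_sub Qc.
have Qb : forall x, Q x -> Q (b x) by move=> x hx; apply: Qi => //; left.
have Qa : forall x, Q x -> Q (Ua x) by move=> x hx; apply: Qi => //; left; exact: IB.
have Qh : forall x, Q x -> Q ((U [o] (bid [+] Ua)) x) by move=> x hx; apply: Qi => //; right; left.
have Qh' : forall x, Q x -> Q (((bid [+] b) [o] U') x) by move=> x hx; apply: Qi => //; right; right.
move=> V [t [ht gt]] x hx.
case: ht => [ht|[et|[et|et]]].
- by apply: Qi => //; left; apply: IB; exists t.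
- rewrite et in gt; rewrite (gop_uniq G gt gU).
  have -> : U = U [o] (bid [+] Ua) [o] (bid [+] b) by rewrite -bcompA r1 compb1.
  by rewrite bcompE; apply: Qh; rewrite baddE bidE; apply: vsub_add => //; exact: Qb.
- rewrite et in gt; rewrite (gop_uniq G gt gU').
  have -> : U' = (bid [+] Ua) [o] ((bid [+] b) [o] U') by rewrite bcompA r1 comp1b.
  by rewrite bcompE baddE bidE; apply: vsub_add; [done | exact: Qh' | apply: Qa; exact: Qh'].
rewrite et in gt; rewrite (gop_uniq G gt gT) eT baddE boppE bidE.
by apply: vsub_sub => //; exact: Qh.
Qed.

Lemma W_list X (l : list (bop X)) m : exists Lm, forall T, W (fun a => In a l) m T -> In T Lm.
Proof.
elim: m => [|m [Lm IH]]; first by exists (bid :: nil) => T h; inversion h; subst; left.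
exists (flat_map (fun a => map (fun T => a [o] T) Lm) l) => T h; inversion h as [|a k U ha hU]; subst.
by apply/in_flat_map; exists a; split=> //; apply: (in_map (fun T => a [o] T)); exact: IH.
Qed.

(* For a monoid of operators 1 + (compact quasinilpotent), joint growth beyond 1 would produce, as limits of
   normalized record words, a two-sided ideal of compact quasinilpotents. *)
Theorem unipotent_growth X (G : bop X -> Prop) (l : list (bop X)) kap : irr G ->
  (forall a b, G a -> G b -> G (a [o] b)) -> (forall a, G a -> cpt (a [-] bid) /\ qn (a [-] bid)) ->
  (forall a, In a l -> G a) -> 1 < kap -> J (fun a => In a l) kap.
Proof.
move=> hi Gm Gq hl hk; apply: NNPP => hJ; set P := fun a => In a l in hJ.
have kn n : 0 < kap ^ n by apply: pow_lt; lra.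
(* Shortest words breaking the bound (i+1) kap^n. All shorter words respect it, so deleting m
   letters from the record costs at least a factor kap^m in norm. *)
have rec_ex i : exists p : nat * BB X X, W P p.1 p.2 /\ INR (S i) * kap ^ p.1 < nm p.2 /\
   forall k V, (k < p.1)%nat -> W P k V -> nm V <= INR (S i) * kap ^ k.
  have h : exists n, exists T : BB X X, W P n T /\ INR (S i) * kap ^ n < nm T.
    apply: NNPP => hn; apply: hJ; exists (INR (S i)) => n T hT; apply: Rnot_lt_le => hlt; apply: hn; by exists n, T.
  have [n [[[T [h1 h2]] hmin] _]] := dec_inh_nat_subset_has_unique_least_element _ (fun n => classic _) h.
  exists (n, T); split=> //; split=> // k V hkn hV; apply: Rnot_lt_le => hlt.
  by have := hmin k (ex_intro _ V (conj hV hlt)); rewrite /= in hkn; lia.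
have [p hp] := choice_fun rec_ex.
pose n i := (p i).1; pose w i : BB X X := (p i).2; pose c i := nm (w i).
have ci i : INR (S i) < c i.
  have [_ [h _]] := hp i; apply: Rle_lt_trans h; rewrite -{1}(Rmult_1_r (INR (S i))).
  apply: Rmult_le_compat_l; first exact: pos_INR.
  by rewrite -(pow1 (p i).1); apply: pow_incr; lra.
have c1 i : 1 < c i by have := ci i; rewrite S_INR; have := pos_INR i; lra.
have short i j V : W P (n i - S j) V -> (S j <= n i)%nat -> nm V * kap ^ S j <= c i.
  move=> hV hj; have [_ [h1 h2]] := hp i.
  have h3 := h2 _ V (ltac:(rewrite -/(n i); lia) : (n i - S j < (p i).1)%nat) hV.
  have h4 := Rmult_le_compat_r _ _ _ (Rlt_le _ _ (kn (S j))) h3.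
  apply: Rle_trans h4 _; rewrite Rmult_assoc -pow_add.
  have -> : (n i - S j + S j = (p i).1)%nat by rewrite -/(n i); lia.
  exact: Rlt_le.
have [q [q0 hq]] := list_nm_bound (l : list (BB X X)).
have long m : exists i0, forall i, (i0 <= i)%nat -> (m <= n i)%nat.
  pose q1 := q + 1.
  have Wq k T : W P k T -> nm T <= q1 ^ k.
    elim=> [|a j U ha _ IH]; first by rewrite pow_O; exact: nm_bid.
    apply: Rle_trans (nm_comp _ _) _; apply: Rmult_le_compat => //; try exact: nm_ge0.
    by have := hq a ha; rewrite /q1; lra.
  have [i0 hi0] := INR_unbounded (q1 ^ m); exists i0 => i hi1.
  case: (Nat.le_gt_cases m (n i)) => // hlt; have := ci i; have [h _] := hp i; have := Wq _ _ h; rewrite -/(w i) -/(c i) -/(n i).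
  have : q1 ^ n i <= q1 ^ m by apply: Rle_pow; [rewrite /q1; lra | lia].
  have := le_INR _ _ hi1; rewrite S_INR; lra.
have ic i : 0 <= / c i by apply: Rlt_le; apply: Rinv_0_lt_compat; have := c1 i; lra.
have icc i : / c i * c i = 1 by apply: Rinv_l; have := c1 i; lra.
pose u i : BB X X := RtoC (/ c i) [*] w i.
have u1 i : nm (u i) = 1 by rewrite nm_scalR // icc.
have [phi [hphi [T hT]]] : exists phi : nat -> nat, (forall n, (phi n < phi (S n))%nat) /\ exists T, vconv (fun n => u (phi n)) T.
  apply: (@seq_extract (BB X X) u) => e he.
  (* Write the record as a R b with outer words of length m+1. It differs from (a - 1) R (b - 1) by
     a R + R b - R, three terms of normalized size at most e/8; the main term is compact in R by
     Vala's theorem. *)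
  have [m hm] : exists m, 8 <= e * kap ^ S m.
    have [m hm] := @pow_ratio_small 8 1 kap e ltac:(lra) hk he; exists m.
    by have := hm (S m) ltac:(lia); rewrite pow1; lra.
  have [Lm hLm] := W_list l (S m).
  have [i0 hi0] := long (S m + S m)%nat.
  pose Pab (ab : bop X * bop X) (f : BB X X) := exists R : BB X X, nm R <= 1 /\ f = (ab.1 [-] bid) [o] R [o] (ab.2 [-] bid).
  pose Lp := filter (fun ab : bop X * bop X => if boolp.pselect (G ab.1 /\ G ab.2) then true else false) (list_prod Lm Lm).
  have hLp ab : In ab Lp <-> In ab (list_prod Lm Lm) /\ G ab.1 /\ G ab.2.
    rewrite filter_In; case: boolp.pselect => h; split=> -[h1 h2] //; by case: h.
  have TBL : TB (fun f => exists ab, In ab Lp /\ Pab ab f) (fun f : BB X X => f).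
    apply: TB_list => -[a b] /hLp [_ [ha hb]].
    apply: (TB_pre _ (@vala _ _ _ 1 (Gq a ha).1 (Gq b hb).1)) => f [R [h1 h2]]; by exists R.
  have ap i : exists f : BB X X, (i0 <= i)%nat -> (exists ab, In ab Lp /\ Pab ab f) /\ nm (u i [-] f) <= 3 * e / 8.
    case: (classic (i0 <= i)%nat) => hi1; last by exists vzero.
    have hn := hi0 i hi1; have [hw _] := hp i; rewrite -/(w i) -/(n i) in hw.
    have e1 : n i = (S m + (n i - S m - S m + S m))%nat by lia.
    rewrite e1 in hw; have [a [V [hwa [hV ew]]]] := W_split hw; have [R [b [hR [hb eV]]]] := W_split hV.
    have Ga : G a by apply: (valg_W Gm _ hwa) => x; exact: hl.
    have Gb : G b by apply: (valg_W Gm _ hb) => x; exact: hl.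
    have i1 : nm V * kap ^ S m <= c i by apply: short; [have -> : (n i - S m = n i - S m - S m + S m)%nat by lia | lia].
    have i2 : nm (a [o] R) * kap ^ S m <= c i.
      by apply: short; [have -> : (n i - S m = S m + (n i - S m - S m))%nat by [lia]; exact: W_app | lia].
    have i3 : nm R * kap ^ S (m + S m) <= c i.
      by apply: short; [have -> : (n i - S (m + S m) = n i - S m - S m)%nat by lia | lia].
    have i4 : nm R * kap ^ S m <= c i.
      apply: Rle_trans i3; apply: nm_mull.
      by apply: Rle_pow; [lra | lia].
    have i5 : nm R <= c i.
      apply: Rle_trans i4; rewrite -{1}(Rmult_1_r (nm R)); apply: nm_mull.
      by rewrite -(pow1 (S m)); apply: pow_incr; lra.
    have small (V' : BB X X) : nm V' * kap ^ S m <= c i -> / c i * nm V' <= e / 8.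
      move=> h; apply: (Rmult_le_reg_r (kap ^ S m)) => //.
      have h1 := Rmult_le_compat_l _ _ _ (ic i) h; rewrite icc in h1; nra.
    exists (RtoC (/ c i) [*] ((a [-] bid) [o] R [o] (b [-] bid))) => _; split.
      exists (a, b); split; first by apply/hLp; split=> //; apply: in_prod; exact: hLm.
      exists (RtoC (/ c i) [*] R); split; last by rewrite compbZr compbZl.
      by rewrite nm_scalR // -(icc i); apply: Rmult_le_compat_l.
    have -> : u i [-] RtoC (/ c i) [*] ((a [-] bid) [o] R [o] (b [-] bid)) =
        RtoC (/ c i) [*] V [+] RtoC (/ c i) [*] (a [o] R) [-] RtoC (/ c i) [*] R.
      rewrite /u ew eV; move: (RtoC (/ c i)) => r; bvec.
    apply: Rle_trans (nm_sub _ _) _.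
    have := vnorm_triangle (RtoC (/ c i) [*] V) (RtoC (/ c i) [*] (a [o] R)); rewrite !nm_scalR //.
    have := small _ i1; have := small _ i2; have := small _ i4; lra.
  have [f hf] := choice_fun ap.
  have [N [col [h1 h2]]] := TBL (e / 8) ltac:(lra).
  exists i0, N, (fun i => col (f i)); split; first by move=> i hi1; apply: h1; case: (hf i hi1).
  move=> i j hi1 hj1 ec; have [a1 a2] := hf i hi1; have [b1 b2] := hf j hj1.
  have := h2 _ _ a1 b1 ec; have := nm_tri3 (u i) (f i) (u j); have := nm_tri3 (f i) (f j) (u j).
  rewrite (nm_sym (f j)); lra.
(* Limits of lam_i g_i with lam_i tending to 0. They are also limits of lam_i (g_i - 1), hence
   compact and quasinilpotent, and they form a two-sided ideal for G. *)
pose JJ (S0 : bop X) := exists (lam : nat -> Cplx) (g : nat -> bop X), (forall i, G (g i)) /\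
   (forall e, 0 < e -> exists N, forall i, (N <= i)%nat -> Cmod (lam i) < e) /\ @vconv (BB X X) (fun i => lam i [*] g i) S0.
have conv_bd (v : nat -> BB X X) S0 : vconv v S0 -> exists N C, forall i, (N <= i)%nat -> nm (v i) <= C.
  move=> h; have [N hN] := h 1 ltac:(lra); exists N, (nm S0 + 1) => i hi1.
  by have := hN i hi1; have := nm_rev (v i) S0; lra.
have JT : JJ T.
  exists (fun i => RtoC (/ c (phi i))), (fun i => w (phi i)); split; [|split=> //].
    move=> i; have [h [h' _]] := hp (phi i); have hn : (1 <= (p (phi i)).1)%nat.
      have := c1 (phi i); rewrite /c /w; case: (p (phi i)) h => -[|k] V /= h //; last lia.
      by inversion h; subst; have := nm_bid X; lra.
    by move: h; rewrite /w; case: (p (phi i)) hn => -[|k] V /= hn h; [lia | apply: (valg_W Gm _ h) => x; exact: hl].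
  move=> e he; have [N hN] := INR_unbounded (/ e); exists N => i hi1.
  rewrite Cmod_RtoC_pos //; have h := ci (phi i); have h2 := inc_ge hphi i.
  have h3 : INR N <= INR (phi i) by apply: le_INR; lia.
  rewrite S_INR in h; rewrite -(Rinv_inv e); apply: Rinv_lt_contravar; last lra.
  by apply: Rmult_lt_0_compat; [exact: Rinv_0_lt_compat | have := c1 (phi i); lra].
have nT : T <> vzero.
  move=> e; have [N hN] := hT (1/2) ltac:(lra); have := hN N (le_n _); rewrite e vopp_0 vadd_0 u1; lra.
apply: nT; apply: (irr_no_semigroup hi (A := JJ)) => //.
- move=> S0 S1 [lam [g [h1 [h2 h3]]]] [mu [h [k1 [k2 k3]]]].
  exists (fun i => lam i * mu i)%C, (fun i => g i [o] h i); split; first by move=> i; exact: Gm.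
  have cv : @vconv (BB X X) (fun i => (lam i [*] g i) [o] (mu i [*] h i)) (S0 [o] S1).
    have [N [C hC]] := conv_bd _ _ k3; move=> e he.
    have pC := Rabs_pos C; have p0 := nm_ge0 S0.
    have [N1 hN1] := h3 (e / (2 * (Rabs C + 1))) ltac:(divpos).
    have [N2 hN2] := k3 (e / (2 * (nm S0 + 1))) ltac:(divpos).
    exists (N + N1 + N2)%nat => i hi1; move: (hC i ltac:(lia)) (hN1 i ltac:(lia)) (hN2 i ltac:(lia)).
    move: (lam i [*] g i : BB X X) (mu i [*] h i : BB X X) => x y hy hx hy2.
    have -> : (x : bop X) [o] y [-] S0 [o] S1 = (x [-] S0) [o] y [+] S0 [o] (y [-] S1) by bvec.
    apply: Rle_lt_trans (vnorm_triangle _ _) _.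
    have a1 := nm_comp (x [-] S0) y; have a2 := nm_comp S0 (y [-] S1).
    have a3 : nm (x [-] S0) * nm y <= e / (2 * (Rabs C + 1)) * Rabs C.
      apply: Rmult_le_compat; [exact: nm_ge0 | exact: nm_ge0 | exact: Rlt_le | have := RRle_abs C; lra].
    have a4 : nm S0 * nm (y [-] S1) <= nm S0 * (e / (2 * (nm S0 + 1))) by apply: Rmult_le_compat_l => //; exact: Rlt_le.
    have d1 : 0 < e / (2 * (Rabs C + 1)) by divpos.
    have d2 : 0 < e / (2 * (nm S0 + 1)) by divpos.
    have a5 : e / (2 * (Rabs C + 1)) * Rabs C = e/2 - e / (2 * (Rabs C + 1)) by field; lra.
    have a6 : nm S0 * (e / (2 * (nm S0 + 1))) = e/2 - e / (2 * (nm S0 + 1)) by field; lra.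
    lra.
  split; last by apply: (vconv_ext _ cv) => i; bvec.
  move=> e he; have [N hN] := h2 e he; have [N' hN'] := k2 1 ltac:(lra).
  exists (N + N')%nat => i hi1; rewrite Cmod_mul; have := hN i ltac:(lia); have := hN' i ltac:(lia).
  have := Cmod_ge0 (lam i); have := Cmod_ge0 (mu i); nra.
- move=> S0 [lam [g [h1 [h2 h3]]]].
  have cv : @vconv (BB X X) (fun i => lam i [*] (g i [-] bid)) S0.
    move=> e he; have [N hN] := h3 (e/2) ltac:(lra); have [N' hN'] := h2 (e/2) ltac:(lra).
    exists (N + N')%nat => i hi1.
    have -> : lam i [*] (g i [-] bid) [-] S0 = (lam i [*] g i [-] S0) [-] lam i [*] bid by vec.
    apply: Rle_lt_trans (nm_sub _ _) _; rewrite vnorm_scal.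
    have := hN i ltac:(lia); have := hN' i ltac:(lia); have := nm_bid X; have := Cmod_ge0 (lam i).
    have := nm_ge0 (bid : BB X X); nra.
  split; first by apply: (cpt_conv (u := fun i => lam i [*] (g i [-] bid))) => // i; apply: cpt_scal; case: (Gq _ (h1 i)).
  apply: (@qn_conv _ (fun i => lam i [*] (g i [-] bid))) => // i; first by apply: cpt_scal; case: (Gq _ (h1 i)).
  by apply: qn_scal; case: (Gq _ (h1 i)).
- move=> g0 S0 hg [lam [g [h1 [h2 h3]]]]; exists lam, (fun i => g0 [o] g i); split; first by move=> i; exact: Gm.
  split=> //; apply: (vconv_ext (u := fun i => g0 [o] (lam i [*] g i))); first by move=> i; bvec.
  exact: (bl_conv (bL g0) h3).
move=> g0 S0 hg [lam [g [h1 [h2 h3]]]]; exists lam, (fun i => g i [o] g0); split; first by move=> i; exact: Gm.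
split=> //; apply: (vconv_ext (u := fun i => (lam i [*] g i) [o] g0)); first by move=> i; bvec.
exact: (bl_conv (bR g0) h3).
Qed.

Section Normalize.
Variables (X : CBanach) (g g' : bop X).
Hypothesis g1 : g [o] g' = bid.
Hypothesis g2 : g' [o] g = bid.

Inductive pw : bop X -> bop X -> Prop :=
| pw0 : pw bid bid
| pwS h h' : pw h h' -> pw (g [o] h) (h' [o] g')
| pwS' h h' : pw h h' -> pw (g' [o] h) (h' [o] g).

Lemma pw_nrm A h h' : nrm A g g' -> pw h h' -> nrm A h h'.
Proof.
move=> hA; elim=> [|{}h {}h' _ IH|{}h {}h' _ IH]; last 2 first.
- exact: nrm_comp.
- by apply: nrm_comp => //; exact: nrm_inv.
rewrite /nrm comp1b vadd_opp; split=> //; split=> //; split; first exact: cpt_0.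
by move=> a ha; rewrite comp1b compb1.
Qed.

Lemma pw_app h h' k k' : pw h h' -> pw k k' -> pw (h [o] k) (k' [o] h').
Proof.
move=> hh hk; elim: hh => [|{}h {}h' _ IH|{}h {}h' _ IH]; first by rewrite comp1b compb1.
  by rewrite bcompA -bcompA; exact: pwS.
by rewrite bcompA -bcompA; exact: pwS'.
Qed.

(** Powers of g minus 1 are multiples of K = g - 1 by operators commuting with K. *)
Lemma pw_qn h h' : qn (g [-] bid) -> pw h h' -> qn (h [-] bid).
Proof.
move=> hq hp; set K := g [-] bid in hq.
have eg : g = bid [+] K by rewrite /K; vec.
have cg : g [o] K = K [o] g by rewrite eg; bvec.
have cg' : g' [o] K = K [o] g'.
  by rewrite -(compb1 (g' [o] K)) -g1 !bcompA -(bcompA g') -cg bcompA g2 comp1b.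
suff [Z [h1 [h2 h3]]] : exists Z : bop X, h [-] bid = Z [o] K /\ Z [o] K = K [o] Z /\ h [o] K = K [o] h.
  by rewrite h1; exact: qn_comm.
elim: hp => [|{}h {}h' _ [Z [h1 [h2 h3]]]|{}h {}h' _ [Z [h1 [h2 h3]]]].
- by exists vzero; rewrite vadd_opp comp0b compb0 comp1b compb1.
- exists (Z [+] h); split; last split.
  + rewrite {1}eg compbDl comp1b compbDl -h1 -h3; vec.
  + by rewrite compbDl compbDr h2 h3.
  + by rewrite -bcompA h3 !bcompA cg.
exists (g' [o] Z [-] g'); split; last split.
- have -> : (g' [o] Z [-] g') [o] K = g' [o] (Z [o] K) [-] g' [o] K by bvec.
  by rewrite -h1 /K !compbDr !compbNr g2; bvec.
- have -> : (g' [o] Z [-] g') [o] K = g' [o] (Z [o] K) [-] g' [o] K by bvec.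
  by rewrite h2 compbDr compbNr bcompA cg' bcompA.
by rewrite -bcompA h3 !bcompA cg'.
Qed.
End Normalize.

(** The products h (1 + a), h a power of g, form an irreducible monoid of unipotents of joint growth
    at most every kap > 1. Differences of its members express t K with arbitrarily small weight,
    while [hilden] bounds words in the t K from below. *)
Lemma irr_normalized X (A : bop X -> Prop) g g' : valg A -> nrm A g g' ->
  irr (fun t => A t \/ t = g \/ t = g') -> forall a, A a -> a = vzero.
Proof.
move=> vA0 nA0 hi0 K hK0; apply: NNPP => nz.
have gq := irr_unipotent vA0 nA0 hi0 (ex_intro _ K (conj hK0 nz)).
pose A0 := @cl (BB X X) A.
have vA : valg A0 := valg_cl vA0.
have nA : nrm A0 g g' := nrm_cl nA0.
have AB t : A t -> A0 t by exact: cl_incl.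
have Ac : @closed_vsubspace (BB X X) A0 by apply: cl_closed; case: vA0.
clearbody A0; have hK := AB _ hK0; have [r1 [r2 [gc gA]]] := nA.
have [[B0 [B1 B2]] [Bm Bq]] := vA.
(* Every product is brought to the form power of g times 1 + a by moving powers of g to the left,
   which conjugates a within the normalized algebra. *)
pose G t := exists h h' a, pw g g' h h' /\ A0 a /\ t = h [o] (bid [+] a).
have Gmul1 t b : G t -> A0 b -> G (t [o] (bid [+] b)).
  move=> [h [h' [a [h1 [h2 ->]]]]] hb; exists h, h', (a [+] b [+] a [o] b); split=> //.
  split; [exact: (B1 _ _ (B1 _ _ h2 hb) (Bm _ _ h2 hb)) | bvec].
have Gm s t : G s -> G t -> G (s [o] t).
  move=> [h [h' [a [h1 [h2 ->]]]]] [k [k' [b [k1 [k2 ->]]]]].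
  have [n1 [n2 [n3 n4]]] := pw_nrm nA k1.
  have -> : h [o] (bid [+] a) [o] (k [o] (bid [+] b)) = h [o] k [o] (bid [+] k' [o] a [o] k) [o] (bid [+] b).
    rewrite bcompA; congr (_ [o] _); rewrite -!(bcompA h); congr (_ [o] _).
    by rewrite compbDl compbDr !bcompA n1 comp1b comp1b compb1.
  apply: Gmul1 => //; exists (h [o] k), (k' [o] h'), (k' [o] a [o] k); split; first exact: pw_app.
  by split=> //; case: (n4 a h2).
have Gq t : G t -> cpt (t [-] bid) /\ qn (t [-] bid).
  move=> [h [h' [a [h1 [h2 ->]]]]]; have n1 := pw_nrm nA h1; split.
    have [_ [_ [hc _]]] := n1.
    have -> : h [o] (bid [+] a) [-] bid = (h [-] bid) [+] h [o] a by bvec.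
    by apply: cpt_add => //; apply: cpt_compl; case: (Bq a h2).
  by apply: (unipotent_mul vA n1) => //; exact: (pw_qn r1 r2 gq h1).
have Gp h h' : pw g g' h h' -> G h.
  by move=> hp; exists h, h', vzero; split=> //; split=> //; rewrite vadd_0 compb1.
have Ga a : A0 a -> G (bid [+] a) by move=> ha; exists bid, bid, a; split; [exact: pw0 | split=> //; rewrite comp1b].
have hi : irr G.
  move=> Q [Qc Qi]; apply: hi0; split=> // t [ht|[->|->]] x hx.
  - have -> : t x = (bid [+] t) x [-] x by rewrite baddE bidE; vec.
    by apply: vsub_sub => //; [exact: csub_sub | apply: Qi => //; apply: Ga; exact: AB].
  - apply: Qi => //; have h := pwS (pw0 g g'); rewrite compb1 in h; exact: (Gp _ _ h).
  apply: Qi => //; have h := pwS' (pw0 g g'); rewrite compb1 in h; exact: (Gp _ _ h).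
have hS : dens (@span (BB X X) G).
  apply: (irr_dens hi); first exact: span_sub.
    by move=> a t ha; apply: (span_map (T := bL a)) => x hx; apply: span1; exact: Gm.
  by move=> y ny; exists bid; split=> //; apply: span1; apply: (Gp _ bid); exact: pw0.
have [l [eta [r [he [hr [hl hw]]]]]] := hilden (Bq K hK).1 nz hS.
have hw0 := hw K ltac:(rewrite vadd_opp nm_0; lra).
pose l' := map (fun t : BB X X => t [o] K) l.
have [k [k1 k2]] : exists k, (forall a, In a k -> G a) /\ forall b, In b l' -> exists d, d <= 1/4 /\ cmb (fun a => In a k) d b.
  apply: cmb_fin_list => b /in_map_iff [t [<- ht]]; have [d hd] := cmb_span (hl t ht).
  (* Uses K = ((1 + zK) - (1 - zK))/(2z): x K has weight 1/z, so t K has weight d/z <= 1/4, and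
     growth 2 of the monoid leaves rate 1/2. *)
  have d0 := cmb_ge0 hd; pose z := 4 * (d + 1); have hz : 0 < z by rewrite /z; lra.
  exists (d * / z); split.
    apply: (Rmult_le_reg_r z) => //; rewrite Rmult_assoc Rinv_l; last lra.
    by rewrite /z; lra.
  apply: (cmb_map (f := fun t => t [o] K)) hd => [||| x hx]; [by rewrite comp0b | by move=> *; rewrite compbDl | by move=> *; rewrite compbZl |].
  have nz2 : RtoC (2 * z) <> C0 by apply: RtoC_neq0; lra.
  have -> : x [o] K = Cinv (RtoC (2 * z)) [*] (x [o] (bid [+] RtoC z [*] K)) [+] (- Cinv (RtoC (2 * z)))%C [*] (x [o] (bid [+] (- RtoC z)%C [*] K)).
    have e2 : (Cinv (RtoC (2 * z)) * RtoC z + Cinv (RtoC (2 * z)) * RtoC z)%C = C1.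
      have -> : (Cinv (RtoC (2 * z)) * RtoC z + Cinv (RtoC (2 * z)) * RtoC z)%C = (Cinv (RtoC (2 * z)) * (RtoC z + RtoC z))%C by ring.
      rewrite -RtoC_add -(_ : 2 * z = z + z); last ring.
      by field.
    have e3 : x [o] K = (Cinv (RtoC (2 * z)) * RtoC z + Cinv (RtoC (2 * z)) * RtoC z)%C [*] (x [o] K) by rewrite e2 vscal_1.
    rewrite {1}e3; move: (RtoC z) (Cinv _) => p q; bvec.
  have ei : Cmod (Cinv (RtoC (2 * z))) = / (2 * z) by rewrite Cmod_inv // Cmod_RtoC_pos //; lra.
  have -> : / z = Cmod (Cinv (RtoC (2 * z))) * 1 + Cmod (- Cinv (RtoC (2 * z)))%C * 1.
    by rewrite Cmod_opp ei; field; lra.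
  by apply: cmbD; apply: cmbZ; apply: cmb1; apply: Gmul1 => //; exact: B2.
have J2 := unipotent_growth hi Gm Gq k1 (ltac:(lra) : 1 < 2).
have [C hC] := cmb_J (ltac:(lra) : 0 <= 2) (ltac:(lra) : 0 <= 1/4) J2 k2.
have [N hN] := half_pow_small C hr.
have [U [hU hU2]] := hw0 N.
have hU' : W (fun a => In a l') N U.
  by apply: W_mono hU => a [t [ht ->]]; apply: (in_map (fun t : BB X X => t [o] K)).
have := hC _ _ hU'; have -> : 1 / 4 * 2 = 1 / 2 by field.
by have := hN N (le_n _); lra.
Qed.

(* An operator of A times an operator normalizing A has only zero diagonal blocks. *)
Theorem normalized_qn X (A : bop X -> Prop) g g' a : valg A -> nrm A g g' -> A a -> qn (a [o] g).
Proof.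
move=> vA nA ha; have [_ [_ Aq]] := vA.
have ac : cpt (a [o] g) by apply: cpt_compr; case: (Aq a ha).
apply: (@gap_qn X (fun t => A t \/ t = g \/ t = g' \/ t = a [o] g)) => //; first by right; right; right.
move=> N M Y gp G iN iM hne hi UT gT.
set P := fun t => _ in iN iM hi.
have AP t : A t -> P t by left.
have Pg : P g by right; left.
have Pg' : P g' by right; right; left.
have [U [gU _]] := g_op G (iM.2 g Pg) (iN.2 g Pg).
have [U' [gU' _]] := g_op G (iM.2 g' Pg') (iN.2 g' Pg').
have [Ua [ga _]] := g_op G (iM.2 a (AP a ha)) (iN.2 a (AP a ha)).
have vI := ind_valg G iN iM AP vA; have nI := ind_nrm G iN iM AP Pg Pg' gU gU' nA.
have eT : UT = Ua [o] U by apply: (gop_uniq G gT); apply: gop_comp => //; exact: iM.2.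
have IUa : ind M gp A Ua by exists a.
have -> : UT = vzero; last exact: qn_0.
have iY : irr (fun t => ind M gp A t \/ t = U \/ t = U').
  move=> Q [Qc Qi]; apply: hi; split=> // V [t [[ht|[et|[et|et]]] gt]].
  - by apply: Qi; left; exists t.
  - by rewrite et in gt; apply: Qi; right; left; exact: (gop_uniq G gt gU).
  - by rewrite et in gt; apply: Qi; right; right; exact: (gop_uniq G gt gU').
  rewrite et in gt; rewrite (gop_uniq G gt gT) eT => x hx; rewrite bcompE; apply: (Qi); first by left.
  by apply: Qi => //; right; left.
by rewrite eT (irr_normalized vI nI iY IUa) comp0b.
Qed.

(** * Exponentials and ideals of an irreducible Lie algebra *)

Section ExpDef.
Variable X : CBanach.
Implicit Types P Q S T : bop X.

Lemma pow_diff S T b n : 0 <= b -> nm S <= b -> nm T <= b ->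
  nm (bpow S (Datatypes.S n) [-] bpow T (Datatypes.S n)) <= INR (Datatypes.S n) * b ^ n * nm (S [-] T).
Proof.
move=> hb hS hT; elim: n => [|n IH].
  by rewrite /= !compb1; lra.
have -> : bpow S (Datatypes.S (Datatypes.S n)) [-] bpow T (Datatypes.S (Datatypes.S n)) =
    S [o] (bpow S (Datatypes.S n) [-] bpow T (Datatypes.S n)) [+] (S [-] T) [o] bpow T (Datatypes.S n).
  rewrite -[bpow S (Datatypes.S (Datatypes.S n))]/(S [o] bpow S (Datatypes.S n)) -[bpow T (Datatypes.S (Datatypes.S n))]/(T [o] bpow T (Datatypes.S n)).
  by move: (bpow S _) (bpow T _) => p q; bvec.
apply: Rle_trans (vnorm_triangle _ _) _.
have h1 := nm_comp S (bpow S (Datatypes.S n) [-] bpow T (Datatypes.S n)).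
have h2 := nm_comp (S [-] T) (bpow T (Datatypes.S n)).
have h3 : nm (bpow T (Datatypes.S n)) <= b ^ Datatypes.S n.
  by apply: Rle_trans (nm_bpow _ _) _; apply: pow_incr; split=> //; exact: nm_ge0.
have h4 := Rmult_le_compat _ _ _ _ (nm_ge0 _) (nm_ge0 _) hS IH.
have h5 := nm_mull (S [-] T) h3.
rewrite (S_INR (Datatypes.S n)); move: h4 h5; rewrite [b ^ Datatypes.S n]/=; lra.
Qed.

(** Euler's product (1 + P/2^k)^(2^k) approximates exp P. Invariance, intertwining and compactness
    modulo the identity pass through its powers at once, without handling a power series. *)
Definition ek P k : bop X := bpow (bid [+] RtoC (/ 2 ^ k) [*] P) (Nat.pow 2 k).

Lemma exp_pow_le c m : exp (c / INR (S m)) ^ S m = exp c.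
Proof.
have hm : INR (S m) <> 0 by have := pos_INR m; rewrite S_INR; lra.
have h n : exp (c / INR (S m)) ^ n = exp (INR n * (c / INR (S m))).
  elim: n => [|n IH]; first by rewrite /= Rmult_0_l exp_0.
  by rewrite (S_INR n) Rmult_plus_distr_r Rmult_1_l exp_plus -IH -tech_pow_Rmult; ring.
by rewrite h; congr exp; field.
Qed.

Lemma INR_pow2 k : INR (Nat.pow 2 k) = 2 ^ k.
Proof. by rewrite pow_INR. Qed.

Lemma one_plus_le P k c : nm P <= c -> nm (bid [+] RtoC (/ 2 ^ k) [*] P) <= exp (c / 2 ^ k).
Proof.
move=> hc; have h2 := pow_lt 2 k ltac:(lra); have h3 := Rinv_0_lt_compat _ h2.
apply: Rle_trans (vnorm_triangle _ _) _; rewrite nm_scalR; last lra.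
have := nm_bid X; have := exp_ineq1_le (c / 2 ^ k).
have := Rmult_le_compat_l _ _ _ (Rlt_le _ _ h3) hc; rewrite /Rdiv (Rmult_comm c); lra.
Qed.

(** Both operators are 2^k-th powers, of (1 + P/2^(k+1))^2 and of 1 + P/2^k; the bases differ by
    P^2/4^(k+1), so the powers differ by order 2^-k. *)
Lemma ek_step P k c : nm P <= c -> nm (ek P (S k) [-] ek P k) <= c * c * exp c / 4 * (1/2) ^ k.
Proof.
move=> hc; have c0 : 0 <= c by have := nm_ge0 P; lra.
have h2 := pow_lt 2 k ltac:(lra).
pose A := bid [+] RtoC (/ 2 ^ S k) [*] P; pose B := bid [+] RtoC (/ 2 ^ k) [*] P.
have e1 : ek P (S k) = bpow (A [o] A) (Nat.pow 2 k).
  rewrite /ek -/A (_ : Nat.pow 2 (S k) = 2 * Nat.pow 2 k)%nat // bpow_mul; congr bpow.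
  by rewrite /= compb1.
have [m hm] : exists m, Nat.pow 2 k = S m by exists (Nat.pow 2 k - 1)%nat; have := pow2_pos k; lia.
have em : INR (S m) = 2 ^ k by rewrite -hm INR_pow2.
have hB : nm B <= exp (c / 2 ^ k) by exact: one_plus_le.
have hA : nm (A [o] A) <= exp (c / 2 ^ k).
  have h := one_plus_le (S k) hc; apply: Rle_trans (nm_comp _ _) _.
  have -> : c / 2 ^ k = c / 2 ^ S k + c / 2 ^ S k by rewrite /=; field; lra.
  by rewrite exp_plus; apply: Rmult_le_compat => //; exact: nm_ge0.
have hd : nm (A [o] A [-] B) <= c * c / (4 * 2 ^ k * 2 ^ k).
  have -> : A [o] A [-] B = RtoC (/ 2 ^ S k * / 2 ^ S k) [*] (P [o] P).
    have -> : B = bid [+] (RtoC (/ 2 ^ S k) + RtoC (/ 2 ^ S k))%C [*] P.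
      by rewrite /B -RtoC_add; congr (_ [+] RtoC _ [*] _); rewrite /=; field; lra.
    by rewrite /A RtoC_mul; move: (RtoC _) => r; bvec.
  have h3 : 0 < / 2 ^ S k by apply: Rinv_0_lt_compat; apply: pow_lt; lra.
  rewrite nm_scalR; last nra.
  have h4 : nm (P [o] P) <= c * c by apply: Rle_trans (nm_comp _ _) _; apply: Rmult_le_compat => //; exact: nm_ge0.
  have -> : c * c / (4 * 2 ^ k * 2 ^ k) = / 2 ^ S k * / 2 ^ S k * (c * c) by rewrite /=; field; lra.
  by apply: Rmult_le_compat_l => //; nra.
rewrite e1 /ek -/B hm.
apply: Rle_trans (pow_diff m (Rlt_le _ _ (exp_pos _)) hA hB) _.
have h5 : exp (c / 2 ^ k) ^ m <= exp c.
  rewrite -(exp_pow_le c m) em; apply: Rle_pow; last lia.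
  have := exp_ineq1_le (c / 2 ^ k); have : 0 <= c / 2 ^ k by apply: Rmult_le_pos => //; exact: Rinv_ge0.
  lra.
have -> : c * c * exp c / 4 * (1/2) ^ k = 2 ^ k * exp c * (c * c / (4 * 2 ^ k * 2 ^ k)).
  have -> : (1/2) ^ k = / 2 ^ k by rewrite -pow_inv; congr (_ ^ _); lra.
  by field; lra.
rewrite em; apply: Rmult_le_compat => //; last by apply: Rmult_le_compat_l => //; lra.
  by apply: Rmult_le_pos; [lra | apply: pow_le; exact: Rlt_le (exp_pos _)].
exact: nm_ge0.
Qed.

Lemma Exp_ex P : exists E, @vconv (BB X X) (ek P) E /\ forall c k, nm P <= c -> nm (ek P k [-] E) <= c * c * exp c * (1/2) ^ k.
Proof.
have [E [h1 h2]] := @geom_conv (BB X X) (ek P) _ (fun k => ek_step k (Rle_refl (nm P))).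
exists E; split=> // c k hc.
have [E' [k1 k2]] := @geom_conv (BB X X) (ek P) _ (fun k => ek_step k hc).
rewrite (vconv_unique h1 k1); apply: Rle_trans (k2 k) _.
have := pow_lt (1/2) k ltac:(lra); have := exp_pos c.
have := Rle_0_sqr c; rewrite /Rsqr => h3 h4 h5; have := Rmult_le_pos _ _ (Rmult_le_pos _ _ h3 (Rlt_le _ _ h4)) (Rlt_le _ _ h5); lra.
Qed.

Definition Exp P := proj1_sig (cid _ (Exp_ex P)).
Lemma Exp_conv P : @vconv (BB X X) (ek P) (Exp P).
Proof. by rewrite /Exp; case: cid => E /= []. Qed.
Lemma Exp_bd P c k : nm P <= c -> nm (ek P k [-] Exp P) <= c * c * exp c * (1/2) ^ k.
Proof. by rewrite /Exp; case: cid => E /= [_]; apply. Qed.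

Lemma Exp_first P c : nm P <= c -> nm (Exp P [-] (bid [+] P)) <= c * c * exp c.
Proof.
move=> hc; have := Exp_bd 0 hc; rewrite /ek /= compb1 Rinv_1 Rmult_1_r nm_sym.
by have -> : RtoC 1 [*] P = P by exact: vscal_1.
Qed.

End ExpDef.

Lemma bpow_inv X (Q : X -> Prop) (P : bop X) n : (forall x, Q x -> Q (P x)) -> forall x, Q x -> Q (bpow P n x).
Proof. by move=> h; elim: n => [//|n IH] x hx; exact: (h _ (IH x hx)). Qed.

Lemma Exp_inv X (Q : X -> Prop) (P : bop X) : closed_vsubspace Q -> (forall x, Q x -> Q (P x)) ->
  forall x, Q x -> Q (Exp P x).
Proof.
move=> Qc h x hx; have VQ := csub_sub Qc; have [_ [_ [_ hc]]] := Qc.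
apply: (hc (fun k => ek P k x)); last exact: (bconv_app x (Exp_conv P)).
move=> k; apply: bpow_inv => // y hy; rewrite baddE bscalE bidE; apply: vsub_add => //; apply: vsub_scal => //; exact: h.
Qed.

Lemma bpow_intertwine X Y (A : blin X Y) (P : bop X) (Q : bop Y) n : A [o] P = Q [o] A ->
  A [o] bpow P n = bpow Q n [o] A.
Proof.
move=> h; elim: n => [|n IH]; first by rewrite comp1b compb1.
rewrite -[bpow P (S n)]/(P [o] bpow P n) -[bpow Q (S n)]/(Q [o] bpow Q n).
by rewrite bcompA h -bcompA IH bcompA.
Qed.

Lemma conv_comp X Y Z (u : nat -> blin Y Z) (v : nat -> blin X Y) S T :
  @vconv (BB Y Z) u S -> @vconv (BB X Y) v T -> @vconv (BB X Z) (fun n => u n [o] v n) (S [o] T).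
Proof.
move=> hu hv e he.
have pT := nm_ge0 T; have pS := nm_ge0 S.
have [N1 hN1] := hv (Rmin 1 (e / (2 * (nm S + 1)))) ltac:(apply: Rmin_pos; [lra | divpos]).
have [N2 hN2] := hu (e / (2 * (nm T + 2))) ltac:(divpos).
exists (N1 + N2)%nat => n hn.
have h1 := hN1 n ltac:(lia); have h2 := hN2 n ltac:(lia).
have h3 := Rmin_l 1 (e / (2 * (nm S + 1))); have h4 := Rmin_r 1 (e / (2 * (nm S + 1))).
move: (u n) (v n) h1 h2 => x y h1 h2.
have -> : x [o] y [-] S [o] T = (x [-] S) [o] y [+] S [o] (y [-] T) by bvec.
apply: Rle_lt_trans (vnorm_triangle _ _) _.
have ny : nm y <= nm T + 1 by have := nm_rev y T; lra.
have a1 := nm_comp (x [-] S) y; have a2 := nm_comp S (y [-] T).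
have d1 : 0 < e / (2 * (nm T + 2)) by divpos.
have d2 : 0 < e / (2 * (nm S + 1)) by divpos.
have a3 : nm (x [-] S) * nm y <= e / (2 * (nm T + 2)) * (nm T + 1).
  by apply: Rmult_le_compat => //; [exact: nm_ge0 | exact: nm_ge0 | exact: Rlt_le].
have a4 : nm S * nm (y [-] T) <= nm S * (e / (2 * (nm S + 1))) by apply: Rmult_le_compat_l => //; lra.
have a5 : e / (2 * (nm T + 2)) * (nm T + 1) = e/2 - e / (2 * (nm T + 2)) by field; lra.
have a6 : nm S * (e / (2 * (nm S + 1))) = e/2 - e / (2 * (nm S + 1)) by field; lra.
lra.
Qed.

Lemma Exp_intertwine X Y (A : blin X Y) (P : bop X) (Q : bop Y) : A [o] P = Q [o] A ->
  A [o] Exp P = Exp Q [o] A.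
Proof.
move=> h; apply: (vconv_unique (u := fun k => A [o] ek P k)); first exact: conv_comp (vconv_const _) (Exp_conv P).
apply: (vconv_ext (u := fun k => ek Q k [o] A)); last exact: conv_comp (Exp_conv Q) (vconv_const _).
by move=> k; rewrite (@bpow_intertwine _ _ A _ (bid [+] RtoC (/ 2 ^ k) [*] Q)) // compbDl compbDr compbZl compbZr h comp1b compb1.
Qed.

Lemma Exp_0 X : Exp (vzero : bop X) = bid.
Proof.
apply: (vconv_unique (Exp_conv _)); apply: (vconv_ext (u := fun _ => bid)); last exact: vconv_const.
move=> k; rewrite /ek vscal_0r vadd_0; elim: (Nat.pow 2 k) => [//|n IH].
by rewrite -[bpow _ (S n)]/(bid [o] bpow bid n) comp1b.
Qed.

Lemma Exp_add X (P Q : bop X) : P [o] Q = Q [o] P -> Exp (P [+] Q) = Exp P [o] Exp Q.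
Proof.
move=> hc; apply: (vconv_unique (Exp_conv _)).
have h1 : @vconv (BB X X) (fun k => ek P k [o] ek Q k) (Exp P [o] Exp Q) := conv_comp (Exp_conv P) (Exp_conv Q).
pose c := nm P + nm Q; have hP := nm_ge0 P; have hQ := nm_ge0 Q.
have key k : nm (ek (P [+] Q) k [-] ek P k [o] ek Q k) <= c * c * exp c * (1/2) ^ k.
  have h2 := pow_lt 2 k ltac:(lra); have h3 := Rinv_0_lt_compat _ h2.
  have hk : 0 <= c / 2 ^ k by apply: Rmult_le_pos; [rewrite /c; lra | lra].
  rewrite /ek -bpow_comp; last by rewrite !compbDl !compbDr !compbZl !compbZr hc; bvec.
  have [m hm] : exists m, Nat.pow 2 k = S m by exists (Nat.pow 2 k - 1)%nat; have := pow2_pos k; lia.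
  have em : INR (S m) = 2 ^ k by rewrite -hm INR_pow2.
  set A := bid [+] _ [*] (P [+] Q); set B := _ [o] _.
  have hA : nm A <= exp (c / 2 ^ k) by apply: one_plus_le; exact: vnorm_triangle.
  have hB : nm B <= exp (c / 2 ^ k).
    apply: Rle_trans (nm_comp _ _) _.
    have -> : c / 2 ^ k = nm P / 2 ^ k + nm Q / 2 ^ k by rewrite /c; field; lra.
    by rewrite exp_plus; apply: Rmult_le_compat; try exact: nm_ge0; apply: one_plus_le; lra.
  have hd : nm (A [-] B) <= c * c / (2 ^ k * 2 ^ k).
    have -> : A [-] B = vopp (RtoC (/ 2 ^ k * / 2 ^ k) [*] (P [o] Q)).
      by rewrite /A /B RtoC_mul; move: (RtoC _) => r; bvec.
    rewrite nm_opp nm_scalR; last nra.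
    have -> : c * c / (2 ^ k * 2 ^ k) = / 2 ^ k * / 2 ^ k * (c * c) by field; lra.
    apply: Rmult_le_compat_l; first nra.
    by apply: Rle_trans (nm_comp _ _) _; rewrite /c; nra.
  rewrite hm; apply: Rle_trans (pow_diff m (Rlt_le _ _ (exp_pos _)) hA hB) _.
  have h5 : exp (c / 2 ^ k) ^ m <= exp c.
    rewrite -(exp_pow_le c m) em; apply: Rle_pow; last lia.
    by have := exp_ineq1_le (c / 2 ^ k); lra.
  have -> : c * c * exp c * (1/2) ^ k = 2 ^ k * exp c * (c * c / (2 ^ k * 2 ^ k)).
    have -> : (1/2) ^ k = / 2 ^ k by rewrite -pow_inv; congr (_ ^ _); lra.
    by field; lra.
  rewrite em; apply: Rmult_le_compat => //; last by apply: Rmult_le_compat_l => //; lra.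
    by apply: Rmult_le_pos; [lra | apply: pow_le; exact: Rlt_le (exp_pos _)].
  exact: nm_ge0.
move=> e he; have [N1 hN1] := h1 (e/2) ltac:(lra); have [N2 hN2] := half_pow_small (c * c * exp c) (e := e/2) ltac:(lra).
exists (N1 + N2)%nat => n hn; have := nm_tri3 (ek (P [+] Q) n) (ek P n [o] ek Q n) (Exp P [o] Exp Q).
have := hN1 n ltac:(lia); have := hN2 n ltac:(lia); have := key n; lra.
Qed.

Lemma Exp_opp X (P : bop X) : Exp P [o] Exp (vopp P) = bid.
Proof. by rewrite -Exp_add ?vadd_opp ?Exp_0 //; bvec. Qed.

Lemma Exp_oppl X (P : bop X) : Exp (vopp P) [o] Exp P = bid.
Proof. by rewrite -Exp_add ?(vadd_comm (vopp P)) ?vadd_opp ?Exp_0 //; bvec. Qed.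

Lemma Exp_cpt X (P : bop X) : cpt P -> cpt (Exp P [-] bid).
Proof.
move=> hP; apply: (cpt_conv (u := fun k => ek P k [-] bid)); last first.
  by apply: (vconv_add (u := fun k => ek P k : BB X X)); [exact: Exp_conv | exact: vconv_const].
move=> k; rewrite /ek; elim: (Nat.pow 2 k) => [|n IH]; first by rewrite vadd_opp; exact: cpt_0.
rewrite -[bpow _ (S n)]/((bid [+] RtoC (/ 2 ^ k) [*] P) [o] bpow (bid [+] RtoC (/ 2 ^ k) [*] P) n).
move: (bpow _ n) IH => Z IH.
have -> : (bid [+] RtoC (/ 2 ^ k) [*] P) [o] Z [-] bid = (Z [-] bid) [+] RtoC (/ 2 ^ k) [*] (P [o] Z) by bvec.
by apply: cpt_add => //; apply: cpt_scal; exact: cpt_compr.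
Qed.

Lemma Exp_Ad X (a z : bop X) : Exp (adk a) z = Exp a [o] z [o] Exp (vopp a).
Proof.
rewrite /adk Exp_add; last by apply: blin_ext => w; rewrite !bcompE !boppE !bl_opp; congr vopp; rewrite [bL a _]/(a [o] _) [bR a _]/(_ [o] a) /=; exact: bcompA.
have hL w : Exp (bL a) w = Exp a [o] w.
  apply: (vconv_unique (u := fun k => ek (bL a) k w)); first exact: (bconv_app w (Exp_conv (bL a))).
  apply: (vconv_ext (u := fun k => ek a k [o] w)); last exact: conv_comp (Exp_conv a) (vconv_const _).
  move=> k; rewrite /ek; elim: (Nat.pow 2 k) => [|n IH]; first exact: comp1b.
  have e : bpow (bid [+] RtoC (/ 2 ^ k) [*] bL a) (S n) w = (bid [+] RtoC (/ 2 ^ k) [*] bL a) (bpow (bid [+] RtoC (/ 2 ^ k) [*] bL a) n w) by [].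
  have e2 : bpow (bid [+] RtoC (/ 2 ^ k) [*] a) (S n) = (bid [+] RtoC (/ 2 ^ k) [*] a) [o] bpow (bid [+] RtoC (/ 2 ^ k) [*] a) n by [].
  rewrite e e2 -bcompA IH baddE bscalE bidE -[bL a _]/(a [o] _).
  by rewrite compbDl comp1b compbZl.
have hR w : Exp (vopp (bR a)) w = w [o] Exp (vopp a).
  apply: (vconv_unique (u := fun k => ek (vopp (bR a)) k w)); first exact: (bconv_app w (Exp_conv (vopp (bR a)))).
  apply: (vconv_ext (u := fun k => w [o] ek (vopp a) k)); last exact: conv_comp (vconv_const _) (Exp_conv (vopp a)).
  move=> k; rewrite /ek; elim: (Nat.pow 2 k) => [|n IH]; first exact: compb1.
  have e : bpow (bid [+] RtoC (/ 2 ^ k) [*] vopp (bR a)) (S n) w = (bid [+] RtoC (/ 2 ^ k) [*] vopp (bR a)) (bpow (bid [+] RtoC (/ 2 ^ k) [*] vopp (bR a)) n w) by [].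
  rewrite e -IH bpow_S baddE bscalE bidE boppE; move: (bpow _ n) => q.
  by rewrite -[bR a _]/(_ [o] a) bcompA compbDr compb1 compbZr compbNr.
by rewrite bcompE hL hR bcompA.
Qed.

(** P x is the limit of the difference quotients (exp (tP) x - x)/t, which lie in the closed
    subspace; [Exp_first] bounds the error by a multiple of t. *)
Lemma Exp_generator X (P : bop X) (Q : X -> Prop) : closed_vsubspace Q ->
  (forall t, 0 < t -> forall x, Q x -> Q (Exp (RtoC t [*] P) x)) -> forall x, Q x -> Q (P x).
Proof.
move=> Qc h x hx; apply: (closed_cl Qc) => e he; have pP := nm_ge0 P; have px := nm_ge0 x.
pose D := nm P * nm P * exp (nm P) * nm x.
have D0 : 0 <= D by apply: Rmult_le_pos => //; apply: Rmult_le_pos; [exact: Rmult_le_pos | exact: Rlt_le (exp_pos _)].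
pose t := Rmin 1 (e / (2 * (D + 1))).
have d0 : 0 < e / (2 * (D + 1)) by divpos.
have ht : 0 < t by apply: Rmin_pos; lra.
have ht1 : t <= 1 by exact: Rmin_l.
have ht2 : t <= e / (2 * (D + 1)) by exact: Rmin_r.
exists (RtoC (/ t) [*] (Exp (RtoC t [*] P) x [-] x)); split.
  by apply: vsub_scal; [exact: csub_sub | apply: vsub_sub => //; [exact: csub_sub | exact: h]].
have nt : RtoC t <> C0 by apply: RtoC_neq0; lra.
have -> : P x [-] RtoC (/ t) [*] (Exp (RtoC t [*] P) x [-] x) = vopp (RtoC (/ t) [*] ((Exp (RtoC t [*] P) [-] (bid [+] RtoC t [*] P)) x)).
  rewrite baddE boppE baddE bidE bscalE RtoC_inv; last lra.
  by move: (Exp _ x) => w; vec.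
have it : 0 < / t by exact: Rinv_0_lt_compat.
rewrite nm_opp nm_scalR; last lra.
have h1 : nm (RtoC t [*] P) <= t * nm P by rewrite nm_scalR; lra.
have h2 := Exp_first h1.
have h3 : exp (t * nm P) <= exp (nm P).
  case: (Rle_lt_or_eq_dec (t * nm P) (nm P)) => [|/exp_increasing h4|->]; [nra | lra | lra].
have h4 : nm (Exp (RtoC t [*] P) [-] (bid [+] RtoC t [*] P)) <= t * nm P * (t * nm P) * exp (nm P).
  apply: Rle_trans h2 _; apply: Rmult_le_compat_l => //; have := Rmult_le_pos _ _ (Rlt_le _ _ ht) pP; nra.
have h5 := nm_ge (Exp (RtoC t [*] P) [-] (bid [+] RtoC t [*] P)) x.
have h6 := Rmult_le_compat_r _ _ _ px h4.
have h7 := Rmult_le_compat_l _ _ _ (Rlt_le _ _ it) (Rle_trans _ _ _ h5 h6).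
apply: Rle_lt_trans h7 _.
have -> : / t * (t * nm P * (t * nm P) * exp (nm P) * nm x) = t * D by rewrite /D; field; lra.
apply: Rle_lt_trans (Rmult_le_compat_r _ _ _ D0 ht2) _.
have -> : e / (2 * (D + 1)) * D = e/2 - e / (2 * (D + 1)) by field; lra.
lra.
Qed.

Section Grp.
Variables (X : CBanach) (L : bop X -> Prop).

(** Products of exponentials together with the inverse product, written in reverse order. *)
Inductive grp : bop X -> bop X -> Prop :=
| grp0 : grp bid bid
| grpS a h h' : L a -> grp h h' -> grp (Exp a [o] h) (h' [o] Exp (vopp a)).

Definition grpm h := exists h', grp h h'.

Lemma grp_app h h' k k' : grp h h' -> grp k k' -> grp (h [o] k) (k' [o] h').
Proof.
move=> hh hk; elim: hh => [|a {}h {}h' ha _ IH]; first by rewrite comp1b compb1.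
by rewrite bcompA -bcompA; exact: grpS.
Qed.

Lemma grpm_mul h k : grpm h -> grpm k -> grpm (h [o] k).
Proof. by move=> [h' hh] [k' hk]; exists (k' [o] h'); exact: grp_app. Qed.

Lemma grpm1 : grpm bid. Proof. by exists bid; exact: grp0. Qed.

Lemma grpm_Exp a : L a -> grpm (Exp a).
Proof. by move=> ha; exists (bid [o] Exp (vopp a)); rewrite -(compb1 (Exp a)); apply: grpS => //; exact: grp0. Qed.

Lemma grp_inv h h' : grp h h' -> h [o] h' = bid /\ h' [o] h = bid.
Proof.
elim=> [|a {}h {}h' _ _ [IH1 IH2]]; first by rewrite comp1b.
split; first by rewrite bcompA -(bcompA (Exp a)) IH1 compb1 Exp_opp.
by rewrite bcompA -(bcompA h') Exp_oppl compb1 IH2.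
Qed.

Lemma grp_cpt h h' : (forall a, L a -> cpt a) -> grp h h' -> cpt (h [-] bid).
Proof.
move=> Lc; elim=> [|a {}h {}h' ha _ IH]; first by rewrite vadd_opp; exact: cpt_0.
have -> : Exp a [o] h [-] bid = Exp a [o] (h [-] bid) [+] (Exp a [-] bid) by bvec.
by apply: cpt_add; [exact: cpt_compl | apply: Exp_cpt; exact: Lc].
Qed.

Lemma irr_grp : (forall c a, L a -> L (c [*] a)) -> irr L -> irr grpm.
Proof.
move=> LZ hi Q [Qc Qi]; apply: hi; split=> // a ha; apply: (Exp_generator Qc) => t _; apply: Qi; apply: grpm_Exp; exact: LZ.
Qed.
End Grp.

(** The closed algebra A generated by I is a Volterra algebra normalized by every exp a with a in L.
    Hence the products of A with the group of exponentials form a semigroup of compact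
    quasinilpotents stable under an irreducible group. *)
Lemma irr_no_ideal X (L I : bop X -> Prop) : (forall a, L a -> cpt a) -> (forall c a, L a -> L (c [*] a)) ->
  irr L -> (forall x, I x -> cpt x) -> (forall a x, L a -> I x -> I (a [o] x [-] x [o] a)) -> J0f I ->
  forall x, I x -> x = vzero.
Proof.
move=> Lc LZ hi Ic Iad IJ x hx.
have V0 : valg (alg I).
  split; first exact: alg_sub.
  split; first by move=> a b; exact: alg_comp.
  move=> a ha; split; last exact: (J0f_qn (J0f_alg IJ) ha).
  move: a ha; apply: alg_min => //; last by move=> a b _ hb; exact: cpt_compl.
  by split; [exact: cpt_0 | split; [move=> a b; exact: cpt_add | move=> c a; exact: cpt_scal]].
pose A := @cl (BB X X) (alg I).
have vA : valg A := valg_cl V0.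
have Ac : @closed_vsubspace (BB X X) A by apply: cl_closed; exact: alg_sub.
have IA z : alg I z -> A z by exact: cl_incl.
have ad0 a z : L a -> alg I z -> alg I (adk a z).
  move=> ha hz; suff [] : alg I z /\ alg I (adk a z) by [].
  have [S0 [S1 S2]] := alg_sub I.
  move: z hz; apply: (@alg_min _ I (fun z => alg I z /\ alg I (adk a z))).
  - split; first by rewrite bl_0.
    split; first by move=> y z [h1 h2] [h3 h4]; rewrite bl_add; split; exact: S1.
    by move=> c y [h1 h2]; rewrite bl_scal; split; exact: S2.
  - by move=> b hb; split; apply: alg1 => //; exact: Iad.
  move=> b z hb [h1 h2]; split; first exact: alg_mull.
  have -> : adk a (b [o] z) = (a [o] b [-] b [o] a) [o] z [+] b [o] adk a z by rewrite !adkE; bvec.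
  by apply: S1; apply: alg_mull => //; exact: Iad.
have ad1 a z : L a -> A z -> A (adk a z).
  by move=> ha; apply: (@cl_inv (BB X X) (adk a) (alg I)) => y; exact: ad0.
clearbody A; have Lo a : L a -> L (vopp a) by move=> ha; rewrite vopp_scal; exact: LZ.
have nE a : L a -> nrm A (Exp a) (Exp (vopp a)).
  move=> ha; split; first exact: Exp_opp.
  split; first exact: Exp_oppl.
  split; first by apply: Exp_cpt; exact: Lc.
  move=> z hz; split; first by rewrite -Exp_Ad; apply: (@Exp_inv (BB X X) A (adk a)) => // y; exact: ad1.
  have e : a = vopp (vopp a) by vec.
  by rewrite {2}e -Exp_Ad; apply: (@Exp_inv (BB X X) A (adk (vopp a))) => // y; apply: ad1; exact: Lo.
have nG h h' : grp L h h' -> nrm A h h'.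
  elim=> [|a {}h {}h' ha _ IH]; last by apply: nrm_comp => //; exact: nE.
  rewrite /nrm comp1b vadd_opp; split=> //; split=> //; split; first exact: cpt_0.
  by move=> a ha; rewrite comp1b compb1.
have [_ [Am Aq]] := vA.
(* The group is irreducible because L is recovered from it by [Exp_generator]; quasinilpotency of a
   h is [normalized_qn]. *)
pose AG t := exists a h, A a /\ grpm L h /\ t = a [o] h.
have swap h a : grpm L h -> A a -> exists b, A b /\ h [o] a = b [o] h.
  move=> [h' hh] ha; have [n1 [n2 [_ n3]]] := nG _ _ hh.
  by exists (h [o] a [o] h'); split; [case: (n3 a ha) | rewrite -bcompA n2 compb1].
rewrite -(compb1 x).
apply: (irr_no_semigroup (irr_grp LZ hi) (A := AG)); last 1 first.
- by exists x, bid; split; [apply: IA; exact: alg1 | split=> //; exact: grpm1].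
- move=> _ _ [a [h [ha [hh ->]]]] [b [k [hb [hk ->]]]].
  have [c [hc e]] := swap h b hh hb; exists (a [o] c), (h [o] k); split; first exact: Am.
  by split; [exact: grpm_mul | rewrite bcompA -(bcompA a) e !bcompA].
- move=> _ [a [h [ha [[h' hh] ->]]]]; split; first by apply: cpt_compr; case: (Aq a ha).
  exact: (normalized_qn vA (nG _ _ hh)).
- move=> h _ hh [a [k [ha [hk ->]]]]; have [c [hc e]] := swap h a hh ha.
  by exists c, (h [o] k); split=> //; split; [exact: grpm_mul | rewrite !bcompA e].
by move=> h _ hh [a [k [ha [hk ->]]]]; exists a, (k [o] h); split=> //; split; [exact: grpm_mul | rewrite bcompA].
Qed.

(** * Graded algebras without finite-rank operators *)

(** Left and right multiplications commute, so each word in them is z -> K^i z K^j with i + j the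
    length; ad K has weight 2 over these two. *)
Lemma gr_adk X (K : bop X) eps : 0 < eps -> gr K eps -> gr (adk K) (2 * eps).
Proof.
move=> he [C hC]; have C0' : 0 <= C by have := hC 0%nat; rewrite pow_O; have := nm_ge0 (bpow K 0); lra.
apply/J_single.
have hJ : J (fun T => T = bL K \/ T = bR K) eps.
  exists (C * C) => n T hT.
  have [i [j [<- hz]]] : exists i j, (i + j = n)%nat /\ forall z, T z = bpow K i [o] z [o] bpow K j.
    elim: hT => [|a {}n {}T ha _ [i [j [<- IH]]]].
      by exists 0%nat, 0%nat; split=> // z; rewrite comp1b compb1.
    case: ha => ->.
      by exists (S i), j; split=> // z; rewrite bcompE IH -[bL K _]/(K [o] _) !bcompA.
    exists i, (S j); split; first lia.
    by move=> z; rewrite bcompE IH -[bR K _]/(_ [o] K) bpow_S bcompA.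
  have p1 : 0 <= C * eps ^ i by apply: Rmult_le_pos => //; apply: pow_le; lra.
  have p2 : 0 <= C * eps ^ j by apply: Rmult_le_pos => //; apply: pow_le; lra.
  rewrite pow_add; apply: nm_le => [|z]; first by have := Rmult_le_pos _ _ p1 p2; lra.
  rewrite hz; apply: Rle_trans (nm_comp _ _) _; have h1 := nm_comp (bpow K i) z.
  have h2 := nm_mulr z (hC i).
  have h3 := Rmult_le_compat _ _ _ _ (nm_ge0 _) (nm_ge0 _) (Rle_trans _ _ _ h1 h2) (hC j); lra.
apply: (cmb_J (P := fun T => T = bL K \/ T = bR K)) hJ _; [lra | lra |] => b ->.
exists (1 + Cmod (- C1)%C * 1); split; first by rewrite Cmod_opp Cmod_C1; lra.
rewrite /adk vopp_scal; apply: cmbD; first by apply: cmb1; left.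
by apply: cmbZ; apply: cmb1; right.
Qed.

Definition fr X (T : bop X) := fd (fun y => exists x, y = T x).

Lemma fr_compl X (S T : bop X) : fr T -> fr (S [o] T).
Proof. by move=> h; apply: fd_sub (fd_map S h) => _ [x ->]; exists (T x); split=> //; exists x. Qed.

Lemma fr_compr X (S T : bop X) : fr S -> fr (S [o] T).
Proof. by apply: fd_sub => _ [x ->]; exists (T x). Qed.

Lemma fr_add X (S T : bop X) : fr S -> fr T -> fr (S [+] T).
Proof.
move=> hS hT; apply: fd_sub (fd_add hS hT) => _ [x ->]; exists (S x), (T x); split; first by exists x.
by split=> //; exists x.
Qed.

Lemma fr_opp X (T : bop X) : fr T -> fr (vopp T).
Proof.
move=> h; have -> : vopp T = vopp bid [o] T by bvec.
exact: fr_compl.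
Qed.

Lemma fr_proj X (e : bop X) : cpt e -> e [o] e = e -> fr e.
Proof.
move=> he ee; apply: (fd_sub (N := fun x => e x = x)); first by move=> _ [x ->]; rewrite -bcompE ee.
apply: (fd_cpt (e := e)) => //; split; first exact: bl_0.
by split=> [x y hx hy|c x hx]; rewrite ?bl_add ?bl_scal ?hx ?hy.
Qed.

(* If V contains no nonzero finite-rank operator, the large spectral part d of the splitting vanishes: its compression to
   the part of the space where K is small is zero. *)
Theorem adm_pointwise X (K h' : bop X) (V : bop X -> Prop) s0 x : cpt K ->
  (bid [+] K) [o] h' = bid -> h' [o] (bid [+] K) = bid -> @closed_vsubspace (BB X X) V ->
  (forall z, V z -> V ((bid [+] K) [o] z [o] h')) -> (forall d, V d -> fr d -> d = vzero) -> 0 < s0 -> V x ->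
  exists B, forall m, nm (bpow (adm (bid [+] K) h') m x) <= B * s0 ^ m.
Proof.
move=> hK hr hl Vc Vi Vf hs0 hx.
have [s [sp [ss0 hs]]] := adm_split hK hr hl Vc Vi hs0.
have [B [c [d [hc [hd [ex [gc gd]]]]]]] := hs x hx.
have ph := nm_ge0 h'.
(* Makes 2 ep |h'| / s < 1: 2 ep bounds ad (K e0), |h'| is the price of passing from ad to [adm],
   and s bounds z from above by B / s^m. *)
pose ep := s / (4 * (nm h' + 1)).
have hep : 0 < ep by divpos.
have [l [e0 [_ [eb [eK [ee [ec hg]]]]]]] := peel hK hep.
set h := bid [+] K in hr hl Vi gc gd *.
have e0d : e0 [o] d [o] e0 = vzero.
  apply: nm_small0 => e1 he1; have pe := nm_ge0 e0.
  have [C hC] := gr_adk hep hg.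
  have C00 : 0 <= C by have := hC 0%nat; rewrite pow_O; have := nm_ge0 (bpow (adk (K [o] e0)) 0); lra.
  have eh : e0 [o] h = h [o] e0 by rewrite /h compbDl compbDr eK; bvec.
  have eh' : e0 [o] h' = h' [o] e0.
    by rewrite -(comp1b (e0 [o] h')) -hl -(bcompA h') (bcompA h) -eh -!bcompA hr compb1.
  have q1 : 2 * ep * nm h' / s < 1.
    have -> : 2 * ep * nm h' / s = nm h' / (2 * (nm h' + 1)) by rewrite /ep; field; lra.
    by apply: (Rmult_lt_reg_r (2 * (nm h' + 1))); [lra | rewrite /Rdiv Rmult_assoc Rinv_l; lra].
  have q0 : 0 <= 2 * ep * nm h' / s by apply: Rmult_le_pos; [nra | exact: Rinv_ge0].
  have [m hm] := @pow_ratio_small (C * nm e0 * nm e0 * Rabs B) _ 1 (e1/2) q0 q1 ltac:(lra).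
  have hm1 := hm (S m) ltac:(lia); rewrite pow1 Rmult_1_r in hm1.
  have d0 : 0 < e1 / (2 * (nm e0 * nm e0 + 1)) by apply: Rdiv_lt_0_compat => //; nra.
  have [z [hz [hz1 hz2]]] := gd (S m) _ ltac:(lia) d0.
  have ez : nm (e0 [o] bpow (adm h h') (S m) z [o] e0) <= e1/2.
    have h1 : bpow (adm h h') (S m) z = bpow (adk K) (S m) z [o] bpow h' (S m).
      rewrite -(adm_adk (h' := h')) // -bcompA -bpow_comp; last by rewrite -/h hr hl.
      rewrite -/h hr; have -> : bpow bid (S m) = bid :> bop X by elim: (S m) => [//|n IH]; rewrite -[bpow _ (S n)]/(bid [o] bpow bid n) IH comp1b.
      by rewrite compb1.
    have h2 : e0 [o] bpow (adm h h') (S m) z [o] e0 = bpow (adk (K [o] e0)) (S m) (e0 [o] z [o] e0) [o] bpow h' (S m).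
      have eq1 := bpow_comm (S m) eh'.
      rewrite h1; move: (bpow h' _) eq1 => q eq1; rewrite bcompA -(bcompA (e0 [o] _)) -eq1 (bcompA (e0 [o] _)).
      congr (_ [o] q); rewrite (adk_pow_comm _ _ eK).1 (adk_pow_comm _ _ eK).2.
      elim: (S m) => [//|n IH]; rewrite -[bpow (adk K) (S n)]/(adk K [o] bpow (adk K) n).
      rewrite -[bpow (adk (K [o] e0)) (S n)]/(adk (K [o] e0) [o] bpow (adk (K [o] e0)) n) !bcompE -IH !adkE.
      have ff := adk_pow_comm (e0 [o] z [o] e0) n eK.
      have f1 : e0 [o] bpow (adk K) n (e0 [o] z [o] e0) = bpow (adk K) n (e0 [o] z [o] e0) by rewrite ff.1 !bcompA ee.
      have f2 : bpow (adk K) n (e0 [o] z [o] e0) [o] e0 = bpow (adk K) n (e0 [o] z [o] e0) by rewrite ff.2 -!bcompA ee.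
      by move: (bpow (adk K) n _) f1 f2 => w f1 f2; rewrite -(bcompA K) f1 -eK (bcompA w) f2.
    rewrite h2; apply: Rle_trans (nm_comp _ _) _.
    have i1 := nm_ge (bpow (adk (K [o] e0)) (S m)) (e0 [o] z [o] e0).
    have i2 : nm (e0 [o] z [o] e0) <= nm e0 * nm z * nm e0.
      by apply: Rle_trans (nm_comp _ _) _; apply: Rmult_le_compat_r => //; exact: nm_comp.
    have i3 := Rmult_le_compat _ _ _ _ (nm_ge0 _) (nm_ge0 _) (hC (S m)) i2.
    have i4 := Rmult_le_compat _ _ _ _ (nm_ge0 _) (nm_ge0 _) (Rle_trans _ _ _ i1 i3) (nm_bpow h' (S m)).
    apply: Rle_trans i4 _; apply: Rle_trans _ hm1.
    have -> : (2 * ep * nm h' / s) ^ S m = (2 * ep) ^ S m * nm h' ^ S m * / s ^ S m.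
      have -> : 2 * ep * nm h' / s = 2 * ep * nm h' * / s by [].
      by rewrite -pow_inv (Rpow_mult_distr _ (/ s)) (Rpow_mult_distr (2 * ep)).
    have sm : 0 < s ^ S m by exact: pow_lt.
    have zb : nm z <= Rabs B * / s ^ S m.
      apply: (Rmult_le_reg_l (s ^ S m)) => //; have := RRle_abs B.
      by have -> : s ^ S m * (Rabs B * / s ^ S m) = Rabs B by [field; lra]; lra.
    have p1 : 0 <= C * (2 * ep) ^ S m * nm e0 * nm e0 * nm h' ^ S m.
      have a1 : 0 <= C * (2 * ep) ^ S m by apply: Rmult_le_pos => //; apply: pow_le; lra.
      exact: (Rmult_le_pos _ _ (Rmult_le_pos _ _ (Rmult_le_pos _ _ a1 pe) pe) (pow_le _ _ ph)).
    by have := Rmult_le_compat_l _ _ _ p1 zb; lra.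
  have -> : e0 [o] d [o] e0 = e0 [o] (d [-] bpow (adm h h') (S m) z) [o] e0 [+] e0 [o] bpow (adm h h') (S m) z [o] e0.
    by move: (bpow _ _ z) => w; bvec.
  apply: Rle_trans (vnorm_triangle _ _) _.
  have i1 := nm_comp (e0 [o] (d [-] bpow (adm h h') (S m) z)) e0; have i2 := nm_comp e0 (d [-] bpow (adm h h') (S m) z).
  have i3 := Rmult_le_compat_r _ _ _ pe i2; have i4 := Rmult_le_compat_l _ _ _ (Rmult_le_pos _ _ pe pe) hz2.
  have i5 : nm e0 * nm e0 * (e1 / (2 * (nm e0 * nm e0 + 1))) = e1/2 - e1 / (2 * (nm e0 * nm e0 + 1)) by field; nra.
  lra.
have ff : fr (sume l).
  apply: fr_proj => //; have -> : sume l = bid [-] e0 by rewrite eb; vec.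
  have -> : (bid [-] e0) [o] (bid [-] e0) = bid [-] e0 [-] e0 [+] e0 [o] e0 by bvec.
  by rewrite ee; vec.
(* Since e0 d e0 = 0, each remaining block of d contains the finite-rank factor [sume l]; d lies in
   V and therefore vanishes. *)
have d0 : d = vzero.
  have e1 : d = e0 [o] d [+] sume l [o] d by rewrite -compbDl -eb comp1b.
  have e2 : e0 [o] d = e0 [o] d [o] sume l by apply: eq_trans (_ : e0 [o] d [o] e0 [+] e0 [o] d [o] sume l = _); [rewrite -compbDr -eb compb1 | rewrite e0d vadd_0l].
  apply: Vf => //; rewrite e1; apply: fr_add; [rewrite e2; exact: fr_compl | exact: fr_compr].
exists (Rabs B) => m; rewrite ex d0 vadd_0; apply: Rle_trans (gc m) _.
have sm : 0 <= s ^ m by apply: pow_le; lra.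
apply: Rle_trans (Rmult_le_compat_r _ _ _ sm (RRle_abs B)) _; apply: Rmult_le_compat_l; first exact: Rabs_pos.
by apply: pow_incr; lra.
Qed.

(** Slow growth of ad K on L makes the block (1 - e) x e zero, by [offdiag], so the root space is
    invariant. Irreducibility forces e = 1: the space is finite-dimensional and K - kap
    nilpotent. *)
Lemma riesz_irr X (L : bop X -> Prop) (K : bop X) kap y : irr L -> cpt K ->
  (forall x, L x -> forall t, 0 < t -> exists D, forall m, nm (bpow (adk K) m x) <= D * t ^ m) ->
  kap <> C0 -> K y = kap [*] y -> y <> vzero -> fr (bid : bop X) /\ exists n, bpow (shf K kap) n = vzero.
Proof.
move=> Li hK growth kz hy ny.
have [n [e [ee [eK [ek' [ekx [c0 [hc0 elb]]]]]]]] := riesz_proj hK kz.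
have fK : (bid [-] e) [o] K = K [o] (bid [-] e) by rewrite compbDl compbDr compbNl compbNr eK; bvec.
have od x : L x -> (bid [-] e) [o] x [o] e = vzero.
  move=> hx; have [D hD] := growth x hx (c0/2) ltac:(lra).
  apply: (offdiag (k := n) (t := c0/2) (D := nm (bid [-] e) * D * nm e) eK elb); last move=> m; try lra.
  - by rewrite !bcompA compbDr compbNr ee compb1 vadd_opp !comp0b.
  - by rewrite -bcompA (shf_pow_comm kap n eK) ek' compb0.
  rewrite -(adk_pow_comm _ m eK).2 -(adk_pow_comm _ m fK).1.
  have i1 := nm_comp ((bid [-] e) [o] bpow (adk K) m x) e; have i2 := nm_comp (bid [-] e) (bpow (adk K) m x).
  have i3 := nm_mull (bid [-] e) (hD m).
  by have := nm_mulr e (Rle_trans _ _ _ i2 i3); lra.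
have ce := nil_cpt hK kz ek'.
case: (Li (fun x => (bid [-] e) x = vzero)).
- split; first exact: csub_ker.
  move=> b hb x hx; have ex : e x = x by apply: esym; apply: vsub_eq0.
  by have := f_equal (fun T : bop X => T x) (od b hb); rewrite !bcompE ex.
- move=> h; case: ny; apply: h; rewrite baddE boppE bidE (ekx 1%nat) ?vadd_opp //.
  by rewrite -[bpow _ _]/(shf K kap [o] bid) compb1 shfE hy; exact: vadd_opp.
move=> h; have eb : e = bid by apply: blin_ext => x; apply: esym; apply: vsub_eq0; exact: h.
rewrite eb in ce ek'; split; first by apply: fr_proj => //; exact: comp1b.
by exists n; rewrite -[LHS]compb1.
Qed.

(** * Finite powers of a Banach space and permutation operators *)

Section PiSpace.
Variables (I : Type) (el : list I) (Y : CBanach).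
Hypothesis elND : NoDup el.
Hypothesis elI : forall i, In i el.

Let lsum (l : list I) (f : I -> Y) : R := fold_right (fun i r => nm (f i) + r) 0 l.

Let lsum_ge0 l f : 0 <= lsum l f.
Proof. by elim: l => [|i l IH] /=; [lra | have := nm_ge0 (f i); lra]. Qed.

Let lsum_ge l f i : In i l -> nm (f i) <= lsum l f.
Proof.
elim: l => [//|j l IH] /= [->|/IH h]; first by have := lsum_ge0 l f; lra.
by have := nm_ge0 (f j); lra.
Qed.

Let lsum_le l f C : (forall i, nm (f i) <= C) -> lsum l f <= INR (length l) * C.
Proof.
move=> h; elim: l => [|i l IH]; first by rewrite /=; lra.
by rewrite [length _]/= S_INR /=; have := h i; lra.
Qed.

Local Obligation Tactic := idtac.
Program Definition Pi : CBanach := @Build_CBanach (I -> Y) (fun f g i => f i [+] g i) (fun _ => vzero)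
  (fun f i => vopp (f i)) (fun c f i => c [*] f i) (lsum el) _ _ _ _ _ _ _ _ _ _ _ _.
Solve Obligations with (by move=> *; apply: boolp.funext => i; vec).
Next Obligation.
move=> f h; apply: boolp.funext => i; apply: vnorm_eq0.
by have := lsum_ge f (elI i); have := nm_ge0 (f i); lra.
Qed.
Next Obligation. by move=> f g; elim: el => [|i l IH] /=; [lra | have := vnorm_triangle (f i) (g i); lra]. Qed.
Next Obligation. by move=> a f; elim: el => [|i l IH] /=; [lra | rewrite vnorm_scal IH; ring]. Qed.
Next Obligation.
move=> u hu.
have hc i : exists l, vconv (fun n => u n i) l.
  apply: vcomplete => e he; have [N hN] := hu e he; exists N => m n hm hn.
  by apply: Rle_lt_trans (hN m n hm hn); exact: (lsum_ge (fun i => u m i [-] u n i) (elI i)).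
have [l hl] := choice_fun hc; exists l => e he.
suff : forall k : list I, exists N, forall n, (N <= n)%nat -> lsum k (fun i => u n i [-] l i) < e by apply.
move=> k; elim: k e he => [|i k IH] e he; first by exists 0%nat => n _ /=.
have [N hN] := IH (e/2) ltac:(lra); have [N' hN'] := hl i (e/2) ltac:(lra).
by exists (N + N')%nat => n hn /=; have := hN n ltac:(lia); have := hN' n ltac:(lia); lra.
Qed.

Lemma PaddE (f g : Pi) i : (f [+] g) i = f i [+] g i. Proof. by []. Qed.
Lemma PscalE c (f : Pi) i : (c [*] f) i = c [*] f i. Proof. by []. Qed.

Definition pr (i : I) : blin Pi Y.
Proof.
refine (@mkB Pi Y (fun f => f i) _ _); first by [].
by exists 1 => f; rewrite Rmult_1_l; exact: lsum_ge.
Defined.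

Definition io (i : I) : blin Y Pi.
Proof.
refine (@mkB Y Pi (fun y j => if boolp.pselect (j = i) then y else vzero) _ _).
  by split=> [x y|c x]; apply: boolp.funext => j; rewrite ?PaddE ?PscalE; case: boolp.pselect => h /=; vec.
exists (INR (length el)) => y; apply: lsum_le => j; case: boolp.pselect => h /=; [exact: Rle_refl | rewrite nm_0; exact: nm_ge0].
Defined.

Definition tw (a : bop Y) (s : I -> I) : blin Pi Pi.
Proof.
refine (@mkB Pi Pi (fun f i => a (f (s i))) _ _).
  split=> [f g|c f]; apply: boolp.funext => i.
    exact: (bl_add a (f (s i)) (g (s i))).
  exact: (bl_scal a c (f (s i))).
exists (INR (length el) * nm a) => f; rewrite Rmult_assoc; apply: lsum_le => i.
apply: Rle_trans (nm_ge _ _) _; apply: nm_mull; exact: (lsum_ge f (elI (s i))).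
Defined.

Let vs (l : list I) (f : I -> Y) : Y := fold_right (fun i r => f i [+] r) vzero l.

Definition sm : blin Pi Y.
Proof.
refine (@mkB Pi Y (vs el) _ _).
  by split=> [f g|c f]; elim: el => [|i l IH] /=; rewrite ?IH ?PaddE ?PscalE; vec.
exists 1 => f; rewrite Rmult_1_l; suff h l : nm (vs l f) <= lsum l f by exact: (h el).
elim: l => [|i l IH]; first by rewrite nm_0; exact: Rle_refl.
by apply: Rle_trans (vnorm_triangle _ _) _; apply: Rplus_le_compat_l; exact: IH.
Defined.

Lemma ioE i j y : io i y j = if boolp.pselect (j = i) then y else vzero. Proof. by []. Qed.

Lemma tw_comp a b s t : tw a s [o] tw b t = tw (a [o] b) (fun i => t (s i)).
Proof. by apply: blin_ext => f; apply: boolp.funext => i. Qed.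

Let vs_map (g : I -> I) l f : vs (map g l) f = vs l (fun i => f (g i)).
Proof. by elim: l => [//|i l IH] /=; rewrite IH. Qed.

Let vs_perm l l' f : Permutation.Permutation l l' -> vs l f = vs l' f.
Proof. by elim=> [//|i k k' _ /= ->//|i j k /=|k1 k2 k3 _ -> _ ->//]; vec. Qed.

(** Summation over all coordinates ignores the permutation s. This makes [sm] a map intertwining the
    lifted operators with the original ones, whatever their degree. *)
Lemma sm_tw a s t : (forall i, s (t i) = i) -> (forall i, t (s i) = i) -> sm [o] tw a s = a [o] sm.
Proof.
move=> st ts; apply: blin_ext => f.
have -> : (sm [o] tw a s) f = vs el (fun i => a (f (s i))) by [].
rewrite -(vs_map s el (fun i => a (f i))) (@vs_perm _ el); last first.
  apply: Permutation.NoDup_Permutation => //.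
    apply: (@NoDup_map_inv I I t); rewrite map_map (_ : map _ el = el) //.
    by rewrite -[RHS]map_id; apply: map_ext.
  by move=> i; split=> // _; apply/in_map_iff; exists (t i).
have -> : (a [o] sm) f = a (vs el f) by [].
by elim: el => [|i l IH] /=; rewrite ?bl_0 // IH bl_add.
Qed.

Lemma sm_io i : sm [o] io i = bid.
Proof.
apply: blin_ext => y; have -> : (sm [o] io i) y = vs el (io i y) by [].
have h l : NoDup l -> vs l (io i y) = if boolp.pselect (In i l) then y else vzero.
  elim: l => [|j l IH] nd /=; first by case: boolp.pselect.
  inversion nd as [|? ? hj hl]; subst; rewrite IH // ?ioE.
  case: boolp.pselect => h1; case: boolp.pselect => h2; case: boolp.pselect => h3 /=; try (vec; done);
    try (by case: hj; rewrite h1); try (by case: h3; left); try (by case: h3; right).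
  by case: h3 => e; [case: h1 | case: h2].
by rewrite h //; case: boolp.pselect => // -[]; exact: elI.
Qed.

Lemma tw_cpt a s : cpt a -> cpt (tw a s).
Proof.
move=> ha; pose F l := fold_right (fun i (T : BB Pi Pi) => io i [o] a [o] pr (s i) [+] T) vzero l.
have -> : tw a s = F el.
  apply: blin_ext => f; apply: boolp.funext => j.
  have h l : NoDup l -> (F l : blin Pi Pi) f j = if boolp.pselect (In j l) then a (f (s j)) else vzero.
    elim: l => [|i l IH] nd; first by case: boolp.pselect.
    inversion nd as [|? ? hi hl]; subst.
    have -> : (F (i :: l) : blin Pi Pi) f j = io i (a (f (s i))) j [+] (F l : blin Pi Pi) f j by [].
    rewrite IH // ioE.
    case: boolp.pselect => h1; case: boolp.pselect => h2; case: boolp.pselect => h3 /=; rewrite ?h1; try (vec; done);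
      try (by case: hi; rewrite -h1); try (by case: h3; left); try (by case: h3; right).
    by case: h3 => e; [case: h1 | case: h2].
  by rewrite h //; case: boolp.pselect => // -[]; exact: elI.
rewrite /F; elim: el => [|i l IH] /=; first exact: cpt_0.
by apply: cpt_add => //; apply: cpt_compr; exact: cpt_compl.
Qed.
End PiSpace.

Lemma csub_pre X Y (T : blin X Y) (Q : Y -> Prop) : closed_vsubspace Q -> closed_vsubspace (fun x => Q (T x)).
Proof.
move=> [q0 [q1 [q2 q3]]]; split; first by rewrite bl_0.
split; first by move=> x y hx hy; rewrite bl_add; exact: q1.
split; first by move=> c x hx; rewrite bl_scal; exact: q2.
by move=> u l hu hl; apply: (q3 (fun n => T (u n))) => //; exact: bl_conv.
Qed.

Definition bLR X Y (A : blin X Y) (B : blin Y X) : blin (BB X X) (BB Y Y).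
Proof.
refine (@mkB (BB X X) (BB Y Y) (fun T => A [o] T [o] B) _ _).
  by split=> [S T|c T]; bvec.
exists (nm A * nm B) => T; apply: Rle_trans (nm_comp _ _) _.
have := nm_mulr B (nm_comp A T); lra.
Defined.

Section Average.
Variable X : CBanach.
Implicit Types (F G : R -> bop X) (B : nat -> bop X).

(* Dyadic average over the 2^k-th roots of unity extracting the coefficient of [cis t]. *)
Fixpoint av F k t : bop X :=
  match k with
  | O => F t
  | S k => RtoC (1/2) [*] (av F k t [+] cis (- (PI / 2 ^ k)) [*] av F k (t + PI / 2 ^ k))
  end.

Lemma avS F k t : av F (S k) t = RtoC (1/2) [*] (av F k t [+] cis (- (PI / 2 ^ k)) [*] av F k (t + PI / 2 ^ k)).
Proof. by []. Qed.

Lemma av_le F G b k t : (forall t, nm (F t [-] G t) <= b) -> nm (av F k t [-] av G k t) <= b.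
Proof.
move=> h; elim: k t => [|k IH] t; first exact: h.
rewrite !avS; move: (IH t) (IH (t + PI / 2 ^ k)) (Cmod_cis (- (PI / 2 ^ k))).
move: (av F k _) (av G k _) (av F k t) (av G k t) (cis _) => x' y' x y c h1 h2 hc.
have -> : RtoC (1/2) [*] (x [+] c [*] x') [-] RtoC (1/2) [*] (y [+] c [*] y') = RtoC (1/2) [*] ((x [-] y) [+] c [*] (x' [-] y')).
  by move: (RtoC _) => r; vec.
by apply: nm_half => //; rewrite vnorm_scal hc Rmult_1_l.
Qed.

Lemma av_cmb F (P : bop X -> Prop) k t : (forall t, P (F t)) -> cmb P 1 (av F k t).
Proof.
move=> h; elim: k t => [|k IH] t; first exact: cmb1.
have e : 1 = Cmod (RtoC (1/2)) * (1 + Cmod (cis (- (PI / 2 ^ k))) * 1) by rewrite Cmod_cis Cmod_RtoC_pos; lra.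
by rewrite {1}e; apply: cmbZ; apply: cmbD => //; exact: cmbZ.
Qed.

Fixpoint tp B N t : bop X := match N with O => vzero | S N => tp B N t [+] cis (INR N * t) [*] B N end.

Lemma av_ext F G k t : (forall t, F t = G t) -> av F k t = av G k t.
Proof. by move=> h; elim: k t => [|k IH] t /=; rewrite ?h ?IH. Qed.

Lemma av_add F G k t : av (fun t => F t [+] G t) k t = av F k t [+] av G k t.
Proof.
elim: k t => [//|k IH] t; rewrite !avS !IH; move: (RtoC _) (cis _) => r c.
by move: (av F k _) (av G k _) (av F k t) (av G k t) => x' y' x y; vec.
Qed.

Lemma odd_cis k x : (1 <= x)%nat -> (x < Nat.pow 2 k)%nat -> exists j, (j < k)%nat /\ cis (INR x * (PI / 2 ^ j)) = (- C1)%C.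
Proof.
elim: k x => [|k IH] x h1 h2; first by move: h2 => /=; lia.
case: (Nat.Even_or_Odd x) => -[y e].
  have [||j [hj1 hj2]] := IH y; [lia | by move: h2; rewrite pow2_split; lia |].
  exists (S j); split; first lia.
  rewrite -hj2 e mult_INR; congr cis; rewrite /=; field; apply: pow_nonzero; lra.
exists 0%nat; split; first lia.
rewrite e plus_INR mult_INR /= Rdiv_1_r.
have -> : ((1 + 1) * INR y + 1) * PI = INR y * (2 * PI) + PI by ring.
by rewrite cis_add INR_IZR_INZ cis_IZR cis_PI; ring.
Qed.

Fixpoint ac k m : Cplx := match k with O => C1 | S k => (RtoC (1/2) * (ac k m * (C1 + cis ((INR m - 1) * (PI / 2 ^ k)))))%C end.

Lemma av_single (b : bop X) k m t : av (fun t => cis (INR m * t) [*] b) k t = (ac k m * cis (INR m * t))%C [*] b.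
Proof.
elim: k t => [|k IH] t; first by rewrite /=; vec.
rewrite avS !IH -[ac (S k) m]/(RtoC (1/2) * (ac k m * (C1 + cis ((INR m - 1) * (PI / 2 ^ k)))))%C.
have -> : cis ((INR m - 1) * (PI / 2 ^ k)) = (cis (INR m * (PI / 2 ^ k)) * cis (- (PI / 2 ^ k)))%C.
  by rewrite -cis_add; congr cis; ring.
have -> : cis (INR m * (t + PI / 2 ^ k)) = (cis (INR m * t) * cis (INR m * (PI / 2 ^ k)))%C by rewrite -cis_add; congr cis; ring.
by move: (RtoC _) (ac k m) (cis (INR m * t)) (cis (INR m * _)) (cis (- _)) => r x y z w; vec.
Qed.

Lemma ac_0 k m j : (j < k)%nat -> cis ((INR m - 1) * (PI / 2 ^ j)) = (- C1)%C -> ac k m = C0.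
Proof.
elim: k => [|k IH] hj e; first lia.
rewrite -[ac (S k) m]/(RtoC (1/2) * (ac k m * (C1 + cis ((INR m - 1) * (PI / 2 ^ k)))))%C.
case: (Nat.eq_dec j k) => [<-|nj]; first by rewrite e; ring.
by rewrite IH //; [ring | lia].
Qed.

Lemma ac_1 k : ac k 1 = C1.
Proof.
elim: k => [//|k IH]; rewrite -[ac (S k) 1]/(RtoC (1/2) * (ac k 1 * (C1 + cis ((INR 1 - 1) * (PI / 2 ^ k)))))%C IH.
have -> : (INR 1 - 1) * (PI / 2 ^ k) = 0 by rewrite /=; ring.
by rewrite cis_0; apply: C_eq => /=; field.
Qed.

(** Averaging over the 2^k-th roots of unity keeps the coefficients of index 1 modulo 2^k. Among
    indices up to 2^k only 1 qualifies; k >= 1 is what removes index 0. *)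
Lemma av_tp B k N : (1 <= k)%nat -> (2 <= N)%nat -> (N <= S (Nat.pow 2 k))%nat -> av (tp B N) k 0 = B 1%nat.
Proof.
move=> hk; elim: N => [|N IH] h2 h3; first lia.
rewrite (av_ext (G := fun t => tp B N t [+] cis (INR N * t) [*] B N)) // av_add av_single.
have vanish m : (m <> 1)%nat -> (m <= Nat.pow 2 k)%nat -> ac k m = C0.
  move=> m1 m2; case: m m1 m2 => [|m] m1 m2.
    by apply: (@ac_0 k 0 0) => //; rewrite /= (_ : (0 - 1) * (PI / 1) = - PI); [rewrite /cis cos_neg sin_neg cos_PI sin_PI; apply: C_eq => /=; ring | field].
  have [||j [hj1 hj2]] := @odd_cis k m; [lia | lia |].
  by apply: (ac_0 hj1); rewrite S_INR -hj2; congr cis; ring.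
have av0 t : av (fun _ => vzero) k t = vzero.
  by elim: (k) t => [//|j IHj] t /=; rewrite !IHj; vec.
case: (Nat.eq_dec N 1) => [->|n1].
  rewrite ac_1 Rmult_0_r cis_0 (av_ext (G := fun t => vzero [+] cis (INR 0 * t) [*] B 0%nat)) // av_add av_single av0 vanish //; last lia.
  vec.
rewrite vanish //; last lia.
by rewrite IH; [vec | lia | lia].
Qed.

Lemma tp_add B B' N t : tp (fun m => B m [+] B' m) N t = tp B N t [+] tp B' N t.
Proof. by elim: N => [|N IH] /=; [vec | rewrite IH; move: (cis _) => c; vec]. Qed.

Lemma tp_shift (q : bop X) B N t : tp (fun m => match m with O => vzero | S m => q [o] B m end) (S N) t = (cis t [*] q) [o] tp B N t.
Proof.
elim: N => [|N IH]; first by rewrite /=; move: (cis (0 * t)) => c; bvec.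
rewrite -[LHS]/(tp _ (S N) t [+] cis (INR (S N) * t) [*] (q [o] B N)) IH.
have -> : cis (INR (S N) * t) = (cis (INR N * t) * cis t)%C by rewrite -cis_add S_INR; congr cis; ring.
by rewrite /=; move: (cis (INR N * t)) (cis t) => c d; bvec.
Qed.

Lemma tp_pow (q : bop X) n : exists B, B 0%nat = bid /\ B 1%nat = RtoC (INR n) [*] q /\ (forall m, (n < m)%nat -> B m = vzero) /\
  forall t, bpow (bid [+] cis t [*] q) n = tp B (S n) t.
Proof.
elim: n => [|n [B [h0 [h1 [h2 h3]]]]].
  exists (fun m => if Nat.eqb m 0 then bid else vzero); split=> //; split; first by rewrite (_ : RtoC (INR 0) = C0) // vscal_0.
  split; first by move=> [|m] hm //; lia.
  by move=> t; rewrite /= Rmult_0_l cis_0; vec.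
exists (fun m => B m [+] match m with O => vzero | S m => q [o] B m end); split; first by rewrite h0; vec.
split.
  have e1 : RtoC 1 = C1 by [].
  by rewrite h1 h0 compb1 S_INR RtoC_add e1; move: (RtoC (INR n)) => r; vec.
split.
  move=> [|m] hm; first lia.
  by rewrite !h2; [bvec | lia | lia].
move=> t; rewrite tp_add tp_shift -h3.
rewrite -[tp B (S (S n)) t]/(tp B (S n) t [+] cis (INR (S n) * t) [*] B (S n)) -h3 h2; last lia.
by rewrite -[bpow _ (S n)]/((bid [+] cis t [*] q) [o] bpow (bid [+] cis t [*] q) n); move: (bpow _ n) => z; move: (cis (INR (S n) * t)) (cis t) => d c; bvec.
Qed.

(** The coefficient of cis t in exp (r cis t a) is r a. Averaging has total weight 1 and division by
    r makes it 1/r, so a is approximated with weight as small as desired by taking r large. *)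
Theorem Exp_average (a : bop X) eta c : 0 < eta -> 0 < c ->
  exists K' d, nm (K' [-] a) <= eta /\ d <= c /\ cmb (fun T => exists z, T = Exp (z [*] a)) d K'.
Proof.
move=> he hc; pose r := 1 + / c; have ic := Rinv_0_lt_compat _ hc; have hr : 0 < r by rewrite /r; lra.
pose b := r * nm a; pose D := b * b * exp b.
have D0 : 0 <= D by apply: Rmult_le_pos; [have := Rle_0_sqr b; rewrite /Rsqr | exact: Rlt_le (exp_pos _)].
(* The successor ensures n >= 1, as needed by [av_tp]; the same n serves as degree exponent of the
   Euler product and as number of averaging steps. *)
have [n hn] := half_pow_small D he; have hn1 := hn (S n) ltac:(lia); move: (S n) hn1 (ltac:(lia) : (1 <= S n)%nat) => {hn} {}n hn hn1.
pose F t := Exp ((RtoC r * cis t)%C [*] a); pose P t := ek ((RtoC r * cis t)%C [*] a) n.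
have FP t : nm (F t [-] P t) <= D * (1/2) ^ n.
  rewrite (nm_sym (F t)); apply: Exp_bd; rewrite vnorm_scal Cmod_mul Cmod_cis Cmod_RtoC_pos; rewrite /b; lra.
have [B [_ [B1 [_ hB]]]] := tp_pow (RtoC (r * / 2 ^ n) [*] a) (Nat.pow 2 n).
have aP : av P n 0 = RtoC r [*] a.
  rewrite (av_ext (G := tp B (S (Nat.pow 2 n)))) ?av_tp //; last 2 first.
  - by have := pow2_pos n; lia.
  - move=> t; rewrite -hB /P /ek; congr (bpow (_ [+] _) _); rewrite !vscal_mul; congr (_ [*] _); rewrite RtoC_mul; ring.
  rewrite B1 vscal_mul -RtoC_mul INR_pow2; congr (RtoC _ [*] _).
  by field; apply: pow_nonzero; lra.
exists (RtoC (/ r) [*] av F n 0), (Cmod (RtoC (/ r)) * 1).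
have ir : 0 < / r by exact: Rinv_0_lt_compat.
split; last split.
- have -> : RtoC (/ r) [*] av F n 0 [-] a = RtoC (/ r) [*] (av F n 0 [-] av P n 0).
    rewrite aP; have nr : RtoC r <> C0 by apply: RtoC_neq0; lra.
    rewrite RtoC_inv; last lra.
    by move: (RtoC r) nr => x nr; vec.
  rewrite nm_scalR; last lra.
  have h := av_le n 0 FP; have i1 : / r <= 1 by rewrite -Rinv_1; apply: Rinv_le_contravar; rewrite /r; lra.
  have := nm_ge0 (av F n 0 [-] av P n 0); nra.
- rewrite Rmult_1_r Cmod_RtoC_pos; last lra.
  by rewrite -(Rinv_inv c); apply: Rinv_le_contravar => //; rewrite /r; lra.
by apply: cmbZ; apply: av_cmb => t; exists (RtoC r * cis t)%C.
Qed.
End Average.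

Lemma enum_NoDup (G : finZmodType) : NoDup (enum G) /\ forall i : G, In i (enum G).
Proof.
have h (s : list G) : (forall x, seq.mem_seq s x = true <-> In x s) /\ (seq.uniq s -> NoDup s).
  elim: s => [|x s [IH1 IH2]]; first by split=> // _; exact: NoDup_nil.
  have e1 y : seq.mem_seq (x :: s) y = true <-> In y (x :: s).
    rewrite /=; split; first by move=> /orP [/eqP ->|/IH1 h]; [left | right].
    by move=> [->|/IH1 h]; apply/orP; [left | right].
  split=> //= /andP [h1 /IH2 h2]; apply: NoDup_cons => // /IH1 h3; by move/negP: h1; apply.
split; first by apply: (h _).2; exact: enum_uniq.
by move=> i; apply/(h _).1; exact: (mem_enum G i).
Qed.

Section Grading.
Variables (G : finZmodType) (Y : CBanach) (Lg : G -> bop Y -> Prop).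
Hypothesis Lc : forall g, @closed_vsubspace (BB Y Y) (Lg g).
Hypothesis Lk : forall g a, Lg g a -> cpt a.
Hypothesis Lb : forall g d a b, Lg g a -> Lg d b -> Lg (GRing.add g d) (a [o] b [-] b [o] a).
Hypothesis Lf : forall g a, Lg g a -> fr a -> a = vzero.
Let L a := exists g, Lg g a.
Hypothesis Li : irr L.

Let ND := (enum_NoDup G).1.
Let el_all := (enum_NoDup G).2.
Let XX := Pi Y el_all.
Let sh (g i : G) : G := GRing.add i (GRing.opp g).
Let hat (g : G) (a : bop Y) : blin XX XX := tw el_all a (sh g).
Let p (g : G) : blin XX Y := pr Y el_all g.
Let i0 : blin Y XX := io Y el_all GRing.zero.
Let S0 : blin XX Y := sm Y el_all.

(** The operators sum_g a_g (x) shift_g with a_g in [Lg g]: commuting with pure shifts, such an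
    operator is determined by the components it shows on vectors supported at zero. *)
Let V (T : blin XX XX) := (forall g, T [o] hat g bid = hat g bid [o] T) /\ forall g, Lg g (p g [o] T [o] i0).

Let Vc : @closed_vsubspace (BB XX XX) V.
Proof.
have -> : V = fun T => forall q : G * bool, if q.2 then (bR (hat q.1 bid) [-] bL (hat q.1 bid)) T = vzero else Lg q.1 (bLR (p q.1) i0 T).
  apply/boolp.predeqP => T; split.
    move=> [h1 h2] [g [|]]; last exact: h2.
    by change (T [o] hat g bid [-] hat g bid [o] T = vzero); rewrite h1 vadd_opp.
  move=> h; split=> g; last exact: (h (g, false)).
  exact: (vsub_eq0 (h (g, true))).
apply: csub_inter => -[g [|]]; first exact: (csub_ker (bR (hat g bid) [-] bL (hat g bid))).
exact: (csub_pre (bLR (p g) i0) (Lc g)).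
Qed.

Let hat_comm g d a : hat g a [o] hat d bid = hat d bid [o] hat g a.
Proof.
rewrite /hat !tw_comp comp1b compb1; congr (tw _ a _); apply: boolp.funext => i.
by rewrite /sh -!GRing.addrA (GRing.addrC (GRing.opp g)).
Qed.

Let coef_comm g d a T : V T -> p d [o] (hat g a [o] T [-] T [o] hat g a) [o] i0 =
  a [o] (p (sh g d) [o] T [o] i0) [-] (p (sh g d) [o] T [o] i0) [o] a.
Proof.
move=> [hT _]; apply: blin_ext => y.
have e : hat g a (i0 y) = hat g bid (i0 (a y)).
  apply: boolp.funext => i.
  have -> : hat g a (i0 y) i = a (i0 y (sh g i)) by [].
  have -> : hat g bid (i0 (a y)) i = i0 (a y) (sh g i) by [].
  by rewrite /i0 !ioE; case: boolp.pselect => h /=; rewrite ?bl_0.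
have e2 : T (hat g a (i0 y)) = hat g bid (T (i0 (a y))) by rewrite e -bcompE hT.
have -> : (p d [o] (hat g a [o] T [-] T [o] hat g a) [o] i0) y = p d (hat g a (T (i0 y))) [-] p d (T (hat g a (i0 y))).
  by rewrite !bcompE baddE boppE bl_add bl_opp !bcompE.
by rewrite e2.
Qed.

Let sh_add g d : GRing.add g (sh g d) = d.
Proof. by rewrite /sh GRing.addrC -GRing.addrA GRing.addNr GRing.addr0. Qed.

Let V_ad g a T : Lg g a -> V T -> V (adk (hat g a) T).
Proof.
move=> ha hT; have [h1 h2] := hT; split=> d; rewrite adkE.
  have e := hat_comm g d a; rewrite compbDl compbNl compbDr compbNr.
  rewrite -(bcompA (hat g a)) h1 (bcompA (hat g a)) e -!bcompA; congr (_ [+] vopp _).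
  by rewrite e !bcompA h1.
rewrite coef_comm //; have := Lb ha (h2 (sh g d)); by rewrite sh_add.
Qed.

Let V_hat g x : Lg g x -> V (hat g x).
Proof.
move=> hx; split=> d; first exact: hat_comm.
have L0 : Lg d vzero by case: (Lc d).
case: (boolp.pselect (sh g d = GRing.zero)) => h.
  have -> : p d [o] hat g x [o] i0 = x.
    apply: blin_ext => y; have -> : (p d [o] hat g x [o] i0) y = x (i0 y (sh g d)) by [].
    by rewrite /i0 ioE; case: boolp.pselect.
  by have <- : g = d by rewrite -(sh_add g d) h GRing.addr0.
have -> : p d [o] hat g x [o] i0 = vzero.
  apply: blin_ext => y; have -> : (p d [o] hat g x [o] i0) y = x (i0 y (sh g d)) by [].
  by rewrite /i0 ioE; case: boolp.pselect => // h3 /=; rewrite bl_0.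
exact: L0.
Qed.

(** Each component of a finite-rank T is of finite rank and homogeneous, hence zero; T then kills
    vectors supported at zero, and by commutation with shifts all vectors. *)
Let V_fr T : V T -> fr T -> T = vzero.
Proof.
move=> [h1 h2] hf.
have z g : p g [o] T [o] i0 = vzero by apply: (Lf (h2 g)); apply: fd_sub (fd_map (p g) hf) => _ [y ->]; exists (T (i0 y)); split=> //; exists (i0 y).
have Ti y : T (i0 y) = vzero.
  apply: boolp.funext => i; have -> : T (i0 y) i = (p i [o] T [o] i0) y by [].
  by rewrite z.
apply: blin_ext => f.
suff h (l : list G) : NoDup l -> T (fun j => if boolp.pselect (In j l) then f j else vzero) = vzero.
  have := h _ ND; have -> // : (fun j => if boolp.pselect (In j (enum G)) then f j else vzero) = f.
  by apply: boolp.funext => j; case: boolp.pselect => // -[]; exact: el_all.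
elim: l => [|i l IH] nd.
  rewrite -(bl_0 T); congr (bf T _); apply: boolp.funext => j; by case: boolp.pselect.
inversion nd as [|? ? hi hl]; subst.
have -> : (fun j => if boolp.pselect (In j (i :: l)) then f j else vzero) =
    hat i bid (i0 (f i)) [+] (fun j => if boolp.pselect (In j l) then f j else vzero) :> XX.
  apply: boolp.funext => j.
  rewrite PaddE; have -> : hat i bid (i0 (f i)) j = i0 (f i) (sh i j) by [].
  have hij : sh i j = GRing.zero <-> j = i.
    split=> [h|->]; last by rewrite /sh GRing.addrN.
    by rewrite -(sh_add i j) h GRing.addr0.
  rewrite /i0 ioE; case: boolp.pselect => h3; case: boolp.pselect => h4; case: boolp.pselect => h5 /=.
  - by case: hi; rewrite -(proj1 hij h4).
  - by rewrite (proj1 hij h4); vec.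
  - vec.
  - by case: h3 => e; [case: h4; apply/hij | case: h5].
  - by case: hi; rewrite -(proj1 hij h4).
  - by case: h3; left; rewrite (proj1 hij h4).
  - by case: h3; right.
  vec.
by rewrite bl_add IH // -bcompE h1 bcompE Ti bl_0 vadd_0.
Qed.

(* Pairs (h, k) of corresponding products of exponentials on Y^G and on Y. *)
Inductive gg : blin XX XX -> blin XX XX -> bop Y -> bop Y -> Prop :=
| gg0 : gg bid bid bid bid
| ggS g a h h' k k' : Lg g a -> gg h h' k k' ->
   gg (Exp (hat g a) [o] h) (h' [o] Exp (vopp (hat g a))) (Exp a [o] k) (k' [o] Exp (vopp a)).

Let S_hat g a : S0 [o] hat g a = a [o] S0.
Proof.
by apply: (sm_tw ND _ _ (t := fun i => GRing.add i g)) => i; rewrite /sh -GRing.addrA ?GRing.addrN ?GRing.addNr GRing.addr0.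
Qed.

Let gg_ex k : grpm L k -> exists h h' k', gg h h' k k' /\ grp L k k'.
Proof.
move=> [k' hk]; suff [h [h' H]] : exists h h', gg h h' k k' by exists h, h', k'.
elim: hk => [|a {}k {}k' [g ha] _ [h [h' H]]]; first by exists bid, bid; exact: gg0.
by exists (Exp (hat g a) [o] h), (h' [o] Exp (vopp (hat g a))); exact: ggS.
Qed.

Let gg_prop h h' k k' : gg h h' k k' -> h [o] h' = bid /\ h' [o] h = bid /\ cpt (h [-] bid) /\
  (forall z, V z -> V (h [o] z [o] h')) /\ S0 [o] h = k [o] S0 /\ S0 [o] h' = k' [o] S0.
Proof.
elim=> [|g a {}h {}h' {}k {}k' ha _ [h1 [h2 [h3 [h4 [h5 h6]]]]]].
  rewrite !comp1b !compb1 vadd_opp; do 2! split=> //; split; first exact: cpt_0.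
  by split=> // z; rewrite comp1b compb1.
split; first by rewrite bcompA -(bcompA _ h) h1 compb1 Exp_opp.
split; first by rewrite bcompA -(bcompA h') Exp_oppl compb1 h2.
split.
  have -> : Exp (hat g a) [o] h [-] bid = Exp (hat g a) [o] (h [-] bid) [+] (Exp (hat g a) [-] bid) by bvec.
  by apply: cpt_add; [exact: cpt_compl | apply: Exp_cpt; apply: (tw_cpt ND); exact: (Lk ha)].
have eI : S0 [o] Exp (hat g a) = Exp a [o] S0 := Exp_intertwine (S_hat g a).
have eI' : S0 [o] Exp (vopp (hat g a)) = Exp (vopp a) [o] S0.
  by apply: Exp_intertwine; rewrite compbNr compbNl S_hat.
split; last by rewrite !bcompA eI h6 -!bcompA h5 eI'.
move=> z /h4 hz.
have -> : Exp (hat g a) [o] h [o] z [o] (h' [o] Exp (vopp (hat g a))) = Exp (hat g a) [o] (h [o] z [o] h') [o] Exp (vopp (hat g a)) by rewrite !bcompA.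
by rewrite -Exp_Ad; apply: (@Exp_inv (BB XX XX) V (adk (hat g a))) => // y; exact: V_ad.
Qed.

(** The spectral estimate is made on Y^G, where [V] has no nonzero finite-rank element, and is
    brought back by x = S0 (hat x) i0 with [S0] intertwining h and k. Finally [adm_adk] turns
    conjugation into ad (k - 1). *)
Let growth k k' g x : grp L k k' -> Lg g x -> forall t, 0 < t -> exists D, forall m, nm (bpow (adk (k [-] bid)) m x) <= D * t ^ m.
Proof.
move=> hk hx t ht.
have [h [h' [k2 [H hk2]]]] := gg_ex (ex_intro _ k' hk).
have [h1 [h2 [h3 [h4 [h5 h6]]]]] := gg_prop H.
have [k3 k4] := grp_inv hk2.
have pk := nm_ge0 k; pose s := t / (nm k + 1).
have hs : 0 < s by divpos.
have eh : bid [+] (h [-] bid) = h by vec.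
have ek' : bid [+] (k [-] bid) = k by vec.
have [B hB] := @adm_pointwise XX (h [-] bid) h' V s (hat g x) h3 (ltac:(rewrite eh; exact: h1)) (ltac:(rewrite eh; exact: h2)) Vc
  (ltac:(rewrite eh; exact: h4)) V_fr hs (V_hat hx).
rewrite eh in hB.
have tr m : S0 [o] bpow (adm h h') m (hat g x) = bpow (adm k k2) m x [o] S0.
  elim: m => [|m IH]; first exact: S_hat.
  rewrite -[bpow (adm h h') (S m)]/(adm h h' [o] bpow (adm h h') m) -[bpow (adm k k2) (S m)]/(adm k k2 [o] bpow (adm k k2) m) !bcompE !admE.
  move: (bpow _ m _) (bpow _ m _) IH => z w IH.
  rewrite compbDr compbNr !bcompA h5 compbDl compbNl IH; congr (_ [+] _).
  by rewrite -!bcompA (bcompA S0) IH -!bcompA h6.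
exists (nm S0 * Rabs B * nm i0) => m.
rewrite -(adm_adk (h' := k2)) ek' //.
have e1 : bpow (adm k k2) m x = S0 [o] bpow (adm h h') m (hat g x) [o] i0.
  have e0 : S0 [o] i0 = bid by apply: sm_io.
  by rewrite tr -bcompA e0 compb1.
rewrite e1; set Z := S0 [o] _ [o] i0.
have i1 := nm_comp Z (bpow k m); have i2 := nm_comp (S0 [o] bpow (adm h h') m (hat g x)) i0.
have i3 := nm_comp S0 (bpow (adm h h') m (hat g x)).
have sm0 : 0 <= s ^ m by apply: pow_le; lra.
have i4 : nm (bpow (adm h h') m (hat g x)) <= Rabs B * s ^ m.
  by apply: Rle_trans (hB m) _; apply: Rmult_le_compat_r => //; exact: RRle_abs.
have i5 := nm_mull S0 i4.
have i6 := nm_mulr i0 (Rle_trans _ _ _ i3 i5).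
have i7 : nm (bpow k m) <= (nm k + 1) ^ m by apply: Rle_trans (nm_bpow _ _) _; apply: pow_incr; lra.
have i8 := Rmult_le_compat _ _ _ _ (nm_ge0 _) (nm_ge0 _) (Rle_trans _ _ _ i2 i6) i7.
apply: Rle_trans i1 _; apply: Rle_trans i8 _; right.
have -> : t = s * (nm k + 1) by rewrite /s; field; lra.
by rewrite Rpow_mult_distr; ring.
Qed.

(** An eigenvalue of k - 1 would make Y finite-dimensional, so a itself would be of finite rank;
    thus products of exponentials are unipotent with joint growth at most 2. Averages of exp (z a)
    approximate a with small weight, and the perturbed fixed-ball argument contradicts this
    growth. *)
Theorem graded_finite_rank g a : Lg g a -> a = vzero.
Proof.
move=> ha; apply: NNPP => na.
have LZ c b : L b -> L (c [*] b) by move=> [d hb]; exists d; have [_ [_ [h _]]] := Lc d; exact: h.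
have hi := irr_grp LZ Li.
have unip k : grpm L k -> cpt (k [-] bid) /\ qn (k [-] bid).
  move=> [k' hk]; have hK : cpt (k [-] bid) by apply: (grp_cpt _ hk) => b [d]; exact: Lk.
  split=> //; set K := k [-] bid in hK *; apply: spec_qn => // kap y kz hy; apply: NNPP => ny.
  have [|fb _] := riesz_irr Li hK _ kz hy ny.
    by move=> x [d hx] t ht; exact: (growth hk hx ht).
  by apply: na; apply: (Lf ha); rewrite -(compb1 a); exact: fr_compl.
have hS : dens (@span (BB Y Y) (grpm L)).
  apply: (irr_dens hi); first exact: span_sub.
    by move=> b t hb; apply: (span_map (T := bL b)) => x hx; apply: span1; exact: grpm_mul.
  by move=> y ny; exists bid; split=> //; apply: span1; exact: grpm1.
have [l [eta [r [he [hr [hl hw]]]]]] := hilden (Lk ha) na hS.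
have [c [c0 hc]] : exists c, 0 < c /\ forall t, In t l -> exists d, d <= c /\ cmb (grpm L) d t.
  elim: l hl {hw} => [|t l IH] hl; first by exists 1; split=> //; lra.
  have [c [k1 k2]] := IH (fun a ha => hl a (or_intror ha)).
  have [d hd] := cmb_span (hl t (or_introl erefl)); have d0 := cmb_ge0 hd.
  exists (c + d); split; first lra.
  by move=> b [<-|/k2 [e [he1 he2]]]; [exists d | exists e]; split=> //; lra.
have [K' [d [hK' [hd hd2]]]] := @Exp_average Y a eta (1 / (4 * c)) he ltac:(divpos).
have hw0 := hw K' hK'; have d0 := cmb_ge0 hd2.
pose l' := map (fun t : BB Y Y => t [o] K') l.
have [k [k1 k2]] : exists k, (forall a, In a k -> grpm L a) /\ forall b, In b l' -> exists d, d <= 1/4 /\ cmb (fun a => In a k) d b.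
  apply: cmb_fin_list => b /in_map_iff [t [<- ht]]; have [d1 [hd1 hd3]] := hc t ht.
  have d10 := cmb_ge0 hd3; exists (d1 * (d * 1)); split.
    have -> : 1/4 = c * (1 / (4 * c) * 1) by field; lra.
    by apply: Rmult_le_compat; lra.
  apply: (cmb_map (f := fun t => t [o] K')) hd3 => [||| x hx]; [by rewrite comp0b | by move=> *; rewrite compbDl | by move=> *; rewrite compbZl |].
  apply: (cmb_map (f := fun t => x [o] t)) hd2 => [||| _ [z ->]]; [by rewrite compb0 | by move=> *; rewrite compbDr | by move=> *; rewrite compbZr |].
  by apply: cmb1; apply: grpm_mul => //; apply: grpm_Exp; apply: LZ; exists g.
have J2 := unipotent_growth hi (fun a b => @grpm_mul _ _ a b) unip k1 (ltac:(lra) : 1 < 2).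
have [C hC] := cmb_J (ltac:(lra) : 0 <= 2) (ltac:(lra) : 0 <= 1/4) J2 k2.
have [N hN] := half_pow_small C hr.
have [U [hU hU2]] := hw0 N.
have hU' : W (fun a => In a l') N U.
  by apply: W_mono hU => x [t [ht ->]]; apply: (in_map (fun t : BB Y Y => t [o] K')).
have := hC _ _ hU'; have -> : 1 / 4 * 2 = 1 / 2 by field.
by have := hN N (le_n _); lra.
Qed.
End Grading.

(** * Jacobson's theorem and traces *)

Lemma nil_J0 X (P : bop X -> Prop) n : (1 <= n)%nat -> (forall T, W P n T -> T = vzero) -> J0f P.
Proof.
move=> hn h l hl s hs; apply: (J_pow hs hn).
  by have [p [_ hp]] := list_nm_bound (l : list (BB X X)); exists p.
by move=> T /(W_mono hl) /h ->; rewrite nm_0; apply: pow_le; lra.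
Qed.

(** A nonzero value of a long word gives consecutive nonzero images, all but the first vector lying
    in the span of r. There are more of them than r has elements. *)
Lemma nil_words X (P : bop X -> Prop) (r : list X) T : J0f P ->
  (forall a x, P a -> span (fun z => In z r) (a x)) -> W P (S (S (length r))) T -> T = vzero.
Proof.
move=> hP hr hT; apply: blin_ext => x; apply: NNPP => nx.
have chain n U : W P n U -> exists v : nat -> X, v n = U x /\ forall i, (i < n)%nat -> exists a, P a /\ v (S i) = a (v i).
  elim=> [|a {}n {}U ha _ [v [h1 h2]]]; first by exists (fun _ => x); split=> // i; lia.
  exists (fun i => if Nat.leb i n then v i else a (U x)); split.
    by case: Nat.leb_spec => //; lia.
  move=> i hi; case: (Nat.leb_spec i n) => h3; last lia.
  case: (Nat.leb_spec (S i) n) => h4; first by apply: h2; lia.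
  by exists a; split=> //; have -> : i = n by [lia]; rewrite h1.
have [v [h1 h2]] := chain _ _ hT.
have nz i : (i <= S (S (length r)))%nat -> v i <> vzero.
  move=> hi e; apply: nx; rewrite -h1.
  have h j : (i + j <= S (S (length r)))%nat -> v (i + j)%nat = vzero.
    elim: j => [|j IH] hj; first by rewrite Nat.add_0_r.
    by rewrite Nat.add_succ_r; have [|a [_ ->]] := h2 (i + j)%nat; [lia | rewrite IH ?bl_0 //; lia].
  by have := h (S (S (length r)) - i)%nat; have -> : (i + (S (S (length r)) - i) = S (S (length r)))%nat by [lia]; apply.
apply: (no_long_chain (l := r) (v := fun i => v (S i)) hP) => i hi; last by apply: h2; lia.
split; last by apply: nz; lia.
by have [|a [ha ->]] := h2 i; [lia | exact: hr].
Qed.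

(* Jacobson's theorem on weakly closed sets of nilpotents, through a maximal subset all of whose N-words vanish. *)
Theorem jacobson X (Wd : bop X -> Prop) : (forall a b, Wd a -> Wd b -> Wd (a [o] b [-] b [o] a)) ->
  (forall a, Wd a -> fr a /\ qn a) -> J0f Wd.
Proof.
move=> hb hq l hl.
have [r hr] : exists r : list X, forall a x, In a l -> span (fun z => In z r) (a x).
  elim: l hl => [|a l IH] hl; first by exists nil.
  have [r hr] := IH (fun b h => hl b (or_intror h)); have [[k hk] _] := hq a (hl a (or_introl erefl)).
  exists (k ++ r) => b x [<-|h].
    by apply: (span_mono (P := fun z => In z k)) => [y hy|]; [apply: in_or_app; left | apply: hk; exists x].
  by apply: (span_mono (P := fun z => In z r)) => [y hy|]; [apply: in_or_app; right | exact: hr].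
pose Wr w := Wd w /\ forall x, span (fun z => In z r) (w x).
have SV := span_sub (fun z => In z r).
have Wrb a b : Wr a -> Wr b -> Wr (a [o] b [-] b [o] a).
  by move=> [h1 h2] [h3 h4]; split; [exact: hb | move=> x; rewrite baddE boppE; apply: vsub_sub; [done | exact: h2 | exact: h4]].
pose N := S (S (length r)).
pose nl (S : bop X -> Prop) := forall T, W S N T -> T = vzero.
have nilS S0 : (forall a, S0 a -> Wr a) -> J0f S0 -> nl S0.
  by move=> h1 h2 T; apply: nil_words h2 _ => a x /h1 [_ h]; exact: h.
have [|S0 [[hS hN] hmax]] := @zorn_sets (bop X) (fun S => (forall a, S a -> Wr a) /\ nl S).
  move=> F hF htot; split; first by move=> a [A [hA ha]]; case: (hF A hA) => h _; exact: h.
  move=> T /W_fin [k [h1 h2]].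
  case: (classic (exists A, F A)) => [hne|hno]; last first.
    have e : k = nil by case: k h1 {h2} => [//|a k] h1; case: (h1 a (or_introl erefl)) => A [hA _]; case: hno; exists A.
    by rewrite e in h2; inversion h2 as [|a n U ha hU]; subst; case: ha.
  have [A [hA hA2]] : exists A, F A /\ forall a, In a k -> A a.
    apply: (@fin_choose_list _ _ (fun A B : bop X -> Prop => forall x, A x -> B x) F (fun a A => A a) k hne htot).
      by move=> c A B _ _ h; exact: h.
    by move=> c hc; have [A [h h']] := h1 c hc; exists A.
  by case: (hF A hA) => _ h; exact: (h T (W_mono hA2 h2)).
have J1 S' n : (1 <= n)%nat -> (forall a, S' a -> Wr a) -> (forall a, S0 a -> S' a) -> (forall T, W S' n T -> T = vzero) ->
    forall a, S' a -> S0 a.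
  by move=> hn h1 h2 h3; apply: hmax => //; split=> //; apply: nilS => //; exact: nil_J0 hn h3.
suff all w : Wr w -> S0 w.
  by apply: (nil_J0 (n := N) _ hN) => [|a ha]; [rewrite /N; lia | apply: all; split; [exact: hl | move=> x; exact: hr]].
move=> hw; apply: NNPP => nw.
have Sz : S0 vzero.
  have Wz : Wr vzero by have := Wrb w w hw hw; rewrite vadd_opp.
  apply: (J1 (fun a => S0 a \/ a = vzero) N); [rewrite /N; lia | by move=> a [/hS|->] | by move=> a; left | | by right].
  move=> T hT; suff [//|/hN //] : T = vzero \/ W S0 N T.
  elim: hT => [|a n U ha _ [->|h]]; [by right; exact: W0 | by left; rewrite compb0 |].
  by case: ha => [ha|->]; [right; exact: WS | left; rewrite comp0b].
(* Otherwise commutators of w with members of [S0] never enter [S0]. After 2N of them every term of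
   the expansion has at least N letters of [S0] on one side and vanishes, while zero belongs to
   [S0]. *)
have [v [hv [nv hsv]]] : exists v, Wr v /\ ~ S0 v /\ forall s, S0 s -> S0 (s [o] v [-] v [o] s).
  apply: NNPP => hno.
  pose E n T := exists i j A B, (i + j = n)%nat /\ W S0 i A /\ W S0 j B /\ T = A [o] w [o] B.
  have it n : exists z, Wr z /\ ~ S0 z /\ @span (BB X X) (E n) z.
    elim: n => [|n [z [h1 [h2 h3]]]].
      exists w; split=> //; split=> //; apply: span1; exists 0%nat, 0%nat, bid, bid.
      by rewrite comp1b compb1; split=> //; split; [exact: W0 | split=> //; exact: W0].
    have [s [hs hs2]] : exists s, S0 s /\ ~ S0 (s [o] z [-] z [o] s).
      apply: NNPP => h; apply: hno; exists z; split=> //; split=> // s hs; apply: NNPP => h'; by apply: h; exists s.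
    exists (s [o] z [-] z [o] s); split; first by apply: Wrb => //; exact: hS.
    split=> //; apply: (span_map (T := adk s) (Q := E (S n)) _ h3) => _ [i [j [A [B [<- [hA [hB ->]]]]]]].
    rewrite adkE; apply: vsub_sub; first exact: span_sub.
      by apply: span1; exists (S i), j, (s [o] A), B; split=> //; split; [exact: WS | rewrite !bcompA].
    apply: span1; exists i, (j + 1)%nat, A, (B [o] s); split; first lia.
    by split=> //; split; [apply: W_app => //; exact: W1 | rewrite !bcompA].
  have [z [_ [h2 h3]]] := it (N + N)%nat; apply: h2; suff -> : z = vzero by [].
  apply: (@span_min _ _ (fun z => z = vzero) (csub_sub (csub_zero (BB X X))) _ z h3) => _ [i [j [A [B [e [hA [hB ->]]]]]]].
  have big n U : (N <= n)%nat -> W S0 n U -> U = vzero.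
    move=> hn hU; have e1 : n = (N + (n - N))%nat by lia.
    by rewrite e1 in hU; have [C [D [hC [_ ->]]]] := W_split hU; rewrite (hN C hC) comp0b.
  case: (Nat.le_gt_cases N i) => hi; first by rewrite (big i A) // !comp0b.
  by rewrite (big j B) ?compb0 //; lia.
apply: nv; pose S' a := S0 a \/ a = v.
(* Filtration by joint kernels of words of length j: letters of [S0] lower the level and v preserves
   it. Among N consecutive letters either one lowers the level or all are v and v^N = 0, so N*N
   letters give zero. *)
pose U j x := forall T, W S0 j T -> T x = vzero.
have US j x s : S0 s -> U (S j) x -> U j (s x).
  move=> hs hx T hT; rewrite -bcompE; apply: hx; have -> : S j = (j + 1)%nat by lia.
  by apply: W_app => //; exact: W1.
have Uinc j x : U j x -> U (S j) x.
  by move=> hx T hT; inversion hT as [|a n V ha hV]; subst; rewrite bcompE hx // bl_0.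
have Uv j x : U j x -> U j (v x).
  move=> hx T hT.
  have h : @span (BB X X) (W S0 j) (T [o] v [-] v [o] T).
    elim: hT => [|s n V hs hV IH]; first by rewrite comp1b compb1 vadd_opp; exact: span0.
    have -> : s [o] V [o] v [-] v [o] (s [o] V) = s [o] (V [o] v [-] v [o] V) [+] (s [o] v [-] v [o] s) [o] V by bvec.
    apply: spanD; first by apply: (span_map (T := bL s)) IH => y hy; apply: span1; exact: WS.
    by apply: span1; apply: WS => //; exact: hsv.
  have -> : T (v x) = (T [o] v [-] v [o] T) x by rewrite baddE boppE !bcompE (hx T hT) bl_0 vopp_0 vadd_0.
  apply: (@span_min _ _ (fun Z : BB X X => (Z : bop X) x = vzero) _ _ _ h); last by move=> Z hZ; exact: hx.
  split=> //; split; first by move=> y z hy hz; rewrite baddE hy hz vadd_0.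
  by move=> c y hy; rewrite bscalE hy vscal_0r.
have vN : bpow v N = vzero.
  apply: (nilS (fun a => a = v)) (W_pow v N); first by move=> a ->.
  move=> k hk s hs; apply: (J_mono hk); apply/J_single; exact: (hq v hv.1).2.
have USj j x s : S0 s -> U j x -> U j (s x) by move=> hs /Uinc; exact: US.
have step n T j x : W S' n T -> U (S j) x -> T = bpow v n \/ U j (T x).
  elim=> [|a {}n {}T ha _ IH] hx; first by left.
  rewrite bcompE; case: (IH hx) => [->|h]; last by right; case: ha => [ha|->]; [exact: USj | exact: Uv].
  case: ha => [ha|->]; [right; apply: US => // | by left].
  by elim: (n) => [//|m IHm]; exact: Uv.
have kill j : forall T x, W S' (j * N) T -> U j x -> T x = vzero.
  elim: j => [|j IH] T x hT hx; first by inversion hT; subst; apply: (hx bid); exact: W0.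
  have e : (S j * N = j * N + N)%nat by rewrite /=; lia.
  rewrite e in hT; have [A [B [hA [hB ->]]]] := W_split hT.
  rewrite bcompE; case: (step N B j x hB hx) => [->|h]; last exact: IH hA h.
  by rewrite vN bl_0.
apply: (J1 S' (N * N)%nat); [rewrite /N /=; lia | by move=> a [/hS|->] | by move=> a; left | | by right].
by move=> T hT; apply: blin_ext => x; apply: (kill N T x hT) => V /hN ->.
Qed.

Fixpoint csum (f : nat -> Cplx) n : Cplx := match n with O => C0 | S n => (csum f n + f n)%C end.

Lemma csum_ext f g n : (forall i, (i < n)%nat -> f i = g i) -> csum f n = csum g n.
Proof. by elim: n => [//|n IH] h /=; rewrite IH ?h // => i hi; apply: h; lia. Qed.

Lemma csum_add f g n : csum (fun i => f i + g i)%C n = (csum f n + csum g n)%C.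
Proof. by elim: n => [|n IH] /=; [ring | rewrite IH; ring]. Qed.

Lemma csum_scal c f n : csum (fun i => c * f i)%C n = (c * csum f n)%C.
Proof. by elim: n => [|n IH] /=; [ring | rewrite IH; ring]. Qed.

Lemma csum_swap (f : nat -> nat -> Cplx) n m : csum (fun i => csum (f i) m) n = csum (fun j => csum (fun i => f i j) n) m.
Proof.
elim: n => [|n IH] /=; last by rewrite IH csum_add.
by elim: m => [|m IHm] //=; rewrite -IHm; ring.
Qed.

(* In a basis adapted to the nilpotent part, a commutator kap + nilpotent would have trace n * kap. *)
Lemma commutator_trace Y (a b : bop Y) kap k (y0 : Y) : fr (bid : bop Y) -> y0 <> vzero ->
  bpow (shf (a [o] b [-] b [o] a) kap) k = vzero -> kap = C0.
Proof.
move=> [l hl] ny0; set c := _ [-] _; set R0 := shf c kap => hR.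
have hl' y : span (fun z => In z l) y by apply: hl; exists y.
pose sp (v : nat -> Y) n := span (fun z => exists i, (i < n)%nat /\ z = v i).
pose good (v : nat -> Y) n := forall i, (i < n)%nat -> ~ sp v i (v i) /\ sp v i (R0 (v i)).
(* A triangular basis for the nilpotent [R0] is built greedily: from a vector outside the current
   span, take its last image under powers of [R0] still outside. *)
have [v [n [hg hs]]] : exists v n, good v n /\ forall y, sp v n y.
  apply: NNPP => hno.
  have ex n : exists v, good v n.
    elim: n => [|n [v hv]]; first by exists (fun _ => vzero) => i; lia.
    have [y hy] : exists y, ~ sp v n y.
      by apply: not_all_ex_not => h; apply: hno; exists v, n.
    have [j [hj1 hj2]] : exists j, ~ sp v n (bpow R0 j y) /\ sp v n (R0 (bpow R0 j y)).
      apply: NNPP => h; have all j : ~ sp v n (bpow R0 j y).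
        by elim: j => [//|j IH] h'; apply: h; exists j.
      by apply: (all k); rewrite hR; exact: span0.
    pose w i := if Nat.eqb i n then bpow R0 j y else v i.
    have e i x : (i <= n)%nat -> sp w i x <-> sp v i x.
      move=> hi; split; apply: span_mono => z [m [hm ->]]; exists m; split=> //; rewrite /w; case: Nat.eqb_spec => //; lia.
    exists w => i hi; rewrite !e; try lia.
    rewrite /w; case: Nat.eqb_spec => [->|h3]; [by split | apply: hv; lia].
  have [v hv] := ex (S (length l)).
  have [j [hj hj2]] := steinitz (v := v) (fun i _ => hl' (v i)).
  by have [|h _] := hv j; [lia | apply: h].
pose lc (q : nat -> Cplx) := fix lc n := match n with O => vzero | S n => lc n [+] q n [*] v n end.
have lc_sp q m : sp v m (lc q m).
  elim: m => [|m IH] /=; first exact: span0.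
  apply: spanD; last by apply: spanZ; apply: span1; exists m; split; [lia |].
  by apply: span_mono IH => z [i [hi ->]]; exists i; split=> //; lia.
have lc_lin p q r m : lc (fun i => r * p i + q i)%C m = r [*] lc p m [+] lc q m.
  by elim: m => [|m IH] /=; [vec | rewrite IH; move: (p m) (q m) => s t; vec].
have lcS q m : lc q (S m) = lc q m [+] q m [*] v m by [].
have lc0 m : lc (fun _ => C0) m = vzero by elim: m => [//|m IH] /=; rewrite IH; vec.
have sp_lc m : (m <= n)%nat -> forall y, sp v m y -> exists q, y = lc q m.
  move=> hm y; elim=> [|_ [i [hi ->]]|x z _ [p ->] _ [q ->]|r x _ [p ->]].
  - by exists (fun _ => C0); rewrite lc0.
  - exists (fun j => if Nat.eqb j i then C1 else C0).
    have h j : (j <= i)%nat -> lc (fun j => if Nat.eqb j i then C1 else C0) j = vzero.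
      elim: j => [//|j IH] hj /=; rewrite IH; last lia.
      by case: Nat.eqb_spec => h; [lia | vec].
    elim: m hm hi => [|m IH] hm hi /=; first lia.
    case: (Nat.eq_dec i m) => [<-|ne]; first by rewrite h // Nat.eqb_refl; vec.
    by rewrite -IH; [case: Nat.eqb_spec => h'; [lia | vec] | lia | lia].
  - by exists (fun i => C1 * p i + q i)%C; rewrite lc_lin vscal_1.
  by exists (fun i => r * p i + C0)%C; rewrite (lc_lin _ (fun _ => C0)) lc0 vadd_0.
have uniq m : (m <= n)%nat -> forall q, lc q m = vzero -> forall i, (i < m)%nat -> q i = C0.
  elim: m => [|m IH] hm q hq i hi; first lia.
  have qm : q m = C0.
    apply: NNPP => nz; have [h _] := hg m ltac:(lia); apply: h.
    have -> : v m = (- Cinv (q m))%C [*] lc q m.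
      have e : lc q m = (- C1)%C [*] (q m [*] v m) by apply: (@vadd_cancel _ _ _ (q m [*] v m)); rewrite [LHS]hq; move: (q m) => s; vec.
      by rewrite e; move: (q m) nz => s nz; vec.
    by apply: spanZ; exact: lc_sp.
  case: (Nat.eq_dec i m) => [->//|ne]; apply: (IH ltac:(lia) q) => //; last lia.
  by move: hq; rewrite /= qm => <-; vec.
have [f hf] : exists f : Y -> nat -> Cplx, forall y, y = lc (f y) n.
  by apply: (@choice_fun Y (fun _ => nat -> Cplx) (fun y q => y = lc q n)) => y; apply: sp_lc.
have fu y q i : y = lc q n -> (i < n)%nat -> f y i = q i.
  move=> e hi; apply: Csub_eq0.
  have -> : (f y i - q i)%C = (- C1 * q i + f y i)%C by ring.
  by apply: (uniq n (le_n n) (fun i => - C1 * q i + f y i)%C) => //; rewrite lc_lin -e -hf; vec.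
pose tr T := csum (fun i => f ((T : bop Y) (v i)) i) n.
have trD r S T : tr (r [*] S [+] T) = (r * tr S + tr T)%C.
  rewrite /tr -csum_scal -csum_add; apply: csum_ext => i hi.
  by rewrite (fu _ (fun j => r * f (S (v i)) j + f (T (v i)) j)%C) //; rewrite lc_lin -!hf baddE bscalE.
have trM S T : tr (S [o] T) = csum (fun i => csum (fun j => f (T (v i)) j * f (S (v j)) i)%C n) n.
  apply: csum_ext => i hi; rewrite bcompE.
  rewrite (fu _ (fun i' => csum (fun j => f (T (v i)) j * f (S (v j)) i')%C n) i) //.
  rewrite {1}(hf (T (v i))); elim: {1 2}(n) => [|m IH] /=.
    by rewrite bl_0 lc0.
  rewrite bl_add bl_scal IH {1}(hf (S (v m))).
  have e r p q : forall j, lc (fun i0 => q i0 + r * p i0)%C j = lc q j [+] r [*] lc p j.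
    by elim=> [|j IHj] /=; [vec | rewrite IHj; move: (q j) (p j) => s t; vec].
  by rewrite -(e _ _ (fun i' => csum (fun j => f (T (v i)) j * f (S (v j)) i')%C m)).
have trC : tr (a [o] b) = tr (b [o] a).
  rewrite !trM csum_swap; apply: csum_ext => i hi; apply: csum_ext => j hj; ring.
have tc : tr c = C0.
  have -> : c = (- C1)%C [*] (b [o] a) [+] a [o] b by rewrite /c; vec.
  by rewrite trD trC; ring.
(* In this basis [R0] is strictly triangular, so its diagonal coordinates vanish. *)
have tR : tr R0 = C0.
  have h : forall i, (i < n)%nat -> f (R0 (v i)) i = C0.
    move=> i hi; have [_ hi2] := hg i hi; have [q e] := sp_lc i ltac:(lia) _ hi2.
    rewrite (fu _ (fun j => if Nat.ltb j i then q j else C0)) //; first by rewrite Nat.ltb_irrefl.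
    have h m : (m <= i)%nat -> lc (fun j => if Nat.ltb j i then q j else C0) m = lc q m.
      elim: m => [//|m IH] hm /=; rewrite IH; last lia.
      by case: Nat.ltb_spec => //; lia.
    have h2 m : lc (fun j => if Nat.ltb j i then q j else C0) (i + m)%nat = lc q i.
      elim: m => [|m IH]; first by rewrite Nat.add_0_r h.
      by rewrite Nat.add_succ_r /= IH; case: Nat.ltb_spec => h'; [lia | vec].
    have en : (i + (n - i))%nat = n by lia.
    by rewrite e -(h2 (n - i)%nat) en.
  rewrite /tr (csum_ext (g := fun _ => C0)) //; by elim: (n) => [//|j IHj] /=; rewrite IHj; ring.
have tb : tr bid = RtoC (INR n).
  rewrite /tr (csum_ext (g := fun _ => C1)).
    elim: (n) => [//|m IH]; rewrite S_INR RtoC_add -IH //.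
  move=> i hi; rewrite bidE (fu _ (fun j => if Nat.eqb j i then C1 else C0)) ?Nat.eqb_refl //.
  have h j : (j <= i)%nat -> lc (fun j => if Nat.eqb j i then C1 else C0) j = vzero.
    elim: j => [//|j IH] hj /=; rewrite IH; last lia.
    by case: Nat.eqb_spec => h; [lia | vec].
  have h2 m : lc (fun j => if Nat.eqb j i then C1 else C0) (S i + m)%nat = v i.
    elim: m => [|m IH]; first by rewrite Nat.add_0_r lcS h // Nat.eqb_refl; vec.
    by rewrite Nat.add_succ_r lcS IH; case: Nat.eqb_spec => h'; [lia | vec].
  have en : (S i + (n - S i))%nat = n by lia.
  by rewrite -{1}(h2 (n - S i)%nat) en.
have : tr c = (kap * tr bid + tr R0)%C by rewrite -trD; congr tr; rewrite /R0 /shf; vec.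
rewrite tc tR tb => e; apply: NNPP => nk.
have np : n <> 0%nat.
  move=> e0; apply: ny0; have [q ->] := sp_lc n (le_n _) _ (hs y0); by rewrite e0.
apply: (Cmul_neq0 nk (@RtoC_neq0 (INR n) _)); first exact: not_0_INR.
by rewrite e; ring.
Qed.

(** * Irreducible graded algebras are scalar *)

Section Core.
Variables (G : finZmodType) (Y : CBanach) (Lg : G -> bop Y -> Prop).
Hypothesis Lc : forall g, @closed_vsubspace (BB Y Y) (Lg g).
Hypothesis Lk : forall g a, Lg g a -> cpt a.
Hypothesis Lb : forall g d a b, Lg g a -> Lg d b -> Lg (GRing.add g d) (a [o] b [-] b [o] a).
Let L a := exists g, Lg g a.
Hypothesis Li : irr L.
Hypothesis comm_qn : forall g d a b, Lg g a -> Lg d b -> qn (a [o] b [-] b [o] a).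

Let LZ c b : L b -> L (c [*] b).
Proof. by move=> [d hb]; exists d; have [_ [_ [h _]]] := Lc d; exact: h. Qed.

Let Lcpt a : L a -> cpt a. Proof. by move=> [g]; exact: Lk. Qed.

(** Schur's lemma: an eigenspace of a central u for a nonzero eigenvalue is invariant, hence
    everything. Without such an eigenvalue u is quasinilpotent, and the algebra it generates is an
    ideal excluded by [irr_no_ideal]. *)
Let central_scalar u : L u -> (forall a, L a -> a [o] u = u [o] a) -> exists c, u = c [*] bid.
Proof.
move=> hu hc.
case: (classic (exists kap y, kap <> C0 /\ u y = kap [*] y /\ y <> vzero)) => [[kap [y [kz [hy ny]]]]|hno].
  suff h x : shf u kap x = vzero by exists kap; apply: blin_ext => x; apply: vsub_eq0; exact: h.
  move: x; case: (Li (Q := fun x => shf u kap x = vzero)) => [|h|//].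
    split; first exact: csub_ker.
    by move=> a ha x hx; rewrite -bcompE -(shf_comm kap (hc a ha)) bcompE hx bl_0.
  by case: ny; apply: h; rewrite shfE hy; exact: vadd_opp.
exists C0; rewrite vscal_0.
have uq : qn u.
  apply: spec_qn; first exact: Lcpt.
  by move=> kap y kz hy; apply: NNPP => ny; apply: hno; exists kap, y.
have J1 : J0f (fun z => z = u) by move=> l hl s hs; apply: (J_mono hl); apply/J_single; exact: uq.
have ac z : alg (fun z => z = u) z -> cpt z /\ forall a, L a -> a [o] z = z [o] a.
  move: z; apply: alg_min; last move=> a b -> [h1 h2]; last 2 first.
  - by move=> a ->; split; [exact: Lcpt | exact: hc].
  - by split; [exact: cpt_compl | move=> c hc'; rewrite bcompA hc // -!bcompA h2].
  split; first by split; [exact: cpt_0 | move=> a _; rewrite comp0b compb0].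
  split; first by move=> x y [h1 h2] [h3 h4]; split; [exact: cpt_add | move=> a ha; rewrite compbDl compbDr h2 ?h4].
  by move=> c x [h1 h2]; split; [exact: cpt_scal | move=> a ha; rewrite compbZl compbZr h2].
apply: (irr_no_ideal Lcpt LZ Li (I := alg (fun z => z = u))); [by move=> x /ac [] | | exact: J0f_alg | exact: alg1].
by move=> a x ha /ac [_ h]; rewrite h // vadd_opp; have [h0 _] := alg_sub (fun z => z = u).
Qed.

Let F g a := Lg g a /\ fr a.

Let F_comm g d a x : Lg g a -> F d x -> F (GRing.add g d) (a [o] x [-] x [o] a).
Proof.
move=> ha [hx fx]; split; first exact: Lb.
by apply: fr_add; [exact: fr_compl | apply: fr_opp; exact: fr_compr].
Qed.

(** The commutators of L with homogeneous finite-rank elements are themselves homogeneous of finite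
    rank, quasinilpotent, and closed under commutation with L. Jacobson's theorem gives them
    vanishing joint growth, so [irr_no_ideal] makes them zero. *)
Let LF0 g d a x : Lg g a -> F d x -> a [o] x [-] x [o] a = vzero.
Proof.
pose W2 z := exists g d a x, Lg g a /\ F d x /\ z = a [o] x [-] x [o] a.
have W2F z : W2 z -> exists g, F g z by move=> [g' [d' [x' [y' [h1 [h2 ->]]]]]]; exists (GRing.add g' d'); exact: F_comm.
move=> ha hx; apply: (irr_no_ideal Lcpt LZ Li (I := W2)); last by exists g, d, a, x.
- by move=> z /W2F [g' [h _]]; exact: Lk h.
- by move=> b z [g1 hb] /W2F [g2 hz]; exists g1, g2, b, z.
apply: jacobson => [b z /W2F [g1 [hb _]] /W2F [g2 hz]|b hb]; first by exists g1, g2, b, z.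
by split; [have [g1 [_ h]] := W2F b hb | have [g' [d' [x' [y' [h1 [[h2 _] ->]]]]]] := hb; exact: comm_qn h1 h2].
Qed.

(** One nonzero finite-rank element is central, so a nonzero scalar; the identity then has finite
    rank, every homogeneous element does, and each of them is central in turn. *)
Theorem irr_graded_scalar g a : Lg g a -> exists c, a = c [*] bid.
Proof.
move=> ha.
case: (classic (exists d x, F d x /\ x <> vzero)) => [[d [x [hx nx]]]|hno]; last first.
  exists C0; rewrite vscal_0; apply: (graded_finite_rank Lc Lk Lb _ Li ha) => d x hx fx.
  by apply: NNPP => nx; apply: hno; exists d, x.
have comF e y : F e y -> forall b, L b -> b [o] y = y [o] b.
  by move=> hy b [h hb]; apply: vsub_eq0; exact: (LF0 hb hy).
have [c ex] := central_scalar (ex_intro _ d hx.1) (comF d x hx).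
have nc : c <> C0 by move=> e; apply: nx; rewrite ex e vscal_0.
have fb : fr (bid : bop Y).
  have -> : bid = Cinv c [*] x :> BB Y Y by rewrite ex; vec.
  have -> : Cinv c [*] x = (Cinv c [*] bid) [o] x by bvec.
  by apply: fr_compl; case: hx.
by apply: central_scalar; [exists g | apply: (comF g); split=> //; rewrite -(compb1 a); exact: fr_compl].
Qed.
End Core.

(** * Gaps of a maximal invariant chain *)

Lemma Rsup_le (E : R -> Prop) x0 b : E x0 -> (forall x, E x -> x <= b) -> Rsup E <= b.
Proof. by move=> h0 h; have [_ h2] := Rsup_lub h0 h; apply: h2. Qed.

Lemma Rsup_ge (E : R -> Prop) x b : E x -> (forall x, E x -> x <= b) -> x <= Rsup E.
Proof. by move=> h0 h; have [h2 _] := Rsup_lub h0 h; apply: h2. Qed.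

Lemma nroot_lt n r b : (1 <= n)%nat -> 0 < b -> nroot n r < b -> r <= b ^ n.
Proof.
move=> hn hb; rewrite /nroot; case: Rle_dec => h; first by have := pow_lt b n hb; lra.
move=> /= hlt; have hn' : 0 < INR n by apply: lt_0_INR; lia.
have e : r = Rpower r (/ INR n) ^ n.
  rewrite -Rpower_pow; last exact: exp_pos.
  by rewrite Rpower_mult Rinv_l ?Rpower_1; lra.
rewrite e; apply: pow_incr; split; [exact: Rlt_le (exp_pos _) | exact: Rlt_le].
Qed.

Lemma nroot_le n r b : (1 <= n)%nat -> 0 < b -> r <= b ^ n -> nroot n r <= b.
Proof.
move=> hn hb hr; rewrite /nroot; case: Rle_dec => h /=; first exact: Rlt_le.
have hn' : 0 < INR n by apply: lt_0_INR; lia.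
apply: Rle_trans (_ : Rpower (b ^ n) (/ INR n) <= _).
  by apply: Rle_Rpower_l; [exact: Rlt_le (Rinv_0_lt_compat _ hn') | lra].
rewrite -Rpower_pow // Rpower_mult Rinv_r; last lra.
by rewrite Rpower_1 //; right.
Qed.

Lemma nroot_ge0 n r : 0 <= nroot n r.
Proof. by rewrite /nroot; case: Rle_dec => h /=; [lra | exact: Rlt_le (exp_pos _)]. Qed.

Section Main.
Variables (G : finZmodType) (X : CBanach) (L : opset X) (Lg : G -> opset X).
Hypothesis hL : lie_algebra L.
Hypothesis hK : forall a, L a -> compact_op a.
Hypothesis hS : subgraded L Lg.
Hypothesis hE : forall g d a b, Lg g a -> Lg d b -> engel L (comm a b).

Let P (T : bop X) := L (T : X -> X).
Let Pg g (T : bop X) := Lg g (T : X -> X).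

Let lift a : L a -> exists T : bop X, a = (T : X -> X) /\ P T.
Proof. by case: hL => _ [h _] ha; have [h1 h2] := h a ha; exists (mkB h1 h2). Qed.

Let P0 : P vzero. Proof. by case: hL => -[]. Qed.
Let PD a b : P a -> P b -> P (a [+] b). Proof. by case: hL => -[_ [h _]] _; exact: h. Qed.
Let PZ c a : P a -> P (c [*] a). Proof. by case: hL => -[_ [_ h]] _; exact: h. Qed.
Let PN a : P a -> P (vopp a). Proof. by rewrite vopp_scal; exact: PZ. Qed.
Let PC a b : P a -> P b -> P (a [o] b [-] b [o] a). Proof. by case: hL => _ [_ h]; exact: h. Qed.
Let Pk a : P a -> cpt a. Proof. by move=> ha; apply: compact_op_cpt; exact: hK. Qed.
Let PgP g a : Pg g a -> P a. Proof. by case: hS => _ [h _]; exact: h. Qed.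

Let adpowE (c x : bop X) n : adpow (c : X -> X) n (x : X -> X) = (bpow (adk c) n x : X -> X).
Proof. by elim: n => [//|n IH]; rewrite /adpow /= -/(adpow _ n _) IH. Qed.

Let adP (c x : bop X) n : P c -> P x -> P (bpow (adk c) n x).
Proof. by move=> hc hx; elim: n => [//|n IH]; exact: PC. Qed.

(** Converts the n-th root condition into a geometric bound with a constant: finitely many small n
    are absorbed into D. *)
Let engel_growth (c x : bop X) t : engel L (c : X -> X) -> P x -> 0 < t -> exists D, forall m, nm (bpow (adk c) m x) <= D * t ^ m.
Proof.
move=> [hc hu] hx ht.
have key n : nm (bpow (adk c) n x) <= adnorm L (c : X -> X) n * nm x.
  have ub r : (exists y, L y /\ opnorm y <= 1 /\ r = opnorm (adpow (c : X -> X) n y)) -> r <= nm (bpow (adk c) n).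
    move=> [y [/lift [y' [-> _]] [h1 ->]]]; rewrite adpowE; apply: Rle_trans (nm_ge (bpow (adk c) n) y') _.
    have h2 : nm y' <= 1 by exact: h1.
    by have := nm_ge0 (bpow (adk c) n); have := nm_ge0 y'; nra.
  case: (classic (x = vzero)) => [->|nz]; first by rewrite bl_0 !nm_0; lra.
  have px := nm_gt0 nz; pose y := RtoC (/ nm x) [*] x.
  have nr : RtoC (nm x) <> C0 by apply: RtoC_neq0; lra.
  have ex : x = RtoC (nm x) [*] y by rewrite /y RtoC_inv; [vec | lra].
  have h : nm (bpow (adk c) n y) <= adnorm L (c : X -> X) n.
    apply: (Rsup_ge _ ub); exists (y : X -> X); split; first exact: PZ.
    split; last by rewrite adpowE.
    apply: Req_le; have : nm y = 1 by rewrite nm_scalR ?Rinv_l //; [lra | exact: Rinv_ge0].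
    by [].
  rewrite {1}ex bl_scal nm_scalR; last lra.
  by rewrite Rmult_comm; apply: Rmult_le_compat_r => //; lra.
have [N hN] := hu t ht.
have big n : (S N <= n)%nat -> nm (bpow (adk c) n x) <= nm x * t ^ n.
  move=> hn; apply: Rle_trans (key n) _; rewrite Rmult_comm; apply: nm_mull.
  apply: nroot_lt => //; first lia.
  by have := hN n ltac:(lia); rewrite /R_dist Rminus_0_r Rabs_pos_eq //; exact: nroot_ge0.
have [D hD] : exists D, forall n, (n <= N)%nat -> nm (bpow (adk c) n x) <= D * t ^ n.
  elim: (N) => [|j [D hD]].
    by exists (nm x) => n hn; have -> : n = 0%nat by [lia]; rewrite pow_O bidE; lra.
  have tj := pow_lt t (S j) ht.
  exists (Rmax D (nm (bpow (adk c) (S j) x) / t ^ S j)) => n hn.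
  case: (Nat.eq_dec n (S j)) => [->|ne].
    apply: Rle_trans (_ : nm (bpow (adk c) (S j) x) / t ^ S j * t ^ S j <= _).
      by right; field; lra.
    by apply: Rmult_le_compat_r; [lra | exact: Rmax_r].
  apply: Rle_trans (hD n ltac:(lia)) _; apply: Rmult_le_compat_r; last exact: Rmax_l.
  by apply: pow_le; lra.
exists (Rmax D (nm x)) => n; have tn := pow_lt t n ht.
case: (Nat.le_gt_cases n N) => hn.
  by apply: Rle_trans (hD n hn) _; apply: Rmult_le_compat_r; [lra | exact: Rmax_l].
by apply: Rle_trans (big n hn) _; apply: Rmult_le_compat_r; [lra | exact: Rmax_r].
Qed.

Variable C : (X -> Prop) -> Prop.
Hypothesis hC : good_chain P C.
Hypothesis hmax : forall M, Inv P M -> (forall N, C N -> vincl M N \/ vincl N M) -> C M.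

(** Equality N = M is allowed; it occurs in [chain_triangularizes] when no room is left, and the
    induced space is then zero. *)
Definition isgap N M := C N /\ C M /\ vincl N M /\ forall Q, C Q -> vincl Q N \/ vincl M Q.

Let cinv M : C M -> Inv P M. Proof. by case: hC => h _; exact: h. Qed.

Let Psum (T : bop X) (Q : X -> X -> Prop) : P T -> (forall x, Q x vzero) -> (forall x y z, Q x y -> Q x z -> Q x (y [+] z)) ->
  (forall g (S : bop X), Pg g S -> forall x, Q x (S x)) -> forall x, Q x (T x).
Proof.
move=> hT Q0 QD Qg x; have [_ [_ [h _]]] := hS; have [f [hf ->]] := h _ hT.
elim: (enum G) => [|g l IH]; first exact: Q0.
have [S [e hS']] : exists S : bop X, f g = (S : X -> X) /\ P S by apply: lift; case: hS => _ [h' _]; exact: h' (hf g).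
by apply: QD => //; rewrite e; apply: (Qg g); rewrite /Pg -e.
Qed.

(** The gap is irreducible, so the closures of the induced components fall under
    [irr_graded_scalar]. A general T is a finite sum of homogeneous elements, and its scalar is the
    sum of theirs. *)
Let gap_scalar N M T : isgap N M -> P T -> exists c, forall x, M x -> N (T x [-] c [*] x).
Proof.
move=> [cN [cM [hNM hgap]]] hT.
have iN := cinv cN; have iM := cinv cM.
have [Y [gp Gs]] := gap_ex iN.1 iM.1 hNM.
have VM := csub_sub iM.1; have VN := csub_sub iN.1.
have hi := gap_irr hC hmax Gs cN cM hNM hgap.
have Li0 : irr (fun U => exists g, ind M gp (Pg g) U).
  move=> Q [Qc Qi]; have VQ := csub_sub Qc; apply: hi; split=> // U [S [hS' gS]] y hy.
  have [x [hx [ey _]]] := g_lift Gs y; rewrite -ey gS //.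
  have [] : M (S x) /\ Q (gp (S x)) by
    apply: (@Psum S (fun z w => M z /\ Q (gp z) -> M w /\ Q (gp w)) hS' _ _ _ x); [
    move=> z _; split; [exact: vsub_0 | by rewrite (proj2 (g_0 Gs (vsub_0 VM)) (vsub_0 VN)); exact: vsub_0] |
    move=> z w w' h1 h2 h3; have [a1 a2] := h1 h3; have [b1 b2] := h2 h3; (split; [exact: vsub_add | by rewrite (g_add Gs) //; exact: vsub_add]) |
    move=> g S' hS2 z [h1 h2]; have hz := iM.2 S' (PgP hS2) z h1; split=> //;
      have [U' [gU' _]] := g_op Gs (iM.2 S' (PgP hS2)) (iN.2 S' (PgP hS2)); by rewrite -gU' //; apply: Qi => //; exists g, S' |
    by split=> //; rewrite ey].
  by [].
have indc g U : ind M gp (Pg g) U -> cpt U.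
  by move=> [S [hS' gS]]; have hp := PgP hS'; exact: (gop_cpt Gs (iM.2 S hp) (iN.2 S hp) gS (Pk hp)).
have indV g : @vsubspace (BB Y Y) (ind M gp (Pg g)).
  have [[h0 [h1 h2]] _] : op_subspace (Lg g) /\ True by split=> //; case: hS.
  split; first by exists vzero; split=> // x hx; rewrite !bzeroE; apply: esym; apply/(g_0 Gs); exact: vsub_0.
  split; first by move=> U V [a [ha ga]] [b [hb gb]]; exists (a [+] b); split; [exact: h1 | apply: (gop_add Gs) => //; apply: iM.2; exact: (@PgP g)].
  by move=> c U [a [ha ga]]; exists (c [*] a); split; [exact: h2 | apply: (gop_scal Gs) => //; apply: iM.2; exact: (@PgP g)].
have gcomm a b U V : P a -> P b -> gop M gp a U -> gop M gp b V -> gop M gp (a [o] b [-] b [o] a) (U [o] V [-] V [o] U).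
  move=> ha hb ga gb.
  have mab p q : P p -> P q -> forall x, M x -> M ((p [o] q) x) by move=> hp hq x hx; rewrite bcompE; apply: iM.2 => //; exact: iM.2.
  apply: (gop_add Gs); [exact: mab | by move=> x hx; rewrite boppE; apply: vsub_opp => //; exact: mab | by apply: gop_comp => //; exact: iM.2 |].
  by apply: (gop_opp Gs); [exact: mab | apply: gop_comp => //; exact: iM.2].
have indb g d U V : ind M gp (Pg g) U -> ind M gp (Pg d) V -> ind M gp (Pg (GRing.add g d)) (U [o] V [-] V [o] U).
  move=> [a [ha ga]] [b [hb gb]]; exists (a [o] b [-] b [o] a); split; last exact: (gcomm _ _ _ _ (PgP ha) (PgP hb)).
  by have [_ [_ [_ h]]] := hS; exact: (h g d _ _ ha hb).
(* Engel growth of [a, b] descends to the gap. A nonzero eigenvalue there would force finite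
   dimension and a nilpotent [U, V] - kap, contrary to the vanishing trace of a commutator. *)
have qn0 g d U V : ind M gp (Pg g) U -> ind M gp (Pg d) V -> qn (U [o] V [-] V [o] U).
  move=> hU hV; have hc := indc _ _ (indb _ _ _ _ hU hV).
  apply: spec_qn => // kap y kz hy; apply: NNPP => ny.
  have [|fb [k hk]] := riesz_irr Li0 hc _ kz hy ny; last by apply: kz; exact: (commutator_trace fb ny hk).
  have [a [ha ga]] := hU; have [b [hb gb]] := hV.
  have Pc := PC (PgP ha) (PgP hb); have gc := gcomm _ _ _ _ (PgP ha) (PgP hb) ga gb.
  move=> x [h [S [hS' gS]]] t ht; have [D hD] := engel_growth (c := a [o] b [-] b [o] a) (hE ha hb) (PgP hS') ht.
  exists D => m; apply: Rle_trans (hD m).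
  have gm : gop M gp (bpow (adk (a [o] b [-] b [o] a)) m S) (bpow (adk (U [o] V [-] V [o] U)) m x).
    by elim: m => [//|m IH]; apply: gcomm => //; exact: adP (PgP hS').
  have hp := adP m Pc (PgP hS').
  exact: (gop_nm Gs (iM.2 _ hp) (iN.2 _ hp) gm).
(* Induced components need not be closed in operator norm. Closures keep the grading relation,
   compactness and, by [qn_conv], quasinilpotent commutators. *)
pose Q g := @cl (BB Y Y) (ind M gp (Pg g)).
have clseq g U : Q g U -> exists u, (forall n, ind M gp (Pg g) (u n)) /\ @vconv (BB Y Y) u U by exact: cl_seq.
have cconv (u v : nat -> bop Y) U V : @vconv (BB Y Y) u U -> @vconv (BB Y Y) v V ->
    @vconv (BB Y Y) (fun n => u n [o] v n [-] v n [o] u n) (U [o] V [-] V [o] U).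
  move=> hu hv; apply: (vconv_add (u := fun n => u n [o] v n)); first exact: conv_comp.
  apply: (vconv_ext (u := fun n => (- C1)%C [*] (v n [o] u n))); first by move=> n; rewrite -vopp_scal.
  by rewrite vopp_scal; apply: vconv_scal; exact: conv_comp.
have sc g U : Q g U -> exists c, U = c [*] bid.
  apply: (@irr_graded_scalar G Y Q) => [g'|g' V /clseq [u [h1 h2]]|g' d' V V' /clseq [u [h1 h2]] /clseq [v [h3 h4]]|R0 [Rc Ri]|g' d' V V' /clseq [u [h1 h2]] /clseq [v [h3 h4]]].
  - exact: cl_closed.
  - by apply: (cpt_conv _ h2) => n; exact: indc (h1 n).
  - have Qc : @closed_vsubspace (BB Y Y) (Q (GRing.add g' d')) by exact: cl_closed.
    have [_ [_ [_ h]]] := Qc; apply: (h _ _ _ (cconv _ _ _ _ h2 h4)) => n; apply: cl_incl; exact: indb.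
  - by apply: Li0; split=> // V [g' hV]; apply: Ri; exists g'; exact: cl_incl.
  apply: (qn_conv _ _ (cconv _ _ _ _ h2 h4)) => n; [exact: indc (indb _ _ _ _ (h1 n) (h3 n)) | exact: qn0 (h1 n) (h3 n)].
have [U [gU _]] := g_op Gs (iM.2 T hT) (iN.2 T hT).
suff [c hc] : exists c, forall x, M x -> gp (T x) = c [*] gp x.
  exists c => x hx; have mT := iM.2 T hT x hx; have mc : M (vopp (c [*] x)) by apply: vsub_opp => //; exact: vsub_scal.
  apply/(g_0 Gs); first exact: vsub_add.
  by rewrite (g_add Gs) // vopp_scal vscal_mul (g_scal Gs) // hc //; vec.
have [_ [_ [h _]]] := hS; have [f [hf e]] := h _ hT.
suff [c hc] : exists c, forall x, M x -> M (opsum (map f (enum G)) x) /\ gp (opsum (map f (enum G)) x) = c [*] gp x.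
  by exists c => x hx; rewrite e; case: (hc x hx).
elim: (enum G) => [|g l [c IH]].
  by exists C0 => x hx; split; [exact: vsub_0 | rewrite vscal_0; apply/(g_0 Gs); exact: vsub_0].
have [S [eS PS]] : exists S : bop X, f g = (S : X -> X) /\ P S by apply: lift; case: hS => _ [h' _]; exact: h' (hf g).
have [V [gV _]] := g_op Gs (iM.2 S PS) (iN.2 S PS).
have [c' ec'] : exists c', V = c' [*] bid by apply: (sc g); apply: cl_incl; exists S; split=> //; rewrite /Pg -eS.
exists (c' + c)%C => x hx; have [i1 i2] := IH x hx; have mS := iM.2 S PS x hx.
have -> : opsum (map f (g :: l)) x = S x [+] opsum (map f l) x by rewrite /= /opadd eS.
split; first exact: vsub_add.
by rewrite (g_add Gs) // i2 -gV // ec' bscalE bidE; vec.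
Qed.

(** Maximality was obtained among invariant subspaces only. A further closed subspace comparable
    with the chain sits inside a gap, where L acts by scalars, so it is invariant and already a
    member. *)
Lemma chain_triangularizes : triangularizable L.
Proof.
have [_ [htot [h0 [hcup hcap]]]] := hC.
exists C; split; last by move=> M /cinv [_ h] T /lift [T' [-> hT]]; exact: h.
split; first by split=> // M /cinv [].
move=> C' [cl' tot'] sub M' cM'; exists M'; split=> //.
have VM' := csub_sub (cl' _ cM').
pose E1 A := C A /\ vincl A M'; pose E2 A := C A /\ vincl M' A.
have cN : C (cl (fun x => exists A, E1 A /\ A x)).
  apply: hcup => [|A []//]; exists (fun x => x = vzero); split=> // x ->; exact: vsub_0.
have cM : C (fun x => forall A, E2 A -> A x) by apply: hcap => A [].
set N := cl _ in cN; set M := (fun x => forall A, E2 A -> A x) in cM.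
have NM' : vincl N M' by apply: cl_min; [exact: cl' | move=> x [A [[_ h] hA]]; exact: h].
have M'M : vincl M' M by move=> x hx A [_ h]; exact: h.
(* The supremum of the members below M' and the infimum of those above; each member is comparable
   with M' and so falls on one side. *)
have gNM : isgap N M.
  split=> //; split=> //; split; first by move=> x /NM' /M'M.
  move=> Q cQ; case: (tot' _ _ (sub _ cQ) cM') => h.
    by left=> x hx; apply: cl_incl; exists Q.
  by right=> x hx; apply: hx.
apply: hmax; last by move=> A /sub hA; case: (tot' _ _ cM' hA); [left | right].
split; first exact: cl'.
move=> a ha x hx; have [c hc] := gap_scalar gNM ha.
have -> : a x = (a x [-] c [*] x) [+] c [*] x by vec.
apply: vsub_add => //; last exact: vsub_scal.
by apply: NM'; apply: hc; exact: M'M.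
Qed.

Definition gap_null (T : bop X) := P T /\ forall N M, isgap N M -> forall x, M x -> N (T x).

Let gap_null_sub : @vsubspace (BB X X) gap_null.
Proof.
have VN N M : isgap N M -> vsubspace N by move=> [/cinv [h _] _]; exact: csub_sub.
split; first by split=> // N M /VN h x hx; rewrite bzeroE; exact: vsub_0.
split; first by move=> S T [pS hS'] [pT hT]; split; [exact: PD | move=> N M g x hx; rewrite baddE; apply: vsub_add; [exact: VN g | exact: hS' g _ hx | exact: hT g _ hx]].
by move=> c T [pT hT]; split; [exact: PZ | move=> N M g x hx; rewrite bscalE; apply: vsub_scal; [exact: VN g | exact: hT g _ hx]].
Qed.

(** On a gap a and b act by scalars, which commute. Hence all commutators of L are null on the gaps,
    and the null elements form an ideal. *)
Let gap_null_comm (a b : bop X) : P a -> P b -> gap_null (adk a b).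
Proof.
move=> ha hb; split; first exact: PC.
move=> N M g x hx; have [c hc] := gap_scalar g ha; have [d hd] := gap_scalar g hb.
have [/cinv [/csub_sub VN iN] _] := g.
have -> : adk a b x = (a (b x [-] d [*] x) [-] b (a x [-] c [*] x)) [+] (d [*] (a x [-] c [*] x) [-] c [*] (b x [-] d [*] x)).
  rewrite adkE baddE boppE !bcompE !bl_add !bl_opp !bl_scal; vec.
by apply: vsub_add => //; (apply: vsub_add => //; [|apply: vsub_opp => //]); try (apply: vsub_scal => //); try (apply: iN => //); auto.
Qed.

Variable I : opset X.
Hypothesis hI : closed_ideal L I.
Let PI (T : bop X) := I (T : X -> X).

Let PI_P T : PI T -> P T. Proof. by case: hI => -[_ [h _]] _; exact: h. Qed.
Let PI_sub : @vsubspace (BB X X) PI.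
Proof. by case: hI => -[[h0 [h1 h2]] _] _; split=> //; split=> [a b|c a]; [exact: h1 | exact: h2]. Qed.
Let PI_comm a x : P a -> PI x -> PI (adk a x).
Proof. by case: hI => -[_ [_ h]] _; exact: h. Qed.

Let liftI i : I i -> exists T : bop X, i = (T : X -> X) /\ PI T.
Proof.
move=> hi; have [T [e hT]] : exists T : bop X, i = (T : X -> X) /\ P T by apply: lift; case: hI => -[_ [h _]] _; exact: h.
by exists T; split=> //; rewrite /PI -e.
Qed.

Let qnorm_le (x i : bop X) : PI i -> qnorm I (x : X -> X) <= nm (x [-] i).
Proof.
move=> hi; rewrite /qnorm /Rinf -[X in _ <= X]Ropp_involutive; apply: Ropp_le_contravar; apply: (Rsup_ge (b := 0)).
  by exists (i : X -> X); rewrite Ropp_involutive.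
move=> r [j [/liftI [T [-> hT]] e]].
have e' : - r = nm (x [-] T) by exact: e.
by have := nm_ge0 (x [-] T); lra.
Qed.

Let qnorm_ex (x : bop X) e : 0 < e -> exists i, PI i /\ nm (x [-] i) < qnorm I (x : X -> X) + e.
Proof.
move=> he; apply: NNPP => hn.
suff : Rsup (fun r => exists i, I i /\ - r = opnorm (opsub (x : X -> X) i)) <= - (qnorm I (x : X -> X) + e).
  have -> : Rsup (fun r => exists i, I i /\ - r = opnorm (opsub (x : X -> X) i)) = - qnorm I (x : X -> X) by rewrite /qnorm /Rinf Ropp_involutive.
  by lra.
apply: (Rsup_le (x0 := - nm (x [-] vzero))).
  by exists (fun _ => vzero); rewrite Ropp_involutive; split=> //; case: PI_sub.
move=> r [j [/liftI [T [-> hT]] e']].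
have e2 : - r = nm (x [-] T) by exact: e'.
suff : qnorm I (x : X -> X) + e <= - r by lra.
by rewrite e2; apply: Rnot_lt_le => hlt; apply: hn; exists T.
Qed.

Let engel_qI (a : bop X) : P a ->
  (forall t, 0 < t -> exists N, forall n x, (N <= n)%nat -> P x -> qnorm I (x : X -> X) <= 1 ->
     qnorm I (bpow (adk a) n x : X -> X) <= t ^ n) -> engel_q L I (a : X -> X).
Proof.
move=> ha h; split=> // t ht; have [N hN] := h (t / 2) ltac:(lra).
exists (S N) => n hn; rewrite /R_dist Rminus_0_r Rabs_pos_eq; last exact: nroot_ge0.
suff : nroot n (adnorm_q L I (a : X -> X) n) <= t / 2 by lra.
apply: nroot_le; [lia | lra |].
apply: (Rsup_le (x0 := qnorm I (adpow (a : X -> X) n ((vzero : bop X) : X -> X)))).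
  exists ((vzero : bop X) : X -> X); split; first exact: P0.
  split=> //; apply: Rle_trans (qnorm_le (i := vzero) _ _) _; first by case: PI_sub.
  by rewrite vadd_opp nm_0; lra.
move=> r [x [/lift [x' [-> hx]] [h1 ->]]]; rewrite adpowE; apply: hN => //; lia.
Qed.

(** Modulo I, ad a acts as ad w with w = a - i. On each gap w acts as the error e' of norm below
    eps, so [partition] bounds the growth of w, and ad w grows at rate proportional to eps.
    Approximability suffices, so the closure of null elements plus I is covered. *)
Let engel_approx (a : bop X) : P a ->
  (forall e, 0 < e -> exists v i, gap_null v /\ PI i /\ nm (a [-] v [-] i) < e) -> engel_q L I (a : X -> X).
Proof.
(* Rate eps on gaps becomes 2 eps after [partition] and 4 eps for ad w; t/8 leaves 4 eps = t/2 < t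
   to absorb constants. *)
move=> ha h; apply: engel_qI => // t ht; pose eps := t / 8.
have he : 0 < eps by rewrite /eps; lra.
have [v [i [[pv hv] [hi hlt]]]] := h eps he.
pose w := a [-] i; pose e' := a [-] v [-] i.
have pw : P w by apply: PD => //; apply: PN; exact: PI_P.
have pe : P e' by apply: PD; [apply: PD => //; exact: PN | apply: PN; exact: PI_P].
have ew : w = v [+] e' by rewrite /w /e'; vec.
have sub u : In u (cons w nil) -> P u by move=> [<-|[]].
have gC : good_chain (fun u => In u (cons w nil)) C.
  by case: hC => h1 h2; split=> // M cM; have [c1 c2] := h1 M cM; split=> // u /sub; exact: c2.
have [D hD] : gr (adk w) (4 * eps).
  have -> : 4 * eps = 2 * (2 * eps) by ring.
  apply: gr_adk; first lra.
  apply/J_single.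
  have hw : J (fun u => In u (cons w nil)) (2 * eps).
    apply: (partition (s := eps) _ gC) => //; first by move=> u /sub; exact: Pk.
      by lra.
    move=> N M cN cM hNM _ hgap.
    have iN := cinv cN; have iM := cinv cM.
    have [Y [gp Gs]] := gap_ex iN.1 iM.1 hNM.
    apply: (gap_grow Gs) => //; [exact: csub_sub iN.1 | by move=> u /sub; exact: iM.2 | by move=> u /sub; exact: iN.2 |].
    exists 1 => n U; rewrite Rmult_1_l; elim=> [|U' k T [u [[<-|[]] gU]] _ IH]; first exact: nm_bid.
    apply: Rle_trans (nm_comp _ _) _; rewrite -tech_pow_Rmult; apply: Rmult_le_compat => //; try exact: nm_ge0.
    apply: Rle_trans (_ : nm e' <= _); last exact: Rlt_le.
    apply: (gop_nm Gs (iM.2 _ pe) (iN.2 _ pe)) => x hx; rewrite gU // ew baddE (g_add Gs); [|exact: iM.2|exact: iM.2].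
    suff -> : gp (v x) = vzero by rewrite vadd_0l.
    by apply/(g_0 Gs); [exact: iM.2 | apply: (hv N M)].
  by case: hw => D hD; exists D => n T hT; apply: hD; apply: W_mono hT => u ->; left.
have D0 : 0 <= D by have := hD 0%nat; rewrite pow_O; have := nm_ge0 (bpow (adk w) 0); lra.
have [N hN] := @pow_ratio_small (2 * D) (4 * eps) t 1 ltac:(lra) ltac:(rewrite /eps; lra) ltac:(lra).
exists N => n x hn px qx; have [i0 [hi0 h0]] := qnorm_ex x (e := 1) ltac:(lra).
(* A representative of x of norm at most 2; powers of ad a on x and of ad w on x0 agree modulo I, so
   the quotient norm is estimated by the latter. *)
pose x0 := x [-] i0; have px0 : P x0 by apply: PD => //; apply: PN; exact: PI_P.
have key : PI (bpow (adk a) n x [-] bpow (adk w) n x0).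
  elim: (n) => [|k IH].
    by rewrite !bidE; have -> : x [-] x0 = i0 by rewrite /x0; vec.
  have pB := adP k pw px0; have pA := adP k ha px.
  rewrite -[bpow (adk a) (S k)]/(adk a [o] bpow (adk a) k) -[bpow (adk w) (S k)]/(adk w [o] bpow (adk w) k) !bcompE.
  move: (bpow (adk a) k x) (bpow (adk w) k x0) IH pA pB => A B IH pA pB.
  have -> : adk a A [-] adk w B = adk a (A [-] B) [-] adk B i by rewrite !adkE /w; bvec.
  apply: (vsub_add PI_sub); first exact: PI_comm.
  by apply: (vsub_opp PI_sub); exact: PI_comm.
apply: Rle_trans (qnorm_le _ key) _.
have -> : bpow (adk a) n x [-] (bpow (adk a) n x [-] bpow (adk w) n x0) = bpow (adk w) n x0 by move: (bpow (adk a) n x) => z; vec.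
apply: Rle_trans (nm_ge (bpow (adk w) n) x0) _.
have := hN n hn; rewrite Rmult_1_l; apply: Rle_trans.
have : nm x0 <= 2 by rewrite /x0; lra.
have := hD n; have := nm_ge0 (bpow (adk w) n); have := nm_ge0 x0; nra.
Qed.

Let JI (T : bop X) := exists v i, gap_null v /\ PI i /\ T = v [+] i.

Let JI_sub : @vsubspace (BB X X) JI.
Proof.
split; first by exists vzero, vzero; split; [case: gap_null_sub | split; [case: PI_sub | rewrite vadd_0]].
split.
  move=> S T [v [i [hv [hi ->]]]] [v' [i' [hv' [hi' ->]]]]; exists (v [+] v'), (i [+] i').
  by split; [exact: (vsub_add gap_null_sub) | split; [exact: (vsub_add PI_sub) | vec]].
move=> c T [v [i [hv [hi ->]]]]; exists (c [*] v), (c [*] i).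
by split; [by apply: gap_null_sub.2.2 | split; [by apply: PI_sub.2.2 | vec]].
Qed.

(** Two candidates for the ideal above I: the closure of the gap-null elements plus I if this
    exceeds I, and otherwise L itself. *)
Lemma closed_ideal_step (a0 : bop X) : P a0 -> ~ PI a0 ->
  exists J, closed_ideal L J /\ (forall x, I x -> J x) /\ (exists x, J x /\ ~ I x) /\ (forall a, J a -> engel_q L I a).
Proof.
move=> h0 n0; case: (classic (exists z, gap_null z /\ ~ PI z)) => [[z [hz nz]]|hn].
  pose K := @cl (BB X X) JI; have [K0 [K1 [K2 K3]]] := cl_closed JI_sub.
  exists (fun a => exists T : bop X, a = (T : X -> X) /\ P T /\ K T); split; last split; last split.
  - split; first (split; last split).
    + split; first by exists vzero.
      split; first by move=> _ _ [S [-> [pS kS]]] [T [-> [pT kT]]]; exists (S [+] T); split=> //; split; [exact: PD | exact: K1].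
      by move=> c _ [T [-> [pT kT]]]; exists (c [*] T); split=> //; split; [exact: PZ | exact: K2].
    + by move=> _ [T [-> [pT _]]].
    + move=> _ _ /lift [a [-> ha]] [T [-> [pT kT]]]; exists (adk a T); split=> //; split; first exact: PC.
      apply: (cl_inv (T := adk a)) kT => _ [v [i [hv [hi ->]]]]; exists (adk a v), (adk a i).
      by split; [apply: gap_null_comm => //; case: hv | split; [exact: PI_comm | rewrite bl_add]].
    move=> T _ hT /lift [A [-> pA]] hconv; exists A; split=> //; split=> //.
    apply: closed_cl (cl_closed JI_sub) _ _ => e he; have [N hN] := hconv e he.
    have [S [eS [pS kS]]] := hT N; exists S; split=> //.
    have := hN N (le_n N); rewrite /R_dist Rminus_0_r eS nm_sym; apply: Rle_lt_trans; exact: Rle_abs.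
  - move=> x /liftI [T [-> hT]]; exists T; split=> //; split; first exact: PI_P.
    by apply: cl_incl; exists vzero, T; split; [case: gap_null_sub | rewrite vadd_0l].
  - exists (z : X -> X); split=> //; exists z; split=> //; split; first by case: hz.
    by apply: cl_incl; exists z, vzero; split=> //; split; [case: PI_sub | rewrite vadd_0].
  move=> _ [T [-> [pT kT]]]; apply: engel_approx => // e he; have [_ [[v [i [hv [hi ->]]]] hlt]] := kT e he.
  by exists v, i; split=> //; split=> //; move: hlt; have -> : T [-] (v [+] i) = T [-] v [-] i by vec.
(* All commutators are gap-null, hence in I, so the quotient is commutative and ad a vanishes on it
   from the first power on. This is why the threshold is n = 1. *)
have sub T : gap_null T -> PI T by move=> hT; apply: NNPP => h; apply: hn; exists T.
have [hsub [_ hbr]] := hL.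
exists L; split; first by split=> //; split=> //; split=> //; exact: hbr.
split; first by move=> x /liftI [T [-> /PI_P]].
split; first by exists (a0 : X -> X).
move=> _ /lift [a [-> ha]]; apply: engel_qI => // t ht; exists 1%nat => -[|n] x hn' px _; first lia.
apply: Rle_trans (qnorm_le (i := bpow (adk a) (S n) x) _ _) _.
  by apply: sub; apply: (gap_null_comm ha); exact: adP.
by rewrite vadd_opp nm_0; apply: pow_le; lra.
Qed.
End Main.

Theorem mainTheorem8 (G : finZmodType) (X : CBanach) (L : opset X)
    (Lg : G -> opset X) :
  lie_algebra L ->
  (forall a, L a -> compact_op a) ->
  subgraded L Lg ->
  (forall g d a b, Lg g a -> Lg d b -> engel L (comm a b)) ->
  E_solvable L /\ triangularizable L.
Proof.
move=> hL hK hS hE.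
have [C [hC hmax]] := max_chain (fun T : bop X => L (T : X -> X)).
split; last exact: chain_triangularizes hL hK hS hE C hC hmax.
move=> I hI [a0 [ha0 na0]]; have [_ [hbd _]] := hL; have [h1 h2] := hbd a0 ha0.
exact: (closed_ideal_step hL hK hS hE hC hmax hI (a0 := mkB h1 h2) ha0 na0).
Qed.
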